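(* Let $0 < p_1, p_2, \theta_1, \theta_2 < \infty$, $p_2 < p_1$ and $p_2 < \min\{\theta_1,\theta_2\}$. Assume that $v_1, v_2 \in \mathcal{W}(\mathbb{R}^n)$, $\omega_1 \in {}^{\mathbf c}\Omega_{\theta_1}$ and $\omega_2 \in \Omega_{\theta_2}$. Suppose that $\widetilde V$ is admissible and $$\varphi_2(x) := \left(\int_0^\infty [\widetilde V(t)\,\mathcal{V}(x,t)]^{\theta_1\to p_2}\, d\Big(-\|\omega_1\|_{\theta_1,(0,t)}^{-\theta_1\to p_2}\Big)\right)^{\frac{1}{\theta_1\to p_2}} \in Q_{\widetilde V^{\frac{1}{p_1\to p_2}}}.$$ Write $\|\mathrm{I}\|$ for $\|\mathrm{I}\|_{{}^{\mathbf c}LM_{p_1\theta_1,\omega_1}(\mathbb{R}^n,v_1)\to LM_{p_2\theta_2,\omega_2}(\mathbb{R}^n,v_2)}$. (i) If $\max\{p_1,\theta_1\} \le \theta_2$, then $$\|\mathrm{I}\| \approx \sup_{x\in(0,\infty)} \varphi_2(x) \sup_{t\in(0,\infty)} \mathcal{V}(t,x)\|\omega_2\|_{\theta_2,(t,\infty)} + \|\omega_1\|_{\theta_1,(0,\infty)}^{-1} \sup_{t\in(0,\infty)} \widetilde V(t)\|\omega_2\|_{\theta_2,(t,\infty)}.$$ (ii) If $p_1 \le \theta_2 < \theta_1$, then $$\|\mathrm{I}\| \approx \left(\int_0^\infty \varphi_2(x)^{\frac{(\theta_1\to\theta_2)\cdot(\theta_1\to p_2)}{\theta_2\to p_2}}\,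 \widetilde V(x)^{\theta_1\to p_2} \Big(\sup_{t\in(0,\infty)} \mathcal{V}(t,x)\|\omega_2\|_{\theta_2,(t,\infty)}\Big)^{\theta_1\to\theta_2} d\Big(-\|\omega_1\|_{\theta_1,(0,x)}^{-\theta_1\to p_2}\Big)\right)^{\frac{1}{\theta_1\to\theta_2}} + \|\omega_1\|_{\theta_1,(0,\infty)}^{-1} \sup_{t\in(0,\infty)} \widetilde V(t)\|\omega_2\|_{\theta_2,(t,\infty)}.$$ (iii) If $\theta_1 \le \theta_2 < p_1$, then $$\|\mathrm{I}\| \approx \sup_{x\in(0,\infty)} \varphi_2(x) \left(\int_0^\infty \mathcal{V}(t,x)^{p_1\to\theta_2}\, d\Big(-\|\omega_2\|_{\theta_2,(t,\infty)}^{p_1\to\theta_2}\Big)\right)^{\frac{1}{p_1\to\theta_2}} + \|\omega_1\|_{\theta_1,(0,\infty)}^{-1} \left(\int_0^\infty \widetilde V(t)^{p_1\to\theta_2}\, d\Big(-\|\omega_2\|_{\theta_2,(t,\infty)}^{p_1\to\theta_2}\Big)\right)^{\frac{1}{p_1\to\theta_2}}.$$ (iv) If $\theta_2 < \min\{p_1,\theta_1\}$, then $$\|\mathrm{I}\| \approx \left(\int_0^\infty \varphi_2(x)^{\frac{(\theta_1\to\theta_2)\cdot(\theta_1\to p_2)}{\theta_2\to p_2}}\, \widetilde V(x)^{\theta_1\to p_2} \left(\int_0^\infty \mathcal{V}(t,x)^{p_1\to\theta_2}\, d\Big(-\|\omega_2\|_{\theta_2,(t,\infty)}^{p_1\to\theta_2}\Big)\right)^{\frac{\theta_1\to\theta_2}{p_1\to\theta_2}}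 d\Big(-\|\omega_1\|_{\theta_1,(0,x)}^{-\theta_1\to p_2}\Big)\right)^{\frac{1}{\theta_1\to\theta_2}} + \|\omega_1\|_{\theta_1,(0,\infty)}^{-1} \left(\int_0^\infty \widetilde V(t)^{p_1\to\theta_2}\, d\Big(-\|\omega_2\|_{\theta_2,(t,\infty)}^{p_1\to\theta_2}\Big)\right)^{\frac{1}{p_1\to\theta_2}}.$$
   Context: Let $n\ge 1$. For measurable $A$ (in $\mathbb{R}^n$ or $\mathbb{R}$), $\mathfrak{M}(A)$ is the set of measurable functions on $A$, $\mathfrak{M}^+(A)$ the non-negative ones, and $\mathcal{W}(A)$ the set of weights: measurable functions that are positive and finite a.e. on $A$. For $p\in(0,\infty]$, $\|f\|_{p,A}=(\int_A|f|^p)^{1/p}$ if $p<\infty$ and $\|f\|_{\infty,A}=\operatorname{ess\,sup}_A|f|$. For a non-negative measurable $w$, $\|f\|_{p,w,A}:=\|fw\|_{p,A}$ (the weight is inside the power). $B(0,t)$ is the open ball of radius $t$ centred at $0$ and ${}^{\mathbf c}B(0,t)=\mathbb{R}^n\setminus B(0,t)$. For $0<p,\theta\le\infty$, $\omega\in\mathfrak{M}^+(0,\infty)$, $v\in\mathcal{W}(\mathbb{R}^n)$: - $LM_{p\theta,\omega}(\mathbb{R}^n,v)$ is the set of $f\in L^{\rm loc}_{p,v}(\mathbb{R}^n)$ (i.e. $\|f\|_{p,v,K}<\infty$ for compact $K$) with $\|f\|_{LM_{p\theta,\omega}(\mathbb{R}^n,v)}:=\big\|\,t\mapsto\|f\|_{p,v,B(0,t)}\big\|_{\theta,\omega,(0,\infty)}<\infty$;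 - ${}^{\mathbf c}LM_{p\theta,\omega}(\mathbb{R}^n,v)$ is the set of $f\in\bigcap_{t>0}L_{p,v}({}^{\mathbf c}B(0,t))$ (i.e. $\|f\|_{p,v,{}^{\mathbf c}B(0,t)}<\infty$ for all $t>0$) with $\|f\|_{{}^{\mathbf c}LM_{p\theta,\omega}(\mathbb{R}^n,v)}:=\big\|\,t\mapsto\|f\|_{p,v,{}^{\mathbf c}B(0,t)}\big\|_{\theta,\omega,(0,\infty)}<\infty$. $\Omega_\theta=\{\omega\in\mathfrak{M}^+(0,\infty):0<\|\omega\|_{\theta,(t,\infty)}<\infty\ \forall t>0\}$ and ${}^{\mathbf c}\Omega_\theta=\{\omega\in\mathfrak{M}^+(0,\infty):0<\|\omega\|_{\theta,(0,t)}<\infty\ \forall t>0\}$. $\|\mathrm{I}\|_{X\to Y}\in[0,\infty]$ is the least constant $c$ with $\|f\|_Y\le c\|f\|_X$ for all $f\in X$ ($\infty$ if there is none). For $0<p,q\le\infty$, the symbol $p\to q$ used as an exponent denotes the number defined by $\frac1{p\to q}=\frac1q-\frac1p$ if $q<p$, and $p\to q=\infty$ if $q\ge p$; the exponent $-\theta_1\to p_2$ means $-(\theta_1\to p_2)$. For $t,x>0$: $\widetilde V(x):=\|v_1^{-1}v_2\|_{p_1\to p_2,\,B(0,x)}$ and $\mathcal{V}(t,x):=\dfrac{\widetilde V(t)}{\widetilde V(t)+\widetilde V(x)}$. The value of a monotone function at an endpoint of its interval means its limit there. A function $U$ is admissible if it is continuous and strictly increasing on $[0,\infty)$, $U(0)=0$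 and $\lim_{t\to\infty}U(t)=\infty$. For admissible $U$, a function $\varphi$ is $U$-quasiconcave if $\varphi$ is equivalent ($\approx$, pointwise on $(0,\infty)$) to an increasing function on $(0,\infty)$ and $\varphi/U$ is equivalent to a decreasing function on $(0,\infty)$. It is non-degenerate if $\lim_{t\to0+}\varphi(t)=\lim_{t\to\infty}\frac1{\varphi(t)}=\lim_{t\to\infty}\frac{\varphi(t)}{U(t)}=\lim_{t\to0+}\frac{U(t)}{\varphi(t)}=0$. $Q_U$ is the family of non-degenerate $U$-quasiconcave functions. Integrals $\int_0^\infty F(t)\,d(G(t))$ with $G$ non-decreasing are Lebesgue–Stieltjes integrals over $(0,\infty)$. $A\approx B$ means $\lambda^{-1}B\le A\le\lambda B$ with $\lambda\ge1$ depending only on inessential parameters; for the norm estimates this means on $n$ and the exponents $p_i,\theta_i$, but not on the weights (in particular one side is infinite iff the other is). Conventions: $0/0=0$, $0\cdot(\pm\infty)=0$, $1/(\pm\infty)=0$. *)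

(* Defs.v *)
From HB Require Import structures.
From mathcomp Require Import all_boot all_order all_algebra.
From mathcomp Require Import all_classical all_reals all_analysis.
From mathcomp Require Import measurable_realfun.

Set Implicit Arguments.
Unset Strict Implicit.
Unset Printing Implicit Defensive.

Import Order.TTheory GRing.Theory Num.Theory.
Import numFieldNormedType.Exports.

Local Open Scope classical_set_scope.
Local Open Scope ring_scope.

(* Lebesgue measure on R^n: iterated product of [lebesgue_measure] on the Borel
   sets, then Caratheodory completion, so that "measurable" means
   Lebesgue-measurable. *)
Section LebesgueRn.
Context {R : realType}.
Local Notation bR := (measurableTypeR R).

Definition borel_cons n (x : bR * n.-tuple bR) : n.+1.-tuple bR :=
  [tuple of x.1 :: x.2].

Lemma measurable_borel_cons n : measurable_fun [set: _] (@borel_cons n).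
Proof. exact: measurable_cons measurable_fst measurable_snd. Qed.

Definition borel_lebesgueS n
    (m : {sigma_finite_measure set (n.-tuple bR) -> \bar R}) :
    set (n.+1.-tuple bR) -> \bar R :=
  pushforward (product_measure1 (@lebesgue_measure R) m) (@borel_cons n).

Section borel_lebesgueS.
Variables (n : nat) (m : {sigma_finite_measure set (n.-tuple bR) -> \bar R}).

HB.instance Definition _ := Measure.copy (borel_lebesgueS m)
  (measure_function_pushforward__canonical__measure_function_Measure
     (product_measure1 (@lebesgue_measure R) m) (@measurable_borel_cons n)).

Let borel_lebesgueS_sigma_finite : sigma_finite setT (borel_lebesgueS m).
Proof.
have /sigma_finiteP[F [TF ndF Foo]] := sigma_finiteT (@lebesgue_measure R).
have /sigma_finiteP[G [TG ndG Goo]] := sigma_finiteT m.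
pose g (x : n.+1.-tuple bR) : (bR * n.-tuple bR)%type :=
  (thead x, [tuple of behead x]).
have mg : measurable_fun setT g.
  apply: measurable_fun_pair; first exact: measurable_tnth.
  exact: measurable_behead.
have gK x : g (borel_cons x) = x.
  by case: x => a t; congr pair; apply/val_inj.
exists (fun k => g @^-1` (F k `*` G k)).
  rewrite -preimage_bigcup (_ : \bigcup_k _ = setT) ?preimage_setT//.
  rewrite -subTset => -[x y] _.
  have [i _ Fix] : (\bigcup_k F k) x by rewrite -TF.
  have [j _ Gjy] : (\bigcup_k G k) y by rewrite -TG.
  exists (maxn i j) => //; split => /=.
    by move: x Fix; exact/subsetPset/ndF/leq_maxl.
  by move: y Gjy; exact/subsetPset/ndG/leq_maxr.
move=> k; have [mF Fk] := Foo k; have [mG Gk] := Goo k; split.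
  by rewrite -[X in measurable X]setTI; apply: mg => //; exact: measurableX.
rewrite /borel_lebesgueS /pushforward -comp_preimage.
rewrite (_ : g \o _ = id); last by apply/funext => x /=; rewrite gK.
by rewrite preimage_id product_measure1E// lte_mul_pinfty// ge0_fin_numE.
Qed.

HB.instance Definition _ := Measure_isSigmaFinite.Build _ _ _
  (borel_lebesgueS m) borel_lebesgueS_sigma_finite.

End borel_lebesgueS.

Fixpoint borel_lebesgue n : {sigma_finite_measure set (n.-tuple bR) -> \bar R} :=
  match n with
  | 0 => dirac ([tuple] : 0.-tuple bR)
  | n'.+1 => borel_lebesgueS (borel_lebesgue n')
  end.

End LebesgueRn.

Definition lebesgueRn {R : realType} (n : nat) : set _ -> \bar R :=
  @completed_measure_extension _ _ _ (@borel_lebesgue R n).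
HB.instance Definition _ (R : realType) n := Measure.on (@lebesgueRn R n).

Notation euclid R n := (caratheodory_type (mu_ext (@borel_lebesgue R n))).
Notation realL R := (caratheodory_type (mu_ext (@wlength R idfun))).

(* Stieltjes measure on ]0, +oo[ of a function G that is nondecreasing there and
   may tend to -oo at 0: [lebesgue_stieltjes_measure] needs a function on the
   whole line, so it is applied to u |-> G (expR u), made right-continuous, and
   the result is transported by expR; see [stieltjes_ocitv]. *)
Section Stieltjes.
Context {R : realType}.
Implicit Types (G : R -> R) (F : R -> \bar R).

Definition nondecreasing_pos G := {in `]0, +oo[ &, {homo G : s t / s <= t}}.

Section measure.
Variables (G : R -> R) (ndG : nondecreasing_pos G).

Definition exp_rc of nondecreasing_pos G := fun s : R =>
  inf [set G (expR u) | u in `]s, +oo[].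

Let Gexp : {homo G \o expR : s t / s <= t}.
Proof. by move=> s t st; apply: ndG; rewrite ?in_itv/= ?expR_gt0// ler_expR. Qed.

Let lbG s : lbound [set G (expR u) | u in `]s, +oo[] (G (expR s)).
Proof. by move=> _ [u /= + <-]; rewrite in_itv/= andbT => /ltW; exact: Gexp. Qed.

Let hasG s : has_inf [set G (expR u) | u in `]s, +oo[].
Proof.
split; last by exists (G (expR s)); exact: lbG.
by exists (G (expR (s + 1))), (s + 1) => //=; rewrite in_itv/= ltrDl ltr01.
Qed.

Let exp_rc_le s u : s < u -> exp_rc ndG s <= G (expR u).
Proof.
move=> su; apply: ge_inf; first by case: (hasG s).
by exists u => //=; rewrite in_itv/= su.
Qed.

Let exp_rc_nd : {homo exp_rc ndG : s t / s <= t}.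
Proof.
move=> s t st; apply: lb_le_inf; first by case: (hasG t).
move=> _ [u /= + <-]; rewrite in_itv/= andbT => tu.
by apply: exp_rc_le; exact: le_lt_trans tu.
Qed.

Let exp_rc_right_continuous : right_continuous (exp_rc ndG).
Proof.
move=> s; apply/cvgrPdist_le => /= e e0.
have [_ [u /= + <-] /ltW Gu] := inf_adherent e0 (hasG s).
rewrite in_itv/= andbT => su.
near=> t; have st : s <= t by near: t; exact: nbhs_right_ge.
rewrite distrC ger0_norm ?subr_ge0 ?exp_rc_nd// lerBlDl (le_trans _ Gu)//.
by apply: exp_rc_le; near: t; exact: nbhs_right_lt.
Unshelve. all: by end_near. Qed.

HB.instance Definition _ :=
  isCumulative.Build R _ R (exp_rc ndG) exp_rc_nd exp_rc_right_continuous.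

Definition stieltjes : set (measurableTypeR R) -> \bar R :=
  pushforward (lebesgue_stieltjes_measure (exp_rc ndG))
    (expR : measurableTypeR R -> measurableTypeR R).

Let measurable_exp :
  measurable_fun [set: measurableTypeR R]
    (expR : measurableTypeR R -> measurableTypeR R).
Proof. exact: measurable_expR. Qed.

HB.instance Definition _ := Measure.copy stieltjes
  (measure_function_pushforward__canonical__measure_function_Measure
     (lebesgue_stieltjes_measure (exp_rc ndG)) measurable_exp).

Lemma stieltjes_ocitv a b : 0 < a -> a <= b ->
  G x @[x --> a^'+] --> G a -> G x @[x --> b^'+] --> G b ->
  stieltjes `]a, b] = (G b - G a)%:E.
Proof.
have E c : 0 < c -> G x @[x --> c^'+] --> G c -> exp_rc ndG (ln c) = G c.
  move=> c0 Gc; apply/eqP; rewrite eq_le; apply/andP; split; last first.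
    rewrite -{1}(lnK c0); apply: lb_le_inf; last exact: lbG.
    by case: (hasG (ln c)).
  apply: (cvgr_to_ge Gc); near=> t.
  have ct : c < t by near: t; exact: nbhs_right_gt.
  have t0 : 0 < t by exact: lt_trans ct.
  by rewrite -(lnK t0); apply: exp_rc_le; rewrite ltr_ln.
move=> a0 ab Ga Gb; have b0 : 0 < b by exact: lt_le_trans ab.
rewrite /stieltjes /pushforward.
have -> : expR @^-1` `]a, b] = `]ln a, ln b]%classic.
  apply/seteqP; split => x /=; rewrite !in_itv/= => /andP[].
    by rewrite -{1}(lnK a0) -{1}(lnK b0) ltr_expR ler_expR => -> ->.
  by rewrite -{2}(lnK a0) -{2}(lnK b0) ltr_expR ler_expR => -> ->.
rewrite /lebesgue_stieltjes_measure /measure_extension measurable_mu_extE/=.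
  by rewrite wlength_itv_bnd ?ler_ln// !E.
exact: is_ocitv.
Unshelve. all: by end_near. Qed.
End measure.

Definition stieltjes_integral G F : \bar R :=
  if pselect (nondecreasing_pos G) is left ndG
  then \int[stieltjes ndG]_(x in `]0%R, +oo[) F x else 0%E.

End Stieltjes.

(* Functions are [\bar R]-valued, with the conventions of the library:
   0 * +oo = 0, +oo^-1 = 0 and 0^-1 = +oo (so 0 / 0 = 0). *)
Section Spaces.
Context {R : realType}.
Local Open Scope ereal_scope.

(* 1 / (p -> q) = 1/q - 1/p if q < p, and p -> q = +oo otherwise *)
Definition arrow (p q : \bar R) : \bar R :=
  if q < p then (q^-1 - p^-1)^-1 else +oo.

Section norm.
Context d (T : measurableType d) (mu : {measure set T -> \bar R}).
Implicit Types (p : \bar R) (f w : T -> \bar R) (A : set T).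

Definition lnorm p A f : \bar R := 'N[mu]_p[f \_ A].

(* the weight is inside the power *)
Definition wlnorm p w A f : \bar R := lnorm p A (fun x => f x * w x).

Definition weight A w := measurable_fun A w /\
  {ae mu, forall x, A x -> 0 < w x /\ w x < +oo}.

End norm.

Notation lnorm1 := (lnorm (@completed_lebesgue_measure R)).
Notation wlnorm1 := (wlnorm (@completed_lebesgue_measure R)).

Section euclid.
Variable n : nat.
Notation Rn := (euclid R n).
Notation lnormn := (lnorm (@lebesgueRn R n)).
Notation wlnormn := (wlnorm (@lebesgueRn R n)).

Definition coord (x : Rn) (i : 'I_n) : R := tnth (x : n.-tuple R) i.

Definition eball (t : R) : set Rn :=
  [set x | (Num.sqrt (\sum_(i < n) coord x i ^+ 2) < t)%R].

(* [euclid R n] carries no topology: compactness is that of 'rV[R]_n *)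
Definition euclid_compact (K : set Rn) :=
  compact [set (\row_i coord x i : 'rV[R]_n) | x in K].

Record qspace := QSpace { carrier : set (Rn -> \bar R) ;
                        snorm : (Rn -> \bar R) -> \bar R }.

Implicit Types (p th : \bar R) (v f : Rn -> \bar R) (w : R -> \bar R).

Definition LM_norm p th w v f : \bar R :=
  wlnorm1 th w `]0%R, +oo[ (fun t => wlnormn p v (eball t) f).

Definition LM p th w v : qspace := QSpace
  [set f | [/\ measurable_fun setT f,
    (forall K, euclid_compact K -> wlnormn p v K f < +oo) &
    LM_norm p th w v f < +oo]]
  (LM_norm p th w v).

Definition cLM_norm p th w v f : \bar R :=
  wlnorm1 th w `]0%R, +oo[ (fun t => wlnormn p v (~` eball t) f).

Definition cLM p th w v : qspace := QSpace
  [set f | [/\ measurable_fun setT f,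
    (forall t : R, (0 < t)%R -> wlnormn p v (~` eball t) f < +oo) &
    cLM_norm p th w v f < +oo]]
  (cLM_norm p th w v).

(* the least c with |f|_Y <= c |f|_X on X, and +oo if there is none *)
Definition embedding_norm (X Y : qspace) : \bar R :=
  ereal_inf [set c%:E | c in [set c : R | (0 <= c)%R /\
    forall f, carrier X f -> snorm Y f <= c%:E * snorm X f]].

Definition Vtilde (p1 p2 : \bar R) (v1 v2 : Rn -> \bar R) (x : R) : \bar R :=
  lnormn (arrow p1 p2) (eball x) (fun y => (v1 y)^-1 * v2 y).

End euclid.

Definition Mplus (w : R -> \bar R) :=
  measurable_fun (`]0%R, +oo[ : set (realL R)) (w : realL R -> \bar R) /\
  (forall t : R, (0 < t)%R -> 0 <= w t).

Definition Omega (th : \bar R) (w : R -> \bar R) := Mplus w /\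
  forall t : R, (0 < t)%R ->
    0 < lnorm1 th `]t, +oo[ w /\ lnorm1 th `]t, +oo[ w < +oo.

Definition cOmega (th : \bar R) (w : R -> \bar R) := Mplus w /\
  forall t : R, (0 < t)%R ->
    0 < lnorm1 th `]0%R, t[ w /\ lnorm1 th `]0%R, t[ w < +oo.

Definition calV (V : R -> \bar R) (t x : R) : \bar R := V t / (V t + V x).

Definition approx_by (lam : R) (a b : \bar R) :=
  (lam^-1)%:E * b <= a /\ a <= lam%:E * b.

Definition equiv_pos (f g : R -> \bar R) := exists lam : R,
  (1 <= lam)%R /\ forall t : R, (0 < t)%R -> approx_by lam (f t) (g t).

(* U takes values in R: strict monotonicity excludes the value +oo *)
Definition admissible (U : R -> \bar R) :=
  [/\ {within `[0%R, +oo[, continuous U},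
      {in `[0%R, +oo[ &, {homo U : s t / (s < t)%R >-> s < t}},
      U 0%R = 0 & U t @[t --> +oo%R] --> +oo].

Definition quasiconcave (U phi : R -> \bar R) :=
  (exists g : R -> \bar R,
    {in `]0%R, +oo[ &, {homo g : s t / (s <= t)%R >-> s <= t}} /\
    equiv_pos phi g) /\
  (exists h : R -> \bar R,
    {in `]0%R, +oo[ &, {homo h : s t / (s <= t)%R >-> t <= s}} /\
    equiv_pos (fun t => phi t / U t) h).

Definition nondegenerate_wrt (U phi : R -> \bar R) :=
  [/\ phi t @[t --> 0%R^'+] --> 0,
      (phi t)^-1 @[t --> +oo%R] --> 0,
      phi t / U t @[t --> +oo%R] --> 0 &
      U t / phi t @[t --> 0%R^'+] --> 0].

Definition QU (U : R -> \bar R) : set (R -> \bar R) :=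
  [set phi | quasiconcave U phi /\ nondegenerate_wrt U phi].

(* integrators, finite on ]0, +oo[ for w in cOmega th, resp. Omega th *)
Definition head_integrator (th : \bar R) (w : R -> \bar R) (r t : R) : R :=
  (- (fine (lnorm1 th `]0%R, t[ w) `^ (- r)))%R.

Definition tail_integrator (th : \bar R) (w : R -> \bar R) (r t : R) : R :=
  (- (fine (lnorm1 th `]t, +oo[ w) `^ r))%R.

Definition phi2 (V : R -> \bar R) (p2 th1 : \bar R) (w1 : R -> \bar R) (x : R) :
    \bar R :=
  let r := fine (arrow th1 p2) in
  (stieltjes_integral (head_integrator th1 w1 r)
     (fun t => (V t * calV V x t) `^ r)) `^ r^-1.

End Spaces.

(* Main.v *)
(* Cut R^n into the shells on which Vtilde doubles.  By Hoelder's inequality the p2-norm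
   of f v2 on a shell is at most the p1-norm a_m of f v1 times a constant multiple of the
   value V_m of Vtilde, with equality if |f v1|^p1 = |f v2|^p2 = (v2 / v1)^(p1 -> p2).  So
   the norm of I is comparable to the best constant B in LMd <= B^th2 cLMd^(th2 / th1),
   an inequality for the sequences a, uniformly over the dyadic grids with
   V (grid M m) = 2^(m - M), which exhaust (0, oo) as M -> oo.

   Let w_m and tau_m be the norms of w1 below, and of w2 above, the m-th grid point.  The
   discrete inequality is analysed on the levels where w, resp. tau, doubles.  It holds if
   tau_m H_m^(1/r) <= B and K_m <= B w_m (or summed versions, if th2 < th1), where
   r = th1 -> p2, H_m is the partial sum of V^r d(-w^-r), and K_m is the norm of the
   multiplier tau V from l^p1 to l^th2 on the first m cells.  Testing on sequences gives
   the converse, even with K_m / V_m in place of tau_m: as V doubles, either H increases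
   by a fixed factor, or tau_m is comparable to K_m / V_m, or K_m H_m^(1/r) / V_m decays
   geometrically.  Finally phi2 is comparable to H_m^(1/r) + V_m / w_m, up to the
   contribution of the total norm of w1, and the supremum, resp. integral, over t in the
   statement is comparable to K_m / V_m. *)

Require Import Defs.
From HB Require Import structures.
From mathcomp Require Import all_boot all_order all_algebra.
From mathcomp Require Import all_classical all_reals all_analysis.
From mathcomp Require Import measurable_realfun.
From mathcomp Require Import ring lra zify.

Set Implicit Arguments.
Unset Strict Implicit.
Unset Printing Implicit Defensive.

Import Order.TTheory GRing.Theory Num.Theory.
Import numFieldNormedType.Exports.
Import HBNNSimple.

Local Open Scope ring_scope.

(* keeps unification from unfolding real powers *)
#[local] Opaque powR.

(** * Real powers and finite sums *)

(** Exponents below 1 are allowed, so neither duality nor Minkowski's inequality is at hand. Hardy's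
    inequality is used only for geometric weights, whose ratio absorbs a leading constant close to
    1. The levels of [w] and of [tau] are not nested, so a [tau]-level is cut into cells at the ends
    of both families. Only one cell ends it: there the outer exponent acts on a single term and two
    multiplier bounds compose. Every other cell ends a level of [w], which has only one end; there
    Hoelder's inequality with exponent [r] produces the sums that become [H]. For necessity with
    [th2 < th1], a test sequence carries the weight of the very sum to be bounded: this sum appears
    on both sides and a power of it cancels. Suprema and Stieltjes integrals, as functions of the
    radius, are only compared with step functions, so integrals are bounded through the simple
    functions below the integrand. The index 0 of the grid [M] is a positive radius; raising both
    indices by [k] keeps the points and adds [k] cells towards 0. Quantities that see the whole ball
    are suprema over [k], and they increase with [k], which lets sums and products pass to the
    limit. *)

Section PowerSums.
Context {R : realType}.
Implicit Types (x y u p q eta : R).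

Lemma le_powR p x y : 0 <= p -> 0 <= x -> x <= y -> x `^ p <= y `^ p.
Proof.
move=> p0 x0 xy; apply: ge0_ler_powR => //; rewrite nnegrE//.
exact: le_trans xy.
Qed.

Lemma powRVK p x : p != 0 -> 0 <= x -> (x `^ p) `^ p^-1 = x.
Proof. by move=> p0 x0; rewrite -powRrM mulfV// powRr1. Qed.

Lemma powRKV p x : p != 0 -> 0 <= x -> (x `^ p^-1) `^ p = x.
Proof. by move=> p0 x0; rewrite -powRrM mulVf// powRr1. Qed.

Lemma powRD_pos p q x : 0 < x -> x `^ (p + q) = x `^ p * x `^ q.
Proof. by move=> x0; rewrite powRD//; apply/implyP => _; rewrite gt_eqF. Qed.

Lemma powRD_ge0 p q x : 0 < p + q -> x `^ (p + q) = x `^ p * x `^ q.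
Proof. by move=> pq; rewrite powRD// gt_eqF. Qed.

Lemma powR_invf p x : 0 <= x -> x^-1 `^ p = (x `^ p)^-1.
Proof. by move=> x0; rewrite -powR_inv1// -powRrM mulN1r powRN. Qed.

Lemma powR_div p x y : 0 <= x -> 0 <= y -> (x / y) `^ p = x `^ p / y `^ p.
Proof. by move=> x0 y0; rewrite powRM ?invr_ge0// powR_invf. Qed.

Lemma le_powRP p x y : 0 < p -> 0 <= x -> 0 <= y ->
  (x `^ p <= y `^ p) = (x <= y).
Proof.
move=> p0 x0 y0; apply/idP/idP => [|xy]; last exact/le_powR/xy/x0/ltW.
move=> h; rewrite leNgt; apply/negP => yx.
by move: h; rewrite leNgt gt0_ltr_powR// nnegrE.
Qed.

Lemma powR_pred p x : 0 <= x -> 0 < p -> x `^ p = x `^ (p - 1) * x.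
Proof. by move=> x0 p0; rewrite mulrC mulr_powRB1. Qed.

Lemma powR_sumD p x y : 0 <= x -> 0 <= y -> 1 <= p ->
  x `^ p + y `^ p <= (x + y) `^ p.
Proof.
move=> x0 y0 p1; have p0 : 0 < p by exact: lt_le_trans p1.
rewrite [leRHS]powR_pred ?addr_ge0// mulrDr lerD// powR_pred//.
  by rewrite ler_wpM2r// le_powR// ?subr_ge0// lerDl.
by rewrite ler_wpM2r// le_powR// ?subr_ge0// lerDr.
Qed.

Lemma powR_Dsum p x y : 0 <= x -> 0 <= y -> 0 < p <= 1 ->
  (x + y) `^ p <= x `^ p + y `^ p.
Proof.
move=> x0 y0 /andP[p0 p1].
rewrite -(@le_powRP p^-1) ?invr_gt0 ?addr_ge0 ?powR_ge0//.
rewrite powRVK ?gt_eqF ?addr_ge0//.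
rewrite (le_trans _ (powR_sumD _ _ _)) ?powR_ge0//; last first.
  by rewrite invf_ge1.
by rewrite !powRVK ?gt_eqF.
Qed.

Section bigs.
Variables (I : Type) (s : seq I) (P : pred I).
Implicit Types F G : I -> R.

Lemma sumr_powR_ge p F : (forall i, P i -> 0 <= F i) -> 1 <= p ->
  \sum_(i <- s | P i) F i `^ p <= (\sum_(i <- s | P i) F i) `^ p.
Proof.
move=> F0 p1; elim: s => [|i l IH]; first by rewrite !big_nil powR_ge0.
rewrite !big_cons; case: ifPn => // Pi; rewrite (le_trans _ (powR_sumD _ _ _))//.
- by rewrite lerD2l.
- exact: F0.
- exact: sumr_ge0.
Qed.

Lemma sumr_powR_le p F : (forall i, P i -> 0 <= F i) -> 0 < p <= 1 ->
  (\sum_(i <- s | P i) F i) `^ p <= \sum_(i <- s | P i) F i `^ p.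
Proof.
move=> F0 p1; elim: s => [|i l IH].
  by case/andP: p1 => p0 _; rewrite !big_nil powR0 ?gt_eqF.
rewrite !big_cons; case: ifPn => // Pi; rewrite (le_trans (powR_Dsum _ _ p1))//.
- exact: F0.
- exact: sumr_ge0.
- by rewrite lerD2l.
Qed.

Lemma hoelder_sum p q F G : (forall i, P i -> 0 <= F i) ->
  (forall i, P i -> 0 <= G i) -> 0 < p -> 0 < q -> p^-1 + q^-1 = 1 ->
  \sum_(i <- s | P i) F i * G i <= (\sum_(i <- s | P i) F i `^ p) `^ p^-1 *
                       (\sum_(i <- s | P i) G i `^ q) `^ q^-1.
Proof.
move=> F0 G0 p0 q0 pq; elim: s => [|i l IH].
  by rewrite !big_nil mulr_ge0 ?powR_ge0.
rewrite !big_cons; case: ifPn => // Pi.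
have a0 := F0 _ Pi; have b0 := G0 _ Pi.
rewrite (le_trans (lerD (lexx _) IH))//.
rewrite (le_trans (hoelder2 _ _ _ _ p0 q0 pq)) ?powR_ge0//.
have SF : 0 <= \sum_(j <- l | P j) F j `^ p by apply: sumr_ge0 => j _; exact: powR_ge0.
have SG : 0 <= \sum_(j <- l | P j) G j `^ q by apply: sumr_ge0 => j _; exact: powR_ge0.
move: (bigop _ _ _) (bigop _ _ _) SF SG => A B A0 B0.
by rewrite (powRKV (lt0r_neq0 p0) A0) (powRKV (lt0r_neq0 q0) B0).
Qed.

Lemma ler_sum_sub (Q : pred I) F : (forall i, P i -> Q i) ->
  (forall i, Q i -> 0 <= F i) ->
  \sum_(i <- s | P i) F i <= \sum_(i <- s | Q i) F i.
Proof.
move=> PQ F0; rewrite [leRHS](bigID P)/=.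
rewrite (eq_bigl (fun i => Q i && P i)); last first.
  by move=> i; case: (boolP (P i)) => [/PQ ->|]; rewrite ?andbF.
by rewrite lerDl sumr_ge0// => i /andP[/F0].
Qed.

(* the exponent of the multiplier norm from l^p to l^q is 1/r = 1/q - 1/p *)
Lemma hoelder_mult p q r F G : (forall i, P i -> 0 <= F i) ->
  (forall i, P i -> 0 <= G i) -> 0 < q -> q < p -> r^-1 = q^-1 - p^-1 ->
  \sum_(i <- s | P i) (F i * G i) `^ q <=
     (\sum_(i <- s | P i) F i `^ r) `^ (q / r) *
     (\sum_(i <- s | P i) G i `^ p) `^ (q / p).
Proof.
move=> F0 G0 q0 qp rE; have p0 : 0 < p by exact: lt_trans qp.
have r0 : 0 < r by rewrite -invr_gt0 rE subr_gt0 ltf_pV2.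
have -> : \sum_(i <- s | P i) (F i * G i) `^ q =
          \sum_(i <- s | P i) F i `^ q * G i `^ q.
  by apply: eq_bigr => i Pi; rewrite powRM ?F0 ?G0.
have e : (r / q)^-1 + (p / q)^-1 = 1.
  by rewrite !invf_div -mulrDr rE subrK mulfV ?gt_eqF.
have := @hoelder_sum (r / q) (p / q) (fun i => F i `^ q) (fun i => G i `^ q)
  (fun i _ => powR_ge0 _ _) (fun i _ => powR_ge0 _ _) (divr_gt0 r0 q0)
  (divr_gt0 p0 q0) e.
move/le_trans; apply; rewrite !invf_div.
have qK c x : (x `^ q) `^ (c / q) = x `^ c.
  by rewrite -powRrM mulrCA (mulfV (lt0r_neq0 q0)) mulr1.
have step a b (A B A' B' : R) : A = A' -> B = B' -> A `^ a * B `^ b <= A' `^ a * B' `^ b.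
  by move=> -> ->.
by apply: step; apply: eq_bigr => i _; exact: qK.
Qed.

End bigs.

(** The leading constant must be arbitrarily close to 1: in Hardy's inequality it is absorbed by the
    ratio of the weights. The cases are separated by [y = e x] with (1 + e)^u = 1 + eta: below, the
    sum is at most (1 + e) x, above, at most (1 + 1/e) y. *)
Lemma powR_eps u eta : 0 < u -> 0 < eta -> exists2 C, 0 < C & forall x y,
  0 <= x -> 0 <= y -> (x + y) `^ u <= (1 + eta) * x `^ u + C * y `^ u.
Proof.
move=> u0 e0; have e1 : 0 < 1 + eta by rewrite addr_gt0.
pose e := (1 + eta) `^ u^-1 - 1.
have ep : 0 < e.
  have := @gt0_ltr_powR R u^-1 _ 1 (1 + eta); rewrite powR1 subr_gt0; apply.
  - by rewrite invr_gt0.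
  - by rewrite nnegrE.
  - by rewrite nnegrE ltW.
  - by rewrite ltrDl.
exists ((1 + e^-1) `^ u) => [|x y x0 y0].
  by rewrite powR_gt0// addr_gt0// invr_gt0.
have [yx|xy] := leP y (e * x).
  apply: (@le_trans _ _ ((1 + eta) * x `^ u)); last first.
    by rewrite lerDl mulr_ge0 ?powR_ge0.
  have -> : (1 + eta) * x `^ u = ((1 + e) * x) `^ u.
    have e1' : 1 + e = (1 + eta) `^ u^-1 by rewrite /e addrC subrK.
    have e2 : 0 <= 1 + e by rewrite addr_ge0// ltW.
    by rewrite (powRM _ e2 x0) e1' (powRKV (lt0r_neq0 u0) (ltW e1)).
  by rewrite le_powR ?(ltW u0) ?addr_ge0// mulrDl mul1r lerD2l.
apply: (@le_trans _ _ ((1 + e^-1) `^ u * y `^ u)); last first.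
  by rewrite lerDr mulr_ge0 ?powR_ge0 ?(ltW e1).
rewrite -powRM ?addr_ge0 ?invr_ge0 ?(ltW ep)//.
rewrite le_powR ?(ltW u0) ?addr_ge0// mulrDl mul1r addrC lerD2l.
by rewrite ler_pdivlMl// ltW.
Qed.

Lemma powR_quasi u : 0 < u -> exists2 C, 0 < C & forall x y,
  0 <= x -> 0 <= y -> (x + y) `^ u <= C * (x `^ u + y `^ u).
Proof.
move=> u0; have [C C0 h] := powR_eps u0 (@ltr01 R).
exists (1 + 1 + C) => [|x y x0 y0]; first by rewrite addr_gt0// addr_gt0.
apply: (le_trans (h _ _ x0 y0)).
have := powR_ge0 x u; have := powR_ge0 y u; nra.
Qed.

(** With [powRB_le], a discrete chain rule: the increment of a power is comparable to x^(u-1) (x -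
    y). *)
Lemma powRB_ge u x y : 1 <= u -> 0 <= y <= x ->
  x `^ (u - 1) * (x - y) <= x `^ u - y `^ u.
Proof.
move=> u1 /andP[y0 yx]; have u0 : 0 < u by exact: lt_le_trans u1.
have x0 := le_trans y0 yx.
rewrite mulrBr -powR_pred// lerB// powR_pred// ler_wpM2r//.
by rewrite le_powR// subr_ge0.
Qed.

(** Young's inequality for x^(u-1) and y, with exponents u/(u-1) and u. *)
Lemma powRB_le u x y : 1 <= u -> 0 <= y -> 0 <= x ->
  x `^ u - y `^ u <= u * (x `^ (u - 1) * (x - y)).
Proof.
move=> u1 y0 x0; have u0 : 0 < u by exact: lt_le_trans u1.
move: u1; rewrite le_eqVlt => /predU1P[<-|u1].
  by rewrite subrr powRr0 !mul1r !powRr1.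
pose p := u / (u - 1).
have v0 : 0 < u - 1 by rewrite subr_gt0.
have p0 : 0 < p by rewrite divr_gt0.
have pu : p^-1 + u^-1 = 1.
  by rewrite /p invf_div -{2}(div1r u) -mulrDl subrK mulfV// gt_eqF.
have := conjugate_powR (powR_ge0 x (u - 1)) y0 p0 u0 pu.
rewrite -powRrM (_ : (u - 1) * p = u); last by rewrite /p mulrCA mulfV ?gt_eqF ?mulr1.
rewrite /p -(ler_pM2l u0) mulrDr [in X in _ <= _ + X -> _]mulrCA mulfV ?gt_eqF// mulr1.
rewrite invf_div => h; rewrite mulrBr -powR_pred//.
have e : u * (x `^ u * ((u - 1) / u)) = u * x `^ u - x `^ u.
  by field; rewrite gt_eqF.
move: h; rewrite e; lra.
Qed.

End PowerSums.

(** * Hardy inequalities for geometric weights *)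

Section Hardy.
Context {R : realType}.
Implicit Types (u lam : R) (x g W G : nat -> R).

Lemma sum_fiber (n N : nat) (P : pred 'I_n) (k : nat -> nat) (F : 'I_n -> R) :
  (forall i, P i -> (k i < N)%N) ->
  \sum_(i < n | P i) F i = \sum_(c < N) \sum_(i < n | P i && (k i == c)) F i.
Proof.
move=> kN; rewrite (exchange_big_dep P) /=; last by move=> c i _ /andP[].
apply: eq_bigr => i Pi; rewrite (big_pred1 (Ordinal (kN _ Pi)))//.
by move=> c; rewrite /= Pi -val_eqE /= eq_sym.
Qed.

Lemma monotone_cut (P : pred nat) (n : nat) :
  (forall i j, (i <= j)%N -> P i -> P j) ->
  exists2 c, (c <= n)%N & forall i, (i < n)%N -> P i = (c <= i)%N.
Proof.
move=> mP; elim: n => [|n [c cn IH]]; first by exists 0%N.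
have [Pn|Pn] := boolP (P n).
  exists c => [|i]; first exact: leqW.
  by rewrite ltnS leq_eqVlt => /predU1P[->|/IH//]; rewrite Pn cn.
exists n.+1 => // i; rewrite ltnS => i_n.
rewrite ltnNge i_n; apply/negbTE; apply: contra Pn; exact: mP.
Qed.

(** [powR_eps] bounds the power of each partial sum by that of the previous one plus a new term.
    Multiplied by [g k.+1 <= lam * g k] and summed, this reproduces the left-hand side with a factor
    at most [1 - eta], which is absorbed. *)
Lemma hardy_left lam u : 0 <= lam < 1 -> 0 < u -> exists2 C, 0 < C &
  forall x g n, (forall k, 0 <= x k) -> (forall k, 0 <= g k) ->
    (forall k, g k.+1 <= lam * g k) ->
  \sum_(k < n) g k * (\sum_(i < k.+1) x i) `^ u <= C * \sum_(k < n) g k * x k `^ u.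
Proof.
(* With this choice [lam * (1 + eta) <= 1 - eta]. *)
move=> /andP[l0 l1] u0; pose eta := (1 - lam) / 2.
have e0 : 0 < eta by rewrite divr_gt0// subr_gt0.
have [C C0 hC] := powR_eps u0 e0.
exists ((1 + C) / eta) => [|x g n x0 g0 gl]; first by rewrite divr_gt0// addr_gt0.
pose P k := \sum_(i < k.+1) x i.
have P0 k : 0 <= P k by rewrite sumr_ge0.
have T0 m : 0 <= \sum_(k < m) g k * x k `^ u.
  by rewrite sumr_ge0// => k _; rewrite mulr_ge0// powR_ge0.
have gP k : 0 <= g k * P k `^ u by rewrite mulr_ge0// powR_ge0.
rewrite mulrAC ler_pdivlMr//.
case: n => [|n]; first by rewrite !big_ord0 mul0r mulr0.
have key : \sum_(k < n) g k.+1 * P k.+1 `^ u <=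
    (1 - eta) * \sum_(k < n) g k * P k `^ u + C * \sum_(k < n) g k.+1 * x k.+1 `^ u.
  rewrite !mulr_sumr -big_split/=; apply: ler_sum => k _.
  have -> : P k.+1 = P k + x k.+1 by rewrite /P big_ord_recr.
  apply: le_trans (ler_wpM2l (g0 _) (hC _ _ (P0 _) (x0 _))) _.
  rewrite mulrDr (mulrCA _ C) lerD2r mulrCA mulrA.
  rewrite (mulrA _ (g k)) ler_wpM2r ?powR_ge0//.
  rewrite (le_trans (ler_wpM2l _ (gl k))) ?addr_ge0 ?(ltW e0)//.
  rewrite mulrA ler_wpM2r// /eta; nra.
have := T0 n.+1.
rewrite [X in X * eta]big_ord_recl /= [X in _ <= (1 + C) * X]big_ord_recl /=.
under [X in (_ + X) * eta <= _]eq_bigr do rewrite /bump /= add1n.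
under [X in _ <= (1 + C) * (_ + X)]eq_bigr do rewrite /bump /= add1n.
have le1 : \sum_(k < n) g k * P k `^ u <=
   g 0%N * P 0%N `^ u + \sum_(k < n) g k.+1 * P k.+1 `^ u.
  have := gP n.
  have -> : g 0%N * P 0%N `^ u + \sum_(k < n) g k.+1 * P k.+1 `^ u =
    \sum_(k < n.+1) g k * P k `^ u.
    by rewrite big_ord_recl; congr (_ + _); apply: eq_bigr => i _; rewrite /bump add1n.
  by rewrite big_ord_recr/= lerDl.
have S0 : 0 <= \sum_(k < n) g k.+1 * x k.+1 `^ u.
  by rewrite sumr_ge0// => k _; rewrite mulr_ge0// powR_ge0.
have P0E : P 0%N = x 0%N by rewrite /P big_ord1.
move: key le1; rewrite -/(P 0%N) P0E.
have : 0 <= g 0%N * x 0%N `^ u by rewrite mulr_ge0// powR_ge0.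
have eta1 : eta < 1 by rewrite /eta; lra.
rewrite /bump /=.
move: (\sum_(k < n) g k.+1 * P k.+1 `^ u) (\sum_(k < n) g k * P k `^ u) S0.
move: (\sum_(k < n) g k.+1 * x k.+1 `^ u) (g 0%N * x 0%N `^ u).
move=> T a S S' T0' a0 key le1 _.
nra.
Qed.

Lemma hardy_right lam u : 0 <= lam < 1 -> 0 < u -> exists2 C, 0 < C &
  forall x g n, (forall k, 0 <= x k) -> (forall k, 0 <= g k) ->
    (forall k, g k <= lam * g k.+1) ->
  \sum_(k < n) g k * (\sum_(k <= i < n) x i) `^ u <= C * \sum_(k < n) g k * x k `^ u.
Proof.
move=> /andP[l0 l1] u0; pose eta := (1 - lam) / 2.
have e0 : 0 < eta by rewrite divr_gt0// subr_gt0.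
have [C C0 hC] := powR_eps u0 e0.
exists (C / eta) => [|x g n x0 g0 gl]; first by rewrite divr_gt0.
pose P k := \sum_(k <= i < n) x i.
have P0 k : 0 <= P k by rewrite sumr_ge0.
have gP k : 0 <= g k * P k `^ u by rewrite mulr_ge0// powR_ge0.
rewrite mulrAC ler_pdivlMr//.
have key : \sum_(k < n) g k * P k `^ u <=
    (1 - eta) * \sum_(k < n) g k.+1 * P k.+1 `^ u + C * \sum_(k < n) g k * x k `^ u.
  rewrite !mulr_sumr -big_split/=; apply: ler_sum => k _.
  have -> : P k = P k.+1 + x k by rewrite /P big_ltn// addrC.
  apply: le_trans (ler_wpM2l (g0 _) (hC _ _ (P0 _) (x0 _))) _.
  rewrite mulrDr (mulrCA _ C) lerD2r mulrCA mulrA.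
  rewrite (mulrA _ (g k.+1)) ler_wpM2r ?powR_ge0//.
  rewrite (le_trans (ler_wpM2l _ (gl k))) ?addr_ge0 ?(ltW e0)//.
  rewrite mulrA ler_wpM2r// /eta; nra.
have le1 : \sum_(k < n) g k.+1 * P k.+1 `^ u <= \sum_(k < n) g k * P k `^ u.
  case: n {key gP} @P P0 => [|n] P P0; first by rewrite !big_ord0.
  rewrite big_ord_recr/= [X in _ + g _ * X `^ u <= _](_ : _ = 0); last first.
    by rewrite /P big_geq.
  rewrite powR0 ?lt0r_neq0// mulr0 addr0 [leRHS]big_ord_recl.
  by rewrite lerDr mulr_ge0// powR_ge0.
have eta1 : eta < 1 by rewrite /eta; lra.
move: key le1; rewrite -/P.
move: (\sum_(k < n) g k.+1 * P k.+1 `^ u) => S'.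
rewrite -/(P _); under [X in _ -> _ -> X * eta <= _]eq_bigr do rewrite -/(P _).
move: (\sum_(k < n) g k * P k `^ u) => S key le1.
nra.
Qed.

Lemma geometric_sum_le lam G n : 0 <= lam < 1 -> (forall k, 0 <= G k) ->
  (forall k, G k <= lam * G k.+1) -> \sum_(k < n.+1) G k <= (1 - lam)^-1 * G n.
Proof.
move=> /andP[l0 l1] G0 Gl; have h : 0 < 1 - lam by rewrite subr_gt0.
rewrite ler_pdivlMl//; elim: n => [|n IH].
  by rewrite big_ord1 ler_piMl//; lra.
rewrite big_ord_recr /= mulrDr (le_trans (lerD IH (lexx _)))//.
have := Gl n; lra.
Qed.

Lemma geometric_sum_ge lam G n : 0 <= lam < 1 -> (forall k, 0 <= G k) ->
  (forall k, G k.+1 <= lam * G k) -> \sum_(k < n) G k <= (1 - lam)^-1 * G 0%N.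
Proof.
move=> /andP[l0 l1] G0 Gl; have h : 0 < 1 - lam by rewrite subr_gt0.
rewrite ler_pdivlMl//.
suff : (1 - lam) * \sum_(k < n) G k + G n <= G 0%N.
  by apply: le_trans; rewrite lerDl.
elim: n => [|n IH]; first by rewrite big_ord0 mulr0 add0r.
rewrite big_ord_recr /=; apply: le_trans IH; have := Gl n; lra.
Qed.

End Hardy.

(** * Monotone sequences grouped into dyadic levels *)

Section Levels.
Context {R : realType}.
Implicit Types (u lam : R) (x W G : nat -> R) (k : nat -> nat).

(** [k i] is the integer part of the binary logarithm of [w i / w 0]. It may skip values, so levels
    may be empty. *)
Lemma level_function (w : nat -> R) : (forall i, 0 < w i) ->
  (forall i, w i <= w i.+1) -> exists k : nat -> nat,
  (forall i j, (i <= j)%N -> (k i <= k j)%N) /\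
  forall i, w 0%N * 2 ^+ k i <= w i < w 0%N * 2 ^+ (k i).+1.
Proof.
move=> w0 wS.
have wm i j : (i <= j)%N -> w i <= w j by exact: (homo_leq (@lexx _ R) (@le_trans _ R)).
have ex i : exists m, w i < w 0%N * 2 ^+ m.
  have := archi_boundP (ltW (divr_gt0 (w0 i) (w0 0%N))).
  set m := Num.bound _ => hm; exists m.
  rewrite -ltr_pdivrMl// mulrC (lt_trans hm)// -natrX ltr_nat.
  exact: ltn_expl.
pose k i := (ex_minn (ex i)).-1.
have kP i : w 0%N * 2 ^+ k i <= w i < w 0%N * 2 ^+ (k i).+1.
  rewrite /k; case: ex_minnP => -[|m] hm min /=.
    by move: hm; rewrite expr0 mulr1 ltNge wm.
  by rewrite hm andbT leNgt; apply/negP => /min; rewrite ltnn.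
exists k; split => // i j /wm wij.
have /andP[h1 _] := kP i; have /andP[_ h2] := kP j.
have : w 0%N * 2 ^+ k i < w 0%N * 2 ^+ (k j).+1 by apply: le_lt_trans h2; apply: le_trans wij.
by rewrite ltr_pM2l// ltr_eXn2l// ?ltr1n.
Qed.

(** By monotonicity the indices of level at least [c] form a final segment; the cut [m] is [n] when
    there are none. *)
Lemma tail_fiber k x n c : (forall i j, (i <= j)%N -> (k i <= k j)%N) ->
  exists2 m, (m <= n)%N & (forall i, (i < n)%N -> (c <= k i)%N = (m <= i)%N) /\
    \sum_(i < n | (c <= k i)%N) x i = \sum_(m <= i < n) x i.
Proof.
move=> km; have [i j ij|m mn hm] := @monotone_cut (fun i => c <= k i)%N n.
  by move/leq_trans; apply; exact: km.
exists m => //; split => //.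
rewrite -(big_mkord (fun i => c <= k i)%N) (@big_cat_nat _ _ _ m 0 n _ _ (leq0n m) mn)/=.
rewrite big_nat_cond big1 ?add0r => [|i /andP[/andP[_ im]]]; last first.
  by rewrite hm ?(leq_trans im)// leqNgt im.
rewrite big_nat_cond [RHS]big_nat_cond; apply: eq_bigl => i.
by case: (boolP (m <= i < n)%N) => //= /andP[mi i_n]; rewrite hm.
Qed.

Lemma head_fiber k x n c : (forall i j, (i <= j)%N -> (k i <= k j)%N) ->
  exists2 m, (m <= n)%N & (forall i, (i < n)%N -> (k i <= c)%N = (i < m)%N) /\
    \sum_(i < n | (k i <= c)%N) x i = \sum_(i < m) x i.
Proof.
move=> km; have [i j ij|m mn hm] := @monotone_cut (fun i => c < k i)%N n.
  by move/leq_trans; apply; exact: km.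
have hm' i : (i < n)%N -> (k i <= c)%N = (i < m)%N.
  by move=> /hm; rewrite ltnNge [X in _ = X]leqNgt => /negb_inj.
exists m => //; split => //.
rewrite -(big_mkord (fun i => k i <= c)%N) (@big_cat_nat _ _ _ m 0 n _ _ (leq0n m) mn)/=.
rewrite [X in _ + X]big_nat_cond [X in _ + X]big1 ?addr0 => [|i /andP[/andP[mi i_n]]]; last first.
  by rewrite hm'// ltnNge mi.
rewrite -(big_mkord xpredT) big_nat_cond [RHS]big_nat_cond; apply: eq_bigl => i.
by case: (boolP (0 <= i < m)%N) => //= im; rewrite hm' ?(leq_trans im).
Qed.

Lemma tail_telescope k x n c u : (forall i j, (i <= j)%N -> (k i <= k j)%N) -> 0 < u ->
  \sum_(m < n | (c <= k m)%N)
    ((\sum_(m <= i < n) x i) `^ u - (\sum_(m.+1 <= i < n) x i) `^ u) =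
  (\sum_(i < n | (c <= k i)%N) x i) `^ u.
Proof.
move=> km u0; pose F m := - (\sum_(m <= i < n) x i) `^ u.
have -> : \sum_(m < n | (c <= k m)%N)
    ((\sum_(m <= i < n) x i) `^ u - (\sum_(m.+1 <= i < n) x i) `^ u) =
  \sum_(m < n | (c <= k m)%N) (F m.+1 - F m).
  by apply: eq_bigr => i _; rewrite /F opprK addrC.
have [m mn [hm ->]] := tail_fiber x n c km.
have [m' mn' [hm' ->]] := tail_fiber (fun m => F m.+1 - F m) n c km.
have -> : m' = m.
  apply/eqP; rewrite eqn_leq; apply/andP; split; rewrite leqNgt; apply/negP => h.
    by have := hm m (leq_trans h mn'); rewrite leqnn hm' ?(leq_trans h mn')// leqNgt h.
  by have := hm' m' (leq_trans h mn); rewrite leqnn hm ?(leq_trans h mn)// leqNgt h.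
rewrite telescope_sumr// /F (big_geq (leqnn n)) powR0 ?lt0r_neq0//.
by rewrite oppr0 sub0r opprK.
Qed.

Lemma head_telescope k x n c u : (forall i j, (i <= j)%N -> (k i <= k j)%N) -> 0 < u ->
  \sum_(m < n | (k m <= c)%N)
    ((\sum_(i < m.+1) x i) `^ u - (\sum_(i < m) x i) `^ u) =
  (\sum_(i < n | (k i <= c)%N) x i) `^ u.
Proof.
move=> km u0; pose F m := (\sum_(i < m) x i) `^ u.
have [m mn [hm ->]] := head_fiber x n c km.
have [m' mn' [hm' ->]] := head_fiber (fun m => F m.+1 - F m) n c km.
have -> : m' = m.
  apply/eqP; rewrite eqn_leq; apply/andP; split; rewrite leqNgt; apply/negP => h.
    by have := hm m (leq_trans h mn'); rewrite ltnn hm' ?(leq_trans h mn')// h.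
  by have := hm' m' (leq_trans h mn); rewrite ltnn hm ?(leq_trans h mn)// h.
rewrite -(big_mkord xpredT (fun m => F m.+1 - F m)) telescope_sumr// /F.
by rewrite big_ord0 powR0 ?lt0r_neq0// subr0.
Qed.

Lemma tail_diff_ge0 x n m u : (forall i, 0 <= x i) -> 0 < u ->
  0 <= (\sum_(m <= i < n) x i) `^ u - (\sum_(m.+1 <= i < n) x i) `^ u.
Proof.
move=> x0 u0; rewrite subr_ge0 le_powR ?(ltW u0) ?sumr_ge0//.
have [mn|mn] := ltnP m n; first by rewrite [leRHS]big_ltn// lerDr.
by rewrite !big_geq// ltnW.
Qed.

Lemma head_diff_ge0 x m u : (forall i, 0 <= x i) -> 0 < u ->
  0 <= (\sum_(i < m.+1) x i) `^ u - (\sum_(i < m) x i) `^ u.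
Proof.
move=> x0 u0; rewrite subr_ge0 le_powR ?(ltW u0) ?sumr_ge0//.
by rewrite big_ord_recr /= lerDl.
Qed.

(** The increments over the level [c] add up to at most the power of the whole tail from that level
    on. Since [G] grows geometrically, [hardy_right] replaces this tail by the level alone. *)
Lemma levels_tail_le lam u : 0 <= lam < 1 -> 0 < u -> exists2 C, 0 < C &
  forall k W G x n N, (forall i j, (i <= j)%N -> (k i <= k j)%N) ->
    (forall i, (i < n)%N -> (k i < N)%N) -> (forall c, 0 <= G c) ->
    (forall c, G c <= lam * G c.+1) -> (forall i, 0 <= x i) ->
    (forall i, W i <= G (k i)) ->
  \sum_(m < n) W m *
    ((\sum_(m <= i < n) x i) `^ u - (\sum_(m.+1 <= i < n) x i) `^ u) <=
  C * \sum_(c < N) G c * (\sum_(i < n | k i == c) x i) `^ u.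
Proof.
move=> l u0; have [C C0 hC] := hardy_right l u0.
exists C => // k W G x n N km kN G0 Gl x0 WG.
pose y c := \sum_(i < n | k i == c) x i.
have y0 c : 0 <= y c by rewrite sumr_ge0.
apply: le_trans (hC y G N y0 G0 Gl).
apply: le_trans (ler_sum _ (fun (m : 'I_n) _ => ler_wpM2r (tail_diff_ge0 n m x0 u0) (WG m))) _.
rewrite [leLHS](@sum_fiber _ n N xpredT k)/=; last by move=> i _; exact: kN.
apply: ler_sum => c _.
have -> : \sum_(c <= i < N) y i = \sum_(i < n | (c <= k i)%N) x i.
  rewrite (@sum_fiber _ n N (fun i => c <= k i)%N k); last by move=> i _; exact: kN.
  rewrite -(big_mkord xpredT (fun d => \sum_(i < n | (c <= k i)%N && (k i == d)) x i)).
  rewrite [RHS](@big_cat_nat _ _ _ c 0 N _ _ (leq0n c) (ltnW (ltn_ord c)))/=.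
  rewrite [X in _ = X + _]big_nat [X in _ = X + _]big1 ?add0r; last first.
    move=> d /andP[_ dc]; rewrite big1// => i /andP[ck /eqP kd].
    by move: dc; rewrite -kd ltnNge ck.
  rewrite big_nat [RHS]big_nat; apply: eq_bigr => d /andP[cd _].
  by rewrite /y; apply: eq_bigl => i; case: eqP => [->|]; rewrite ?andbF// cd.
rewrite -(tail_telescope x n c km u0) mulr_sumr.
under eq_bigr => i /eqP -> do over.
apply: ler_sum_sub => [i /eqP ->//|i _].
by rewrite mulr_ge0// tail_diff_ge0.
Qed.

(** A level sum is at most the tail sum from this level on, which telescopes into the increments at
    all later levels. Exchanging the sums leaves a geometric sum of [G c] over [c <= k m],
    comparable to [G (k m)]. *)
Lemma levels_tail_ge lam u : 0 <= lam < 1 -> 0 < u -> exists2 C, 0 < C &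
  forall k W G x n N, (forall i j, (i <= j)%N -> (k i <= k j)%N) ->
    (forall c, 0 <= G c) ->
    (forall c, G c <= lam * G c.+1) -> (forall i, 0 <= x i) ->
    (forall i, G (k i) <= W i) ->
  \sum_(c < N) G c * (\sum_(i < n | k i == c) x i) `^ u <=
  C * \sum_(m < n) W m *
    ((\sum_(m <= i < n) x i) `^ u - (\sum_(m.+1 <= i < n) x i) `^ u).
Proof.
move=> l u0; exists (1 - lam)^-1.
  by rewrite invr_gt0 subr_gt0; case/andP: l.
move=> k W G x n N km G0 Gl x0 WG.
pose D (m : 'I_n) := (\sum_(m <= i < n) x i) `^ u - (\sum_(m.+1 <= i < n) x i) `^ u.
have D0 m : 0 <= D m by exact: tail_diff_ge0.
apply: (@le_trans _ _ (\sum_(c < N) \sum_(m < n | (c <= k m)%N) G c * D m)).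
  apply: ler_sum => c _; rewrite -mulr_sumr ler_wpM2l// tail_telescope//.
  rewrite le_powR ?(ltW u0) ?sumr_ge0// ler_sum_sub//.
  by move=> i /eqP ->.
rewrite (exchange_big_dep xpredT)//= mulr_sumr; apply: ler_sum => m _.
rewrite -mulr_suml mulrA ler_wpM2r//.
apply: (@le_trans _ _ (\sum_(c < (k m).+1) G c)).
  rewrite (big_ord_widen_cond _ (fun c => c <= k m)%N G (leq_maxl N (k m).+1)).
  rewrite (big_ord_widen_cond _ xpredT G (leq_maxr N (k m).+1)).
  by apply: ler_sum_sub => // i /andP[].
by rewrite (le_trans (geometric_sum_le _ l G0 Gl))// ler_wpM2l// invr_ge0 subr_ge0 ltW//; case/andP: l.
Qed.

(** Mirror image of [levels_tail_le]: decaying weights, initial segments and [hardy_left]. *)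
Lemma levels_head_le lam u : 0 <= lam < 1 -> 0 < u -> exists2 C, 0 < C &
  forall k W G x n N, (forall i j, (i <= j)%N -> (k i <= k j)%N) ->
    (forall i, (i < n)%N -> (k i < N)%N) -> (forall c, 0 <= G c) ->
    (forall c, G c.+1 <= lam * G c) -> (forall i, 0 <= x i) ->
    (forall i, W i <= G (k i)) ->
  \sum_(m < n) W m *
    ((\sum_(i < m.+1) x i) `^ u - (\sum_(i < m) x i) `^ u) <=
  C * \sum_(c < N) G c * (\sum_(i < n | k i == c) x i) `^ u.
Proof.
move=> l u0; have [C C0 hC] := hardy_left l u0.
exists C => // k W G x n N km kN G0 Gl x0 WG.
pose y c := \sum_(i < n | k i == c) x i.
have y0 c : 0 <= y c by rewrite sumr_ge0.
apply: le_trans (hC y G N y0 G0 Gl).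
apply: le_trans (ler_sum _ (fun (m : 'I_n) _ => ler_wpM2r (head_diff_ge0 m x0 u0) (WG m))) _.
rewrite [leLHS](@sum_fiber _ n N xpredT k)/=; last by move=> i _; exact: kN.
apply: ler_sum => c _.
have -> : \sum_(i < c.+1) y i = \sum_(i < n | (k i <= c)%N) x i.
  rewrite (@sum_fiber _ n c.+1 (fun i => k i <= c)%N k)//.
  apply: eq_bigr => d _.
  rewrite /y; apply: eq_bigl => i; case: eqP => [->|]; rewrite ?andbF//.
  by rewrite -ltnS ltn_ord.
rewrite -(head_telescope x n c km u0) mulr_sumr.
under eq_bigr => i /eqP -> do over.
apply: ler_sum_sub => [i /eqP ->//|i _].
by rewrite mulr_ge0// head_diff_ge0.
Qed.

(** After exchanging the sums, [D m] is counted at all levels from [k m] on, where the weights decay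
    geometrically from [G (k m)]. *)
Lemma levels_increment lam k G (D : nat -> R) n N : 0 <= lam < 1 ->
  (forall c, 0 <= G c) -> (forall c, G c.+1 <= lam * G c) ->
  (forall i, 0 <= D i) ->
  \sum_(c < N) G c * \sum_(m < n | (k m <= c)%N) D m <=
  (1 - lam)^-1 * \sum_(m < n) G (k m) * D m.
Proof.
move=> l G0 Gl D0; have h : 0 <= (1 - lam)^-1.
  by rewrite invr_ge0 subr_ge0 ltW//; case/andP: l.
under eq_bigr do rewrite mulr_sumr.
rewrite (exchange_big_dep xpredT)//= mulr_sumr; apply: ler_sum => m _.
rewrite -mulr_suml mulrA ler_wpM2r//.
rewrite -(big_mkord (fun c => k m <= c)%N).
have [Nk|kN] := leqP N (k m).
  rewrite big_nat_cond big1 ?mulr_ge0// => i /andP[/andP[_ iN]].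
  by rewrite leqNgt (leq_trans iN).
rewrite (@big_cat_nat _ _ _ (k m) 0 N _ _ (leq0n _) (ltnW kN))/=.
rewrite big_nat_cond big1 ?add0r => [|i /andP[/andP[_ ik]]]; last by rewrite leqNgt ik.
rewrite big_mkcond/= -{1}(add0n (k m)) big_addn big_mkord.
have Gl' i : G (i.+1 + k m)%N <= lam * G (i + k m)%N by rewrite addSn.
have := @geometric_sum_ge _ lam (fun i => G (i + k m)%N) (N - k m) l (fun=> G0 _) Gl'.
rewrite add0n; apply: le_trans; apply: ler_sum => i _.
by rewrite leq_addl.
Qed.

End Levels.

(** * The discrete inequality: sufficient conditions *)

Section Ends.

Definition next_end (E : pred nat) (n l : nat) := (l + find E (iota l (n - l)))%N.

Lemma next_endP (E : pred nat) n l : E n.-1 -> (l < n)%N ->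
  [/\ (l <= next_end E n l < n)%N, E (next_end E n l) &
      forall i, (l <= i < next_end E n l)%N -> ~~ E i].
Proof.
move=> En ln; have h : has E (iota l (n - l)).
  by apply/hasP; exists n.-1 => //; rewrite mem_iota; lia.
have := nth_find l h; rewrite has_find size_iota in h.
rewrite nth_iota// => Ee; split => //.
  by rewrite /next_end leq_addr/=; lia.
move=> i /andP[li ie]; have := @before_find _ l E (iota l (n - l)) (i - l).
rewrite /next_end in ie; rewrite nth_iota; last by lia.
by rewrite subnKC// => ->//; lia.
Qed.

Definition level_end (k : nat -> nat) n i := (i.+1 == n) || (k i.+1 != k i).

Lemma level_end_inj k n i j : (forall i j, (i <= j)%N -> (k i <= k j)%N) ->
  (i < n)%N -> (j < n)%N -> level_end k n i -> level_end k n j -> k i = k j -> i = j.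
Proof.
move=> km; wlog ij : i j / (i < j)%N => [h i_n jn ei ej kij|].
  have [ij|ij|//] := ltngtP i j; first exact: h.
  by apply/esym/h.
move=> i_n jn /orP[/eqP e|/eqP ki] _ kij; first by lia.
by exfalso; apply: ki; apply/eqP; rewrite eqn_leq kij km//= -kij km.
Qed.

Lemma level_endPn k n i : ~~ level_end k n i -> k i.+1 = k i.
Proof. by rewrite negb_or => /andP[_ /negPn/eqP]. Qed.

(** No level ends strictly before the next marked index, so [k] does not move on the way. *)
Lemma next_end_level (E : pred nat) k n l :
  (forall i, level_end k n i -> E i) -> (l < n)%N -> k (next_end E n l) = k l.
Proof.
move=> kE ln; have En : E n.-1 by apply: kE; rewrite /level_end; case: n ln => //= n _; rewrite eqxx.
have [/andP[le _] _ h] := next_endP En ln.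
move: h; rewrite -(subnKC le); elim: (_ - l)%N => [|d IH] h; first by rewrite addn0.
rewrite addnS (@level_endPn k n).
  by apply: IH => i /andP[li id]; apply: h; lia.
by apply/negP => /kE; apply/negP; apply: h; lia.
Qed.

Context {R : realType}.

Lemma big_at_most_one (I : finType) (P : pred I) :
  (forall i j, P i -> P j -> i = j) ->
  (P =1 pred0) \/ exists2 i, P i & P =1 pred1 i.
Proof.
move=> uP; case: (pickP P) => [i Pi|]; [right|by left].
exists i => // j; apply/idP/eqP => [Pj|->//]; exact: uP.
Qed.

Lemma sum_at_most_one (I : finType) (P : pred I) (x : R) :
  (forall i j, P i -> P j -> i = j) -> 0 <= x -> \sum_(i | P i) x <= x.
Proof.
move=> /big_at_most_one[P0|[i Pi P1]] x0; first by rewrite big_pred0.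
by rewrite (big_pred1 i).
Qed.

Lemma powR_sum_at_most_one (I : finType) (P : pred I) (F : I -> R) (t : R) :
  (forall i j, P i -> P j -> i = j) -> 0 < t ->
  (\sum_(i | P i) F i) `^ t <= \sum_(i | P i) F i `^ t.
Proof.
move=> /big_at_most_one[P0|[i Pi P1]] t0.
  by rewrite !big_pred0// powR0// lt0r_neq0.
by rewrite !(big_pred1 i).
Qed.

(** A level has at most one end, so each [F c] is counted at most once. *)
Lemma sum_level_end_le k n N (F : nat -> R) (P : pred nat) :
  (forall i j, (i <= j)%N -> (k i <= k j)%N) ->
  (forall i, (i < n)%N -> (k i < N)%N) -> (forall c, 0 <= F c) ->
  (forall i, P i -> level_end k n i) ->
  \sum_(i < n | P i) F (k i) <= \sum_(c < N) F c.
Proof.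
move=> km kN F0 PE; rewrite (@sum_fiber _ n N _ k); last by move=> i _; exact: kN.
apply: ler_sum => c _; under eq_bigr => i /andP[_ /eqP ->] do over.
apply: sum_at_most_one => // i j /andP[/PE ei /eqP ki] /andP[/PE ej /eqP kj].
by apply/val_inj/(level_end_inj km (ltn_ord i) (ltn_ord j) ei ej); rewrite ki kj.
Qed.

End Ends.

Section Discrete.
Context {R : realType}.
Implicit Types (p th r s t B C : R) (V w tau a x y K : nat -> R)
  (P S : pred nat).

(* powers of the discrete norms of f, where [a i] is the norm of [f v1] on the i-th
   shell; the weights w1, w2 enter through their head, resp. tail, norms [w], [tau] *)
Definition LMd p2 th2 V tau a n := \sum_(m < n) tau m `^ th2 *
  ((\sum_(i < m.+1) (V i * a i) `^ p2) `^ (th2 / p2) -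
   (\sum_(i < m) (V i * a i) `^ p2) `^ (th2 / p2)).

Definition cLMd p1 th1 w a n := \sum_(m < n) w m `^ th1 *
  ((\sum_(m <= i < n) a i `^ p1) `^ (th1 / p1) -
   (\sum_(m.+1 <= i < n) a i `^ p1) `^ (th1 / p1)).

Definition multiplier p th n (P : pred nat) x B := forall y, (forall i, 0 <= y i) ->
  \sum_(i < n | P i) (x i * y i) `^ th <=
  B `^ th * (\sum_(i < n | P i) y i `^ p) `^ (th / p).

(** For [p <= th] the space l^p embeds into l^th with constant 1, so a bound on the entries is
    enough. *)
Lemma multiplier_sup p th n P x B : 0 < p -> p <= th -> 0 <= B ->
  (forall i, (i < n)%N -> P i -> 0 <= x i <= B) -> multiplier p th n P x B.
Proof.
move=> p0 pth B0 xB y y0; have th0 : 0 < th by exact: lt_le_trans pth.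
apply: (@le_trans _ _ (\sum_(i < n | P i) B `^ th * (y i `^ p) `^ (th / p))).
  apply: ler_sum => i Pi; have /andP[x0 xb] := xB _ (ltn_ord i) Pi.
  rewrite -powRrM mulrCA mulfV ?lt0r_neq0// mulr1 -powRM//.
  by rewrite le_powR ?(ltW th0) ?mulr_ge0// ler_wpM2r.
rewrite -mulr_sumr ler_wpM2l ?powR_ge0// sumr_powR_ge//.
  by move=> i _; rewrite powR_ge0.
by rewrite ler_pdivlMr// mul1r.
Qed.

Lemma multiplier_pow p th s n P x B : 0 < th -> th < p -> s^-1 = th^-1 - p^-1 ->
  0 <= B -> (forall i, 0 <= x i) ->
  \sum_(i < n | P i) x i `^ s <= B `^ s -> multiplier p th n P x B.
Proof.
move=> th0 thp sE B0 x0 xB y y0; have p0 : 0 < p by exact: lt_trans thp.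
have s0 : 0 < s by rewrite -invr_gt0 sE subr_gt0 ltf_pV2.
apply: (le_trans (@hoelder_mult _ _ _ (fun i : 'I_n => P i) p th s (fun i => x i)
  (fun i => y i) (fun i _ => x0 i) (fun i _ => y0 i) th0 thp sE)).
rewrite ler_wpM2r ?powR_ge0//.
have -> : B `^ th = (B `^ s) `^ (th / s).
  by rewrite -powRrM mulrCA mulfV ?mulr1 ?lt0r_neq0.
rewrite le_powR ?divr_ge0 ?(ltW th0) ?(ltW s0) ?sumr_ge0// => i _.
by rewrite powR_ge0.
Qed.

Lemma le_multiplier p th n P x B B' : 0 <= th -> 0 <= B -> B <= B' ->
  multiplier p th n P x B -> multiplier p th n P x B'.
Proof.
move=> th0 B0 BB h y y0; apply: (le_trans (h _ y0)).
by rewrite ler_wpM2r ?powR_ge0// le_powR.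
Qed.

Lemma doubling_pow V r : (forall i, 0 < V i) -> (forall i, V i.+1 = 2 * V i) ->
  forall i, V i `^ r = 2 `^ (- r) * V i.+1 `^ r.
Proof.
move=> V0 VS i; rewrite VS powRM ?(ltW (V0 _))// mulrA powRN mulVf ?mul1r//.
Qed.

Lemma half_pow_lt1 r : 0 < r -> 0 <= (2 : R) `^ (- r) < 1.
Proof.
move=> r0; rewrite powR_ge0 powRN invf_lt1 ?powR_gt0//=.
by have := @gt0_ltr_powR R r r0 1 2; rewrite powR1 !nnegrE; apply; rewrite ?ltr1n.
Qed.

(** The Hoelder factor is the sum of V_i^P with 1/P = 1/p2 - 1/p1. It is geometric, hence dominated
    by V_e^P: a run of shells behaves like its last shell. *)
Lemma geometric_hoelder p1 p2 : 0 < p2 < p1 -> exists2 C, 0 < C &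
  forall V a n e (S : pred nat), (forall i, 0 < V i) -> (forall i, V i.+1 = 2 * V i) ->
  (forall i, 0 <= a i) -> (forall i, (i < n)%N -> S i -> (i <= e)%N) ->
  \sum_(i < n | S i) (V i * a i) `^ p2 <=
  C * (V e `^ p2 * (\sum_(i < n | S i) a i `^ p1) `^ (p2 / p1)).
Proof.
move=> /andP[p20 p12]; have p10 : 0 < p1 by exact: lt_trans p12.
pose P := (p2^-1 - p1^-1)^-1.
have P0 : 0 < P by rewrite invr_gt0 subr_gt0 ltf_pV2.
have l := half_pow_lt1 P0.
have h : 0 < (1 - 2 `^ (- P))^-1 :> R by rewrite invr_gt0 subr_gt0; case/andP: l.
exists ((1 - 2 `^ (- P))^-1 `^ (p2 / P)) => [|V a n e S V0 VS a0 Se].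
  by rewrite powR_gt0.
have PE : P^-1 = p2^-1 - p1^-1 by rewrite /P invrK.
apply: (le_trans (@hoelder_mult _ _ _ (fun i : 'I_n => S i) p1 p2 P (fun i => V i)
  (fun i => a i) (fun i _ => ltW (V0 i)) (fun i _ => a0 i) p20 p12 PE)).
rewrite mulrA ler_wpM2r ?powR_ge0//.
have -> : V e `^ p2 = (V e `^ P) `^ (p2 / P).
  by rewrite -powRrM mulrCA mulfV ?mulr1 ?lt0r_neq0.
rewrite -powRM ?powR_ge0 ?(ltW h)// le_powR ?divr_ge0 ?(ltW p20) ?(ltW P0)//.
  by rewrite sumr_ge0// => i _; rewrite powR_ge0.
have Vg k : V k `^ P <= 2 `^ (- P) * V k.+1 `^ P by rewrite -doubling_pow.
apply: (le_trans _ (geometric_sum_le e l (fun k => powR_ge0 (V k) P) Vg)).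
rewrite (big_ord_widen_cond _ S (fun i => V i `^ P) (leq_maxl n e.+1)).
rewrite (big_ord_widen_cond _ xpredT (fun i => V i `^ P) (leq_maxr n e.+1)).
by apply: ler_sum_sub => [i /andP[Si i_n]|i _]; [rewrite ltnS Se|rewrite powR_ge0].
Qed.

End Discrete.

(** * Cells cut out by the levels of two sequences *)

Section Upper.
Context {R : realType}.
Implicit Types (p th r s t B C : R) (V w tau a x y K W T : nat -> R)
  (P S : pred nat) (k j : nat -> nat).

Section levels.
Variables (p1 p2 th1 th2 : R).
Hypotheses (p20 : 0 < p2) (p21 : p2 < p1) (p2th1 : p2 < th1) (p2th2 : p2 < th2).
Let r := (p2^-1 - th1^-1)^-1.

(** In use, [k] numbers the levels of [w] and [j] those of [tau]. *)
Definition inner_end k j n c e :=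
  level_end k n e && ~~ level_end j n e && (j e == c).

(** A cell is a maximal run of indices in which no level of either kind ends before the last index;
    it is named by that index. *)
Definition cell_end k j n := next_end (fun e => level_end j n e || level_end k n e) n.

Definition cell_norm k j n a e :=
  (\sum_(i < n | cell_end k j n i == e) a i `^ p1) `^ p1^-1.

(** A cell lies inside one level of each kind, and [geometric_hoelder] reduces it to its last index.
    This index either ends the [j]-level or is an inner end. *)
Lemma cell_split : exists2 C, 0 < C & forall V a n k j c,
  (forall i, 0 < V i) -> (forall i, V i.+1 = 2 * V i) -> (forall i, 0 <= a i) ->
  \sum_(i < n | j i == c) (V i * a i) `^ p2 <=
  C * (\sum_(e < n | level_end j n e && (j e == c)) (V e * cell_norm k j n a e) `^ p2 +
       \sum_(e < n | inner_end k j n c e) (V e * cell_norm k j n a e) `^ p2).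
Proof.
have p10 : 0 < p1 by exact: lt_trans p21.
have [C C0 hC] := @geometric_hoelder R p1 p2 (introT andP (conj p20 p21)).
exists C => // V a n k j c V0 VS a0; set A := cell_norm k j n a.
set ec := cell_end k j n.
pose E e := level_end j n e || level_end k n e.
have ecP i : (i < n)%N -> [/\ (i <= ec i)%N, (ec i < n)%N, E (ec i), j (ec i) = j i & k (ec i) = k i].
  move=> i_n; have En : E n.-1 by rewrite /E /level_end prednK ?eqxx//; case: n i_n {E A ec}.
  have [/andP[h1 h2] h3 _] := next_endP En i_n.
  split => //; apply: next_end_level => // e; rewrite /E => ->//.
  by rewrite orbT.
rewrite (@sum_fiber _ n n (fun i => j i == c) ec); last by move=> i _; have [] := ecP i (ltn_ord i).
have -> : \sum_(e < n | level_end j n e && (j e == c)) (V e * A e) `^ p2 +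
       \sum_(e < n | inner_end k j n c e) (V e * A e) `^ p2 =
     \sum_(e < n | E e && (j e == c)) (V e * A e) `^ p2.
  rewrite [RHS](bigID (fun e : 'I_n => level_end j n e))/=; congr (_ + _);
  apply: eq_bigl => e; rewrite /inner_end /E;
  by case: (level_end j n e) => /=; rewrite ?andbF ?andbT// ?orbF.
rewrite [X in C * X]big_mkcond mulr_sumr; apply: ler_sum => e _.
case: ifPn => [_|Ee]; last first.
  rewrite mulr0 big1// => i /andP[/eqP ji /eqP ei]; move: Ee.
  by have [_ _ h1 h2 _] := ecP i (ltn_ord i); rewrite -ei h1 h2 ji eqxx.
have -> : (V e * A e) `^ p2 =
    V e `^ p2 * (\sum_(i < n | ec i == e) a i `^ p1) `^ (p2 / p1).
  rewrite powRM ?powR_ge0 ?(ltW (V0 _))//; congr (_ * _).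
  by rewrite /A /cell_norm -powRrM mulrC.
apply: (le_trans _ (hC V a n e (fun i => ec i == e) V0 VS a0 _)).
  by apply: ler_sum_sub => [i /andP[]//|i _]; rewrite powR_ge0.
by move=> i i_n /eqP <-; have [] := ecP i i_n.
Qed.

(** [levels_head_le] passes to the levels of [tau], which [cell_split] cuts into cells. The cells
    that end a [tau]-level ([alpha]) go through the multiplier [tau V] on the levels of [w], then
    through [K c / W c] from l^th1 to l^th2. The inner cells ([beta]) are enlarged to the [w]-level
    they end; Hoelder's inequality with 1/p2 = 1/r + 1/th1 inside a [tau]-level then leads to the
    last multiplier. On the other side, [levels_tail_ge] bounds the level norms by [cLMd]. *)
Lemma upper_levels : exists2 C, 0 < C & forall V w tau a n N k j W T K B,
  (forall i, 0 < V i) -> (forall i, V i.+1 = 2 * V i) -> (forall i, 0 <= a i) ->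
  (forall i l, (i <= l)%N -> (k i <= k l)%N) ->
  (forall i l, (i <= l)%N -> (j i <= j l)%N) ->
  (forall i, (i < n)%N -> (k i < N)%N) -> (forall i, (i < n)%N -> (j i < N)%N) ->
  (forall c, 0 < W c) -> (forall c, W c.+1 = 2 * W c) ->
  (forall c, 0 < T c) -> (forall c, T c = 2 * T c.+1) ->
  (forall i, W (k i) <= w i) ->
  (forall i, 0 <= tau i <= T (j i)) -> (forall i, T (j i) <= 2 * tau i) ->
  0 <= B -> (forall c, 0 <= K c) ->
  (forall c, multiplier p1 th2 n (fun e => k e == c) (fun e => tau e * V e) (K c)) ->
  multiplier th1 th2 N xpredT (fun c => K c / W c) B ->
  multiplier th1 th2 N xpredT (fun c => T c *
    (\sum_(e < n | inner_end k j n c e) (V e / W (k e)) `^ r) `^ r^-1) B ->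
  LMd p2 th2 V tau a n <= C * (B `^ th2 * cLMd p1 th1 w a n `^ (th2 / th1)).
Proof.
have p10 : 0 < p1 by exact: lt_trans p21.
have th10 : 0 < th1 by exact: lt_trans p2th1.
have th20 : 0 < th2 by exact: lt_trans p2th2.
have t0 : 0 < th2 / p2 by rewrite divr_gt0.
have r0 : 0 < r by rewrite invr_gt0 subr_gt0 ltf_pV2.
have rE : r^-1 = p2^-1 - th1^-1 by rewrite /r invrK.
have [C1 C10 h1] := levels_head_le (half_pow_lt1 th20) t0.
have [C2 C20 h2] := cell_split.
have [C3 C30 h3] := powR_quasi t0.
have [C4 C40 h4] := levels_tail_ge (half_pow_lt1 th10) (divr_gt0 th10 p10).
exists (C1 * (C2 `^ (th2 / p2) * C3 * ((2 `^ th2 + 1) * C4 `^ (th2 / th1)))).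
  by rewrite !mulr_gt0// ?powR_gt0// addr_gt0// powR_gt0.
move=> V w tau a n N k j W T K B V0 VS a0 km jm kN jN W0 WS T0 TS wk tauj tauj2 B0 K0
  hK ha hb.
set Cn := cLMd p1 th1 w a n.
pose ec := cell_end k j n.
pose E e := level_end j n e || level_end k n e.
pose A := cell_norm k j n a.
pose b c := \sum_(i < n | k i == c) a i `^ p1.
pose y c := b c `^ p1^-1.
have A0 e : 0 <= A e by rewrite powR_ge0.
have b0 c : 0 <= b c by rewrite sumr_ge0// => i _; rewrite powR_ge0.
have y0 c : 0 <= y c by rewrite powR_ge0.
have ecP i : (i < n)%N -> [/\ (ec i < n)%N & k (ec i) = k i].
  move=> i_n; have En : E n.-1 by rewrite /E /level_end prednK ?eqxx//; case: (n) i_n.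
  have [/andP[_ hn] _ _] := next_endP En i_n.
  split => //; apply: next_end_level => // e; rewrite /E => ->//.
  by rewrite orbT.
have cl : \sum_(c < N) (W c * y c) `^ th1 <= C4 * Cn.
  have -> : \sum_(c < N) (W c * y c) `^ th1 =
      \sum_(c < N) W c `^ th1 * (\sum_(i < n | k i == c) a i `^ p1) `^ (th1 / p1).
    apply: eq_bigr => c _; rewrite powRM ?(ltW (W0 _))//; congr (_ * _).
    by rewrite /y -powRrM mulrC.
  apply: (h4 k (fun m => w m `^ th1) (fun c => W c `^ th1) (fun i => a i `^ p1)) => //.
  - by move=> c; rewrite powR_ge0.
  - by move=> c; rewrite -(doubling_pow _ W0 WS).
  - by move=> c; rewrite powR_ge0.
  - by move=> i; rewrite le_powR ?(ltW th10) ?(ltW (W0 _)).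
have cl0 : 0 <= \sum_(c < N) (W c * y c) `^ th1.
  by rewrite sumr_ge0// => c _; rewrite powR_ge0.
have cl' : (\sum_(c < N) (W c * y c) `^ th1) `^ (th2 / th1) <=
    C4 `^ (th2 / th1) * Cn `^ (th2 / th1).
  rewrite -powRM ?(ltW C40)//; last first.
    by rewrite -(pmulr_rge0 _ C40) (le_trans cl0).
  by rewrite le_powR ?divr_ge0 ?(ltW th10) ?(ltW th20).
have G0 c : 0 <= T c `^ th2 by rewrite powR_ge0.
have Gl c : T c.+1 `^ th2 <= 2 `^ (- th2) * T c `^ th2.
  by rewrite (TS c) powRM ?(ltW (T0 _))// mulrA powRN mulVf ?mul1r.
have X0 i : 0 <= (V i * a i) `^ p2 by rewrite powR_ge0.
have tG i : tau i `^ th2 <= T (j i) `^ th2.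
  by have /andP[? ?] := tauj i; rewrite le_powR ?(ltW th20).
apply: (le_trans (h1 j (fun m => tau m `^ th2) (fun c => T c `^ th2)
  (fun i => (V i * a i) `^ p2) n N jm jN G0 Gl X0 tG)).
pose Sa c := \sum_(e < n | level_end j n e && (j e == c)) (V e * A e) `^ p2.
pose Sb c := \sum_(e < n | inner_end k j n c e) (V e * A e) `^ p2.
have Sa0 c : 0 <= Sa c by rewrite sumr_ge0// => e _; rewrite powR_ge0.
have Sb0 c : 0 <= Sb c by rewrite sumr_ge0// => e _; rewrite powR_ge0.
(* A [tau]-level has at most one end, so the power [th2 / p2] acts on a single term; the factor
   2^th2 comes from [T (j e) <= 2 * tau e]. *)
have alpha : \sum_(c < N) T c `^ th2 * Sa c `^ (th2 / p2) <=
    2 `^ th2 * (B `^ th2 * (C4 `^ (th2 / th1) * Cn `^ (th2 / th1))).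
  apply: (@le_trans _ _ (\sum_(c < N) \sum_(e < n | level_end j n e && (j e == c))
      2 `^ th2 * (tau e * V e * A e) `^ th2)).
    apply: ler_sum => c _.
    apply: (@le_trans _ _ (T c `^ th2 * \sum_(e < n | level_end j n e && (j e == c))
        ((V e * A e) `^ p2) `^ (th2 / p2))).
      rewrite ler_wpM2l ?powR_ge0// powR_sum_at_most_one// => e e'.
      move=> /andP[ee /eqP je] /andP[ee' /eqP je']; apply/val_inj.
      by apply: (level_end_inj jm (ltn_ord e) (ltn_ord e') ee ee'); rewrite je je'.
    rewrite mulr_sumr; apply: ler_sum => e /andP[_ /eqP <-].
    rewrite -powRrM mulrCA mulfV ?lt0r_neq0// mulr1.
    have VA : 0 <= V e * A e by rewrite mulr_ge0// ltW.
    have te : 0 <= tau e by case/andP: (tauj e).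
    rewrite -mulrA -!powRM ?mulr_ge0 ?(ltW (T0 _)) ?(ltW (V0 _))//.
    rewrite le_powR ?(ltW th20) ?mulr_ge0 ?(ltW (T0 _)) ?(ltW (V0 _))//.
    by rewrite [leRHS]mulrA ler_wpM2r.
  rewrite -(@sum_fiber _ n N (fun e => level_end j n e) j (fun e => 2 `^ th2 * (tau e * V e * A e) `^ th2)); last by move=> e _; exact: jN.
  rewrite -mulr_sumr ler_wpM2l ?powR_ge0//.
  apply: (@le_trans _ _ (\sum_(e < n) (tau e * V e * A e) `^ th2)).
    by apply: ler_sum_sub => // e _; rewrite powR_ge0.
  rewrite (@sum_fiber _ n N _ k); last by move=> e _; exact: kN.
  apply: (@le_trans _ _ (\sum_(c < N) (K c / W c * (W c * y c)) `^ th2)).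
    apply: ler_sum => c _; apply: (le_trans (hK c A A0)).
    rewrite mulrA divfK ?lt0r_neq0// powRM// ler_wpM2l ?powR_ge0//.
    have -> : \sum_(e < n | k e == c) A e `^ p1 = b c.
      rewrite /b [RHS](@sum_fiber _ n n (fun i => k i == c) ec); last by move=> i _; have [] := ecP i (ltn_ord i).
      rewrite [LHS]big_mkcond; apply: eq_bigr => e _; case: ifPn => [/eqP ke|ke].
        rewrite powRKV ?lt0r_neq0//; last by rewrite sumr_ge0// => i _; rewrite powR_ge0.
        apply: eq_bigl => i; case: eqP => ei; rewrite ?andbF// andbT.
        by have [_ h] := ecP i (ltn_ord i); rewrite -h /ec ei ke eqxx.
      rewrite big1// => i /andP[/eqP ki /eqP ei]; move: ke.
      by have [_ h] := ecP i (ltn_ord i); rewrite -ei /ec h ki eqxx.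
    by rewrite /y -powRrM mulrC.
  apply: (le_trans (ha (fun c => W c * y c) _)).
    by move=> c; rewrite mulr_ge0// ltW.
  by rewrite ler_wpM2l ?powR_ge0.
(* Distinct inner ends lie in distinct [w]-levels, so replacing [A e] by the norm [y (k e)] of the
   whole level counts no level twice. *)
have beta : \sum_(c < N) T c `^ th2 * Sb c `^ (th2 / p2) <=
    B `^ th2 * (C4 `^ (th2 / th1) * Cn `^ (th2 / th1)).
  pose z c := \sum_(e < n | inner_end k j n c e) (W (k e) * y (k e)) `^ th1.
  pose rho c := \sum_(e < n | inner_end k j n c e) (V e / W (k e)) `^ r.
  have z0 c : 0 <= z c by rewrite sumr_ge0// => e _; rewrite powR_ge0.
  have rho0 c : 0 <= rho c by rewrite sumr_ge0// => e _; rewrite powR_ge0.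
  apply: (@le_trans _ _ (\sum_(c < N) (T c * rho c `^ r^-1 * z c `^ th1^-1) `^ th2)).
    apply: ler_sum => c _.
    have Sbl : Sb c <= rho c `^ (p2 / r) * z c `^ (p2 / th1).
      apply: (@le_trans _ _ (\sum_(e < n | inner_end k j n c e)
          (V e / W (k e) * (W (k e) * y (k e))) `^ p2)).
        apply: ler_sum => e /andP[/andP[ke _] _].
        have -> : V e / W (k e) * (W (k e) * y (k e)) = V e * y (k e).
          by rewrite mulrA (divfK (lt0r_neq0 (W0 _))).
        apply: (le_powR (ltW p20)); first exact: (mulr_ge0 (ltW (V0 e)) (A0 e)).
        apply: (ler_wpM2l (ltW (V0 e))); apply: le_powR.
        - by rewrite invr_ge0 ltW.
        - by apply: sumr_ge0 => i _; exact: powR_ge0.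
        apply: ler_sum_sub => [i /eqP ei|i _]; last by rewrite powR_ge0.
        by have [_ h] := ecP i (ltn_ord i); rewrite -h /ec ei.
      have V1 e : inner_end k j n c e -> 0 <= V e / W (k e).
        by rewrite divr_ge0 ?(ltW (V0 _)) ?(ltW (W0 _)).
      have V2 e : inner_end k j n c e -> 0 <= W (k e) * y (k e).
        by rewrite mulr_ge0 ?(ltW (W0 _)).
      exact: (@hoelder_mult _ _ _ (fun e : 'I_n => inner_end k j n c e) th1 p2 r
        (fun e => V e / W (k e)) (fun e => W (k e) * y (k e)) (fun e => V1 e)
        (fun e => V2 e) p20 p2th1 rE).
    move: (Sb c) (rho c) (z c) (T c) (Sb0 c) (rho0 c) (z0 c) (T0 c) Sbl.
    move=> S' rho' z' T' S'0 rho'0 z'0 T'0 S'l.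
    rewrite -mulrA powRM ?mulr_ge0 ?powR_ge0 ?(ltW T'0)//.
    rewrite ler_wpM2l ?powR_ge0//.
    apply: (le_trans (le_powR (ltW t0) S'0 S'l)).
    do 2 rewrite (powRM _ (powR_ge0 _ _) (powR_ge0 _ _)).
    have ex (u : R) : (p2 / u) * (th2 / p2) = u^-1 * th2.
      by rewrite mulrC mulrA divfK ?lt0r_neq0// mulrC.
    by rewrite -!powRrM !ex.
  apply: (le_trans (hb (fun c => z c `^ th1^-1) _)).
    by move=> c; rewrite powR_ge0.
  apply: ler_wpM2l; first exact: powR_ge0.
  apply: (le_trans _ cl'); apply: le_powR.
  - by rewrite divr_ge0 ?(ltW th10) ?(ltW th20).
  - by apply: sumr_ge0 => c _; exact: powR_ge0.
  have -> : \sum_(c < N) (z c `^ th1^-1) `^ th1 = \sum_(c < N) z c.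
    by apply: eq_bigr => c _; rewrite (powRKV (lt0r_neq0 th10) (z0 c)).
  rewrite /z -(@sum_fiber _ n N (fun e => level_end k n e && ~~ level_end j n e) j
     (fun e => (W (k e) * y (k e)) `^ th1)); last by move=> e _; exact: jN.
  apply: (@sum_level_end_le _ k n N (fun c => (W c * y c) `^ th1)
    (fun e => level_end k n e && ~~ level_end j n e)) => //.
    by move=> c; rewrite powR_ge0.
  by move=> e /andP[].
rewrite -mulrA ler_wpM2l ?(ltW C10)//.
apply: (@le_trans _ _ (\sum_(c < N) C2 `^ (th2 / p2) * C3 *
   (T c `^ th2 * Sa c `^ (th2 / p2) + T c `^ th2 * Sb c `^ (th2 / p2)))).
  apply: ler_sum => c _; rewrite -mulrDr [leRHS]mulrCA ler_wpM2l ?powR_ge0//.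
  apply: (@le_trans _ _ ((C2 * (Sa c + Sb c)) `^ (th2 / p2))).
    rewrite le_powR ?(ltW t0)//; last exact: h2.
    by rewrite sumr_ge0// => e _; rewrite powR_ge0.
  by rewrite powRM ?addr_ge0 ?(ltW C20)// -mulrA ler_wpM2l ?powR_ge0// h3.
rewrite -mulr_sumr big_split/= -!mulrA ler_wpM2l ?powR_ge0// ler_wpM2l ?(ltW C30)//.
apply: (le_trans (lerD alpha beta)).
by rewrite mulrDl mul1r (mulrCA (C4 `^ _) (B `^ _)).
Qed.

End levels.
End Upper.

(** * Sufficient conditions in terms of partial sums and envelopes *)

Section Upper.
Context {R : realType}.
Implicit Types (p th r s t B C : R) (V w tau a x y K W T : nat -> R)
  (P S : pred nat) (k j : nat -> nat).

Definition jump r w i := w i `^ (- r) - w i.+1 `^ (- r).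

Definition Hsum r V w m := \sum_(i < m) V i `^ r * jump r w i.

(** [K] counts as 0 before the index 0, so that the increments up to [e] add up to the power of
    [K e]. *)
Definition Kincr s K m := K m `^ s - (if m is m'.+1 then K m' `^ s else 0).

Lemma le_powRN r (x y : R) : 0 <= r -> 0 < x -> x <= y -> y `^ (- r) <= x `^ (- r).
Proof.
move=> r0 x0 xy; rewrite !powRN lef_pV2 ?posrE ?powR_gt0 ?(lt_le_trans x0)//.
by rewrite le_powR// ltW.
Qed.

Lemma jump_ge0 r w i : 0 <= r -> (forall i, 0 < w i) -> (forall i, w i <= w i.+1) ->
  0 <= jump r w i.
Proof. by move=> r0 w0 wS; rewrite subr_ge0 le_powRN. Qed.

(** Discrete form of the rule that u X^(u-1) dX integrates to X^u, by [powRB_le] at each index of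
    [S]. Partial sums over all indices dominate those over [S]. *)
Lemma sum_power_rule u (c : nat -> R) S M : 1 <= u -> (forall i, 0 <= c i) ->
  (\sum_(l < M | S l) c l) `^ u <=
  u * \sum_(l < M | S l) c l * (\sum_(i < l.+1) c i) `^ (u - 1).
Proof.
move=> u1 c0; have u0 : 0 < u by exact: lt_le_trans u1.
elim: M => [|M IH]; first by rewrite !big_ord0 powR0 ?mulr0 ?lt0r_neq0.
rewrite [X in X `^ _]big_mkcond [X in u * X]big_mkcond !big_ord_recr /= -!big_mkcond /=.
case: ifPn => SM; last by rewrite !addr0.
set A := \sum_(l < M | S l) c l; have A0 : 0 <= A by rewrite sumr_ge0.
rewrite mulrDr -lerBlDr; apply: le_trans IH; rewrite lerBlDr -lerBlDl.
apply: (le_trans (powRB_le u1 A0 _)); first by rewrite addr_ge0.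
rewrite (addrC A) addrK ler_wpM2l ?(ltW u0)// mulrC ler_wpM2l//.
rewrite le_powR ?subr_ge0 ?addr_ge0// addrC lerD2r /A.
by rewrite ler_sum_sub.
Qed.

(** Summation by parts: V_l^r w_l^(-r) is the jump term at [l] plus V_l^r w_(l+1)^(-r). As [V]
    doubles, the latter is 2^(-r) times the next term of the sum and is absorbed; only the last term
    is left. *)
Lemma level_abel r : 0 < r -> exists2 C, 0 < C & forall V w j c M,
  (forall i, 0 < V i) -> (forall i, V i.+1 = 2 * V i) ->
  (forall i, 0 < w i) -> (forall i, w i <= w i.+1) ->
  (forall i l, (i <= l)%N -> (j i <= j l)%N) -> j M = c ->
  \sum_(l < M.+1 | j l == c) (V l / w l) `^ r <=
  C * (\sum_(l < M | j l == c) V l `^ r * jump r w l + (V M / w M) `^ r).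
Proof.
move=> r0; have /andP[h0 h1] := @half_pow_lt1 R r r0.
have hC : 0 < 1 - (2 : R) `^ (- r) by rewrite subr_gt0.
exists (1 - 2 `^ (- r))^-1; first by rewrite invr_gt0.
move=> V w j c M V0 VS w0 wS jm; rewrite ler_pdivlMl//.
have Vw i : (V i / w i) `^ r = V i `^ r * w i `^ (- r).
  by rewrite powR_div ?(ltW (V0 _)) ?(ltW (w0 _))// powRN.
have Vw0 i : 0 <= V i `^ r * w i `^ (- r) by rewrite mulr_ge0 ?powR_ge0.
have J0 l : 0 <= V l `^ r * jump r w l.
  by rewrite mulr_ge0 ?powR_ge0// jump_ge0// ltW.
elim: M => [|M IH] jM.
  rewrite big_mkcond big_ord1 jM eqxx big_ord0 add0r ler_piMl ?powR_ge0//.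
have first_term (x y : R) : 0 <= x -> 0 <= y -> (1 - 2 `^ (- r)) * x <= y + x.
  by move=> x0 y0; nra.
rewrite [X in _ * X <= _]big_mkcond big_ord_recr /= -big_mkcond /= jM eqxx.
have [jMc|jMc] := eqVneq (j M) c; last first.
  rewrite big1 ?add0r => [|l /eqP jl].
    by apply: first_term; rewrite ?powR_ge0// sumr_ge0.
  have : (j l <= j M)%N by apply: jm; rewrite -ltnS.
  have : (j M <= c)%N by rewrite -jM; exact: jm.
  by rewrite jl => h2 h3; move: jMc; rewrite eqn_leq h2 h3.
rewrite mulrDr (le_trans (lerD (IH jMc) (lexx _)))//.
rewrite [X in _ <= X + _]big_mkcond big_ord_recr /= -big_mkcond /= jMc eqxx.
rewrite -!addrA lerD2l !Vw /jump mulrBr.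
rewrite (doubling_pow r V0 VS M).
set v := V M.+1 `^ r; set e := w M.+1 `^ (- r); set e' := w M `^ (- r).
have : 0 <= v by rewrite powR_ge0.
have : 0 <= e by rewrite powR_ge0.
by move=> ? ?; lra.
Qed.

Lemma Kincr_sum s K e : 0 < s -> \sum_(m < e.+1) Kincr s K m = K e `^ s.
Proof.
move=> s0; elim: e => [|e IH]; first by rewrite big_ord1 /Kincr subr0.
by rewrite big_ord_recr /= IH /Kincr addrC subrK.
Qed.

Lemma Kincr_ge0 s K m : 0 < s -> (forall i, 0 <= K i) -> (forall i, K i <= K i.+1) ->
  0 <= Kincr s K m.
Proof.
move=> s0 K0 KS; rewrite /Kincr; case: m => [|m]; first by rewrite subr0 powR_ge0.
by rewrite subr_ge0 le_powR// ltW.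
Qed.

Section theorem.
Variables (p1 p2 th1 th2 : R).
Hypotheses (p20 : 0 < p2) (p21 : p2 < p1) (p2th1 : p2 < th1) (p2th2 : p2 < th2).
Let r := (p2^-1 - th1^-1)^-1.
Let r0 : 0 < r. Proof. by rewrite invr_gt0 subr_gt0 ltf_pV2//; exact: (lt_trans p20). Qed.

(* [K] is, up to [c], the norm of the multiplier [tau V] from l^p1 to l^th2,
   restricted to initial segments *)
Definition multiplier_envelope c tau V K := forall n P B, 0 <= B ->
  (forall e, (e < n)%N -> P e -> K e <= B) ->
  multiplier p1 th2 n P (fun e => tau e * V e) (c * B).

Definition admissible_data V w tau K :=
  [/\ forall i, 0 < V i, forall i, V i.+1 = 2 * V i,
      (forall i, 0 < w i) /\ (forall i, w i <= w i.+1),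
      (forall i, 0 < tau i) /\ (forall i, tau i.+1 <= tau i) &
      (forall i, tau i * V i <= K i) /\ (forall i, K i <= K i.+1)].

(** The levels of [tau] are those of its nondecreasing inverse, so [T] is halved from one level to
    the next. *)
Lemma level_data w tau : (forall i, 0 < w i) -> (forall i, w i <= w i.+1) ->
  (forall i, 0 < tau i) -> (forall i, tau i.+1 <= tau i) ->
  exists k j W T,
  [/\ (forall i l, (i <= l)%N -> (k i <= k l)%N) /\
      (forall i l, (i <= l)%N -> (j i <= j l)%N),
      (forall c, 0 < W c) /\ (forall c, W c.+1 = 2 * W c),
      (forall c, 0 < T c) /\ (forall c, T c = 2 * T c.+1),
      (forall i, W (k i) <= w i) /\ (forall i, w i <= 2 * W (k i)) &
      (forall i, 0 <= tau i <= T (j i)) /\ (forall i, T (j i) <= 2 * tau i)] :> Prop.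
Proof.
move=> w0 wS t0 tS.
have [k [km kw]] := level_function w0 wS.
have [|i|j [jm jt]] := @level_function R (fun i => (tau i)^-1).
- by move=> i; rewrite invr_gt0.
- by rewrite lef_pV2 ?posrE.
exists k, j, (fun c => w 0%N * 2 ^+ c), (fun c => tau 0%N / 2 ^+ c).
have e2 c : 0 < (2 : R) ^+ c by rewrite exprn_gt0.
split; split => //.
- by move=> c; rewrite mulr_gt0.
- by move=> c; rewrite exprS mulrCA.
- by move=> c; rewrite divr_gt0.
- by move=> c; rewrite exprS invfM; field; rewrite lt0r_neq0.
- by move=> i; case/andP: (kw i).
- by move=> i; rewrite mulrCA -exprS ltW//; case/andP: (kw i).
- move=> i; rewrite (ltW (t0 i))/=; have /andP[h _] := jt i.
  rewrite ler_pdivlMr//; have := ler_wpM2l (ltW (mulr_gt0 (t0 0%N) (t0 i))) h.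
  by rewrite mulfK ?lt0r_neq0// mulrACA mulfV ?lt0r_neq0// mul1r.
- move=> i; have /andP[_ h] := jt i.
  rewrite ler_pdivrMr//; have := ler_wpM2l (ltW (mulr_gt0 (t0 0%N) (t0 i))) (ltW h).
  rewrite mulfK ?lt0r_neq0// mulrACA mulfV ?lt0r_neq0// mul1r exprS.
  by rewrite mulrCA mulrA.
Qed.

(** An inner end does not end its [j]-level, so it differs from the last index [n.-1]; hence
    [M.+1 < n]. *)
Lemma inner_end_max k j n c :
  (forall e, (e < n)%N -> ~~ inner_end k j n c e) \/
  exists2 M, (M.+1 < n)%N && inner_end k j n c M &
    forall e, (e < n)%N -> inner_end k j n c e -> (e <= M)%N.
Proof.
have [e0 Qe0|Q0] := pickP (fun e : 'I_n => inner_end k j n c e); last first.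
  by left => e en; have := Q0 (Ordinal en) => /= ->.
right; have [M QM Mmax] := @arg_maxnP _ e0 (fun e : 'I_n => inner_end k j n c e) val Qe0.
exists M; last by move=> e en Qe; exact: (Mmax (Ordinal en)).
rewrite QM andbT; move: QM => /andP[/andP[_]]; rewrite negb_or => /andP[h _] _.
by rewrite ltn_neqAle h ltn_ord.
Qed.

(** [level_abel] is applied up to the last inner end [M]. The leftover [V M / w M], times
    [T c <= 2 * tau M], is at most [2 * (K M / w M)], because [tau M * V M <= K M]. *)
Lemma inner_sum_le : exists2 C, 0 < C & forall V w tau K n k j W T c M u,
  admissible_data V w tau K ->
  (forall i l, (i <= l)%N -> (j i <= j l)%N) ->
  (forall c, 0 < W c) -> (forall i, w i <= 2 * W (k i)) ->
  0 < T c -> T c <= 2 * tau M ->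
  (M.+1 < n)%N && inner_end k j n c M ->
  (forall e, (e < n)%N -> inner_end k j n c e -> (e <= M)%N) -> 
  u = T c * (\sum_(e < n | inner_end k j n c e) (V e / W (k e)) `^ r) `^ r^-1 ->
  u <= C * (T c * (\sum_(l < M | j l == c) V l `^ r * jump r w l) `^ r^-1 + K M / w M).
Proof.
have [C1 C10 h1] := level_abel r0.
have ri : 0 < r^-1 by rewrite invr_gt0.
have [C2 C20 h2] := powR_quasi ri.
exists (2 * C1 `^ r^-1 * C2 * 2); first by rewrite !mulr_gt0// powR_gt0.
move=> V w tau K n k j W T c M u [V0 VS [w0 wS] [t0 tS] [tK KS]] jm W0 wW T0 Tt
  /andP[Mn QM] Mmax ->.
have J0 l : 0 <= V l `^ r * jump r w l.
  by rewrite mulr_ge0 ?powR_ge0// jump_ge0// ltW.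
have jM : j M = c by case/andP: QM => _ /eqP.
set X := \sum_(l < M | j l == c) _.
have X0 : 0 <= X by rewrite sumr_ge0.
have VM0 : 0 <= V M / w M by rewrite divr_ge0 ?(ltW (V0 _)) ?(ltW (w0 _)).
have S1 : (\sum_(e < n | inner_end k j n c e) (V e / W (k e)) `^ r) `^ r^-1 <=
    2 * C1 `^ r^-1 * C2 * (X `^ r^-1 + V M / w M).
  apply: (@le_trans _ _ ((2 `^ r * (C1 * (X + (V M / w M) `^ r))) `^ r^-1)).
    apply: (le_powR (ltW ri)); first by apply: sumr_ge0 => e _; exact: powR_ge0.
    apply: (@le_trans _ _ (2 `^ r * \sum_(e < M.+1 | j e == c) (V e / w e) `^ r)).
      rewrite mulr_sumr.
      apply: (@le_trans _ _ (\sum_(e < n | inner_end k j n c e) 2 `^ r * (V e / w e) `^ r)).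
        apply: ler_sum => e _.
        rewrite -powRM ?divr_ge0 ?(ltW (V0 _)) ?(ltW (w0 _))//.
        rewrite le_powR ?(ltW r0) ?divr_ge0 ?(ltW (V0 _)) ?(ltW (W0 _))//.
        have h : 1 <= 2 * W (k e) / w e by rewrite ler_pdivlMr// mul1r.
        have -> : 2 * (V e / w e) = V e / W (k e) * (2 * W (k e) / w e).
          by field; rewrite !lt0r_neq0.
        by rewrite ler_peMr// divr_ge0 ?(ltW (V0 _)) ?(ltW (W0 _)).
      rewrite (big_ord_widen_cond _ (inner_end k j n c) (fun e => 2 `^ r * (V e / w e) `^ r) (leq_maxl n M.+1)).
      rewrite (big_ord_widen_cond _ (fun e => j e == c) (fun e => 2 `^ r * (V e / w e) `^ r) (leq_maxr n M.+1)).
      apply: ler_sum_sub => [e /andP[Qe en]|e _]; last by rewrite mulr_ge0 ?powR_ge0.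
      by rewrite ltnS Mmax// andbT; case/andP: Qe.
    by rewrite ler_wpM2l ?powR_ge0// h1.
  rewrite powRM ?powR_ge0 ?mulr_ge0 ?addr_ge0 ?powR_ge0 ?(ltW C10)//.
  have XV0 : 0 <= X + (V M / w M) `^ r by rewrite addr_ge0 ?powR_ge0.
  rewrite powRVK ?lt0r_neq0// -!mulrA ler_wpM2l// (powRM _ (ltW C10) XV0).
  rewrite ler_wpM2l ?powR_ge0//; apply: (le_trans (h2 _ _ X0 (powR_ge0 _ _))).
  by rewrite powRVK ?lt0r_neq0.
have K0 : 0 <= K M by rewrite (le_trans _ (tK M))// mulr_ge0// ltW.
apply: (le_trans (ler_wpM2l (ltW T0) S1)); rewrite mulrCA -!mulrA.
rewrite ler_wpM2l// ler_wpM2l ?powR_ge0// ler_wpM2l ?(ltW C20)// !mulrDr lerD//.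
  by rewrite ler_peMl ?ler1n// mulr_ge0 ?powR_ge0 ?(ltW T0).
apply: (le_trans (ler_wpM2r VM0 Tt)); rewrite -mulrA ler_wpM2l// mulrA.
by rewrite ler_wpM2r ?invr_ge0 ?(ltW (w0 _)).
Qed.

(** For [th1 <= th2] the multipliers from l^th1 to l^th2 in [upper_levels] are bounded by their
    suprema. *)
Lemma upper_sup c : 0 < c -> th1 <= th2 -> exists2 C, 0 < C &
  forall V w tau K a n B,
  admissible_data V w tau K -> multiplier_envelope c tau V K ->
  (forall i, 0 <= a i) -> 0 <= B ->
  (forall m, (m < n)%N -> tau m * Hsum r V w m `^ r^-1 <= B) ->
  (forall m, (m < n)%N -> K m <= B * w m) ->
  LMd p2 th2 V tau a n <= C * (B `^ th2 * cLMd p1 th1 w a n `^ (th2 / th1)).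
Proof.
move=> c0 th12.
have th10 : 0 < th1 by exact: lt_trans p2th1.
have th20 : 0 < th2 by exact: lt_le_trans th12.
have [C1 C10 h1] := upper_levels p20 p21 p2th1 p2th2.
have [C2 C20 h2] := inner_sum_le.
have C'0 : 0 < c * 2 + C2 * 3 by rewrite addr_gt0 ?mulr_gt0.
exists (C1 * (c * 2 + C2 * 3) `^ th2) => [|V w tau K a n B ad env a0 B0 hH hK].
  by rewrite mulr_gt0 ?powR_gt0.
have [V0 VS [w0 wS] [t0 tS] [tK KS]] := ad.
have [k [j [W [T [[km jm] [W0 WS] [T0 TS] [Wk kW] [tT Tt]]]]]] := level_data w0 wS t0 tS.
have K0 m : 0 <= K m by rewrite (le_trans _ (tK m))// mulr_ge0// ltW.
pose N := (maxn (k n) (j n)).+1.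
have kN i : (i < n)%N -> (k i < N)%N.
  by move=> i_n; rewrite ltnS leq_max (km _ _ (ltnW i_n)).
have jN i : (i < n)%N -> (j i < N)%N.
  by move=> i_n; rewrite ltnS leq_max (jm _ _ (ltnW i_n)) orbT.
pose KK d := c * (2 * B * W d).
have KK0 d : 0 <= KK d by rewrite !mulr_ge0 ?(ltW c0) ?(ltW (W0 _)).
have mK d : multiplier p1 th2 n (fun e => k e == d) (fun e => tau e * V e) (KK d).
  apply: env; first by rewrite !mulr_ge0 ?(ltW (W0 _)).
  move=> e en /eqP <-; apply: (le_trans (hK _ en)).
  by rewrite mulrAC mulrC ler_wpM2r.
have B'0 : 0 <= (c * 2 + C2 * 3) * B by rewrite mulr_ge0 ?(ltW C'0).
have ma : multiplier th1 th2 N xpredT (fun d => KK d / W d) ((c * 2 + C2 * 3) * B).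
  apply: multiplier_sup => // d _ _; rewrite divr_ge0 ?(ltW (W0 _))//=.
  have -> : KK d / W d = c * 2 * B by rewrite /KK; field; rewrite lt0r_neq0.
  by rewrite ler_wpM2r// lerDl mulr_ge0 ?(ltW C20).
have mb : multiplier th1 th2 N xpredT (fun d => T d *
    (\sum_(e < n | inner_end k j n d e) (V e / W (k e)) `^ r) `^ r^-1) ((c * 2 + C2 * 3) * B).
  apply: multiplier_sup => // d _ _; rewrite mulr_ge0 ?powR_ge0 ?(ltW (T0 _))//=.
  have [none|[M /[dup] MQ /andP[Mn QM] Mmax]] := inner_end_max k j n d.
    rewrite big_pred0 => [|e]; last by apply/negbTE/none.
    by rewrite powR0 ?mulr0// invr_neq0// lt0r_neq0.
  have jM : j M = d by case/andP: QM => _ /eqP.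
  have TM : T d <= 2 * tau M by rewrite -jM.
  apply: (le_trans (h2 V w tau K n k j W T d M _ ad jm W0 kW (T0 d) TM MQ Mmax erefl)).
  apply: (@le_trans _ _ (C2 * 3 * B)); last first.
    by rewrite ler_wpM2r// lerDr mulr_ge0// ltW.
  rewrite -mulrA ler_wpM2l ?(ltW C20)//.
  have -> : 3 * B = 2 * B + B by ring.
  rewrite lerD//; last by rewrite ler_pdivrMr// hK// ltnW.
  apply: (@le_trans _ _ (2 * (tau M * Hsum r V w M `^ r^-1))); last first.
    by rewrite ler_wpM2l// hH// ltnW.
  rewrite mulrA ler_pM ?powR_ge0 ?(ltW (T0 _))//; apply: le_powR.
  - by rewrite ltW// invr_gt0.
  - by apply: sumr_ge0 => l _; rewrite mulr_ge0 ?powR_ge0// jump_ge0// ltW.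
  apply: ler_sum_sub => // l _.
  by rewrite mulr_ge0 ?powR_ge0// jump_ge0// ltW.
apply: (le_trans (h1 V w tau a n N k j W T KK _ V0 VS a0 km jm kN jN W0 WS T0 TS Wk tT Tt B'0 KK0 mK ma mb)).
by rewrite powRM ?(ltW C'0)// !mulrA.
Qed.

(** For [th2 < th1] these multipliers are bounded in l^s. The power rule turns H^(s/r) into the
    first sum of the hypotheses, and the second sum is [K / w] summed by parts over the levels of
    [w]. *)
Lemma upper_sum c s : 0 < c -> th2 < th1 -> s^-1 = th2^-1 - th1^-1 ->
  exists2 C, 0 < C & forall V w tau K a n B,
  admissible_data V w tau K -> multiplier_envelope c tau V K ->
  (forall i, 0 <= a i) -> 0 <= B ->
  \sum_(m < n.-1) tau m `^ s *
    (V m `^ r * jump r w m * Hsum r V w m.+1 `^ (s / r - 1)) <= B `^ s ->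
  \sum_(m < n) w m `^ (- s) * Kincr s K m <= B `^ s ->
  LMd p2 th2 V tau a n <= C * (B `^ th2 * cLMd p1 th1 w a n `^ (th2 / th1)).
Proof.
move=> c0 th21 sE.
have th20 : 0 < th2 by exact: lt_trans p2th2.
have th10 : 0 < th1 by exact: lt_trans th21.
have s0 : 0 < s by rewrite -invr_gt0 sE subr_gt0 ltf_pV2.
have rE : r^-1 = p2^-1 - th1^-1 by rewrite /r invrK.
have rs : r <= s.
  by rewrite -lef_pV2 ?posrE// rE sE lerD2r lef_pV2// ltW.
have sr0 : 0 <= s / r by exact: (divr_ge0 (ltW s0) (ltW r0)).
have sr1 : 1 <= s / r by rewrite ler_pdivlMr// mul1r.
have [C1 C10 h1] := upper_levels p20 p21 p2th1 p2th2.
have [C2 C20 h2] := inner_sum_le.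
have [C3 C30 h3] := powR_quasi s0.
have /andP[g0 g1] := @half_pow_lt1 R s s0.
have g2 : 0 < 1 - (2 : R) `^ (- s) by rewrite subr_gt0.
(* [D] is lost in summing [Kincr] over the levels of [w], [E] in the bound of the inner sums by the
   power rule; [F] serves both multipliers. *)
pose D := (1 - (2 : R) `^ (- s))^-1 * 2 `^ s.
have D0 : 0 < D by rewrite mulr_gt0 ?powR_gt0 ?invr_gt0.
pose E := C2 `^ s * (C3 * (2 `^ s * (s / r) + D)).
have E0 : 0 < E.
  apply: mulr_gt0; first exact: powR_gt0.
  apply: mulr_gt0 => //; apply: addr_gt0 => //.
  by apply: mulr_gt0; [exact: powR_gt0|exact: divr_gt0].
pose F := c * D `^ s^-1 + E `^ s^-1.
have F0 : 0 < F by rewrite addr_gt0 ?mulr_gt0 ?powR_gt0.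
exists (C1 * F `^ th2) => [|V w tau K a n B ad env a0 B0 hH hK].
  by rewrite mulr_gt0 ?powR_gt0.
have [V0 VS [w0 wS] [t0 tS] [tK KS]] := ad.
have [k [j [W [T [[km jm] [W0 WS] [T0 TS] [Wk kW] [tT Tt]]]]]] := level_data w0 wS t0 tS.
have K0 m : 0 <= K m by rewrite (le_trans _ (tK m))// mulr_ge0// ltW.
have J0 l : 0 <= V l `^ r * jump r w l.
  by rewrite mulr_ge0 ?powR_ge0// jump_ge0// ltW.
pose N := (maxn (k n) (j n)).+1.
have kN i : (i < n)%N -> (k i < N)%N.
  by move=> i_n; rewrite ltnS leq_max (km _ _ (ltnW i_n)).
have jN i : (i < n)%N -> (j i < N)%N.
  by move=> i_n; rewrite ltnS leq_max (jm _ _ (ltnW i_n)) orbT.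
have KI m : 0 <= Kincr s K m by exact: Kincr_ge0.
(* The value of [K] at the last index of level at most [d], written through increments so that its
   power [s] can be summed over the levels. *)
pose K1 d := (\sum_(m < n | (k m <= d)%N) Kincr s K m) `^ s^-1.
have K10 d : 0 <= K1 d by rewrite powR_ge0.
have KK1 e : (e < n)%N -> K e <= K1 (k e).
  move=> en; rewrite -[leLHS](powRVK (lt0r_neq0 s0) (K0 e)) -(Kincr_sum K e s0).
  apply: le_powR; first by rewrite invr_ge0 ltW.
    by apply: sumr_ge0.
  rewrite (big_ord_widen n (fun m => Kincr s K m) en).
  by apply: ler_sum_sub => // m me; apply: km; rewrite -ltnS.
have K1W : \sum_(d < N) (K1 d / W d) `^ s <= D * B `^ s.
  apply: (@le_trans _ _ (\sum_(d < N) W d `^ (- s) * \sum_(m < n | (k m <= d)%N) Kincr s K m)).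
    apply: ler_sum => d _; rewrite powR_div ?(ltW (W0 _))// powRN mulrC.
    by rewrite /K1 powRKV ?lt0r_neq0// sumr_ge0.
  apply: (le_trans (@levels_increment _ _ k (fun d => W d `^ (- s)) (Kincr s K) n N
    (introT andP (conj g0 g1)) (fun d => powR_ge0 _ _) _ KI)).
    by move=> d; rewrite WS powRM// ltW.
  rewrite /D -mulrA ler_wpM2l ?invr_ge0 ?(ltW g2)//.
  apply: (le_trans _ (ler_wpM2l (powR_ge0 _ _) hK)).
  rewrite mulr_sumr; apply: ler_sum => m _; rewrite mulrA ler_wpM2r//.
  rewrite -[2 `^ s]invrK -powRN -powR_invf ?invrK//.
  rewrite -powRM ?invr_ge0 ?(ltW (w0 _))//.
  rewrite le_powRN ?(ltW s0) ?mulr_gt0 ?invr_gt0//.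
  by rewrite ler_pdivrMl// kW.
have FB0 : 0 <= F * B by rewrite mulr_ge0 ?(ltW F0).
pose KK d := c * K1 d.
have KK0 d : 0 <= KK d by rewrite mulr_ge0 ?(ltW c0).
have mK d : multiplier p1 th2 n (fun e => k e == d) (fun e => tau e * V e) (KK d).
  by apply: env => // e en /eqP <-; exact: KK1.
have toB (x : R) : 0 <= x -> (x `^ s^-1 * B) `^ s = x * B `^ s.
  by move=> x0; rewrite powRM ?powR_ge0// powRKV ?lt0r_neq0.
have ma : multiplier th1 th2 N xpredT (fun d => KK d / W d) (F * B).
  apply: (@le_multiplier _ _ _ _ _ _ (c * D `^ s^-1 * B)).
  - exact: ltW.
  - by rewrite !mulr_ge0 ?powR_ge0 ?(ltW c0).
  - by rewrite ler_wpM2r// lerDl powR_ge0.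
  apply: (multiplier_pow th20 th21 sE).
  - by rewrite !mulr_ge0 ?powR_ge0 ?(ltW c0).
  - by move=> d; rewrite divr_ge0 ?(ltW (W0 _)).
  rewrite -mulrA powRM ?mulr_ge0 ?powR_ge0 ?(ltW c0)// toB ?(ltW D0)//.
  apply: (le_trans _ (ler_wpM2l (powR_ge0 _ _) K1W)).
  rewrite mulr_sumr; apply: ler_sum => d _.
  have KW : 0 <= K1 d / W d by exact: (divr_ge0 (K10 d) (ltW (W0 d))).
  by rewrite /KK -mulrA (powRM _ (ltW c0) KW).
have mb : multiplier th1 th2 N xpredT (fun d => T d *
    (\sum_(e < n | inner_end k j n d e) (V e / W (k e)) `^ r) `^ r^-1) (F * B).
  apply: (@le_multiplier _ _ _ _ _ _ (E `^ s^-1 * B)).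
  - exact: ltW.
  - by rewrite !mulr_ge0 ?powR_ge0.
  - by rewrite ler_wpM2r// lerDr mulr_ge0 ?powR_ge0 ?(ltW c0).
  apply: (multiplier_pow th20 th21 sE).
  - by rewrite !mulr_ge0 ?powR_ge0.
  - by move=> d; rewrite mulr_ge0 ?powR_ge0 ?(ltW (T0 _)).
  rewrite toB ?(ltW E0)//.
  pose G l := tau l `^ s * (V l `^ r * jump r w l * Hsum r V w l.+1 `^ (s / r - 1)).
  have G0 l : 0 <= G l.
    exact: (mulr_ge0 (powR_ge0 _ _) (mulr_ge0 (J0 l) (powR_ge0 _ _))).
  apply: (@le_trans _ _ (\sum_(d < N) C2 `^ s * (C3 *
     (2 `^ s * (s / r) * (\sum_(l < n.-1 | j l == d) G l) +
      \sum_(e < n | inner_end k j n d e) (K1 (k e) / W (k e)) `^ s)))).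
    apply: ler_sum => d _.
    have [none|[M /[dup] MQ /andP[Mn QM] Mmax]] := inner_end_max k j n d.
      rewrite [X in T d * X `^ _]big_pred0 => [|e]; last by apply/negbTE/none.
      rewrite (powR0 (invr_neq0 (lt0r_neq0 r0))) mulr0 (powR0 (lt0r_neq0 s0)).
      rewrite !mulr_ge0 ?powR_ge0 ?(ltW C30)// addr_ge0//.
        apply: mulr_ge0; first exact: (mulr_ge0 (powR_ge0 _ _) sr0).
        by apply: sumr_ge0 => l _; exact: G0.
      by apply: sumr_ge0 => e _; exact: powR_ge0.
    have jM : j M = d by case/andP: QM => _ /eqP.
    have TM : T d <= 2 * tau M by rewrite -jM.
    have := h2 V w tau K n k j W T d M _ ad jm W0 kW (T0 d) TM MQ Mmax erefl.
    set X := \sum_(l < M | j l == d) _.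
    have X0 : 0 <= X by apply: sumr_ge0.
    have U0 : 0 <= T d * (\sum_(e < n | inner_end k j n d e) (V e / W (k e)) `^ r) `^ r^-1.
      by rewrite mulr_ge0 ?powR_ge0 ?(ltW (T0 _)).
    move=> /(le_powR (ltW s0) U0)/le_trans; apply.
    have TX0 : 0 <= T d * X `^ r^-1 by rewrite mulr_ge0 ?powR_ge0 ?(ltW (T0 _)).
    have Kw0 : 0 <= K M / w M by rewrite divr_ge0 ?(ltW (w0 _)).
    rewrite powRM ?addr_ge0 ?(ltW C20)// ler_wpM2l ?powR_ge0//.
    apply: (le_trans (h3 _ _ TX0 Kw0)); rewrite ler_wpM2l ?(ltW C30)// lerD//.
      rewrite powRM ?powR_ge0 ?(ltW (T0 _))// -powRrM (mulrC r^-1).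
      have Xr := @sum_power_rule (s / r) (fun l => V l `^ r * jump r w l)
         (fun l => j l == d) M sr1 J0.
      apply: (le_trans (ler_wpM2l (powR_ge0 _ _) Xr)).
      rewrite mulrCA -[leRHS]mulrA [leRHS]mulrCA; apply: (ler_wpM2l sr0).
      rewrite !mulr_sumr.
      apply: (@le_trans _ _ (\sum_(l < M | j l == d) 2 `^ s * G l)).
        apply: ler_sum => l /eqP jl; rewrite /G !mulrA.
        rewrite ler_wpM2r ?powR_ge0// -!mulrA [leRHS]mulrA ler_wpM2r//.
        by rewrite -powRM ?(ltW (t0 _))// le_powR ?(ltW s0) ?(ltW (T0 _))// -jl.
      have Mn' : (M <= n.-1)%N by rewrite -ltnS (ltn_predK Mn) ltnW.
      rewrite (big_ord_widen_cond _ (fun l => j l == d) (fun l => 2 `^ s * G l) Mn').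
      apply: ler_sum_sub => [l /andP[]//|l _].
      by rewrite mulr_ge0 ?powR_ge0.
    apply: (@le_trans _ _ ((K1 (k M) / W (k M)) `^ s)).
      rewrite le_powR ?(ltW s0)// ler_pM ?invr_ge0 ?(ltW (w0 _))//.
        by apply: KK1; exact: ltnW.
      by rewrite lef_pV2 ?posrE.
    rewrite (bigD1 (Ordinal (ltnW Mn)))//= lerDl.
    by apply: sumr_ge0 => e _; exact: powR_ge0.
  rewrite -mulr_sumr -mulr_sumr big_split/= -mulr_sumr /E -!mulrA.
  rewrite ler_wpM2l ?powR_ge0// ler_wpM2l ?(ltW C30)// mulrDl lerD//.
    rewrite (mulrA s) (mulrA (2 `^ s)); apply: (ler_wpM2l (mulr_ge0 (powR_ge0 _ _) sr0)).
    apply: le_trans hH.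
    rewrite [leRHS](@sum_fiber _ n.-1 N xpredT j)//.
    by move=> i _; apply: jN; exact: (leq_trans (ltn_ord i) (leq_pred n)).
  apply: le_trans K1W.
  rewrite -(@sum_fiber _ n N (fun e => level_end k n e && ~~ level_end j n e) j
     (fun e => (K1 (k e) / W (k e)) `^ s)); last by move=> e _; exact: jN.
  apply: (@sum_level_end_le _ k n N (fun c => (K1 c / W c) `^ s)
    (fun e => level_end k n e && ~~ level_end j n e)) => //.
    by move=> d; rewrite powR_ge0.
  by move=> e /andP[].
apply: (le_trans (h1 V w tau a n N k j W T KK _ V0 VS a0 km jm kN jN W0 WS T0 TS Wk tT Tt FB0 KK0 mK ma mb)).
by rewrite powRM ?(ltW F0)// !mulrA.
Qed.

End theorem.
End Upper.

(** * The discrete inequality: necessary conditions *)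

Section Lower.
Context {R : realType}.
Implicit Types (p th r s t B C : R) (V w tau a K W T : nat -> R)
  (P S : pred nat) (k j : nat -> nat).

(** For [th / p >= 1] powers are superadditive, so an increment dominates the power of its own new
    term. *)
Lemma LMd_ge p th V tau a n : 0 < p -> p <= th ->
  (forall i, 0 <= V i) -> (forall i, 0 <= tau i) -> (forall i, 0 <= a i) ->
  \sum_(i < n) (tau i * V i * a i) `^ th <= LMd p th V tau a n.
Proof.
move=> p0 pth V0 t0 a0; have th0 : 0 < th by exact: lt_le_trans pth.
apply: ler_sum => m _.
rewrite -mulrA powRM ?mulr_ge0// ler_wpM2l ?powR_ge0//.
rewrite big_ord_recr /= lerBrDl.
have -> : (V m * a m) `^ th = ((V m * a m) `^ p) `^ (th / p).
  by rewrite -powRrM mulrCA mulfV ?mulr1 ?lt0r_neq0.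
rewrite powR_sumD ?powR_ge0 ?sumr_ge0//; last by rewrite ler_pdivlMr// mul1r.
by move=> i _; rewrite powR_ge0.
Qed.

(** Each [tau m] may be lowered to [tau n], after which the increments telescope. *)
Lemma LMd_ge_last p th V tau a n : 0 < p -> p <= th ->
  (forall i, 0 <= V i) -> (forall i, 0 < tau i) -> (forall i, tau i.+1 <= tau i) ->
  tau n `^ th * (\sum_(i < n.+1) (V i * a i) `^ p) `^ (th / p) <=
  LMd p th V tau a n.+1.
Proof.
move=> p0 pth V0 t0 tS; have th0 : 0 < th by exact: lt_le_trans pth.
have tp : 0 < th / p by rewrite divr_gt0.
have X0 i : 0 <= (V i * a i) `^ p by rewrite powR_ge0.
have tm i l : (i <= l)%N -> tau l <= tau i.
  by apply: (@homo_leq _ _ (fun x y => y <= x)) => // x y z xy yz; exact: le_trans xy.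
apply: (@le_trans _ _ (\sum_(m < n.+1) tau n `^ th *
  ((\sum_(i < m.+1) (V i * a i) `^ p) `^ (th / p) -
   (\sum_(i < m) (V i * a i) `^ p) `^ (th / p)))); last first.
  apply: ler_sum => m _; apply: ler_wpM2r; first exact: (head_diff_ge0 m X0 tp).
  by rewrite le_powR ?(ltW th0) ?(ltW (t0 _))// tm// -ltnS.
rewrite -mulr_sumr.
rewrite -(big_mkord xpredT (fun m =>
  ((\sum_(i < m.+1) (V i * a i) `^ p) `^ (th / p) -
   (\sum_(i < m) (V i * a i) `^ p) `^ (th / p)))).
rewrite (telescope_sumr (fun m => (\sum_(i < m) (V i * a i) `^ p) `^ (th / p)))//.
by rewrite big_ord0 powR0 ?subr0// lt0r_neq0.
Qed.

(* the weights [e] sum to at most 1, so that Jensen's inequality applies *)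
Lemma jensen_levels p1 p2 th1 (n : nat) S (e y : nat -> R) : 0 < p2 -> p2 < p1 -> p2 < th1 ->
  (forall i, 0 <= e i) -> (forall i, 0 <= y i) -> \sum_(i < n | S i) e i <= 1 ->
  (\sum_(i < n | S i) (e i `^ p2^-1 * y i) `^ p1) `^ (th1 / p1) <=
  \sum_(i < n | S i) e i * y i `^ th1.
Proof.
move=> p20 p21 p2th e0 y0 e1; have p10 : 0 < p1 by exact: lt_trans p21.
have th0 : 0 < th1 by exact: lt_trans p2th.
have ele i : (i < n)%N -> S i -> e i <= 1.
  move=> i_n Si; apply: le_trans e1.
  by rewrite (bigD1 (Ordinal i_n))//= lerDl sumr_ge0.
have epow x i : (i < n)%N -> S i -> 1 <= x -> e i `^ x <= e i.
  move=> i_n Si x1; have [->|en] := eqVneq (e i) 0.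
    by rewrite powR0// lt0r_neq0// (lt_le_trans _ x1).
  by rewrite ge1r_powR// lt0r en e0 ele.
have [th1p1|p1th1] := leP th1 p1.
  apply: (@le_trans _ _ (\sum_(i < n | S i) ((e i `^ p2^-1 * y i) `^ p1) `^ (th1 / p1))).
    apply: sumr_powR_le => [i _|]; first by rewrite powR_ge0.
    by rewrite divr_gt0//= ler_pdivrMr// mul1r.
  apply: ler_sum => i Si; rewrite -powRrM mulrCA mulfV ?lt0r_neq0// mulr1.
  rewrite powRM ?powR_ge0// ler_wpM2r ?powR_ge0// -powRrM epow// mulrC.
  by rewrite ler_pdivlMr// mul1r ltW.
have t1 : 0 < th1 - p1 by rewrite subr_gt0.
have c1 : (th1 / (th1 - p1))^-1 + (th1 / p1)^-1 = 1.
  by rewrite !invf_div -mulrDl subrK mulfV// lt0r_neq0.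
have ee i : e i `^ (th1 / (th1 - p1))^-1 * e i `^ (th1 / p1)^-1 = e i.
  by rewrite -powRD_ge0 c1 ?ltr01// powRr1.
set Y := \sum_(i < n | S i) e i * y i `^ th1.
have Y0 : 0 <= Y by apply: sumr_ge0 => i _; rewrite mulr_ge0 ?powR_ge0.
have -> : Y = (Y `^ (p1 / th1)) `^ (th1 / p1).
  by rewrite -powRrM mulrA divfK ?lt0r_neq0// mulfV ?powRr1// lt0r_neq0.
apply: le_powR; first by rewrite divr_ge0// ltW.
  by apply: sumr_ge0 => i _; rewrite powR_ge0.
apply: (@le_trans _ _ (\sum_(i < n | S i)
    e i `^ (th1 / (th1 - p1))^-1 * (e i `^ (th1 / p1)^-1 * y i `^ p1))).
  apply: ler_sum => i Si; rewrite mulrA ee powRM ?powR_ge0// ler_wpM2r ?powR_ge0//.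
  by rewrite -powRrM epow// mulrC ler_pdivlMr// mul1r ltW.
apply: (le_trans (@hoelder_sum _ _ _ (fun i : 'I_n => S i) (th1 / (th1 - p1)) (th1 / p1)
  (fun i => e i `^ (th1 / (th1 - p1))^-1) (fun i => e i `^ (th1 / p1)^-1 * y i `^ p1)
  (fun i _ => powR_ge0 _ _) (fun i _ => mulr_ge0 (powR_ge0 _ _) (powR_ge0 _ _))
  (divr_gt0 th0 t1) (divr_gt0 th0 p10) c1)).
have -> : \sum_(i < n | S i) (e i `^ (th1 / (th1 - p1))^-1) `^ (th1 / (th1 - p1)) =
    \sum_(i < n | S i) e i.
  by apply: eq_bigr => i _; rewrite powRKV// lt0r_neq0// divr_gt0.
have -> : \sum_(i < n | S i) (e i `^ (th1 / p1)^-1 * y i `^ p1) `^ (th1 / p1) = Y.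
  apply: eq_bigr => i _; rewrite powRM ?powR_ge0// powRKV ?lt0r_neq0 ?divr_gt0//.
  by rewrite -powRrM mulrCA mulfV ?mulr1// lt0r_neq0.
rewrite invf_div [(th1 / p1)^-1]invf_div ler_piMl ?powR_ge0//.
have E0 : 0 <= \sum_(i < n | S i) e i by apply: sumr_ge0.
apply: (@le_trans _ _ (1 `^ ((th1 - p1) / th1))); last by rewrite powR1.
by apply: le_powR => //; rewrite divr_ge0 ?ltW.
Qed.

(** The jumps telescope from the first index of level at least [c], where [w] is at least [W c]. *)
Lemma level_jump r w k W c n : 0 < r -> (forall i, 0 < w i) -> (forall i, w i <= w i.+1) ->
  (forall i l, (i <= l)%N -> (k i <= k l)%N) ->
  (forall c, 0 < W c) -> (forall c, W c <= W c.+1) -> (forall i, W (k i) <= w i) ->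
  \sum_(i < n | k i == c) jump r w i <= W c `^ (- r).
Proof.
move=> r0 w0 wS km W0 WS Wk.
have [m mn [hm hs]] := tail_fiber (jump r w) n c km.
apply: (@le_trans _ _ (\sum_(i < n | (c <= k i)%N) jump r w i)).
  by apply: ler_sum_sub => [i /eqP ->//|i _]; exact: jump_ge0 (ltW r0) w0 wS.
rewrite hs; have [->|m_n] := eqVneq m n; first by rewrite big_geq ?powR_ge0.
have {}m_n : (m < n)%N by rewrite ltn_neqAle m_n.
apply: (@le_trans _ _ (w m `^ (- r))).
  under eq_bigr do rewrite /jump -opprB.
  rewrite sumrN (telescope_sumr (fun i => w i `^ (- r)))// opprB gerBl.
  by rewrite powR_ge0.
rewrite le_powRN ?(ltW r0)//; apply: le_trans (Wk m).
have Wm i l : (i <= l)%N -> W i <= W l.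
  by apply: (homo_leq (@lexx _ R) (@le_trans _ R)).
by apply: Wm; rewrite hm.
Qed.

(** Cancelling Z^(th2/th1) leaves the exponent 1 - th2/th1 = th2/s on the left. *)
Lemma self_bound th1 th2 s : 0 < th2 -> th2 < th1 -> s^-1 = th2^-1 - th1^-1 ->
  forall Z A B C, 0 <= Z -> 0 <= A -> 0 <= B -> 0 <= C ->
  Z <= A * (B `^ th2 * (C * Z) `^ (th2 / th1)) ->
  Z <= (A `^ th2^-1 * C `^ th1^-1) `^ s * B `^ s.
Proof.
move=> th20 th21 sE Z A B C Z0 A0 B0 C0.
have th10 : 0 < th1 by exact: lt_trans th21.
have s0 : 0 < s by rewrite -invr_gt0 sE subr_gt0 ltf_pV2.
rewrite -powRM ?mulr_ge0 ?powR_ge0//.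
rewrite le_eqVlt in Z0; case/predU1P: Z0 => [<- _|Zp]; first by rewrite powR_ge0.
rewrite powRM ?(ltW Zp)// => h.
have e : th2 / s + th2 / th1 = 1.
  by rewrite -mulrDr sE subrK mulfV// lt0r_neq0.
have {h} h : Z `^ (th2 / s) <= A * (B `^ th2 * C `^ (th2 / th1)).
  have Zt : 0 < Z `^ (th2 / th1) by rewrite powR_gt0.
  rewrite -(ler_pM2r Zt) -powRD_pos// e powRr1 ?(ltW Zp)//.
  by rewrite -!mulrA.
rewrite -(@le_powRP _ (th2 / s)) ?divr_gt0 ?(ltW Zp) ?powR_ge0//.
have sK (x : R) : (x `^ s) `^ (th2 / s) = x `^ th2.
  by rewrite -powRrM mulrCA mulfV ?mulr1// lt0r_neq0.
apply: (le_trans h); rewrite sK.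
rewrite !powRM ?mulr_ge0 ?powR_ge0// powRKV ?lt0r_neq0// -powRrM (mulrC th1^-1).
by rewrite mulrAC mulrA.
Qed.

Section theorem.
Variables (p1 p2 th1 th2 : R).
Hypotheses (p20 : 0 < p2) (p21 : p2 < p1) (p2th1 : p2 < th1) (p2th2 : p2 < th2).
Let r := (p2^-1 - th1^-1)^-1.
Let p10 : 0 < p1. Proof. exact: lt_trans p21. Qed.
Let th10 : 0 < th1. Proof. exact: lt_trans p2th1. Qed.
Let th20 : 0 < th2. Proof. exact: lt_trans p2th2. Qed.
Let r0 : 0 < r. Proof. by rewrite invr_gt0 subr_gt0 ltf_pV2//; exact: (lt_trans p20). Qed.
Let rE : r^-1 = p2^-1 - th1^-1. Proof. by rewrite /r invrK. Qed.

Lemma cLMd_levels : exists2 C, 0 < C & forall w k W a n N,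
  (forall i, 0 < w i) ->
  (forall i l, (i <= l)%N -> (k i <= k l)%N) ->
  (forall i, (i < n)%N -> (k i < N)%N) ->
  (forall c, 0 < W c) -> (forall c, W c.+1 = 2 * W c) ->
  (forall i, w i <= 2 * W (k i)) -> (forall i, 0 <= a i) ->
  cLMd p1 th1 w a n <=
  C * \sum_(c < N) W c `^ th1 * (\sum_(i < n | k i == c) a i `^ p1) `^ (th1 / p1).
Proof.
have [C C0 h] := levels_tail_le (half_pow_lt1 th10) (divr_gt0 th10 p10).
exists (C * 2 `^ th1) => [|w k W a n N w0 km kN W0 WS wW a0].
  by rewrite mulr_gt0 ?powR_gt0.
have W20 c : 0 < 2 * W c by rewrite mulr_gt0.
have W2S c : 2 * W c.+1 = 2 * (2 * W c) by rewrite WS.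
have := h k (fun m => w m `^ th1) (fun c => (2 * W c) `^ th1) (fun i => a i `^ p1) n N km kN.
have G0 c : 0 <= (2 * W c) `^ th1 by rewrite powR_ge0.
have Gl c : (2 * W c) `^ th1 <= 2 `^ (- th1) * (2 * W c.+1) `^ th1.
  by rewrite -(doubling_pow th1 W20 W2S).
have A0 i : 0 <= a i `^ p1 by rewrite powR_ge0.
have wG i : w i `^ th1 <= (2 * W (k i)) `^ th1.
  by rewrite le_powR ?(ltW th10) ?(ltW (w0 _)).
move/(_ G0 Gl A0 wG)/le_trans; apply.
rewrite -mulrA ler_wpM2l ?(ltW C0)// mulr_sumr.
by apply: ler_sum => c _; rewrite powRM ?(ltW (W0 _))// mulrA.
Qed.

(** On the level [c] the numbers W_c^r jump_i add up to at most 1, so [jensen_levels] applies to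
    them; the powers of [W c] cancel because r th1/p2 = th1 + r. The cost of a test sequence thus
    becomes an integral against d(-w^(-r)). *)
Lemma cLMd_jump : exists2 C, 0 < C & forall w a (y : nat -> R) n,
  (forall i, 0 < w i) -> (forall i, w i <= w i.+1) -> (forall i, 0 <= y i) ->
  (forall i, a i = jump r w i `^ p2^-1 * y i) ->
  cLMd p1 th1 w a n <= C * \sum_(i < n) jump r w i * y i `^ th1.
Proof.
have [C C0 h] := cLMd_levels; exists C => // w a y n w0 wS y0 aE.
have [k [km kw]] := level_function w0 wS.
pose W c := w 0%N * 2 ^+ c.
have W0 c : 0 < W c by rewrite mulr_gt0// exprn_gt0.
have WS c : W c.+1 = 2 * W c by rewrite /W exprS mulrCA.
have Wk i : W (k i) <= w i by case/andP: (kw i).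
have wW i : w i <= 2 * W (k i) by rewrite -WS ltW//; case/andP: (kw i).
have J0 i : 0 <= jump r w i by exact: jump_ge0 (ltW r0) w0 wS.
have a0 i : 0 <= a i by rewrite aE mulr_ge0 ?powR_ge0.
have kN i : (i < n)%N -> (k i < (k n).+1)%N by move=> /ltnW/km.
apply: (le_trans (h w k W a n _ w0 km kN W0 WS wW a0)).
rewrite ler_wpM2l ?(ltW C0)// [leRHS](@sum_fiber _ n (k n).+1 xpredT k)/=; last first.
  by move=> i _; exact: kN.
apply: ler_sum => c _.
pose e i := W c `^ r * jump r w i.
have e0 i : 0 <= e i by rewrite mulr_ge0 ?powR_ge0.
have e1 : \sum_(i < n | k i == c) e i <= 1.
  rewrite -mulr_sumr; apply: (@le_trans _ _ (W c `^ r * W c `^ (- r))).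
    rewrite ler_wpM2l ?powR_ge0// (@level_jump _ _ k)// => d.
    by rewrite WS ler_peMl ?ler1n// ltW.
  by rewrite -powRD_pos// subrr powRr0.
have := @jensen_levels p1 p2 th1 n (fun i => k i == c) e y p20 p21 p2th1 e0 y0 e1.
have -> : \sum_(i < n | k i == c) (e i `^ p2^-1 * y i) `^ p1 =
   W c `^ (r / p2 * p1) * \sum_(i < n | k i == c) a i `^ p1.
  rewrite mulr_sumr; apply: eq_bigr => i _; rewrite powRrM -powRM ?powR_ge0//.
  by rewrite aE /e (powRM _ (powR_ge0 _ _) (J0 i)) -powRrM mulrA.
have S0 : 0 <= \sum_(i < n | k i == c) a i `^ p1.
  by apply: sumr_ge0 => i _; rewrite powR_ge0.
rewrite powRM ?powR_ge0// -powRrM => hj.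
have ex : r / p2 * p1 * (th1 / p1) = th1 + r.
  rewrite -mulrA (mulrCA p1) mulfV ?mulr1 ?lt0r_neq0//.
  have -> : r / p2 = 1 + r / th1.
    have : r * r^-1 = 1 by rewrite mulfV// lt0r_neq0.
    by rewrite rE mulrBr => <-; rewrite subrK.
  by rewrite mulrDl mul1r divfK// lt0r_neq0.
have {hj} := ler_wpM2l (powR_ge0 (W c) (- r)) hj.
rewrite (mulrA (W c `^ (- r))) -powRD_pos// ex addrCA addNr addr0 => /le_trans; apply.
rewrite mulr_sumr; apply: ler_sum => i _.
by rewrite /e -mulrA [leLHS]mulrA -powRD_pos// addNr powRr0 mul1r.
Qed.

Definition lower_hyp V w tau B := forall a n, (forall i, 0 <= a i) ->
  LMd p2 th2 V tau a n <= B `^ th2 * cLMd p1 th1 w a n `^ (th2 / th1).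

(** The test sequence satisfies (V a)^p2 = V^r jump, and its cost is at most a multiple of [H]. Both
    sides are then powers of [H], whose quotient leaves the exponent 1/p2 - 1/th1 = 1/r. *)
Lemma lower_H : exists2 C, 0 < C & forall V w tau B m,
  (forall i, 0 < V i) -> (forall i, 0 < w i) -> (forall i, w i <= w i.+1) ->
  (forall i, 0 < tau i) -> (forall i, tau i.+1 <= tau i) ->
  0 <= B -> lower_hyp V w tau B ->
  tau m * Hsum r V w m.+1 `^ r^-1 <= C * B.
Proof.
have [C C0 h] := cLMd_jump; exists (C `^ th1^-1) => [|V w tau B m V0 w0 wS t0 tS B0 hyp].
  by rewrite powR_gt0.
have J0 i : 0 <= jump r w i by exact: jump_ge0 (ltW r0) w0 wS.
pose y i := V i `^ (r / th1); pose a i := jump r w i `^ p2^-1 * y i.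
have y0 i : 0 <= y i by rewrite powR_ge0.
have a0 i : 0 <= a i by rewrite mulr_ge0 ?powR_ge0.
set H := Hsum r V w m.+1.
have H0 : 0 <= H by apply: sumr_ge0 => i _; rewrite mulr_ge0 ?powR_ge0.
have cost : cLMd p1 th1 w a m.+1 <= C * H.
  apply: (le_trans (h w a y m.+1 w0 wS y0 (fun=> erefl))).
  rewrite ler_wpM2l ?(ltW C0)//; apply: ler_sum => i _.
  by rewrite mulrC ler_wpM2r// /y -powRrM divfK// lt0r_neq0.
have cost0 : 0 <= cLMd p1 th1 w a m.+1.
  apply: sumr_ge0 => i _; rewrite mulr_ge0 ?powR_ge0//.
  by apply: tail_diff_ge0; rewrite ?divr_gt0// => l; rewrite powR_ge0.
have gain := @LMd_ge_last p2 th2 V tau a m p20 (ltW p2th2) (fun i => ltW (V0 i)) t0 tS.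
have XH : \sum_(i < m.+1) (V i * a i) `^ p2 = H.
  apply: eq_bigr => i _; rewrite /a mulrCA !powRM ?mulr_ge0 ?powR_ge0 ?(ltW (V0 _))//.
  rewrite powRKV ?lt0r_neq0// mulrC /y -powRrM -powRD_pos//; congr (_ `^ _ * _).
  have : r * r^-1 = 1 by rewrite mulfV// lt0r_neq0.
  rewrite rE mulrBr => e.
  by rewrite -{1}(mul1r p2) -mulrDl -e subrK divfK// lt0r_neq0.
rewrite XH in gain.
have := le_trans gain (hyp a m.+1 a0).
have : cLMd p1 th1 w a m.+1 `^ (th2 / th1) <= (C * H) `^ (th2 / th1).
  by rewrite le_powR// divr_ge0 ?ltW.
move=> /(ler_wpM2l (powR_ge0 B th2)) h1 /le_trans /(_ h1) {h1}.
rewrite le_eqVlt in H0; case/predU1P: H0 => [<- _|Hp].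
  by rewrite powR0 ?mulr0 ?mulr_ge0 ?powR_ge0// invr_neq0// lt0r_neq0.
have Cth : C `^ (th2 / th1) = (C `^ th1^-1) `^ th2 by rewrite -powRrM mulrC.
rewrite powRM ?(ltW C0) ?(ltW Hp)// Cth => h1.
rewrite -(@le_powRP _ th2)// ?mulr_ge0 ?powR_ge0 ?(ltW (t0 _))//.
rewrite [leRHS]powRM ?powR_ge0// powRM ?powR_ge0 ?(ltW (t0 _))//.
rewrite -powRrM -(ler_pM2r (powR_gt0 (th2 / th1) Hp)) -mulrA -powRD_pos//.
have -> : r^-1 * th2 + th2 / th1 = th2 / p2.
  by rewrite rE mulrC -mulrDr subrK.
by apply: (le_trans h1); rewrite mulrA (mulrC (B `^ _)).
Qed.

(** The test sequence is chosen so that [cLMd_jump] prices it by the sum [S1] itself. Its gain is at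
    least a multiple of [S1], and [self_bound] concludes. *)
Lemma lower_S1 s : th2 < th1 -> s^-1 = th2^-1 - th1^-1 ->
  exists2 C, 0 < C & forall V w tau B n,
  (forall i, 0 < V i) -> (forall i, 0 < w i) -> (forall i, w i <= w i.+1) ->
  (forall i, 0 < tau i) -> (forall i, tau i.+1 <= tau i) ->
  0 <= B -> lower_hyp V w tau B ->
  \sum_(m < n) tau m `^ s *
    (V m `^ r * jump r w m * Hsum r V w m.+1 `^ (s / r - 1)) <= C * B `^ s.
Proof.
move=> th21 sE.
have s0 : 0 < s by rewrite -invr_gt0 sE subr_gt0 ltf_pV2.
have rs : r <= s.
  by rewrite -lef_pV2 ?posrE// rE sE lerD2r lef_pV2// ltW.
have sr1 : 1 <= s / r by rewrite ler_pdivlMr// mul1r.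
pose u := s / r - 1; have u0 : 0 <= u by rewrite subr_ge0.
(* The partial sums of (V a)^p2 are at least tau^x H^(1+z) / (1 + z); since (1 + z) t = s/r, the
   increments of their power [t] reproduce the weight in [S1]. *)
pose z := u * (p2 / th1); have z0 : 0 <= z by rewrite mulr_ge0// divr_ge0 ?ltW.
pose t := th2 / p2; have t1 : 1 <= t by rewrite ler_pdivlMr// mul1r ltW.
have z1 : 0 < 1 + z by rewrite ltr_pwDl.
have zt : (1 + z) * t = s / r.
  have sth : s / th2 = 1 + s / th1.
    by rewrite -(mulfV (lt0r_neq0 s0)) sE -mulrDr subrK.
  have rp : r / p2 = 1 + r / th1.
    by rewrite -(mulfV (lt0r_neq0 r0)) rE -mulrDr subrK.
  have -> : (1 + z) * t = th2 * (1 / p2 + u / th1).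
    by rewrite /z /t; field; rewrite !lt0r_neq0.
  have -> : 1 / p2 = (1 + r / th1) / r by rewrite -rp; field; rewrite !lt0r_neq0.
  have -> : s / r = th2 * (1 + s / th1) / r by rewrite -sth; field; rewrite !lt0r_neq0.
  by rewrite /u; field; rewrite !lt0r_neq0.
have [C C0 h] := cLMd_jump.
pose c1 := (1 + z) `^ (- (t - 1)).
have c10 : 0 < c1 by rewrite powR_gt0.
exists ((c1^-1 `^ th2^-1 * C `^ th1^-1) `^ s) => [|V w tau B n V0 w0 wS t0 tS B0 hyp].
  by rewrite powR_gt0// mulr_gt0 ?powR_gt0 ?invr_gt0.
have J0 i : 0 <= jump r w i by exact: jump_ge0 (ltW r0) w0 wS.
have tm i l : (i <= l)%N -> tau l <= tau i.
  by apply: (@homo_leq _ _ (fun x y => y <= x)) => // x y q xy yz; exact: le_trans xy.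
pose c i := V i `^ r * jump r w i.
have c0 i : 0 <= c i by rewrite mulr_ge0 ?powR_ge0.
pose H m := Hsum r V w m.
have H0 m : 0 <= H m by apply: sumr_ge0 => i _; exact: c0.
have HS m : H m <= H m.+1 by rewrite /H /Hsum big_ord_recr/= lerDl c0.
pose g i := tau i `^ s * H i.+1 `^ u.
have g0 i : 0 <= g i by rewrite mulr_ge0 ?powR_ge0.
pose y i := (V i `^ r * g i) `^ th1^-1; pose a i := jump r w i `^ p2^-1 * y i.
have y0 i : 0 <= y i by rewrite powR_ge0.
have a0 i : 0 <= a i by rewrite mulr_ge0 ?powR_ge0.
set S1 := \sum_(m < n) _.
have S1E : S1 = \sum_(i < n) jump r w i * y i `^ th1.
  apply: eq_bigr => i _; rewrite /y powRKV ?lt0r_neq0 ?mulr_ge0 ?powR_ge0//.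
  by rewrite /g /u /H; ring.
have S10 : 0 <= S1 by rewrite S1E; apply: sumr_ge0 => i _; rewrite mulr_ge0 ?powR_ge0.
have cost : cLMd p1 th1 w a n <= C * S1.
  by rewrite S1E; exact: (h w a y n w0 wS y0 (fun=> erefl)).
have cost0 : 0 <= cLMd p1 th1 w a n.
  apply: sumr_ge0 => i _; rewrite mulr_ge0 ?powR_ge0//.
  by apply: tail_diff_ge0; rewrite ?divr_gt0// => l; rewrite powR_ge0.
pose x := s * (p2 / th1).
have x0 : 0 <= x by rewrite ltW// mulr_gt0// divr_gt0.
have X_eq i : (V i * a i) `^ p2 = tau i `^ x * (H i.+1 `^ z * c i).
  rewrite /a mulrCA !powRM ?mulr_ge0 ?powR_ge0 ?(ltW (V0 _))//.
  rewrite powRKV ?lt0r_neq0// /y -!powRrM.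
  rewrite /g (powRM _ (powR_ge0 _ _) (mulr_ge0 (powR_ge0 _ _) (powR_ge0 _ _))).
  rewrite (powRM _ (powR_ge0 _ _) (powR_ge0 _ _)) -!powRrM.
  rewrite /x /z /c (mulrC th1^-1).
  have -> : V i `^ r = V i `^ p2 * V i `^ (r * (p2 / th1)).
    rewrite -powRD_pos//; congr (_ `^ _).
    have : r * r^-1 = 1 by rewrite mulfV// lt0r_neq0.
    rewrite rE mulrBr => e.
    have -> : r * (p2 / th1) = p2 * (r / th1) by rewrite mulrCA.
    have e' : r / th1 = r / p2 - 1 by rewrite -e subKr.
    by rewrite e' mulrBr mulr1 mulrCA mulfV ?lt0r_neq0// mulr1 addrC subrK.
  by ring.
have gain : c1 * S1 <= LMd p2 th2 V tau a n.
  rewrite mulr_sumr; apply: ler_sum => m _.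
  rewrite mulrCA.
  pose E l := \sum_(i < l) (V i * a i) `^ p2.
  have X0 i : 0 <= (V i * a i) `^ p2 by rewrite powR_ge0.
  have E0 l : 0 <= E l by apply: sumr_ge0.
  have ES : E m.+1 = E m + (V m * a m) `^ p2 by rewrite /E big_ord_recr.
  have EE : 0 <= E m <= E m.+1.
    by apply/andP; split; [exact: E0 | rewrite ES lerDl; exact: X0].
  (* The power rule for the partial sums [H], after lowering each [tau i] to [tau m]. *)
  have low : tau m `^ x * (H m.+1 `^ (1 + z) / (1 + z)) <= E m.+1.
    rewrite /E; under eq_bigr do rewrite X_eq.
    apply: (@le_trans _ _ (\sum_(i < m.+1) tau m `^ x * (H i.+1 `^ z * c i))).
      rewrite -mulr_sumr ler_wpM2l ?powR_ge0// ler_pdivrMr// mulrC.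
      have z11 : 1 <= 1 + z by rewrite lerDl.
      have := @sum_power_rule R (1 + z) c xpredT m.+1 z11 c0.
      move/le_trans; apply; rewrite ler_wpM2l ?(ltW z1)//.
      apply: ler_sum => i _; rewrite (addrC 1) addrK mulrC; exact: lexx.
    apply: ler_sum => i _; rewrite ler_wpM2r ?mulr_ge0 ?powR_ge0//.
    apply: le_powR => //; first exact: (ltW (t0 _)).
    by apply: tm; rewrite -ltnS.
  have low0 : 0 <= tau m `^ x * (H m.+1 `^ (1 + z) / (1 + z)).
    by rewrite mulr_ge0 ?divr_ge0 ?powR_ge0 ?(ltW z1).
  have dE : E m.+1 - E m = tau m `^ x * (H m.+1 `^ z * c m).
    by rewrite -X_eq; apply/eqP; rewrite subr_eq addrC; apply/eqP.
  have := @powRB_ge R t (E m.+1) (E m) t1 EE.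
  rewrite dE => pb.
  have tau0 := ltW (t0 m).
  apply: (@le_trans _ _ (tau m `^ th2 * ((tau m `^ x * (H m.+1 `^ (1 + z) / (1 + z))) `^ (t - 1) *
     (tau m `^ x * (H m.+1 `^ z * c m))))); last first.
    apply: ler_wpM2l; first exact: powR_ge0.
    apply: le_trans pb; apply: ler_wpM2r.
      by rewrite !mulr_ge0 ?powR_ge0.
    by apply: le_powR; rewrite ?subr_ge0.
  rewrite -/(H m.+1) -/u.
  have Hz0 : 0 <= H m.+1 `^ (1 + z) / (1 + z) by rewrite divr_ge0 ?powR_ge0 ?(ltW z1).
  rewrite (powRM _ (powR_ge0 _ _) Hz0) powR_div ?powR_ge0 ?(ltW z1)// -!powRrM.
  have [Hm|Hm] := eqVneq (H m.+1) 0.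
    have cm : c m = 0.
      apply/eqP; rewrite eq_le c0 andbT -Hm /H /Hsum big_ord_recr /= lerDr.
      exact: H0.
    by rewrite -/(c m) cm !(mul0r, mulr0).
  have Hp : 0 < H m.+1 by rewrite lt0r Hm H0.
  have e1 : tau m `^ s = tau m `^ th2 * tau m `^ (x * (t - 1)) * tau m `^ x.
    rewrite -!powRD_pos//; congr (_ `^ _).
    have -> : th2 + x * (t - 1) + x = th2 + x * t by ring.
    rewrite /x /t.
    have -> : s * (p2 / th1) * (th2 / p2) = th2 * (s / th1).
      by field; rewrite !lt0r_neq0.
    rewrite -{1}(mulr1 th2) -mulrDr.
    have -> : 1 + s / th1 = s / th2.
      by rewrite -(mulfV (lt0r_neq0 s0)) sE -mulrDr subrK.
    by rewrite mulrCA mulfV ?mulr1// lt0r_neq0.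
  have e2 : H m.+1 `^ u = H m.+1 `^ ((1 + z) * (t - 1)) * H m.+1 `^ z.
    rewrite -powRD_pos//; congr (_ `^ _).
    by rewrite /u -zt; ring.
  rewrite e1 e2 /c1 powRN -/(c m) le_eqVlt; apply/orP; left; apply/eqP.
  by ring.
apply: (self_bound th20 th21 sE) => //.
- by rewrite invr_ge0 ltW.
- exact: ltW.
- rewrite -ler_pdivrMl ?invr_gt0// invrK; apply: (le_trans gain).
  apply: (le_trans (hyp a n a0)); rewrite ler_wpM2l ?powR_ge0//.
  by rewrite le_powR// divr_ge0 ?ltW.
Qed.

End theorem.
End Lower.

(** * Lower bounds from extremal sequences of the multipliers *)

Section LowerEnvelope.
Context {R : realType}.
Implicit Types (p th r s t x B C : R) (V w tau a K W T : nat -> R)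
  (P S : pred nat) (k j : nat -> nat).

Lemma powR_lt1 p x : 0 < p -> 0 < x < 1 -> x `^ p < 1.
Proof.
move=> p0 /andP[x0 x1]; have := @gt0_ltr_powR R p p0 x 1.
by rewrite !nnegrE ler01 (ltW x0) powR1; apply.
Qed.

(* the third case is geometric decay of Q H^(1/r) from one cell to the next *)
Lemma doubling_trichotomy (qq r : R) : 0 < qq -> 0 < r ->
  exists kappa eps eta : R, [/\ 0 < kappa, 0 < eps, 0 < eta < 1 &
  forall Q Q' t H c : R, 0 <= Q -> 0 <= Q' -> 0 <= t -> 0 <= H -> 0 <= c ->
    Q' `^ qq <= 2 `^ (- qq) * Q `^ qq + t `^ qq ->
  [\/ eps * H <= c, Q <= kappa * t |
      c <= eps * H /\ Q' * (H + c) `^ r^-1 <= eta * (Q * H `^ r^-1)]].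
Proof.
move=> q0 r0; have ri : 0 < r^-1 by rewrite invr_gt0.
have qi : 0 < qq^-1 by rewrite invr_gt0.
pose x : R := 2 `^ (- qq); have /andP[x0 x1] : 0 < x < 1.
  by rewrite powR_gt0//=; case/andP: (@half_pow_lt1 R qq q0).
(* [l] lies between x = 2^(-qq) and 1. The gap [d] pays for [t], and a growth of [H] by the factor
   [e] uses up half of the exponent in l^(1/qq), which leaves [eta]. *)
pose l := (1 + x) / 2; have l0 : 0 < l by rewrite /l; lra.
have l1 : l < 1 by rewrite /l; lra.
pose d := (1 - x) / 2; have d0 : 0 < d by rewrite /d; lra.
have xd : x + d = l by rewrite /d /l; lra.
pose e := l `^ (- (r / (2 * qq))); have e1 : 1 < e.
  rewrite /e powRN invf_gt1 ?powR_gt0//.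
  by rewrite powR_lt1 ?l0// divr_gt0// mulr_gt0.
pose eta := l `^ (2 * qq)^-1.
have eta1 : eta < 1.
  by rewrite powR_lt1 ?l0// invr_gt0 mulr_gt0.
exists (d `^ (- qq^-1)), (e - 1), eta; split; rewrite ?powR_gt0 ?subr_gt0//.
move=> Q Q' t H c Q0 Q'0 t0 H0 c0 hQ.
have [|ce] := leP ((e - 1) * H) c; first by constructor 1.
have [|Qt] := leP Q (d `^ (- qq^-1) * t); first by constructor 2.
constructor 3; split; first exact: ltW.
have tQ : t `^ qq <= d * Q `^ qq.
  have : (d `^ (- qq^-1) * t) `^ qq <= Q `^ qq.
    by rewrite le_powR ?mulr_ge0 ?powR_ge0 ?(ltW q0) ?(ltW Qt).
  rewrite powRM ?powR_ge0// -powRrM mulNr mulVf ?lt0r_neq0// powRN powRr1 ?(ltW d0)//.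
  by rewrite ler_pdivrMl.
have Q'Q : Q' <= l `^ qq^-1 * Q.
  rewrite -(@le_powRP _ qq)// ?mulr_ge0 ?powR_ge0// powRM ?powR_ge0//.
  rewrite powRKV ?lt0r_neq0 ?(ltW l0)//; apply: (le_trans hQ).
  by rewrite -xd mulrDl lerD2l.
have Hc : (H + c) `^ r^-1 <= e `^ r^-1 * H `^ r^-1.
  rewrite -powRM ?(le_trans ler01 (ltW e1))// le_powR ?(ltW ri) ?addr_ge0//.
  by move: ce; lra.
apply: (le_trans (ler_pM Q'0 (powR_ge0 _ _) Q'Q Hc)).
rewrite mulrACA ler_wpM2r ?mulr_ge0 ?powR_ge0//.
rewrite /e -powRrM -powRD_pos// /eta le_eqVlt; apply/orP; left; apply/eqP.
by congr (_ `^ _); field; rewrite !lt0r_neq0.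
Qed.

Section theorem.
Variables (p1 p2 th1 th2 : R).
Hypotheses (p20 : 0 < p2) (p21 : p2 < p1) (p2th1 : p2 < th1) (p2th2 : p2 < th2).
Let r := (p2^-1 - th1^-1)^-1.
Let p10 : 0 < p1. Proof. exact: lt_trans p21. Qed.
Let th10 : 0 < th1. Proof. exact: lt_trans p2th1. Qed.
Let th20 : 0 < th2. Proof. exact: lt_trans p2th2. Qed.
Let r0 : 0 < r. Proof. by rewrite invr_gt0 subr_gt0 ltf_pV2//; exact: (lt_trans p20). Qed.
Let rE : r^-1 = p2^-1 - th1^-1. Proof. by rewrite /r invrK. Qed.

(* [e c] bounds from below the norm of the multiplier [tau V] from l^p1 to l^th2
   on the block [k i = c], with extremal sequence [b] *)
Definition multiplier_attained qq tau V K := forall k n,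
  (forall i l, (i <= l)%N -> (k i <= k l)%N) ->
  exists e b : nat -> R, [/\ forall c, 0 <= e c, forall i, 0 <= b i,
    forall m, (m < n)%N -> K m `^ qq <= \sum_(c < (k m).+1) e c `^ qq,
    forall c, \sum_(i < n | k i == c) b i `^ p1 <= 1 &
    forall c, e c `^ th2 <= \sum_(i < n | k i == c) (tau i * V i * b i) `^ th2].

(** The last condition says that [K / V] decays geometrically but for what [tau] supplies. *)
Definition decreasing_data V w tau K qq :=
  [/\ forall i, 0 < V i, forall i, V i.+1 = 2 * V i,
      (forall i, 0 < w i) /\ (forall i, w i <= w i.+1),
      (forall i, 0 < tau i) /\ (forall i, tau i.+1 <= tau i) &
      [/\ forall i, 0 <= K i, forall i, K i <= K i.+1,
        forall i, K i.+1 / V i.+1 <= K i / V i &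
        forall i, (K i.+1 / V i.+1) `^ qq <=
          2 `^ (- qq) * (K i / V i) `^ qq + tau i `^ qq] ].

(** The constant level function makes the first [m.+1] indices a single block. Its extremal sequence
    costs at most a power of [w m], as [w] is nondecreasing. *)
Lemma lower_K qq V w tau K B m : 0 < qq -> decreasing_data V w tau K qq ->
  multiplier_attained qq tau V K -> 0 <= B -> lower_hyp p1 p2 th1 th2 V w tau B ->
  K m <= B * w m.
Proof.
move=> q0 [V0 VS [w0 wS] [t0 tS] [K0 KS _ _]] att B0 hyp.
have [e [b [e0 b0 hK hb he]]] := att (fun=> 0%N) m.+1 (fun _ _ _ => leqnn _).
have {}hK : K m <= e 0%N.
  by have := hK m (ltnSn m); rewrite big_ord1 le_powRP.
have {hb} := hb 0%N; rewrite eqxx => hb; have {he} := he 0%N; rewrite eqxx => he.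
have wm i l : (i <= l)%N -> w i <= w l by apply: (homo_leq (@lexx _ R) (@le_trans _ R)).
have cost : cLMd p1 th1 w b m.+1 <= w m `^ th1.
  have X0 i : 0 <= b i `^ p1 by rewrite powR_ge0.
  have tp : 0 < th1 / p1 by rewrite divr_gt0.
  apply: (@le_trans _ _ (\sum_(l < m.+1 | (0 <= 0)%N) w m `^ th1 *
      ((\sum_(l <= i < m.+1) b i `^ p1) `^ (th1 / p1) -
       (\sum_(l.+1 <= i < m.+1) b i `^ p1) `^ (th1 / p1)))).
    apply: ler_sum => l _; apply: ler_wpM2r; first exact: (tail_diff_ge0 m.+1 l X0 tp).
    by apply: le_powR; rewrite ?(ltW th10) ?(ltW (w0 _))// wm// -ltnS.
  rewrite -mulr_sumr (@tail_telescope _ (fun=> 0%N) _ m.+1 0%N)//.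
  rewrite ler_piMr ?powR_ge0//.
  apply: (@le_trans _ _ (1 `^ (th1 / p1))); last by rewrite powR1.
  by apply: le_powR; rewrite ?(ltW tp) ?sumr_ge0.
have gain := @LMd_ge R p2 th2 V tau b m.+1 p20 (ltW p2th2) (fun i => ltW (V0 i))
  (fun i => ltW (t0 i)) b0.
have := le_trans gain (hyp b m.+1 b0); move=> /(le_trans he) h.
apply: (le_trans hK); rewrite -(@le_powRP _ th2) ?mulr_ge0 ?(ltW (w0 _))//.
rewrite powRM ?(ltW (w0 _))//; apply: (le_trans h).
rewrite ler_wpM2l ?powR_ge0//.
apply: (@le_trans _ _ ((w m `^ th1) `^ (th2 / th1))).
  apply: le_powR => //; first by rewrite divr_ge0 ?ltW.
  apply: sumr_ge0 => i _; rewrite mulr_ge0 ?powR_ge0//.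
  by apply: tail_diff_ge0; rewrite ?divr_gt0// => l; rewrite powR_ge0.
by rewrite -powRrM mulrCA mulfV ?mulr1// lt0r_neq0.
Qed.

(** Let [Z] be the sum of (e_c / W_c)^s. The extremal sequences of the [w]-levels, scaled by [la],
    cost at most a multiple of [Z] and gain at least [Z], so [self_bound] applies. [hardy_left] then
    passes from the single levels [e] to [K], and [level_jump] sums the jumps in a level. *)
Lemma lower_S2 qq s : 0 < qq -> th2 < th1 -> s^-1 = th2^-1 - th1^-1 ->
  exists2 C, 0 < C & forall V w tau K B n, decreasing_data V w tau K qq ->
  multiplier_attained qq tau V K -> 0 <= B -> lower_hyp p1 p2 th1 th2 V w tau B ->
  \sum_(m < n) K m `^ s * (w m `^ (- (s - r)) * jump r w m) <= C * B `^ s.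
Proof.
move=> q0 th21 sE.
have s0 : 0 < s by rewrite -invr_gt0 sE subr_gt0 ltf_pV2.
have sth : s / th2 = 1 + s / th1.
  by rewrite -(mulfV (lt0r_neq0 s0)) sE -mulrDr subrK.
have rs : r <= s.
  by rewrite -lef_pV2 ?posrE// rE sE lerD2r lef_pV2// ltW.
have [C1 C10 h1] := @hardy_left R _ (s / qq) (half_pow_lt1 s0) (divr_gt0 s0 q0).
have [C C0 h] := cLMd_levels p20 p21 p2th1.
exists (C1 * (1 `^ th2^-1 * C `^ th1^-1) `^ s) => [|V w tau K B n].
  by rewrite mulr_gt0// powR_gt0// mulr_gt0 ?powR_gt0 ?invr_gt0.
move=> [V0 VS [w0 wS] [t0 tS] [K0 KS _ _]] att B0 hyp.
have [k [km kw]] := level_function w0 wS.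
pose W c := w 0%N * 2 ^+ c.
have W0 c : 0 < W c by rewrite mulr_gt0// exprn_gt0.
have WS c : W c.+1 = 2 * W c by rewrite /W exprS mulrCA.
have WSle c : W c <= W c.+1 by rewrite WS ler_peMl ?ler1n// ltW.
have Wk i : W (k i) <= w i by case/andP: (kw i).
have wW i : w i <= 2 * W (k i) by rewrite -WS ltW//; case/andP: (kw i).
have J0 i : 0 <= jump r w i by exact: jump_ge0 (ltW r0) w0 wS.
have [e [b [e0 b0 hK hb he]]] := att k n km.
pose N := (k n).+1.
have kN i : (i < n)%N -> (k i < N)%N by move=> /ltnW/km.
pose y c := e c / W c; have y0 c : 0 <= y c by rewrite divr_ge0// ltW.
(* Equality case of Hoelder's inequality from l^th1 to l^th2: both (W la)^th1 and (la e)^th2 equal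
   y^s, since s/th2 = 1 + s/th1. *)
pose la c := (W c)^-1 * y c `^ (s / th1).
have la0 c : 0 <= la c by rewrite mulr_ge0 ?powR_ge0// invr_ge0 ltW.
pose a i := la (k i) * b i.
have a0 i : 0 <= a i by rewrite mulr_ge0.
pose Z := \sum_(c < N) y c `^ s.
have Z0 : 0 <= Z by apply: sumr_ge0 => c _; rewrite powR_ge0.
have cost : cLMd p1 th1 w a n <= C * Z.
  apply: (le_trans (h w k W a n N w0 km kN W0 WS wW a0)).
  rewrite ler_wpM2l ?(ltW C0)//; apply: ler_sum => c _.
  have -> : \sum_(i < n | k i == c) a i `^ p1 =
            la c `^ p1 * \sum_(i < n | k i == c) b i `^ p1.
    by rewrite mulr_sumr; apply: eq_bigr => i /eqP ic; rewrite /a ic powRM.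
  have S0 : 0 <= \sum_(i < n | k i == c) b i `^ p1.
    by apply: sumr_ge0 => i _; rewrite powR_ge0.
  rewrite powRM ?powR_ge0// -powRrM (mulrCA p1) mulfV ?mulr1 ?lt0r_neq0// mulrA.
  rewrite -powRM ?(ltW (W0 _))// /la mulrA mulfV ?mul1r ?lt0r_neq0// -powRrM divfK ?lt0r_neq0//.
  rewrite ler_piMr ?powR_ge0//.
  apply: (@le_trans _ _ (1 `^ (th1 / p1))); last by rewrite powR1.
  by apply: le_powR => //; rewrite divr_ge0 ?ltW.
have cost0 : 0 <= cLMd p1 th1 w a n.
  apply: sumr_ge0 => i _; rewrite mulr_ge0 ?powR_ge0//.
  by apply: tail_diff_ge0; rewrite ?divr_gt0// => l; rewrite powR_ge0.
have gain : Z <= LMd p2 th2 V tau a n.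
  apply: le_trans (@LMd_ge R p2 th2 V tau a n p20 (ltW p2th2) (fun i => ltW (V0 i))
    (fun i => ltW (t0 i)) a0).
  rewrite [leRHS](@sum_fiber _ n N xpredT k)/=; last by move=> i _; exact: kN.
  apply: ler_sum => c _.
  have -> : \sum_(i < n | k i == c) (tau i * V i * a i) `^ th2 =
     la c `^ th2 * \sum_(i < n | k i == c) (tau i * V i * b i) `^ th2.
    rewrite mulr_sumr; apply: eq_bigr => i /eqP ic.
    have T0 : 0 <= tau i * V i * b i by rewrite !mulr_ge0// ltW.
    by rewrite /a ic (mulrCA (tau i * V i)) (powRM _ (la0 c) T0).
  apply: (@le_trans _ _ (la c `^ th2 * e c `^ th2)); last first.
    by rewrite ler_wpM2l ?powR_ge0.
  rewrite -powRM// /la mulrAC (mulrC _ (e c)) -/(y c).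
  have [->|yn] := eqVneq (y c) 0.
    by rewrite powR0 ?lt0r_neq0// powR_ge0.
  have yp : 0 < y c by rewrite lt0r yn y0.
  rewrite -{2}(powRr1 (y0 c)) -powRD_pos// -sth -powRrM divfK ?lt0r_neq0//.
have hZ : Z <= (1 `^ th2^-1 * C `^ th1^-1) `^ s * B `^ s.
  apply: (self_bound th20 th21 sE) => //; first exact: ltW.
  rewrite mul1r; apply: (le_trans gain); apply: (le_trans (hyp a n a0)).
    by rewrite ler_wpM2l ?powR_ge0// le_powR// divr_ge0 ?ltW.
rewrite -mulrA; apply: le_trans (ler_wpM2l (ltW C10) hZ).
pose g c := W c `^ (- s).
have g0 c : 0 <= g c by rewrite powR_ge0.
have gl c : g c.+1 <= 2 `^ (- s) * g c by rewrite /g WS powRM// ltW.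
have x0 c : 0 <= e c `^ qq by rewrite powR_ge0.
have := h1 (fun c => e c `^ qq) g N x0 g0 gl.
have -> : \sum_(c < N) g c * (e c `^ qq) `^ (s / qq) = Z.
  apply: eq_bigr => c _; rewrite -powRrM mulrCA mulfV ?mulr1 ?lt0r_neq0//.
  by rewrite /y powR_div ?(ltW (W0 _))// /g powRN mulrC.
apply: le_trans; rewrite (@sum_fiber _ n N xpredT k)/=; last by move=> i _; exact: kN.
apply: ler_sum => c _; set X := \sum_(i < c.+1) _.
have X0 : 0 <= X by apply: sumr_ge0.
apply: (@le_trans _ _ (\sum_(i < n | k i == c) X `^ (s / qq) * (W c `^ (- (s - r)) * jump r w i))).
  apply: ler_sum => i /eqP ic; apply: ler_pM; rewrite ?powR_ge0 ?mulr_ge0 ?powR_ge0//.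
    have -> : K i `^ s = (K i `^ qq) `^ (s / qq).
      by rewrite -powRrM mulrCA mulfV ?mulr1// lt0r_neq0.
    apply: le_powR; rewrite ?divr_ge0 ?powR_ge0 ?(ltW s0) ?(ltW q0)//.
    by rewrite /X -ic; exact: hK.
  apply: ler_wpM2r => //; apply: le_powRN; rewrite ?subr_ge0//.
  by rewrite -ic.
rewrite -mulr_sumr -mulr_sumr mulrC ler_wpM2r ?powR_ge0//.
have -> : g c = W c `^ (- (s - r)) * W c `^ (- r).
  by rewrite -powRD_pos//; congr (_ `^ _); ring.
by rewrite ler_wpM2l ?powR_ge0// (@level_jump _ _ _ k).
Qed.

End theorem.
End LowerEnvelope.

(** * The summed trichotomy, and maxima and weighted sums as envelopes *)

Section Conversions.
Context {R : realType}.
Implicit Types (p th q qq r s t x B C : R) (V w tau a K W T : nat -> R)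
  (P S : pred nat) (k j : nat -> nat).

(** In the first two cases of [doubling_trichotomy] the terms with [g] and with [t] dominate; in the
    third, the decrease of (Q H^(1/r))^s, which telescopes over the cells. In the first two cases
    this quantity may increase, but by at most [s / r * Z], and [G] compensates for it. *)
Lemma trichotomy_sum qq r s : 0 < qq -> 0 < r -> r <= s -> exists C D,
  [/\ 0 < C, 0 < D & forall Q Q' t H c g : R,
  [/\ 0 <= Q, 0 <= Q', 0 <= t, 0 <= H & 0 <= c] -> Q' <= Q ->
  Q' `^ qq <= 2 `^ (- qq) * Q `^ qq + t `^ qq -> c `^ (s / r - 1) <= g ->
  Q `^ s * (c * H `^ (s / r - 1)) <=
    C * (t `^ s * (c * (H + c) `^ (s / r - 1)) + Q `^ s * (c * g)) +
    D * ((Q * H `^ r^-1) `^ s - (Q' * (H + c) `^ r^-1) `^ s)].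
Proof.
move=> q0 r0 rs; have s0 : 0 < s by exact: lt_le_trans rs.
have [kappa [eps [eta [k0 e0 /andP[eta0 eta1] tri]]]] := doubling_trichotomy q0 r0.
have sr1 : 1 <= s / r by rewrite ler_pdivlMr// mul1r.
have sr0 : 0 < s / r by exact: lt_le_trans sr1.
pose u := s / r - 1; have u0 : 0 <= u by rewrite subr_ge0.
have etas : eta `^ s < 1 by rewrite powR_lt1 ?eta0.
have d0 : 0 < 1 - eta `^ s by rewrite subr_gt0.
(* In the third case the left-hand side is at most [eps * Y], while Y - Y' is at least (1 - eta^s)
   Y. *)
pose D := eps / (1 - eta `^ s); have D0 : 0 < D by rewrite divr_gt0.
pose L := eps^-1 + 1; have L0 : 0 < L by rewrite addr_gt0 ?invr_gt0.
pose G := (1 + D * (s / r)); have G0 : 0 < G by rewrite addr_gt0// mulr_gt0.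
exists (G * (kappa `^ s + L `^ u)), D; split => //.
  by rewrite mulr_gt0// addr_gt0 ?powR_gt0.
move=> Q Q' t H c g [Q0 Q'0 t0 H0 c0] QQ hQ cg.
rewrite -/u in cg *; have g0 : 0 <= g by apply: le_trans cg; rewrite powR_ge0.
have H'0 : 0 <= H + c by rewrite addr_ge0.
have YE x y : 0 <= x -> 0 <= y -> (x * y `^ r^-1) `^ s = x `^ s * y `^ (s / r).
  by move=> x0 y0; rewrite powRM ?powR_ge0// -powRrM (mulrC _ s).
rewrite !YE//.
set t1 := Q `^ s * (c * H `^ u).
set Y := Q `^ s * H `^ (s / r); set Y' := Q' `^ s * (H + c) `^ (s / r).
pose Z := Q `^ s * (c * (H + c) `^ u).
have tZ : t1 <= Z.
  apply: ler_wpM2l; first exact: powR_ge0.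
  by apply: ler_wpM2l => //; apply: le_powR => //; rewrite lerDl.
have YZ : Y' - Y <= s / r * Z.
  apply: (@le_trans _ _ (Q `^ s * ((H + c) `^ (s / r) - H `^ (s / r)))).
    rewrite mulrBr lerB// ler_wpM2r ?powR_ge0//.
    by apply: le_powR => //; exact: ltW.
  have := powRB_le sr1 H0 H'0; rewrite addrAC subrr add0r => h.
  apply: (le_trans (ler_wpM2l (powR_ge0 _ _) h)).
  by rewrite mulrCA /Z (mulrC c).
have S10 : 0 <= t `^ s * (c * (H + c) `^ u) by rewrite !mulr_ge0 ?powR_ge0.
have S20 : 0 <= Q `^ s * (c * g) by rewrite !mulr_ge0 ?powR_ge0.
have main B : Z <= B -> t1 <= G * B + D * (Y - Y').
  move=> ZB; apply: (@le_trans _ _ (G * Z + D * (Y - Y'))); last first.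
    by rewrite lerD2r ler_wpM2l// ltW.
  rewrite /G mulrDl mul1r -addrA; apply: (le_trans tZ).
  rewrite lerDl -mulrA -mulrDr mulr_ge0 ?(ltW D0)//.
  by move: YZ; lra.
case: (tri Q Q' t H c Q0 Q'0 t0 H0 c0 hQ) => [hc|hQt|[hc hY]].
- rewrite -mulrA; apply: main.
  have HL : H + c <= L * c.
    by rewrite /L mulrDl mul1r lerD2r ler_pdivlMl.
  apply: (@le_trans _ _ (L `^ u * (Q `^ s * (c * g)))); last first.
    apply: (@le_trans _ _ (L `^ u * (t `^ s * (c * (H + c) `^ u) + Q `^ s * (c * g)))).
      by apply: ler_wpM2l; rewrite ?powR_ge0 ?lerDr.
    by apply: ler_wpM2r; rewrite ?addr_ge0 ?lerDr ?powR_ge0.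
  rewrite mulrCA /Z; apply: ler_wpM2l; first exact: powR_ge0.
  rewrite mulrCA; apply: ler_wpM2l => //.
  apply: (@le_trans _ _ ((L * c) `^ u)); first exact: le_powR.
  by rewrite powRM ?(ltW L0)// ler_wpM2l ?powR_ge0.
- rewrite -mulrA; apply: main.
  apply: (@le_trans _ _ (kappa `^ s * (t `^ s * (c * (H + c) `^ u)))); last first.
    apply: (@le_trans _ _ (kappa `^ s * (t `^ s * (c * (H + c) `^ u) + Q `^ s * (c * g)))).
      by apply: ler_wpM2l; rewrite ?powR_ge0 ?lerDl.
    by apply: ler_wpM2r; rewrite ?addr_ge0 ?lerDl ?powR_ge0.
  rewrite mulrA -powRM ?(ltW k0)// /Z; apply: ler_wpM2r.
    by rewrite mulr_ge0 ?powR_ge0.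
  by apply: le_powR => //; exact: ltW.
- apply: (@le_trans _ _ (D * (Y - Y'))); last first.
    have GG : 0 <= G * (kappa `^ s + L `^ u).
      exact: (mulr_ge0 (ltW G0) (addr_ge0 (powR_ge0 _ _) (powR_ge0 _ _))).
    by rewrite lerDr; exact: (mulr_ge0 GG (addr_ge0 S10 S20)).
  have hY' : Y' <= eta `^ s * Y.
    rewrite /Y /Y' -!YE// -powRM ?mulr_ge0 ?powR_ge0 ?(ltW eta0)//.
    by apply: le_powR; rewrite ?mulr_ge0 ?powR_ge0 ?(ltW s0).
  apply: (@le_trans _ _ (eps * Y)).
    rewrite /t1 /Y [leRHS]mulrCA; apply: ler_wpM2l; first exact: powR_ge0.
    rewrite (powR_pred H0 sr0) -/u (mulrC _ H) mulrA.
    by apply: ler_wpM2r; first exact: powR_ge0.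
  rewrite /D -mulrA ler_pM2l// ler_pdivlMl//.
  by move: hY'; lra.
Qed.

(* with these weights (head_norm / V)^q is an average of tau^q when V doubles *)
Definition head_weight q i : R := if i == 0%N then 1 else 1 - 2 `^ (- q).

Definition head_norm q (y : nat -> R) m :=
  (\sum_(i < m.+1) head_weight q i * y i `^ q) `^ q^-1.

Fixpoint head_max (y : nat -> R) m :=
  if m is m'.+1 then Num.max (head_max y m') (y m) else y 0%N.

Lemma head_max_le y m B : (forall i, (i <= m)%N -> y i <= B) -> head_max y m <= B.
Proof.
elim: m => [|m IH] h /=; first exact: h.
by rewrite ge_max h// IH// => i im; rewrite h// (leq_trans im).
Qed.

Lemma head_weight_bounds q i : 0 < q ->
  0 < 1 - 2 `^ (- q) <= head_weight q i /\ head_weight q i <= 1.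
Proof.
move=> q0; have /andP[h0 h1] := @half_pow_lt1 R q q0.
rewrite /head_weight; case: ifP => _; rewrite subr_gt0 h1/=; last first.
  by rewrite lexx gerBl.
by rewrite gerBl h0.
Qed.

Lemma head_norm_pow q y m : 0 < q -> head_norm q y m `^ q =
  \sum_(i < m.+1) head_weight q i * y i `^ q.
Proof.
move=> q0; rewrite powRKV ?lt0r_neq0// sumr_ge0// => i _.
have [/andP[h1 h2] _] := head_weight_bounds i q0.
by rewrite mulr_ge0 ?powR_ge0// (le_trans (ltW h1) h2).
Qed.

Lemma head_norm_powS q y m : 0 < q -> head_norm q y m.+1 `^ q =
  head_norm q y m `^ q + (1 - 2 `^ (- q)) * y m.+1 `^ q.
Proof. by move=> q0; rewrite !head_norm_pow// big_ord_recr. Qed.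

Section head.
Variables (V tau : nat -> R).
Hypotheses (V0 : forall i, 0 < V i) (VS : forall i, V i.+1 = 2 * V i).
Hypotheses (t0 : forall i, 0 < tau i) (tS : forall i, tau i.+1 <= tau i).
Let y i := tau i * V i.
Let y0 i : 0 <= y i. Proof. by rewrite mulr_ge0// ltW. Qed.

(** One step multiplies the previous (K/V)^q by 2^(-q) and adds 1 - 2^(-q) times the new tau^q. As
    [tau] decreases, these averages stay above tau^q and decrease. *)
Lemma head_norm_data q : 0 < q -> let K := head_norm q y in
  [/\ forall i, y i <= K i, forall i, 0 <= K i, forall i, K i <= K i.+1,
      forall i, K i.+1 / V i.+1 <= K i / V i &
      forall i, (K i.+1 / V i.+1) `^ q <= 2 `^ (- q) * (K i / V i) `^ q + tau i `^ q].
Proof.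
move=> q0; have /andP[h0 h1] := @half_pow_lt1 R q q0; cbv zeta.
have hp : 0 < 1 - (2 : R) `^ (- q) by rewrite subr_gt0.
have KZp : head_norm q y 0%N `^ q = y 0%N `^ q.
  by rewrite head_norm_pow// big_ord1 /head_weight eqxx mul1r.
have K0 i : 0 <= head_norm q y i by rewrite powR_ge0.
have := fun i => head_norm_powS y i q0.
move: (head_norm q y) KZp K0 => K KZp K0 KSp.
have KS i : K i <= K i.+1.
  rewrite -(@le_powRP _ q)// KSp lerDl; apply: mulr_ge0; last exact: powR_ge0.
  exact: ltW.
have Q0 i : 0 <= K i / V i by rewrite divr_ge0// ltW.
have QS i : (K i.+1 / V i.+1) `^ q =
    2 `^ (- q) * (K i / V i) `^ q + (1 - 2 `^ (- q)) * tau i.+1 `^ q.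
  rewrite powR_div ?(ltW (V0 _))// KSp mulrDl; congr (_ + _).
    rewrite VS (powRM _ (ler0n _ _) (ltW (V0 i))) powR_div ?(ltW (V0 _))// invfM powRN.
    by rewrite mulrCA.
  rewrite /y powRM ?(ltW (V0 _)) ?(ltW (t0 _))// mulrA mulfK//.
  by rewrite lt0r_neq0// powR_gt0.
have tQ i : tau i <= K i / V i.
  elim: i => [|i IH].
    rewrite ler_pdivlMr// -(@le_powRP _ q) ?y0// KZp; exact: lexx.
  rewrite -(@le_powRP _ q) ?(ltW (t0 _))// QS -lerBlDr.
  have -> : tau i.+1 `^ q - (1 - 2 `^ (- q)) * tau i.+1 `^ q =
            2 `^ (- q) * tau i.+1 `^ q by ring.
  rewrite ler_wpM2l// le_powR ?(ltW q0) ?(ltW (t0 _))//.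
  exact: le_trans (tS i) IH.
split => // i.
- by rewrite -ler_pdivlMr.
- rewrite -(@le_powRP _ q)// QS.
  apply: (@le_trans _ _ (2 `^ (- q) * (K i / V i) `^ q +
      (1 - 2 `^ (- q)) * (K i / V i) `^ q)); last by rewrite -mulrDl addrC subrK mul1r.
  rewrite lerD2l ler_wpM2l ?(ltW hp)// le_powR ?(ltW q0) ?(ltW (t0 _))//.
  exact: le_trans (tS i) (tQ i).
- rewrite QS lerD2l; apply: (@le_trans _ _ (tau i.+1 `^ q)).
    by rewrite ler_piMl ?powR_ge0// gerBl.
  by rewrite le_powR ?(ltW q0) ?(ltW (t0 _)).
Qed.

(** Here [K / V] becomes the maximum of its half and of the new [tau]; bounding this by the sum
    gives the recursion with exponent 1. *)
Lemma head_max_data : let K := head_max y in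
  [/\ forall i, y i <= K i, forall i, 0 <= K i, forall i, K i <= K i.+1,
      forall i, K i.+1 / V i.+1 <= K i / V i &
      forall i, (K i.+1 / V i.+1) `^ 1 <= 2 `^ (- 1) * (K i / V i) `^ 1 + tau i `^ 1].
Proof.
move=> K.
have KE i : K i.+1 = Num.max (K i) (y i.+1).
  by [].
have K0E : K 0%N = y 0%N.
  by [].
have yK i : y i <= K i by case: i => [|i]; rewrite ?K0E// KE le_max lexx orbT.
have K0 i : 0 <= K i by apply: le_trans (yK i).
have QS i : K i.+1 / V i.+1 = Num.max (K i / V i / 2) (tau i.+1).
  rewrite KE maxr_pMl ?invr_ge0 ?(ltW (V0 _))//; congr (Num.max _ _).
    by rewrite VS invfM mulrCA mulrC.
  by rewrite /y mulfK// lt0r_neq0.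
have Q0 i : 0 <= K i / V i by rewrite divr_ge0// ltW.
have tQ i : tau i <= K i / V i by rewrite ler_pdivlMr//; exact: yK.
have QSle i : K i.+1 / V i.+1 <= K i / V i / 2 + tau i.
  rewrite QS ge_max; apply/andP; split; first by rewrite lerDl ltW.
  by rewrite (le_trans (tS i))// lerDr divr_ge0.
split => // i; first by rewrite KE le_max lexx.
  rewrite QS ge_max; apply/andP; split; last exact: le_trans (tS i) (tQ i).
  by have := Q0 i; lra.
rewrite !powRr1 ?(ltW (t0 _)) ?Q0//; apply: (le_trans (QSle i)).
by rewrite powR_inv1// mulrC.
Qed.

Section theorem.
Variables (p1 th2 : R).
Hypotheses (p10 : 0 < p1) (th20 : 0 < th2).

(** The weights are at least 1 - 2^(-q), the price for passing to the unweighted l^q norm of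
    Hoelder's inequality. *)
Lemma head_norm_envelope q : th2 < p1 -> q^-1 = th2^-1 - p1^-1 ->
  multiplier_envelope p1 th2 ((1 - 2 `^ (- q)) `^ (- q^-1)) tau V (head_norm q y).
Proof.
move=> tp qE n P B B0 hB.
have q0 : 0 < q by rewrite -invr_gt0 qE subr_gt0 ltf_pV2.
have /andP[h0 h1] := @half_pow_lt1 R q q0.
have hp : 0 < 1 - (2 : R) `^ (- q) by rewrite subr_gt0.
apply: (multiplier_pow th20 tp qE) => //; first by rewrite mulr_ge0 ?powR_ge0.
rewrite powRM ?powR_ge0// -powRrM mulNr mulVf ?lt0r_neq0// (powRN _ 1) powRr1 ?(ltW hp)//.
rewrite ler_pdivlMl// mulr_sumr.
have [e0 Pe0|P0] := pickP (fun e : 'I_n => P e); last first.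
  by rewrite big_pred0 ?powR_ge0.
have [M PM Mmax] := @arg_maxnP _ e0 (fun e : 'I_n => P e) val Pe0.
apply: (@le_trans _ _ (head_norm q y M `^ q)); last first.
  by rewrite le_powR ?(ltW q0) ?powR_ge0// hB.
rewrite head_norm_pow//.
apply: (@le_trans _ _ (\sum_(i < n | (i < M.+1)%N) head_weight q i * y i `^ q)).
  apply: (@le_trans _ _ (\sum_(i < n | P i) head_weight q i * y i `^ q)).
    apply: ler_sum => i _; apply: ler_wpM2r; first exact: powR_ge0.
    by have [/andP[]] := head_weight_bounds i q0.
  apply: ler_sum_sub => [i Pi|i _]; first by rewrite ltnS; exact: Mmax.
  have [/andP[h2 h3] _] := head_weight_bounds i q0.
  by rewrite mulr_ge0 ?powR_ge0// (le_trans (ltW h2) h3).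
by rewrite -(@big_ord_widen _ _ _ M.+1 n (fun i => head_weight q i * y i `^ q)).
Qed.

Lemma head_max_envelope : p1 <= th2 ->
  multiplier_envelope p1 th2 1 tau V (head_max y).
Proof.
move=> pt n P B B0 hB; rewrite mul1r; apply: multiplier_sup => // i i_n Pi.
have [yK _ _ _ _] := head_max_data.
by rewrite y0/= (le_trans (yK i))// hB.
Qed.

(** On each block the sequence is the equality case of Hoelder's inequality, normalised in l^p1, and
    [e c] is the l^q norm of [y] there. The weights in [head_norm] are at most 1. *)
Lemma head_norm_attained q : th2 < p1 -> q^-1 = th2^-1 - p1^-1 ->
  multiplier_attained p1 th2 q tau V (head_norm q y).
Proof.
move=> tp qE k n km.
have q0 : 0 < q by rewrite -invr_gt0 qE subr_gt0 ltf_pV2.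
pose X c := \sum_(i < n | k i == c) y i `^ q.
have X0 c : 0 <= X c by apply: sumr_ge0 => i _; rewrite powR_ge0.
have yp i : 0 < y i by rewrite mulr_gt0.
have Xp i : (i < n)%N -> 0 < X (k i).
  move=> i_n; rewrite /X (bigD1 (Ordinal i_n))//= ltr_pwDl ?powR_gt0//.
  by apply: sumr_ge0 => l _; rewrite powR_ge0.
exists (fun c => X c `^ q^-1), (fun i => (y i `^ q / X (k i)) `^ p1^-1); split => //.
- by move=> c; rewrite powR_ge0.
- by move=> i; rewrite powR_ge0.
- move=> m mn; rewrite head_norm_pow//.
  under [leRHS]eq_bigr do rewrite powRKV ?lt0r_neq0//.
  apply: (@le_trans _ _ (\sum_(i < n | (k i < (k m).+1)%N) y i `^ q)); last first.
    rewrite (@sum_fiber _ n (k m).+1 (fun i : 'I_n => (k i < (k m).+1)%N) k)//.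
    apply: ler_sum => c _; apply: ler_sum_sub => [i /andP[]//|i _].
    exact: powR_ge0.
  apply: (@le_trans _ _ (\sum_(i < n | (i < m.+1)%N) y i `^ q)); last first.
    apply: ler_sum_sub => [i|i _]; last exact: powR_ge0.
    by rewrite !ltnS; exact: km.
  rewrite -(@big_ord_widen _ _ _ m.+1 n (fun i => y i `^ q))//.
  apply: ler_sum => i _; rewrite ler_piMl ?powR_ge0//.
  by have [] := head_weight_bounds i q0.
- move=> c.
  have E : \sum_(i < n | k i == c) ((y i `^ q / X (k i)) `^ p1^-1) `^ p1 =
     (X c)^-1 * X c.
    rewrite {2}/X mulr_sumr; apply: eq_bigr => i /eqP ic.
    by rewrite powRKV ?lt0r_neq0 ?divr_ge0 ?powR_ge0// ic mulrC.
  rewrite E; have [->|Xn] := eqVneq (X c) 0; first by rewrite mulr0.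
  by rewrite mulVf.
- move=> c; have [Xc|Xn] := eqVneq (X c) 0.
    rewrite Xc powR0 ?invr_neq0 ?lt0r_neq0// powR0 ?lt0r_neq0//.
    by apply: sumr_ge0 => i _; rewrite powR_ge0.
  have Xcp : 0 < X c by rewrite lt0r Xn X0.
  have qth : q / th2 = 1 + q / p1.
    by rewrite -(mulfV (lt0r_neq0 q0)) qE -mulrDr subrK.
  have E : \sum_(i < n | k i == c) (tau i * V i * (y i `^ q / X (k i)) `^ p1^-1) `^ th2 =
     X c `^ (- (th2 / p1)) * X c.
    rewrite {2}/X mulr_sumr; apply: eq_bigr => i /eqP ic.
    rewrite ic -/(y i) powRM ?powR_ge0// -powRrM powR_div ?powR_ge0//.
    rewrite -powRrM -powRN mulrA -powRD_pos//.
    have -> : th2 + q * (p1^-1 * th2) = q.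
      rewrite (mulrC p1^-1) mulrCA; have -> : q / p1 = q / th2 - 1 by rewrite qth addrC addKr.
      by rewrite mulrBr mulr1 addrC subrK mulrCA mulfV ?mulr1// lt0r_neq0.
    by rewrite mulrC [p1^-1 * _]mulrC.
  rewrite E -{3}(powRr1 (X0 c)) -powRD_pos// -powRrM.
  rewrite le_eqVlt; apply/orP; left; apply/eqP; congr (_ `^ _).
  by rewrite mulrC qE mulrBr mulfV ?lt0r_neq0// addrC.
Qed.

(** The extremal sequence is the unit mass at an index of the block where [y] is largest; an empty
    block gets [e c = 0]. *)
Lemma head_max_attained : p1 <= th2 ->
  multiplier_attained p1 th2 1 tau V (head_max y).
Proof.
move=> pt k n km.
have [b hb] : exists b : nat -> nat, forall c, 
    (exists2 i, (i < n)%N & k i = c) -> [/\ (b c < n)%N, k (b c) = c &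
     forall i, (i < n)%N -> k i = c -> y i <= y (b c)].
  have /choice[b hb] : forall c, exists l : nat, (exists2 i, (i < n)%N & k i = c) ->
     [/\ (l < n)%N, k l = c & forall i, (i < n)%N -> k i = c -> y i <= y l].
    move=> c; have [[i i_n ic]|h] := pselect (exists2 i, (i < n)%N & k i = c); last first.
      by exists 0%N.
    have ic' : k (Ordinal i_n) == c by rewrite /= ic.
    have [M /eqP PM Mmax] := @arg_maxP _ _ _ (Ordinal i_n) (fun e : 'I_n => k e == c)
      (fun e : 'I_n => y e) ic'.
    exists M => _; split => // l ln lc; apply: (Mmax (Ordinal ln)).
    by rewrite /= lc.
  by exists b.
pose has c := [exists i : 'I_n, k i == c].
have hasP c : has c -> exists2 i, (i < n)%N & k i = c.
  by move=> /existsP[i /eqP ic]; exists i.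
exists (fun c => if has c then y (b c) else 0), (fun i => (b (k i) == i)%:R); split => //.
- by move=> c; case: ifP.
- move=> m mn; rewrite powRr1; last by have [_ K0 _ _ _] := head_max_data.
  have S0 (c : nat) : 0 <= (if has c then y (b c) else 0) by case: ifP.
  under [leRHS]eq_bigr => c _ do rewrite (powRr1 (S0 c)).
  apply: head_max_le => i im; have i_n : (i < n)%N by exact: leq_ltn_trans mn.
  have kim : (k i < (k m).+1)%N by rewrite ltnS km.
  rewrite (bigD1 (Ordinal kim))//= ler_wpDr ?sumr_ge0//.
  have hi : has (k i) by apply/existsP; exists (Ordinal i_n).
  by rewrite hi; have [_ _] := hb _ (hasP _ hi); apply.
- move=> c; have [hc|hc] := boolP (has c); last first.
    rewrite big1 ?ler01// => i ic; case/existsP: hc; by exists i.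
  have [bn kb _] := hb _ (hasP _ hc).
  rewrite (bigD1 (Ordinal bn)) /= ?kb// eqxx powR1 big1 ?addr0// => i /andP[/eqP ic].
  rewrite ic -val_eqE /= eq_sym => /negbTE ->.
  by rewrite powR0 ?lt0r_neq0.
- move=> c; have S0 (i : 'I_n) : 0 <= (tau i * V i * (b (k i) == i)%:R) `^ th2.
    by rewrite powR_ge0.
  case: ifP => [hc|_]; last by rewrite powR0 ?sumr_ge0// lt0r_neq0.
  have [bn kb _] := hb _ (hasP _ hc).
  by rewrite (bigD1 (Ordinal bn)) /= ?kb// eqxx mulr1 lerDl sumr_ge0.
Qed.

End theorem.
End head.
End Conversions.

(** * Summation by parts up to infinity and the combined lower bounds *)

Section DiscreteBounds.
Context {R : realType}.
Implicit Types (p th q qq r s t x B C : R) (V w tau a K W T : nat -> R)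
  (P S : pred nat) (k j : nat -> nat).

Lemma jump_le r w i : jump r w i <= w i `^ (- r).
Proof. by rewrite /jump gerBl powR_ge0. Qed.

(** [z i] is the mass that d(-w^(-r)) has from [i] on. Summing by parts and continuing up to [N]
    with [K] frozen at its last value leaves the boundary term z_N^(s/r) K^s, which tends to 0. *)
Lemma zeta_tail_sum r s w K omega B n : 0 < r -> r <= s ->
  (forall i, 0 < w i) -> (forall i, w i <= w i.+1) ->
  (forall i, 0 <= K i) -> (forall i, K i <= K i.+1) ->
  (forall i, omega <= w i `^ (- r)) ->
  (forall e, 0 < e -> exists N, forall i, (N <= i)%N -> w i `^ (- r) - omega <= e) ->
  (forall N, \sum_(i < N) (w i `^ (- r) - omega) `^ (s / r - 1) *
     (K i `^ s * jump r w i) <= B) ->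
  \sum_(m < n) (w m `^ (- r) - omega) `^ (s / r) * Kincr s K m <= s / r * B.
Proof.
move=> r0 rs w0 wS K0 KS om zlim hB.
have s0 : 0 < s by exact: lt_le_trans rs.
have sr1 : 1 <= s / r by rewrite ler_pdivlMr// mul1r.
have sr0 : 0 < s / r by exact: lt_le_trans sr1.
pose z i := w i `^ (- r) - omega.
have z0 i : 0 <= z i by rewrite subr_ge0.
have zS i : z i - z i.+1 = jump r w i by rewrite /z /jump opprB addrA subrK.
have J0 i : 0 <= jump r w i by exact: jump_ge0 (ltW r0) w0 wS.
have Km i l : (i <= l)%N -> K i <= K l by apply: (homo_leq (@lexx _ R) (@le_trans _ R)).
have step i : (z i `^ (s / r) - z i.+1 `^ (s / r)) * K i `^ s <=
    s / r * (z i `^ (s / r - 1) * (K i `^ s * jump r w i)).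
  have := powRB_le sr1 (z0 i.+1) (z0 i); rewrite zS => h.
  apply: (le_trans (ler_wpM2r (powR_ge0 _ _) h)).
  by rewrite le_eqVlt; apply/orP; left; apply/eqP; ring.
case: n => [|n]; first by rewrite big_ord0 mulr_ge0 ?(ltW sr0)//; have := hB 0%N; rewrite big_ord0.
have abel N : \sum_(m < N.+1) z m `^ (s / r) * Kincr s K m =
   \sum_(i < N) (z i `^ (s / r) - z i.+1 `^ (s / r)) * K i `^ s + z N `^ (s / r) * K N `^ s.
  elim: N => [|N IH]; first by rewrite big_ord1 big_ord0 add0r /Kincr subr0.
  rewrite big_ord_recr IH big_ord_recr /= /Kincr.
  move: (z N `^ _) (z N.+1 `^ _) (K N `^ _) (K N.+1 `^ _) (\sum_(i < N) _) => *; ring.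
have bound N : (n <= N)%N -> \sum_(m < n.+1) z m `^ (s / r) * Kincr s K m <=
   s / r * B + z N `^ (s / r) * K n `^ s.
  move=> nN; rewrite abel.
  have E : z n `^ (s / r) * K n `^ s <=
    \sum_(n <= i < N) (z i `^ (s / r) - z i.+1 `^ (s / r)) * K n `^ s + z N `^ (s / r) * K n `^ s.
    rewrite -mulr_suml -mulrDl; apply: ler_wpM2r; first exact: powR_ge0.
    under eq_bigr do rewrite -opprB.
    by rewrite sumrN (telescope_sumr (fun i => z i `^ (s / r)))// opprB subrK.
  apply: (le_trans (lerD (lexx _) E)); rewrite addrA lerD2r.
  apply: (@le_trans _ _ (s / r * \sum_(i < N) z i `^ (s / r - 1) * (K i `^ s * jump r w i))).
    rewrite mulr_sumr -(big_mkord xpredT (fun i => (z i `^ (s / r) - z i.+1 `^ (s / r)) * K i `^ s)).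
    rewrite -(big_mkord xpredT (fun i => s / r * (z i `^ (s / r - 1) * (K i `^ s * jump r w i)))).
    rewrite (@big_cat_nat _ _ _ n 0 N _ _ (leq0n n) nN)/=; apply: lerD.
      by apply: ler_sum => i _; exact: step.
    rewrite big_nat_cond [leRHS]big_nat_cond; apply: ler_sum => i /andP[/andP[ni _] _].
    apply: le_trans (step i); apply: ler_wpM2l.
      rewrite subr_ge0 le_powR ?(ltW sr0)// -subr_ge0 zS; exact: J0.
    by apply: le_powR; rewrite ?(ltW s0)//; exact: Km.
  by rewrite ler_pM2l.
apply/ler_addgt0Pr => e e0.
have Kn0 : 0 < K n `^ s + 1 by rewrite ltr_wpDl ?powR_ge0.
have ek : 0 < e / (K n `^ s + 1) by rewrite divr_gt0.
have [N hN] := zlim ((e / (K n `^ s + 1)) `^ (s / r)^-1) (powR_gt0 _ ek).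
apply: (le_trans (bound (maxn N n) (leq_maxr _ _))); rewrite lerD2l.
have h : z (maxn N n) `^ (s / r) <= e / (K n `^ s + 1).
  rewrite -[leRHS](powRKV (lt0r_neq0 sr0)) ?(ltW ek)//.
  by apply: le_powR; rewrite ?(ltW sr0)//; exact: hN (leq_maxl _ _).
apply: (le_trans (ler_wpM2r (powR_ge0 _ _) h)).
rewrite -mulrA ler_piMr ?(ltW e0)// ler_pdivrMl// mulr1 lerDl ler01//.
Qed.

(** w^(-s) is the power s/r of the tail mass plus the limit [omega]: the sum over jumps controls the
    former, the bound on omega^(1/r) K the latter. *)
Lemma zeta_sum r s : 0 < r -> r <= s -> exists2 C, 0 < C & forall w K omega B n,
  (forall i, 0 < w i) -> (forall i, w i <= w i.+1) ->
  (forall i, 0 <= K i) -> (forall i, K i <= K i.+1) -> 0 <= omega ->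
  (forall i, omega <= w i `^ (- r)) ->
  (forall e, 0 < e -> exists N, forall i, (N <= i)%N -> w i `^ (- r) - omega <= e) ->
  0 <= B ->
  (forall N, \sum_(i < N) (w i `^ (- r) - omega) `^ (s / r - 1) *
     (K i `^ s * jump r w i) <= B `^ s) ->
  (forall i, omega `^ r^-1 * K i <= B) ->
  \sum_(m < n) w m `^ (- s) * Kincr s K m <= C * B `^ s.
Proof.
move=> r0 rs; have s0 : 0 < s by exact: lt_le_trans rs.
have sr0 : 0 < s / r by rewrite divr_gt0.
have [C C0 hC] := powR_quasi sr0.
exists (C * (s / r + 1)) => [|w K omega B n w0 wS K0 KS o0 om zlim B0 hB hK].
  by rewrite mulr_gt0// addr_gt0.
have D0 m : 0 <= Kincr s K m by exact: Kincr_ge0.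
have z0 i : 0 <= w i `^ (- r) - omega by rewrite subr_ge0.
apply: (@le_trans _ _ (\sum_(m < n) C * ((w m `^ (- r) - omega) `^ (s / r) +
   omega `^ (s / r)) * Kincr s K m)).
  apply: ler_sum => m _; apply: ler_wpM2r => //.
  apply: le_trans (hC _ _ (z0 m) o0); rewrite subrK -powRrM mulNr.
  by rewrite mulrCA mulfV ?mulr1// lt0r_neq0.
under eq_bigr do rewrite -mulrA mulrDl.
rewrite -mulr_sumr big_split /= -mulrA; apply: ler_wpM2l; first exact: ltW.
rewrite mulrDl mul1r; apply: lerD; first exact: zeta_tail_sum.
rewrite -mulr_sumr; case: n => [|n]; first by rewrite big_ord0 mulr0 powR_ge0.
rewrite Kincr_sum// mulrC (mulrC s) powRrM.
by rewrite mulrC -powRM ?powR_ge0// le_powR ?(ltW s0) ?mulr_ge0 ?powR_ge0.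
Qed.

Section theorem.
Variables (p1 p2 th1 th2 : R).
Hypotheses (p20 : 0 < p2) (p21 : p2 < p1) (p2th1 : p2 < th1) (p2th2 : p2 < th2).
Let r := (p2^-1 - th1^-1)^-1.
Let p10 : 0 < p1. Proof. exact: lt_trans p21. Qed.
Let th10 : 0 < th1. Proof. exact: lt_trans p2th1. Qed.
Let th20 : 0 < th2. Proof. exact: lt_trans p2th2. Qed.
Let r0 : 0 < r. Proof. by rewrite invr_gt0 subr_gt0 ltf_pV2//; exact: (lt_trans p20). Qed.
Let rE : r^-1 = p2^-1 - th1^-1. Proof. by rewrite /r invrK. Qed.

(** Induction over the cells: a large new term is bounded through [lower_K], a large [tau] through
    [lower_H], and in the third case the quantity decreases. *)
Lemma lower_sup qq : 0 < qq -> exists2 C, 0 < C & forall V w tau K B m,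
  decreasing_data V w tau K qq -> multiplier_attained p1 th2 qq tau V K ->
  0 <= B -> lower_hyp p1 p2 th1 th2 V w tau B ->
  K m / V m * (Hsum r V w m + (V m / w m) `^ r) `^ r^-1 <= C * B.
Proof.
move=> q0; have ri : 0 < r^-1 by rewrite invr_gt0.
have [kappa [eps [eta [k0 e0 /andP[eta0 eta1] tri]]]] := doubling_trichotomy q0 r0.
have [C1 C10 h1] := lower_H p20 p21 p2th1 p2th2.
have [C2 C20 h2] := powR_quasi ri.
pose L := eps^-1 + 1; have L0 : 0 < L by rewrite addr_gt0 ?invr_gt0.
pose C0 := L `^ r^-1 + kappa * C1.
have C00 : 0 < C0 by rewrite addr_gt0 ?powR_gt0 ?mulr_gt0.
exists (C2 * (C0 + 1)) => [|V w tau K B m dat att B0 hyp].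
  by rewrite mulr_gt0// addr_gt0.
have hK i := lower_K p20 p21 p2th1 p2th2 i q0 dat att B0 hyp.
have [V0 VS [w0 wS] [t0 tS] [K0 KS QS QQ]] := dat.
have J0 i : 0 <= jump r w i by exact: jump_ge0 (ltW r0) w0 wS.
pose H i := Hsum r V w i; pose c i := V i `^ r * jump r w i.
have c0 i : 0 <= c i by rewrite mulr_ge0 ?powR_ge0.
have H0 i : 0 <= H i by apply: sumr_ge0 => l _; exact: c0.
have HS i : H i.+1 = H i + c i by rewrite /H /Hsum big_ord_recr.
have Q0 i : 0 <= K i / V i by rewrite divr_ge0// ltW.
have hH i : tau i * H i.+1 `^ r^-1 <= C1 * B by exact: h1.
have QV i : K i / V i * (V i / w i) = K i / w i by rewrite mulrA divfK// lt0r_neq0.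
have main i : K i / V i * H i `^ r^-1 <= C0 * B.
  elim: i => [|i IH].
    rewrite /H /Hsum big_ord0 powR0 ?lt0r_neq0// mulr0 mulr_ge0//.
    exact: ltW.
  rewrite HS; case: (tri _ _ _ _ _ (Q0 i) (Q0 i.+1) (ltW (t0 i)) (H0 i) (c0 i) (QQ i)).
  - move=> hc; have HL : H i + c i <= L * c i by rewrite /L mulrDl mul1r lerD2r ler_pdivlMl.
    apply: (@le_trans _ _ (K i / V i * (L * (V i / w i) `^ r) `^ r^-1)).
      apply: ler_pM => //; first exact: powR_ge0.
      apply: le_powR; rewrite ?(ltW ri) ?addr_ge0//; apply: (le_trans HL).
      rewrite ler_wpM2l ?(ltW L0)// powR_div ?(ltW (V0 _)) ?(ltW (w0 _))// -powRN.
      by rewrite ler_wpM2l ?powR_ge0// jump_le.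
    have Vw0 : 0 <= V i / w i by rewrite divr_ge0// ltW.
    rewrite (powRM _ (ltW L0) (powR_ge0 _ _)) powRVK ?lt0r_neq0//.
    rewrite mulrCA QV mulrDl ler_wpDr ?mulr_ge0 ?(ltW k0) ?(ltW C10)//.
    by rewrite ler_wpM2l ?powR_ge0// ler_pdivrMr.
  - move=> hQ; apply: (@le_trans _ _ (kappa * tau i * (H i + c i) `^ r^-1)).
      by apply: ler_wpM2r; rewrite ?powR_ge0//; exact: le_trans (QS i) hQ.
    rewrite -HS -mulrA mulrDl ler_wpDl ?mulr_ge0 ?powR_ge0//.
    by rewrite -mulrA ler_wpM2l ?(ltW k0)//; exact: hH.
  - move=> [_ h]; apply: (le_trans h); apply: le_trans IH.
    by apply: ler_piMl; [exact: (mulr_ge0 (Q0 i) (powR_ge0 _ _)) | exact: ltW].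
have W0 : 0 <= (V m / w m) `^ r by rewrite powR_ge0.
apply: (@le_trans _ _ (K m / V m * (C2 * (H m `^ r^-1 + ((V m / w m) `^ r) `^ r^-1)))).
  by apply: ler_wpM2l => //; exact: h2.
rewrite powRVK ?lt0r_neq0 ?divr_ge0 ?(ltW (V0 _)) ?(ltW (w0 _))//.
rewrite mulrCA -mulrA ler_wpM2l ?(ltW C20)// mulrDr mulrDl mul1r; apply: lerD.
  exact: main.
by rewrite QV ler_pdivrMr.
Qed.

(** [trichotomy_sum] at each cell: the differences of [Y] telescope and [Y 0 = 0]. By [Qg], what
    remains are the sums of [lower_S1] and [lower_S2]. *)
Lemma lower_sum qq s : 0 < qq -> th2 < th1 -> s^-1 = th2^-1 - th1^-1 ->
  exists2 C, 0 < C & forall V w tau K B n,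
  decreasing_data V w tau K qq -> multiplier_attained p1 th2 qq tau V K ->
  0 <= B -> lower_hyp p1 p2 th1 th2 V w tau B ->
  \sum_(m < n) (K m / V m) `^ s * (V m `^ r * jump r w m *
    (Hsum r V w m + (V m / w m) `^ r) `^ (s / r - 1)) <= C * B `^ s.
Proof.
move=> q0 th21 sE.
have s0 : 0 < s by rewrite -invr_gt0 sE subr_gt0 ltf_pV2.
have rs : r < s.
  by rewrite -ltf_pV2 ?posrE// rE sE ltrD2r ltf_pV2.
have sr0 : 0 < s / r by rewrite divr_gt0.
have u0 : 0 < s / r - 1 by rewrite subr_gt0 ltr_pdivlMr// mul1r.
have [C [D [C0 D0 tri]]] := trichotomy_sum q0 r0 (ltW rs).
have [C1 C10 h1] := lower_S1 p20 p21 p2th1 p2th2 th21 sE.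
have [C2 C20 h2] := lower_S2 p20 p21 p2th1 p2th2 q0 th21 sE.
have [C3 C30 h3] := powR_quasi u0.
exists (C3 * (C * (C1 + C2) + C2)) => [|V w tau K B n dat att B0 hyp].
  by rewrite mulr_gt0// addr_gt0// mulr_gt0// addr_gt0.
have hS2 := h2 V w tau K B n dat att B0 hyp.
have [V0 VS [w0 wS] [t0 tS] [K0 KS QS QQ]] := dat.
have hS1 := h1 V w tau B n V0 w0 wS t0 tS B0 hyp.
have J0 i : 0 <= jump r w i by exact: jump_ge0 (ltW r0) w0 wS.
pose H i := Hsum r V w i; pose c i := V i `^ r * jump r w i.
have c0 i : 0 <= c i by rewrite mulr_ge0 ?powR_ge0.
have H0 i : 0 <= H i by apply: sumr_ge0 => l _; exact: c0.
have HS i : H i.+1 = H i + c i by rewrite /H /Hsum big_ord_recr.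
pose Q i := K i / V i.
have Q0 i : 0 <= Q i by rewrite divr_ge0// ltW.
pose u := s / r - 1; pose g i := (V i / w i) `^ r `^ u.
have cg i : c i `^ u <= g i.
  apply: le_powR; rewrite ?(ltW u0)// powR_div ?(ltW (V0 _)) ?(ltW (w0 _))// -powRN.
  by rewrite ler_wpM2l ?powR_ge0// jump_le.
have ru : r * u = s - r by rewrite /u mulrBr mulr1 mulrCA mulfV ?mulr1// lt0r_neq0.
have Qg i : Q i `^ s * (c i * g i) = K i `^ s * (w i `^ (- (s - r)) * jump r w i).
  rewrite /g -powRrM ru powR_div ?(ltW (V0 _)) ?(ltW (w0 _))// -powRN.
  rewrite /Q powR_div ?(ltW (V0 _))// /c.
  have -> : V i `^ s = V i `^ r * V i `^ (s - r) by rewrite -powRD_pos// addrC subrK.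
  have n1 : V i `^ r != 0 by rewrite lt0r_neq0// powR_gt0.
  have n2 : V i `^ (s - r) != 0 by rewrite lt0r_neq0// powR_gt0.
  move: (V i `^ r) (V i `^ (s - r)) n1 n2 (w i `^ _) (jump r w i) (K i `^ s) => x y x0 y0 *.
  by field; rewrite x0 y0.
pose Y i := (Q i * H i `^ r^-1) `^ s.
have step i : Q i `^ s * (c i * H i `^ u) <=
   C * (tau i `^ s * (c i * H i.+1 `^ u) + Q i `^ s * (c i * g i)) + D * (Y i - Y i.+1).
  rewrite /Y HS; apply: (tri (Q i) (Q i.+1) (tau i) (H i) (c i) (g i) _ (QS i) (QQ i) (cg i)).
  by split=> //; exact: ltW.
have T : \sum_(i < n) Q i `^ s * (c i * H i `^ u) <= C * (C1 + C2) * B `^ s.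
  apply: (@le_trans _ _ (\sum_(i < n) (C * (tau i `^ s * (c i * H i.+1 `^ u) +
      Q i `^ s * (c i * g i)) + D * (Y i - Y i.+1)))); first exact: ler_sum.
  rewrite big_split /= -!mulr_sumr big_split /= -[leRHS]addr0; apply: lerD.
    rewrite -mulrA ler_wpM2l ?(ltW C0)// mulrDl; apply: lerD; first exact: hS1.
    by under eq_bigr do rewrite Qg.
  rewrite pmulr_rle0//; under eq_bigr do rewrite -opprB.
  rewrite sumrN -(big_mkord xpredT (fun i => Y i.+1 - Y i)) (telescope_sumr Y)// opprB.
  have -> : Y 0%N = 0.
    have rn : r^-1 != 0 by rewrite invr_neq0// lt0r_neq0.
    by rewrite /Y /H /Hsum big_ord0 (powR0 rn) mulr0 powR0// lt0r_neq0.
  by rewrite sub0r oppr_le0 powR_ge0.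
apply: (@le_trans _ _ (\sum_(m < n) C3 * (Q m `^ s * (c m * H m `^ u) +
    Q m `^ s * (c m * g m)))).
  apply: ler_sum => m _.
  have -> : C3 * (Q m `^ s * (c m * H m `^ u) + Q m `^ s * (c m * g m)) =
            Q m `^ s * (c m * (C3 * (H m `^ u + g m))) by ring.
  apply: ler_wpM2l; first exact: powR_ge0.
  apply: ler_wpM2l; first exact: c0.
  by apply: h3 => //; exact: powR_ge0.
rewrite -mulr_sumr -mulrA ler_wpM2l ?(ltW C30)// big_split /= mulrDl; apply: lerD => //.
by under eq_bigr do rewrite Qg.
Qed.

End theorem.
End DiscreteBounds.

(** * Integrals over finitely many pieces and weights on the half-line *)

Local Open Scope classical_set_scope.
Local Open Scope ring_scope.

Local Open Scope ereal_scope.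

Section Pieces.
Context d (T : measurableType d) (R : realType) (mu : {measure set T -> \bar R}).
Implicit Types (D : set T) (f g : T -> \bar R) (B : \bar R).

(* no measurability: the integral of a nonnegative function is a supremum over
   simple functions *)
Lemma le_integral_nonneg D f g : (forall x, D x -> 0 <= f x) ->
  (forall x, D x -> f x <= g x) -> \int[mu]_(x in D) f x <= \int[mu]_(x in D) g x.
Proof.
move=> f0 fg; have g0 x : D x -> 0 <= g x by move=> Dx; exact: le_trans (f0 _ Dx) (fg _ Dx).
rewrite !ge0_integralE//; apply: ereal_sup_le => _ [h hf <-].
exists h => // x.
apply: (le_trans (hf x)); rewrite /patch; case: ifP => // Dx.
by apply: fg; rewrite inE in Dx.
Qed.

(** Hands the bound over to the simple functions below [f], to which additivity and monotone
    convergence apply. *)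
Lemma integral_le_simple D f B : measurable D -> (forall x, D x -> 0 <= f x) ->
  (forall h : {nnsfun T >-> R}, (forall x, D x -> (h x)%:E <= f x) ->
     \int[mu]_(x in D) (h x)%:E <= B) -> \int[mu]_(x in D) f x <= B.
Proof.
move=> mD f0 hB; rewrite ge0_integralE//; apply: ge_ereal_sup => _ [h hf <-].
rewrite -integralT_nnsfun.
have -> : \int[mu]_x (h x)%:E = \int[mu]_(x in D) (h x)%:E.
  rewrite [RHS]integral_mkcond; apply: eq_integral => x _; rewrite /patch; case: ifP => // Dx.
  have := hf x; rewrite /patch Dx => hx; apply/eqP; rewrite eq_le [X in X && _]hx.
  have -> : point = 0 :> \bar R by [].
  by rewrite lee_fin; exact: fun_ge0.
by apply: hB => x Dx; have := hf x; rewrite /patch mem_set.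
Qed.

(** Monotone convergence along the sets is applied to a simple function below [f], not to [f]. *)
Lemma integral_le_exhaust (F : nat -> set T) f B : (forall i, measurable (F i)) ->
  nondecreasing_seq F -> (forall x, (\bigcup_i F i) x -> 0 <= f x) ->
  (forall i (h : {nnsfun T >-> R}), (forall x, F i x -> (h x)%:E <= f x) ->
     \int[mu]_(x in F i) (h x)%:E <= B) -> \int[mu]_(x in \bigcup_i F i) f x <= B.
Proof.
move=> mF ndF f0 hB; apply: integral_le_simple => //; first exact: bigcup_measurable.
move=> h hf.
have mh D : measurable_fun D (fun x => (h x)%:E).
  by apply/measurable_EFinP; exact: measurable_funTS.
have h0 x : (\bigcup_i F i) x -> 0 <= (h x)%:E by rewrite lee_fin.
have := @ge0_nondecreasing_set_cvg_integral _ _ _ F (fun x => (h x)%:E) mu ndF mF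
   (fun i => mh (F i)) (fun i x Fx => h0 x (ex_intro2 _ _ i Logic.I Fx)).
move=> /cvg_lim <-//; apply: lime_le.
  apply: ereal_nondecreasing_is_cvgn.
  exact: (@ge0_nondecreasing_set_nondecreasing_integral _ _ _ F _ mu ndF mF
    (fun i => mh (F i)) (fun i x Fx => h0 x (ex_intro2 _ _ i Logic.I Fx))).
apply: nearW => i; apply: hB => x Fx; apply: hf; exists i => //.
Qed.

Lemma integral_le_finite (A : nat -> set T) N f g (c : nat -> \bar R) :
  (forall i, measurable (A i)) -> trivIset setT A ->
  (forall i, (i < N)%N -> measurable_fun (A i) g) ->
  (forall i, 0 <= c i) -> (forall i x, A i x -> 0 <= g x) ->
  (forall i x, (i < N)%N -> A i x -> 0 <= f x) ->
  (forall i x, (i < N)%N -> A i x -> f x <= c i * g x) ->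
  \int[mu]_(x in \big[setU/set0]_(i < N) A i) f x <=
  \sum_(i < N) c i * \int[mu]_(x in A i) g x.
Proof.
move=> mA tA mg c0 g0 f0 fg.
have DE x : (\big[setU/set0]_(i < N) A i) x -> exists2 i, (i < N)%N & A i x.
  by rewrite -bigcup_mkord => -[i /= iN Ai]; exists i.
have AD i x : (i < N)%N -> A i x -> (\big[setU/set0]_(i < N) A i) x.
  by move=> iN Ai; rewrite -bigcup_mkord; exists i.
apply: integral_le_simple => [|x /DE[i iN Ai]|h hf].
- by apply: bigsetU_measurable => i _.
- exact: f0 iN Ai.
have mh D : measurable_fun D (fun x => (h x)%:E).
  by apply/measurable_EFinP; exact: measurable_funTS.
rewrite -(big_mkord xpredT A) -(big_mkord xpredT (fun i => c i * \int[mu]_(x in A i) g x)).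
rewrite ge0_integral_bigsetU//=; last first.
- by move=> x _; rewrite lee_fin.
- exact: sub_trivIset tA.
- exact: iota_uniq.
rewrite big_mkord [leRHS]big_mkord; apply: lee_sum => i _.
rewrite -ge0_integralZl//; [|exact: mg|by move=> x; exact: g0].
apply: le_integral_nonneg => x Ai; first by rewrite lee_fin.
by apply: (le_trans (hf x (AD _ _ (ltn_ord i) Ai))); exact: fg.
Qed.

Lemma integral_ge_finite D (A : nat -> set T) N f g (c : nat -> \bar R) :
  measurable D -> (forall i, measurable (A i)) -> trivIset setT A ->
  (forall i, (i < N)%N -> A i `<=` D) ->
  (forall i, (i < N)%N -> measurable_fun (A i) g) ->
  (forall i, 0 <= c i) -> (forall i x, A i x -> 0 <= g x) ->
  (forall x, D x -> 0 <= f x) ->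
  (forall i x, (i < N)%N -> A i x -> c i * g x <= f x) ->
  \sum_(i < N) c i * \int[mu]_(x in A i) g x <= \int[mu]_(x in D) f x.
Proof.
move=> mD mA tA AD mg c0 g0 f0 fg.
pose G x := \sum_(i < N) c i * (g \_ (A i)) x.
have mG i : (i < N)%N -> measurable_fun D (fun x => c i * (g \_ (A i)) x).
  move=> iN; apply: emeasurable_funM; first exact: measurable_cst.
  apply/(@measurable_restrict _ _ _ _ (A i) D) => //.
  by rewrite setIidr; [exact: mg|exact: AD].
have G0 i x : 0 <= c i * (g \_ (A i)) x.
  rewrite mule_ge0// /patch; case: ifP => // /set_mem; exact: g0.
apply: (@le_trans _ _ (\int[mu]_(x in D) G x)).
  rewrite /G ge0_integral_sum//=; last by move=> i; exact: mG.
  apply: lee_sum => i _; rewrite ge0_integralZl//.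
  - rewrite -integral_mkcondr setIidr//; exact: AD.
  - apply/(@measurable_restrict _ _ _ _ (A i) D) => //.
    by rewrite setIidr; [exact: mg|exact: AD].
  - by move=> x _; rewrite /patch; case: ifP => // /set_mem; exact: g0.
apply: le_integral_nonneg => x Dx; first by apply: sume_ge0.
have [[i iN Ai]|nA] := pselect (exists2 i, (i < N)%N & A i x); last first.
  rewrite /G big1 ?f0// => i _; rewrite /patch ifN ?mule0//.
  by apply/negP => /set_mem Ai; apply: nA; exists i.
rewrite /G (bigD1 (Ordinal iN))//= big1 ?adde0.
  by rewrite /patch mem_set//; exact: fg.
move=> j ji; rewrite /patch ifN ?mule0//; apply/negP => /set_mem Aj.
move/eqP: ji; apply; apply/val_inj => /=.
by apply: (tA j i) => //; exists x.
Qed.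

End Pieces.

(** * Integrals of powers of a weight over intervals *)

Section LebesgueLine.
Context {R : realType}.
Notation leb := (@completed_lebesgue_measure R).
Implicit Types (w : R -> \bar R) (th r t a b e : R).

Lemma lnormE d (T : measurableType d) (mu : {measure set T -> \bar R}) (p : R)
    (A : set T) (f : T -> \bar R) : (0 < p)%R ->
  lnorm mu p%:E A f = (\int[mu]_(x in A) (`|f x| `^ p)) `^ p^-1.
Proof.
move=> p0; rewrite /lnorm unlock; congr (_ `^ _).
rewrite [RHS]integral_mkcond; apply: eq_integral => x _; rewrite /patch.
case: ifP => // _; have -> : point = 0 :> \bar R by [].
by rewrite abse0 poweR0r// lt0r_neq0.
Qed.

Lemma measurable_realL_itv (i : interval R) : measurable ([set` i] : set (realL R)).
Proof. by apply: sub_caratheodory; exact: measurable_itv. Qed.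

Lemma completed_lebesgue_set1 a : leb [set a] = 0.
Proof. exact: lebesgue_measure_set1. Qed.

Section weight.
Variables (w : R -> \bar R) (th : R).
Hypothesis mw : measurable_fun (`]0%R, +oo[ : set (realL R)) (w : realL R -> \bar R).
Hypothesis th0 : (0 < th)%R.

Definition wpow (t : realL R) : \bar R := `|w t| `^ th.

Lemma wpow_ge0 t : 0 <= wpow t. Proof. exact: poweR_ge0. Qed.

Lemma measurable_wpow (D : set (realL R)) : measurable D -> D `<=` `]0%R, +oo[ ->
  measurable_fun D wpow.
Proof.
move=> mD D0; apply: (measurable_funS (measurable_realL_itv `]0%R, +oo[) D0).
apply: (measurableT_comp (measurable_poweR th)).
exact: (measurableT_comp (@abse_measurable R setT)).
Qed.

Let mI := measurable_realL_itv.

Lemma wpow_setU (A B : set (realL R)) : measurable A -> measurable B ->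
  A `<=` `]0%R, +oo[ -> B `<=` `]0%R, +oo[ -> (forall x, A x -> ~ B x) ->
  \int[leb]_(x in A `|` B) wpow x = \int[leb]_(x in A) wpow x + \int[leb]_(x in B) wpow x.
Proof.
move=> mA mB A0 B0 AB; apply: ge0_integral_setU => //.
- apply: measurable_wpow; first exact: measurableU.
  by move=> x [/A0|/B0].
- by move=> *; exact: wpow_ge0.
- by apply/eqP; rewrite predeqE => x; split => // -[/AB].
Qed.

Lemma wpow_close c : (0 < c)%R ->
  \int[leb]_(x in `]0%R, c]) wpow x = \int[leb]_(x in `]0%R, c[) wpow x.
Proof.
move=> c0; have -> : `]0%R, c]%classic = `]0%R, c[ `|` [set c].
  by rewrite setUitv1// bnd_simp.
have mc : measurable ([set c] : set (realL R)) by rewrite -set_itv1; exact: mI.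
have c1 : [set c] `<=` `]0%R, +oo[ by move=> x ->; rewrite /= in_itv/= c0.
rewrite wpow_setU//; first last.
- by move=> x /=; rewrite in_itv/= => /andP[_ + xc]; rewrite xc ltxx.
- by move=> x /=; rewrite !in_itv/= => /andP[->].
rewrite [X in _ + X](_ : _ = 0) ?adde0//.
apply: null_set_integral => //; last exact: completed_lebesgue_set1.
exact: measurable_wpow.
Qed.

Lemma wpow_head_split a b : (0 < a)%R -> (a <= b)%R ->
  \int[leb]_(x in `]0%R, b[) wpow x =
  \int[leb]_(x in `]0%R, a[) wpow x + \int[leb]_(x in `]a, b]) wpow x.
Proof.
move=> a0 ab; have b0 : (0 < b)%R by exact: lt_le_trans ab.
rewrite -wpow_close// -(wpow_close a0).
have -> : `]0%R, b]%classic = `]0%R, a] `|` `]a, b].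
  by rewrite -itv_bndbnd_setU// bnd_simp// ltW.
apply: wpow_setU; try exact: mI.
- by move=> x /=; rewrite !in_itv/= => /andP[->].
- by move=> x /=; rewrite !in_itv/= andbT => /andP[/(lt_trans a0)].
- by move=> x /=; rewrite !in_itv/= => /andP[_ xa] /andP[]; rewrite ltNge xa.
Qed.

Lemma wpow_tail_split a b : (0 < a)%R -> (a <= b)%R ->
  \int[leb]_(x in `]a, +oo[) wpow x =
  \int[leb]_(x in `]a, b]) wpow x + \int[leb]_(x in `]b, +oo[) wpow x.
Proof.
move=> a0 ab; have -> : `]a, +oo[%classic = `]a, b] `|` `]b, +oo[.
  by rewrite -itv_bndbnd_setU// bnd_simp.
apply: wpow_setU; try exact: mI.
- by move=> x /=; rewrite !in_itv/= andbT => /andP[/(lt_trans a0)].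
- by move=> x /=; rewrite !in_itv/= !andbT => /(le_lt_trans ab)/(lt_trans a0).
- by move=> x /=; rewrite !in_itv/= andbT => /andP[_ xa]; rewrite ltNge xa.
Qed.

Lemma wpow_exhaust (F : nat -> interval R) B :
  nondecreasing_seq (fun i => [set` F i]) -> (forall i, [set` F i] `<=` `]0%R, +oo[) ->
  (forall i, \int[leb]_(x in [set` F i]) wpow x <= B) ->
  \int[leb]_(x in \bigcup_i [set` F i]) wpow x <= B.
Proof.
move=> ndF F0 hB.
have mF i : measurable_fun ([set` F i] : set (realL R)) wpow.
  by apply: measurable_wpow; [exact: mI|exact: F0].
have := @ge0_nondecreasing_set_cvg_integral _ _ _ (fun i => [set` F i] : set (realL R))
  wpow leb ndF (fun i => mI _) mF (fun i x _ => wpow_ge0 x).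
move=> /cvg_lim <-//; apply: lime_le; last exact: nearW.
apply: ereal_nondecreasing_is_cvgn.
exact: (@ge0_nondecreasing_set_nondecreasing_integral _ _ _ (fun i => [set` F i] : set (realL R))
  wpow leb ndF (fun i => mI _) mF (fun i x _ => wpow_ge0 x)).
Qed.

(** If every interval from [b] carried more than [e], each of the intervals that exhaust []b, b +
    1]] would have mass at most [X - e], and so would their union. *)
Lemma wpow_small_right b e : (0 < b)%R -> (0 < e)%R ->
  \int[leb]_(x in `]b, (b + 1)%R]) wpow x < +oo ->
  exists2 t, (b < t)%R & \int[leb]_(x in `]b, t]) wpow x <= e%:E.
Proof.
move=> b0 e0 hfin; apply: contrapT => hn.
set X := \int[leb]_(x in `]b, (b + 1)%R]) wpow x in hfin.
have X0 : 0 <= X by apply: integral_ge0 => x _; exact: wpow_ge0.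
have Xf : X \is a fin_num by rewrite ge0_fin_numE.
have : X <= X - e%:E.
  have E : `]b, (b + 1)%R]%classic = \bigcup_i `](b + i.+1%:R^-1)%R, (b + 1)%R]%classic.
    apply/seteqP; split => [x|x [i _]] /=; rewrite !in_itv/=; last first.
      move=> /andP[h ->]; rewrite andbT; apply: lt_trans h.
      by rewrite ltrDl invr_gt0.
    move=> /andP[bx xb]; have [k hk] := ltr_add_invr bx.
    by exists k => //=; rewrite in_itv/= hk xb.
  rewrite {1}/X E; apply: wpow_exhaust => [i j ij|i x|i].
  - apply/subsetPset => x /=; rewrite !in_itv/= => /andP[h ->]; rewrite andbT.
    apply: le_lt_trans h; rewrite lerD2l lef_pV2 ?posrE// ler_nat.
    by rewrite ltnS.
  - rewrite /= !in_itv/= andbT => /andP[h _]; apply: lt_trans h.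
    by rewrite addr_gt0// invr_gt0.
  - set t := (b + _)%R; have bt : (b < t)%R by rewrite ltrDl invr_gt0.
    have t1 : (t <= b + 1)%R by rewrite lerD2l invf_le1// ler1n.
    have : X = \int[leb]_(x in `]b, t]) wpow x + \int[leb]_(x in `]t, (b + 1)%R]) wpow x.
      rewrite /X; have -> : `]b, (b + 1)%R]%classic = `]b, t] `|` `]t, (b + 1)%R].
        by rewrite -itv_bndbnd_setU// bnd_simp// ltW.
      apply: wpow_setU; try exact: mI.
      + by move=> x /=; rewrite !in_itv/= andbT => /andP[/(lt_trans b0)].
      + by move=> x /=; rewrite !in_itv/= andbT => /andP[/(lt_trans bt)/(lt_trans b0)].
      + by move=> x /=; rewrite !in_itv/= => /andP[_ xa] /andP[]; rewrite ltNge xa.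
    move=> XE; rewrite leeBrDr// [leRHS]XE [leLHS]addeC; apply: leeD2r.
    rewrite leNgt; apply/negP => /ltW h; apply: hn; exists t => //.
rewrite leNgt => /negP; apply; rewrite lteBlDr// lteDl// lte_fin//.
Qed.

Lemma wpow_small_tail a e : (0 < a)%R -> (0 < e)%R ->
  \int[leb]_(x in `]a, +oo[) wpow x < +oo ->
  exists2 t, (a < t)%R & \int[leb]_(x in `]t, +oo[) wpow x <= e%:E.
Proof.
move=> a0 e0 hfin; apply: contrapT => hn.
set X := \int[leb]_(x in `]a, +oo[) wpow x in hfin.
have X0 : 0 <= X by apply: integral_ge0 => x _; exact: wpow_ge0.
have Xf : X \is a fin_num by rewrite ge0_fin_numE.
have : X <= X - e%:E.
  have E : `]a, +oo[%classic = \bigcup_i `]a, (a + i.+1%:R)%R]%classic.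
    apply/seteqP; split => [x|x [i _]] /=; rewrite !in_itv/= ?andbT; last by case/andP.
    move=> ax; exists (Num.bound (x - a)) => //=; rewrite in_itv/= ax/= -lerBlDl.
    by rewrite (le_trans (ltW (archi_boundP _))) ?subr_ge0 ?ltW// ltr_nat.
  rewrite {1}/X E; apply: wpow_exhaust => [i j ij|i x|i].
  - apply/subsetPset => x /=; rewrite !in_itv/= => /andP[-> h]/=.
    by apply: (le_trans h); rewrite lerD2l ler_nat ltnS.
  - by rewrite /= !in_itv/= andbT => /andP[/(lt_trans a0)].
  - set t := (a + _)%R; have bt : (a < t)%R by rewrite ltrDl.
    have := wpow_tail_split a0 (ltW bt); rewrite -/X => XE.
    rewrite leeBrDr// [leRHS]XE; apply: leeD2l.
    rewrite leNgt; apply/negP => /ltW h; apply: hn; exists t => //.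
rewrite leNgt => /negP; apply; rewrite lteBlDr// lteDl// lte_fin//.
Qed.

Lemma wpow_total_le B : (forall t, (0 < t)%R -> \int[leb]_(x in `]0%R, t[) wpow x <= B) ->
  \int[leb]_(x in `]0%R, +oo[) wpow x <= B.
Proof.
move=> hB; have -> : `]0%R, +oo[%classic = \bigcup_i `]0%R, (i.+1%:R : R)[%classic.
  apply/seteqP; split => [x|x [i _]] /=; rewrite !in_itv/= ?andbT; last by case/andP.
  move=> x0; exists (Num.bound x) => //=; rewrite in_itv/= x0/=.
  by rewrite (lt_trans (archi_boundP _)) ?ltW// ltr_nat.
apply: wpow_exhaust => [i j ij|i x|i]; last exact: hB.
  apply/subsetPset => x /=; rewrite !in_itv/= => /andP[-> h]/=.
  by apply: (lt_le_trans h); rewrite ler_nat ltnS.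
by rewrite /= !in_itv/= andbT => /andP[].
Qed.

End weight.
End LebesgueLine.

Local Close Scope ereal_scope.

(** * Head and tail norms of the weights as Stieltjes integrators *)

Section OmegaWeights.
Context {R : realType}.
Notation leb := (@completed_lebesgue_measure R).
Implicit Types (w : R -> \bar R) (th r t a b e x y : R).

Lemma powR_cvg p x : 0 < x -> y `^ p @[y --> x] --> x `^ p.
Proof.
move=> x0; have : derivable (fun y : R => y `^ p) x 1.
  by apply: derivable_powR; rewrite in_itv/= x0.
by move=> /derivable1_diffP/differentiable_continuous.
Qed.

(** Supplies the right continuity that [stieltjes_ocitv] asks for: a monotone function with
    arbitrarily small right increments is right-continuous, and [psi] preserves this. *)
Lemma right_cvgP (H : R -> R) (psi : R -> R) b :
  {in `]0, +oo[ &, {homo H : s t / s <= t}} \/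
  {in `]0, +oo[ &, {homo H : s t /~ s <= t}} ->
  0 < b -> (forall e, 0 < e -> exists2 t, b < t & `|H t - H b| <= e) ->
  psi y @[y --> H b] --> psi (H b) ->
  psi (H x) @[x --> b^'+] --> psi (H b).
Proof.
move=> mon b0 small cpsi; apply: (@cvg_comp _ _ _ H psi _ _ _ _ cpsi).
apply/cvgrPdist_le => /= e e0; have [t bt ht] := small e e0.
near=> x; have bx : b < x by near: x; exact: nbhs_right_gt.
have xt : x <= t by near: x; apply: nbhs_right_le.
have i y : 0 < y -> y \in `]0, +oo[ by move=> y0; rewrite in_itv/= y0.
have x0 := lt_trans b0 bx; have t0 := lt_trans b0 bt.
apply: le_trans ht; rewrite distrC; case: mon => mon.
- have h1 := mon b x (i _ b0) (i _ x0) (ltW bx).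
  have h2 := mon x t (i _ x0) (i _ t0) xt.
  by rewrite !ger0_norm ?subr_ge0 ?(le_trans h1)// lerD2r.
- have h1 := mon x b (i _ x0) (i _ b0) (ltW bx).
  have h2 := mon t x (i _ t0) (i _ x0) xt.
  by rewrite !ler0_norm ?subr_le0 ?(le_trans h2)// lerN2 lerD2r.
Unshelve. all: by end_near. Qed.

Section head.
Variables (w : R -> \bar R) (th : R).
Hypotheses (th0 : 0 < th) (hw : cOmega th%:E w).
Let mw := hw.1.1.

Definition head t := fine (lnorm leb th%:E `]0, t[ w).

Let hfin t : 0 < t -> lnorm leb th%:E `]0, t[ w = (head t)%:E.
Proof.
move=> t0; rewrite fineK// ge0_fin_numE; first by have [_ /(_ t t0)[]] := hw.
exact: Lnorm_ge0.
Qed.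

Lemma head_gt0 t : 0 < t -> 0 < head t.
Proof.
by move=> t0; rewrite -lte_fin -hfin//; have [_ /(_ t t0)[]] := hw.
Qed.

Lemma head_pow t : 0 < t -> (\int[leb]_(x in `]0%R, t[) wpow w th x = (head t `^ th)%:E)%E.
Proof.
move=> t0; rewrite -poweR_EFin -hfin// lnormE// -poweRrM mulVf ?lt0r_neq0//.
by rewrite poweRe1// integral_ge0// => x _; exact: wpow_ge0.
Qed.

Lemma head_le a b : 0 < a -> a <= b -> head a <= head b.
Proof.
move=> a0 ab; have b0 := lt_le_trans a0 ab.
rewrite -(@le_powRP _ th)// ?(ltW (head_gt0 _))// -lee_fin -!head_pow//.
rewrite (wpow_head_split th mw a0 ab) leeDl// integral_ge0// => x _.
exact: wpow_ge0.
Qed.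

Lemma head_diff a b : 0 < a -> a <= b ->
  (\int[leb]_(x in `]a, b]) wpow w th x = (head b `^ th - head a `^ th)%:E)%E.
Proof.
move=> a0 ab; have b0 := lt_le_trans a0 ab.
by rewrite EFinB -!head_pow// (wpow_head_split th mw a0 ab) addeAC subee ?add0e// head_pow.
Qed.

Let head_small b e : 0 < b -> 0 < e -> exists2 t, b < t & `|head t `^ th - head b `^ th| <= e.
Proof.
move=> b0 e0; have b1 : b <= b + 1 by rewrite lerDl.
have [|t bt ht] := wpow_small_right (th := th) mw b0 e0.
  by rewrite head_diff// ltry.
exists t => //; rewrite head_diff ?(ltW bt)// lee_fin in ht.
rewrite ger0_norm// subr_ge0 le_powR ?(ltW th0) ?(ltW (head_gt0 _))//.
exact: head_le (ltW bt).
Qed.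

Let i y : y \in `]0, +oo[ -> 0 < y. Proof. by rewrite in_itv/= andbT. Qed.

Lemma head_integrator_nd r : 0 < r -> nondecreasing_pos (head_integrator th%:E w r).
Proof.
move=> r0 s t /i s0 /i t0 st; rewrite /head_integrator -!/(head _) lerN2.
by rewrite le_powRN ?(ltW r0) ?head_gt0// head_le.
Qed.

Lemma head_mass r (ndG : nondecreasing_pos (head_integrator th%:E w r)) a b :
  0 < a -> a <= b -> stieltjes ndG `]a, b] = (head a `^ (- r) - head b `^ (- r))%:E.
Proof.
move=> a0 ab; have b0 := lt_le_trans a0 ab.
have cv c : 0 < c -> head_integrator th%:E w r x @[x --> c^'+] --> head_integrator th%:E w r c.
  move=> c0; pose psi (y : R) := - (y `^ th^-1) `^ (- r).
  have E x : head_integrator th%:E w r x = psi (head x `^ th).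
    rewrite /psi powRVK ?lt0r_neq0//.
    by rewrite /head fine_ge0// Lnorm_ge0.
  rewrite E (_ : head_integrator th%:E w r = psi \o (fun x => head x `^ th)); last first.
    by apply/funext => x; rewrite E.
  apply: (@right_cvgP (fun x => head x `^ th) psi) => //.
  - left => s t /i s0 /i t0 st; rewrite le_powR ?(ltW th0) ?(ltW (head_gt0 _))//.
    exact: head_le.
  - by move=> e e0; exact: head_small.
  - have p0 : 0 < head c `^ th by rewrite powR_gt0// head_gt0.
    apply: cvgN; rewrite (_ : (fun y : R => _) = (fun y : R => y `^ (- r)) \o (fun y : R => y `^ th^-1))//.
    apply: cvg_comp; first exact: powR_cvg.
    by apply: powR_cvg; rewrite powR_gt0.
rewrite stieltjes_ocitv//; [|exact: cv|exact: cv].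
by rewrite /head_integrator -!/(head _) opprK addrC.
Qed.

Let W := lnorm leb th%:E `]0, +oo[ w.

Lemma head_le_total t : 0 < t -> ((head t)%:E <= W)%E.
Proof.
move=> t0; rewrite -hfin// /W !lnormE//.
have I0 (D : set (realL R)) : (0 <= \int[leb]_(x in D) wpow w th x)%E.
  by apply: integral_ge0 => x _; exact: wpow_ge0.
apply: gt0_ler_poweR; rewrite ?invr_ge0 ?(ltW th0) ?in_itv/= ?leey ?andbT ?I0//.
apply: ge0_subset_integral => //; try exact: measurable_realL_itv.
- by apply: (measurable_wpow th mw) => //; exact: measurable_realL_itv.
- by move=> x _; exact: wpow_ge0.
- by move=> x /=; rewrite !in_itv/= => /andP[->].
Qed.

Lemma total_le B : 0 <= B -> (forall t, 0 < t -> head t <= B) -> (W <= B%:E)%E.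
Proof.
move=> B0 hB; rewrite /W lnormE//.
have I0 (D : set (realL R)) : (0 <= \int[leb]_(x in D) wpow w th x)%E.
  by apply: integral_ge0 => x _; exact: wpow_ge0.
have h : (\int[leb]_(x in `]0%R, +oo[) wpow w th x <= (B `^ th)%:E)%E.
  apply: (wpow_total_le (th := th) mw) => t t0; rewrite head_pow// lee_fin.
  by rewrite le_powR ?(ltW th0) ?(ltW (head_gt0 _))// hB.
have -> : B%:E = ((B `^ th)%:E `^ th^-1)%E.
  by rewrite poweR_EFin powRVK// lt0r_neq0.
by apply: gt0_ler_poweR; rewrite ?invr_ge0 ?(ltW th0) ?in_itv/= ?leey ?andbT ?I0 ?lee_fin ?powR_ge0.
Qed.

(** It is 0 when the total norm is infinite. *)
Definition total_inv := fine (W^-1)%E.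

Lemma total_inv_ge0 : 0 <= total_inv.
Proof. by rewrite /total_inv fine_ge0// inve_ge0 Lnorm_ge0. Qed.

(** The total norm is not 0, so its inverse is not [+oo]. *)
Lemma total_invE : (W^-1 = total_inv%:E)%E.
Proof.
rewrite /total_inv fineK//; have := head_le_total ltr01; have := head_gt0 ltr01.
case: W => [x h0 | _ _ | _ //]; last by rewrite invey.
rewrite lee_fin => h; rewrite inver; case: ifPn => // /eqP x0; move: h.
by rewrite x0 leNgt h0.
Qed.

(** If head^(-r) stayed more than [e] above total_inv^r, then [head] would stay below a number
    smaller than the total norm, against [total_le]. *)
Lemma total_invP r : 0 < r -> (forall t, 0 < t -> total_inv `^ r <= head t `^ (- r)) /\
  forall e, 0 < e -> exists2 T, 0 < T & forall t, T <= t ->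
    head t `^ (- r) - total_inv `^ r <= e.
Proof.
move=> r0.
have h1 t : 0 < t -> total_inv `^ r <= head t `^ (- r).
  move=> t0; rewrite powRN -powR_invf ?(ltW (head_gt0 _))//.
  apply: le_powR; rewrite ?(ltW r0) ?total_inv_ge0//.
  have := head_le_total t0; rewrite /total_inv; case: W => [x|_|//]; last first.
    by rewrite invey/= invr_ge0 ltW// head_gt0.
  rewrite lee_fin => hx; have x0 := lt_le_trans (head_gt0 t0) hx.
  by rewrite inver gt_eqF//= lef_pV2// posrE head_gt0.
split=> // e e0; apply: contrapT => hn.
pose z := total_inv `^ r + e; have z0 : 0 < z by rewrite ltr_wpDl ?powR_ge0.
have hz t : 0 < t -> head t <= z `^ (- r^-1).
  move=> t0; rewrite leNgt; apply/negP => hlt; apply: hn; exists t => // s ts.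
  have s0 := lt_le_trans t0 ts.
  have hs : z `^ (- r^-1) <= head s by apply: le_trans (ltW hlt) (head_le t0 ts).
  have := le_powRN (ltW r0) (powR_gt0 _ z0) hs.
  rewrite -powRrM mulrNN mulVf ?lt0r_neq0// powRr1 ?(ltW z0)// /z.
  by rewrite lerBlDl.
have := total_le (powR_ge0 _ _) hz => Wz.
have : z <= total_inv `^ r.
  move: Wz; rewrite /total_inv; have := head_le_total ltr01; case: W => [x| //|//].
  rewrite !lee_fin => hx xz; have x0 := lt_le_trans (head_gt0 ltr01) hx.
  rewrite inver gt_eqF//=; rewrite powR_invf ?(ltW x0)// -powRN.
  have := le_powRN (ltW r0) x0 xz.
  by rewrite -powRrM mulrNN mulVf ?lt0r_neq0// powRr1 ?(ltW z0).
by rewrite /z leNgt ltrDl e0.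
Qed.

End head.

Section tail.
Variables (w : R -> \bar R) (th : R).
Hypotheses (th0 : 0 < th) (hw : Omega th%:E w).
Let mw := hw.1.1.

Definition tail t := fine (lnorm leb th%:E `]t, +oo[ w).

Lemma lnorm_tail t : 0 < t -> lnorm leb th%:E `]t, +oo[ w = (tail t)%:E.
Proof.
move=> t0; rewrite fineK// ge0_fin_numE; first by have [_ /(_ t t0)[]] := hw.
exact: Lnorm_ge0.
Qed.

Lemma tail_gt0 t : 0 < t -> 0 < tail t.
Proof.
by move=> t0; rewrite -lte_fin -lnorm_tail//; have [_ /(_ t t0)[]] := hw.
Qed.

Lemma tail_pow t : 0 < t -> (\int[leb]_(x in `]t, +oo[) wpow w th x = (tail t `^ th)%:E)%E.
Proof.
move=> t0; rewrite -poweR_EFin -lnorm_tail// lnormE// -poweRrM mulVf ?lt0r_neq0//.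
by rewrite poweRe1// integral_ge0// => x _; exact: wpow_ge0.
Qed.

Lemma tail_le a b : 0 < a -> a <= b -> tail b <= tail a.
Proof.
move=> a0 ab; have b0 := lt_le_trans a0 ab.
rewrite -(@le_powRP _ th)// ?(ltW (tail_gt0 _))// -lee_fin -!tail_pow//.
rewrite (wpow_tail_split th mw a0 ab) leeDr// integral_ge0// => x _.
exact: wpow_ge0.
Qed.

Lemma tail_diff a b : 0 < a -> a <= b ->
  (\int[leb]_(x in `]a, b]) wpow w th x = (tail a `^ th - tail b `^ th)%:E)%E.
Proof.
move=> a0 ab; have b0 := lt_le_trans a0 ab.
by rewrite EFinB -!tail_pow// (wpow_tail_split th mw a0 ab) addeK// tail_pow.
Qed.

Let tail_small_right b e : 0 < b -> 0 < e ->
  exists2 t, b < t & `|tail t `^ th - tail b `^ th| <= e.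
Proof.
move=> b0 e0; have b1 : b <= b + 1 by rewrite lerDl.
have [|t bt ht] := wpow_small_right (th := th) mw b0 e0.
  by rewrite tail_diff// ltry.
exists t => //; rewrite tail_diff ?(ltW bt)// lee_fin in ht.
rewrite distrC ger0_norm// subr_ge0 le_powR ?(ltW th0) ?(ltW (tail_gt0 _)) ?(lt_trans b0)//.
exact: tail_le (ltW bt).
Qed.

Let i y : y \in `]0, +oo[ -> 0 < y. Proof. by rewrite in_itv/= andbT. Qed.

Lemma tail_integrator_nd r : 0 < r -> nondecreasing_pos (tail_integrator th%:E w r).
Proof.
move=> r0 s t /i s0 /i t0 st; rewrite /tail_integrator -!/(tail _) lerN2.
by rewrite le_powR ?(ltW r0) ?(ltW (tail_gt0 _))// tail_le.
Qed.

Lemma tail_mass r (ndG : nondecreasing_pos (tail_integrator th%:E w r)) a b :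
  0 < a -> a <= b -> stieltjes ndG `]a, b] = (tail a `^ r - tail b `^ r)%:E.
Proof.
move=> a0 ab; have b0 := lt_le_trans a0 ab.
have cv c : 0 < c -> tail_integrator th%:E w r x @[x --> c^'+] --> tail_integrator th%:E w r c.
  move=> c0; pose psi (y : R) := - (y `^ th^-1) `^ r.
  have E x : tail_integrator th%:E w r x = psi (tail x `^ th).
    rewrite /psi powRVK ?lt0r_neq0//.
    by rewrite /tail fine_ge0// Lnorm_ge0.
  rewrite E (_ : tail_integrator th%:E w r = psi \o (fun x => tail x `^ th)); last first.
    by apply/funext => x; rewrite E.
  apply: (@right_cvgP (fun x => tail x `^ th) psi) => //.
  - right => s t /i s0 /i t0 st; rewrite le_powR ?(ltW th0) ?(ltW (tail_gt0 _))//.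
    exact: tail_le.
  - by move=> e e0; exact: tail_small_right.
  - have p0 : 0 < tail c `^ th by rewrite powR_gt0// tail_gt0.
    apply: cvgN; rewrite (_ : (fun y : R => _) = (fun y : R => y `^ r) \o (fun y : R => y `^ th^-1))//.
    apply: cvg_comp; first exact: powR_cvg.
    by apply: powR_cvg; rewrite powR_gt0.
rewrite stieltjes_ocitv//; [|exact: cv|exact: cv].
by rewrite /tail_integrator -!/(tail _) opprK addrC.
Qed.

Lemma tail_small e : 0 < e -> exists2 T, 0 < T & forall t, T <= t -> tail t <= e.
Proof.
move=> e0; have [|T T1 hT] := wpow_small_tail (th := th) mw ltr01 (powR_gt0 th e0).
  by rewrite tail_pow// ltry.
have T0 : 0 < T by exact: lt_trans T1.
exists T => // t Tt; have t0 := lt_le_trans T0 Tt.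
rewrite tail_pow// lee_fin le_powRP ?(ltW e0) ?(ltW (tail_gt0 _))// in hT.
by apply: le_trans hT; exact: tail_le.
Qed.

End tail.
End OmegaWeights.

(** * Hoelder's inequality on shells and dyadic grids *)

Section WeightPair.
Context d (T : measurableType d) (R : realType) (mu : {measure set T -> \bar R}).
Hypothesis cmu : measure_is_complete mu.
Variables (v1 v2 : T -> \bar R) (p1 p2 : R).
Hypotheses (hv1 : weight mu setT v1) (hv2 : weight mu setT v2).
Hypotheses (p20 : 0 < p2) (p21 : p2 < p1).
Implicit Types (S D : set T) (f g : T -> \bar R) (x y lam : R).

Definition arrow_exp := (p2^-1 - p1^-1)^-1.
Let P := arrow_exp.
Let p10 : 0 < p1. Proof. exact: lt_trans p21. Qed.

Lemma arrow_exp_gt0 : 0 < arrow_exp.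
Proof. by rewrite invr_gt0 subr_gt0 ltf_pV2. Qed.
Let P0 := arrow_exp_gt0.

Lemma arrow_expE : p2 * (P / p1 + 1) = P.
Proof.
have e : P / p2 - P / p1 = 1.
  by rewrite -mulrBr /P /arrow_exp mulVf// lt0r_neq0// -invr_gt0.
have -> : P / p1 + 1 = P / p2 by rewrite -e addrC subrK.
by rewrite mulrCA mulfV ?mulr1// lt0r_neq0.
Qed.

Definition dens (t : T) : \bar R := (`|(v1 t)^-1 * v2 t| `^ P)%E.

Definition good : set T := [set t | (0 < v1 t < +oo)%E /\ (0 < v2 t < +oo)%E].

Lemma ae_good : {ae mu, forall t, good t}.
Proof.
have [_ h1] := hv1; have [_ h2] := hv2; move: h1 h2; apply: filterS2 => t h1 h2.
by have [a b] := h1 I; have [a' b'] := h2 I; split; apply/andP.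
Qed.

Let a1 t := fine (v1 t).
Let a2 t := fine (v2 t).

Lemma good_fine t : good t -> [/\ v1 t = (a1 t)%:E, v2 t = (a2 t)%:E, 0 < a1 t & 0 < a2 t].
Proof.
rewrite /a1 /a2; move=> [/andP[h1 h2] /andP[h3 h4]].
have f1 : v1 t \is a fin_num by rewrite ge0_fin_numE// ltW.
have f2 : v2 t \is a fin_num by rewrite ge0_fin_numE// ltW.
by split; rewrite ?fineK// -lte_fin fineK.
Qed.

Definition dens_real t : R := (a1 t `^ (-1) * a2 t) `^ P.

Lemma densE t : good t -> dens t = (dens_real t)%:E.
Proof.
move=> /good_fine[e1 e2 h1 h2]; rewrite /dens e1 e2 inver gt_eqF// -EFinM abse_EFin poweR_EFin ger0_norm ?mulr_ge0 ?invr_ge0 ?ltW//.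
by rewrite /dens_real powRN powRr1 ?ltW.
Qed.

Lemma dens_real_gt0 t : good t -> 0 < dens_real t.
Proof. by move=> /good_fine[_ _ h1 h2]; rewrite powR_gt0// mulr_gt0// powR_gt0. Qed.

Let ma1 : measurable_fun setT a1.
Proof. by apply: (measurableT_comp (@fine_measurable R setT measurableT)); have [] := hv1. Qed.
Let ma2 : measurable_fun setT a2.
Proof. by apply: (measurableT_comp (@fine_measurable R setT measurableT)); have [] := hv2. Qed.

Let mratio : measurable_fun setT (fun t => a1 t `^ (-1) * a2 t).
Proof. by apply: measurable_funM => //; exact: (measurableT_comp (measurable_powR _)). Qed.

(** The measurable function [dens_real] agrees with [dens] almost everywhere, and the measure is
    complete. *)
Lemma measurable_dens D : measurable D -> measurable_fun D dens.
Proof.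
move=> mD; apply: (@ae_measurable_fun _ _ _ mu cmu D (EFin \o dens_real) dens).
  by move: ae_good; apply: filterS => t gt _; rewrite densE.
apply/measurable_EFinP; apply: measurable_funTS.
exact: (measurableT_comp (measurable_powR _) mratio).
Qed.

(** [dens] is positive almost everywhere, so [S] is a null set. *)
Lemma dens_null S g : measurable S -> (\int[mu]_(t in S) dens t = 0)%E ->
  measurable_fun S g -> (forall t, S t -> 0 <= g t)%E -> (\int[mu]_(t in S) g t = 0)%E.
Proof.
move=> mS S0 mg g0.
have d0 t : (0 <= dens t)%E by exact: poweR_ge0.
have : ae_eq mu S dens (cst 0%E).
  apply/(ae_eq_integral_abs mu mS (measurable_dens mS)).
  by rewrite -S0; apply: eq_integral => t _; rewrite gee0_abs.
move=> hS.
have : ae_eq mu S g (cst 0%E).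
  move: hS ae_good; apply: filterS2 => t hS gt St; have := hS St; rewrite densE//= => -[h].
  by have := dens_real_gt0 gt; rewrite h ltxx.
move=> /(ae_eq_integral_abs mu mS mg) <-; apply: eq_integral => t /set_mem St.
by rewrite gee0_abs// g0.
Qed.

(* (A B)^p2 <= (lam A)^p1 + (B / lam)^P, from p2/p1 + p2/P = 1 *)
Lemma split_product A B lam : 0 < lam -> 0 <= A -> 0 <= B ->
  (A * B) `^ p2 <= lam `^ p1 * A `^ p1 + lam `^ (- P) * B `^ P.
Proof.
move=> l0 A0 B0.
have X0 : 0 <= lam * A by rewrite mulr_ge0// ltW.
have Y0 : 0 <= lam^-1 * B by rewrite mulr_ge0// invr_ge0 ltW.
have li : 0 <= lam^-1 by rewrite invr_ge0 ltW.
rewrite powRN -powR_invf ?(ltW l0)// -(powRM p1 (ltW l0) A0) -(powRM P li B0).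
have -> : A * B = lam * A * (lam^-1 * B).
  by rewrite mulrACA mulfV ?mul1r// lt0r_neq0.
move: (lam * A) (lam^-1 * B) X0 Y0 => x y x0 y0.
have e : p2 / p1 + p2 / P = 1.
  by rewrite /P /arrow_exp invrK -mulrDr addrC subrK mulfV// lt0r_neq0.
have e1 : (x `^ p1) `^ (p2 / p1) = x `^ p2.
  by rewrite -powRrM mulrCA mulfV ?mulr1// lt0r_neq0.
have e2 : (y `^ P) `^ (p2 / P) = y `^ p2.
  by rewrite -powRrM mulrCA mulfV ?mulr1// lt0r_neq0.
rewrite powRM// -e1 -e2; move: (x `^ p1) (y `^ P) (powR_ge0 x p1) (powR_ge0 y P) => X Y X0 Y0.
have q1 : 0 <= p2 / p1 by rewrite divr_ge0 ?ltW.
have q2 : 0 <= p2 / P by rewrite divr_ge0 ?ltW.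
have [XY|/ltW YX] := leP X Y.
  apply: (@le_trans _ _ (Y `^ (p2 / p1) * Y `^ (p2 / P))).
    by rewrite ler_wpM2r ?powR_ge0// le_powR.
  by rewrite -powRD_ge0 e// powRr1// lerDr.
apply: (@le_trans _ _ (X `^ (p2 / p1) * X `^ (p2 / P))).
  by rewrite ler_wpM2l ?powR_ge0// le_powR.
by rewrite -powRD_ge0 e// powRr1// lerDl.
Qed.

Let mpow f p D : measurable D -> measurable_fun D f -> measurable_fun D (fun t => (`|f t| `^ p)%E).
Proof.
move=> mD mf; apply: (measurableT_comp (measurable_poweR p)).
exact: (measurableT_comp (@abse_measurable R setT)).
Qed.

(** [split_product] holds at almost every point, including those where [f] is infinite: there the
    right-hand side is [+oo]. *)
Lemma integral_split_product S f lam : measurable S -> measurable_fun setT f -> 0 < lam ->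
  (\int[mu]_(t in S) (`|f t * v2 t| `^ p2) <=
   (lam `^ p1)%:E * \int[mu]_(t in S) (`|f t * v1 t| `^ p1) +
   (lam `^ (- P))%:E * \int[mu]_(t in S) dens t)%E.
Proof.
move=> mS mf l0.
have mv1 : measurable_fun S (fun t => `|f t * v1 t| `^ p1)%E.
  by apply: mpow => //; apply: measurable_funTS; apply: emeasurable_funM => //; case: hv1.
have mv2 : measurable_fun S (fun t => `|f t * v2 t| `^ p2)%E.
  by apply: mpow => //; apply: measurable_funTS; apply: emeasurable_funM => //; case: hv2.
have md := measurable_dens mS.
rewrite -ge0_integralZl//; [|by move=> t _; exact: poweR_ge0|by rewrite lee_fin powR_ge0].
rewrite -ge0_integralZl//; [|by move=> t _; exact: poweR_ge0|by rewrite lee_fin powR_ge0].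
have c1 t : (0 <= (lam `^ p1)%:E * `|f t * v1 t| `^ p1)%E.
  by rewrite mule_ge0 ?lee_fin ?powR_ge0 ?poweR_ge0.
have c2 t : (0 <= (lam `^ (- P))%:E * dens t)%E.
  by rewrite mule_ge0 ?lee_fin ?powR_ge0 ?poweR_ge0.
have m1 : measurable_fun S (fun t => (lam `^ p1)%:E * `|f t * v1 t| `^ p1)%E.
  by apply: emeasurable_funM => //; exact: measurable_cst.
have m2 : measurable_fun S (fun t => (lam `^ (- P))%:E * dens t)%E.
  by apply: emeasurable_funM => //; exact: measurable_cst.
rewrite -ge0_integralD//; apply: ae_ge0_le_integral => //.
- by move=> t _; exact: poweR_ge0.
- by move=> t _; rewrite adde_ge0.
- exact: emeasurable_funD.
move: ae_good; apply: filterS => t gt _; rewrite densE//.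
have [-> -> h1 h2] := good_fine gt.
have l1 : (0 < (lam `^ p1)%:E)%E by rewrite lte_fin powR_gt0.
have inf : (`|f t| = +oo ->
   `|f t * (a2 t)%:E| `^ p2 <= (lam `^ p1)%:E * `|f t * (a1 t)%:E| `^ p1 +
   (lam `^ (- P))%:E * (dens_real t)%:E)%E.
  move=> finf; rewrite !abseM finf gt0_mulye ?abse_EFin ?lte_fin ?normr_gt0 ?gt_eqF//.
  rewrite gt0_mulye ?abse_EFin ?lte_fin ?normr_gt0 ?gt_eqF//.
  by rewrite !poweRyr ?lt0r_neq0// gt0_muley// addye ?leey// -EFinM.
case E : (f t) inf => [z| |] inf; [clear inf|exact: inf|exact: inf].
rewrite -!EFinM -EFinD lee_fin !normrM.
rewrite (ger0_norm (ltW h1)) (ger0_norm (ltW h2)).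
have -> : `|z| * a2 t = `|z| * a1 t * (a1 t `^ (-1) * a2 t).
  by rewrite powRN powRr1 ?(ltW h1)// mulrA mulfK// lt0r_neq0.
rewrite /dens_real; apply: split_product => //; first by rewrite mulr_ge0// ltW.
by rewrite mulr_ge0 ?powR_ge0// ltW.
Qed.

(** Hoelder's inequality up to the factor 2. For [x > 0] the choice lam = (y/x)^(1/(p1 + P)) makes
    the two terms of [integral_split_product] equal; for [x = 0] a large [lam] makes the second one
    arbitrarily small. *)
Lemma shell_upper S f (x y : R) : measurable S -> measurable_fun setT f ->
  0 <= x -> 0 < y ->
  (\int[mu]_(t in S) (`|f t * v1 t| `^ p1) <= x%:E)%E ->
  (\int[mu]_(t in S) dens t <= y%:E)%E ->
  (\int[mu]_(t in S) (`|f t * v2 t| `^ p2) <= (2 * (x `^ (p2 / p1) * y `^ (p2 / P)))%:E)%E.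
Proof.
move=> mS mf x0 y0 hx hy.
have main lam : 0 < lam -> (\int[mu]_(t in S) (`|f t * v2 t| `^ p2) <=
    (lam `^ p1 * x + lam `^ (- P) * y)%:E)%E.
  move=> l0; apply: (le_trans (integral_split_product mS mf l0)).
  by rewrite EFinD !EFinM; apply: leeD; apply: lee_wpmul2l => //; rewrite lee_fin powR_ge0.
have s0 : 0 < p1 + P by rewrite addr_gt0.
have n1 : p1 != 0 by rewrite lt0r_neq0.
have n2 : P != 0 by rewrite lt0r_neq0.
have n3 : p1 + P != 0 by rewrite lt0r_neq0.
have e : p2^-1 = (p1 + P) / (p1 * P).
  have : P^-1 = p2^-1 - p1^-1 by rewrite /P /arrow_exp invrK.
  move=> e; rewrite -[LHS](subrK p1^-1) -e; field; by rewrite n1 n2.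
have p2E : p2 = p1 * P / (p1 + P) by rewrite -[LHS]invrK e invf_div.
have e1 : p2 / p1 = P / (p1 + P) by rewrite p2E; field; rewrite n1 n3.
have e2 : p2 / P = p1 / (p1 + P) by rewrite p2E; field; rewrite n2 n3.
move: x0; rewrite le_eqVlt => /predU1P[x0|x0].
  rewrite -x0 powR0 ?mul0r ?mulr0; last by rewrite lt0r_neq0// divr_gt0.
  apply/lee_addgt0Pr => eps e0; rewrite add0e.
  have := main ((y / eps) `^ P^-1); rewrite -x0 mulr0 add0r powR_gt0 ?divr_gt0// => /(_ isT).
  have ye : 0 <= y / eps by rewrite divr_ge0 ?ltW.
  by rewrite powRN powRKV// invf_div divfK// lt0r_neq0.
have := main ((y / x) `^ (p1 + P)^-1); rewrite powR_gt0 ?divr_gt0// => /(_ isT).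
have -> : ((y / x) `^ (p1 + P)^-1) `^ p1 * x = x `^ (p2 / p1) * y `^ (p2 / P).
  rewrite -powRrM powR_div ?ltW// e1 e2 mulrC (mulrC _ p1) mulrA.
  rewrite [LHS](_ : _ = y `^ (p1 / (p1 + P)) * (x * x `^ (- (p1 / (p1 + P))))).
    rewrite -{1}(powRr1 (ltW x0)) -powRD_pos// mulrC; congr (_ `^ _ * _).
    by field.
  by rewrite powRN; ring.
have -> : ((y / x) `^ (p1 + P)^-1) `^ (- P) * y = x `^ (p2 / p1) * y `^ (p2 / P).
  rewrite -powRrM mulrN powRN powR_div ?ltW// invf_div e1 e2 (mulrC _ P).
  rewrite -mulrA; congr (_ * _).
  have -> : p1 / (p1 + P) = - (P / (p1 + P)) + 1 by field.
  by rewrite powRD_pos// powRr1 ?(ltW y0)// powRN.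
by rewrite mulr2n mulrDl mul1r.
Qed.

(* extremal function: |test v1|^p1 = |test v2|^p2 = (v2 / v1)^P *)
Definition test t : R := a1 t `^ (-1) * (a1 t `^ (-1) * a2 t) `^ (P / p1).

Lemma measurable_test : measurable_fun setT test.
Proof.
apply: measurable_funM; first exact: (measurableT_comp (measurable_powR _)).
exact: (measurableT_comp (measurable_powR _) mratio).
Qed.

Lemma test_powE t c : good t -> 0 <= c ->
  (`|(c * test t)%:E * v1 t| `^ p1 = (c `^ p1)%:E * dens t)%E /\
  (`|(c * test t)%:E * v2 t| `^ p2 = (c `^ p2)%:E * dens t)%E.
Proof.
move=> gt c0; rewrite densE//; have [-> -> h1 h2] := good_fine gt.
have i1 : a1 t `^ (-1) = (a1 t)^-1 by rewrite powRN powRr1// ltW.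
have i0 : 0 < (a1 t)^-1 by rewrite invr_gt0.
have r0 : 0 < (a1 t)^-1 * a2 t by rewrite mulr_gt0.
have p0 := powR_ge0 ((a1 t)^-1 * a2 t) (P / p1).
rewrite /test /dens_real i1 -!EFinM !abse_EFin !poweR_EFin.
split; congr (_%:E).
  have -> : c * ((a1 t)^-1 * ((a1 t)^-1 * a2 t) `^ (P / p1)) * a1 t =
            c * ((a1 t)^-1 * a2 t) `^ (P / p1).
    rewrite [(a1 t)^-1 * _]mulrC -!mulrA mulVf ?mulr1//; last by rewrite lt0r_neq0.
  by rewrite ger0_norm ?mulr_ge0// (powRM _ c0 p0) -powRrM divfK// lt0r_neq0.
have -> : c * ((a1 t)^-1 * ((a1 t)^-1 * a2 t) `^ (P / p1)) * a2 t =
          c * ((a1 t)^-1 * a2 t) `^ (P / p1 + 1).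
  by rewrite powRD_pos// powRr1 ?(ltW r0)//; ring.
by rewrite ger0_norm ?mulr_ge0 ?powR_ge0// (powRM _ c0 (powR_ge0 _ _)) -powRrM [_ * p2]mulrC arrow_expE.
Qed.

Lemma test_integral S f (c : R) : measurable S -> measurable_fun setT f -> 0 <= c ->
  (forall t, S t -> f t = (c * test t)%:E) ->
  (\int[mu]_(t in S) (`|f t * v1 t| `^ p1) = (c `^ p1)%:E * \int[mu]_(t in S) dens t)%E /\
  (\int[mu]_(t in S) (`|f t * v2 t| `^ p2) = (c `^ p2)%:E * \int[mu]_(t in S) dens t)%E.
Proof.
move=> mS mf c0 fE.
have md := measurable_dens mS.
have mv1 : measurable_fun S (fun t => `|f t * v1 t| `^ p1)%E.
  by apply: mpow => //; apply: measurable_funTS; apply: emeasurable_funM => //; case: hv1.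
have mv2 : measurable_fun S (fun t => `|f t * v2 t| `^ p2)%E.
  by apply: mpow => //; apply: measurable_funTS; apply: emeasurable_funM => //; case: hv2.
have mc (k : R) : measurable_fun S (fun t => k%:E * dens t)%E.
  by apply: emeasurable_funM => //; exact: measurable_cst.
have d0 t : (0 <= dens t)%E by exact: poweR_ge0.
rewrite -!ge0_integralZl ?lee_fin ?powR_ge0//.
split; apply: ge0_ae_eq_integral => //.
- by move=> t _; exact: poweR_ge0.
- by move=> t _; rewrite mule_ge0 ?lee_fin ?powR_ge0.
- by move: ae_good; apply: filterS => t gt St; rewrite fE//; case: (test_powE gt c0).
- by move=> t _; exact: poweR_ge0.
- by move=> t _; rewrite mule_ge0 ?lee_fin ?powR_ge0.
- by move: ae_good; apply: filterS => t gt St; rewrite fE//; case: (test_powE gt c0).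
Qed.

End WeightPair.

(** * Dyadic grids of an admissible function *)

Section Grid.
Context {R : realType}.
Implicit Types (V : R -> \bar R) (x y t : R).

Lemma arrowE (p q : R) : 0 < q -> q < p ->
  arrow p%:E q%:E = ((q^-1 - p^-1)^-1)%:E.
Proof.
move=> q0 qp; have p0 := lt_trans q0 qp.
rewrite /arrow lte_fin qp !inver !gt_eqF// -EFinB inver gt_eqF//.
by rewrite subr_gt0 ltf_pV2.
Qed.

Section admissible.
Variable V : R -> \bar R.
Hypothesis hV : admissible V.

Let i y : 0 <= y -> y \in `[0, +oo[. Proof. by move=> y0; rewrite in_itv/= y0. Qed.

Lemma admissible_lt x y : 0 <= x -> x < y -> (V x < V y)%E.
Proof.
case: hV => _ h _ _ x0 xy; apply: h => //; apply: i => //.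
exact: le_trans (ltW xy).
Qed.

Lemma admissible_fin x : 0 <= x -> V x = (fine (V x))%:E.
Proof.
move=> x0; rewrite fineK// ge0_fin_numE.
  have x1 : x < x + 1 by rewrite ltrDl.
  by apply: lt_le_trans (admissible_lt x0 x1) _; rewrite leey.
case: hV => _ _ V00 _; move: x0; rewrite le_eqVlt => /predU1P[<-|x0]; first by rewrite V00.
by rewrite -V00 ltW// admissible_lt.
Qed.

Lemma admissible_surj y : 0 < y -> exists2 x, 0 < x & V x = y%:E.
Proof.
move=> y0; have [cV mV V00 Vy] := hV.
have [b [b0 hb]] : exists b, 0 < b /\ y <= fine (V b).
  have /cvgeyPge/(_ y)[b [_ hb]] := Vy.
  exists (Num.max b 1 + 1); have m0 : 0 < Num.max b 1 + 1 by rewrite ltr_wpDl// le_max ler01 orbT.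
  split => //; rewrite -lee_fin -admissible_fin ?(ltW m0)//; apply: hb.
  by rewrite ltr_pwDr// le_max lexx.
have cf : {within `[0, b], continuous (fine \o V)}.
  apply/subspace_continuousP => x /= xb; have x0 : 0 <= x.
    by move: xb; rewrite in_itv/= => /andP[].
  apply: fine_cvg; rewrite -admissible_fin//.
  have cV' : {within `[0, b], continuous V}.
    apply: continuous_subspaceW cV => z /=; rewrite !in_itv/= => /andP[-> _]//.
  by move/subspace_continuousP : cV'; apply.
have := @IVT _ (fine \o V) 0 b y (ltW b0) cf; rewrite /= V00/=.
have hb0 : 0 <= fine (V b) by apply: le_trans hb; exact: ltW.
rewrite min_l// max_r// (ltW y0) hb => /(_ isT)[x]; rewrite in_itv/= => /andP[x0 _] xy.
exists x; last by rewrite admissible_fin// xy.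
rewrite lt_neqAle x0 andbT; apply/eqP => xE; move: xy; rewrite -xE V00/= => e.
by rewrite -e ltxx in y0.
Qed.

Lemma admissible_inverse : exists g : R -> R, forall y, 0 < y -> 0 < g y /\ V (g y) = y%:E.
Proof.
have /choice[g hg] : forall y, exists x, 0 < y -> 0 < x /\ V x = y%:E.
  move=> y; have [y0|y0] := ltP 0 y; last by exists 0.
  by have [x x0 xy] := admissible_surj y0; exists x.
by exists g.
Qed.

Section grid.
Variable g : R -> R.
Hypothesis hg : forall y, 0 < y -> 0 < g y /\ V (g y) = y%:E.

Definition grid_value (M m : nat) : R := 2 ^+ m / 2 ^+ M.
Definition grid_at (M m : nat) : R := g (grid_value M m).

Lemma grid_value_gt0 M m : 0 < grid_value M m.
Proof. by rewrite divr_gt0 ?exprn_gt0. Qed.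

Lemma grid_valueS M m : grid_value M m.+1 = 2 * grid_value M m.
Proof. by rewrite /grid_value exprS mulrA. Qed.

Lemma grid_valueSS k M m : grid_value (M + k) (m + k) = grid_value M m.
Proof.
have k0 : (2 : R) ^+ k != 0 by rewrite lt0r_neq0// exprn_gt0.
by rewrite /grid_value !exprD invfM mulrACA mulfV// mulr1.
Qed.

(** This invariance relates the grids: the grid [M + k] is the grid [M] with [k] more cells towards
    0. *)
Lemma gridSS k M m : grid_at (M + k) (m + k) = grid_at M m.
Proof. by rewrite /grid_at grid_valueSS. Qed.

Lemma grid_gt0 M m : 0 < grid_at M m.
Proof. by have [] := hg (grid_value_gt0 M m). Qed.

Lemma V_grid M m : V (grid_at M m) = (grid_value M m)%:E.
Proof. by have [] := hg (grid_value_gt0 M m). Qed.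

Lemma V_le x y : 0 <= x -> 0 <= y -> (V x <= V y)%E = (x <= y).
Proof.
move=> x0 y0; apply/idP/idP => [|xy].
  by apply: contraLR; rewrite -ltNge => /(admissible_lt y0); rewrite ltNge.
by move: xy; rewrite le_eqVlt => /predU1P[->//|/(admissible_lt x0)/ltW].
Qed.

Lemma gridS_lt M m : grid_at M m < grid_at M m.+1.
Proof.
rewrite ltNge -V_le ?(ltW (grid_gt0 _ _))// !V_grid lee_fin -ltNge grid_valueS.
by rewrite ltr_pMl ?grid_value_gt0// ltr1n.
Qed.

Lemma grid_le M m l : (m <= l)%N -> grid_at M m <= grid_at M l.
Proof.
by apply: (homo_leq (@lexx _ R) (@le_trans _ R)) => k; exact/ltW/gridS_lt.
Qed.

Lemma ex_pow2_gt x : exists M : nat, x < 2 ^+ M.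
Proof.
exists (Num.bound x); have [x0|x0] := leP 0 x; last first.
  by apply: (lt_le_trans x0); rewrite exprn_ge0.
apply: (lt_trans (archi_boundP x0)).
by rewrite -natrX ltr_nat ltn_expl.
Qed.

Lemma ex_pow2_lt x : 0 < x -> exists M : nat, (2 ^+ M)^-1 < x.
Proof.
move=> x0; have [M hM] := ex_pow2_gt x^-1; exists M.
by rewrite invf_plt// posrE exprn_gt0.
Qed.

(** On the [M]-th window [V] runs from 2^(-M) to 2^M. *)
Lemma grid_exhaust : (`]0, +oo[%classic : set R) =
  \bigcup_M `]grid_at M 0, grid_at M (M + M)%N]%classic.
Proof.
apply/seteqP; split => [x|x [M _]] /=; rewrite !in_itv/= ?andbT; last first.
  by move=> /andP[/(lt_trans (grid_gt0 _ _))].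
move=> x0; have Vx0 : 0 < fine (V x).
  rewrite -lte_fin -admissible_fin ?(ltW x0)//; have [_ _ V00 _] := hV.
  by have := admissible_lt (lexx 0) x0; rewrite V00.
have [M1 h1] := ex_pow2_lt Vx0; have [M2 h2] := ex_pow2_gt (fine (V x)).
exists (maxn M1 M2) => //=; rewrite in_itv/=; apply/andP; split.
  rewrite ltNge -V_le ?(ltW x0) ?(ltW (grid_gt0 _ _))// V_grid admissible_fin ?(ltW x0)//.
  rewrite lee_fin -ltNge; apply: le_lt_trans h1.
  rewrite /grid_value expr0 mul1r lef_pV2 ?posrE ?exprn_gt0//.
  by rewrite ler_weXn2l ?ler1n// leq_maxl.
rewrite -V_le ?(ltW x0) ?(ltW (grid_gt0 _ _))// V_grid admissible_fin ?(ltW x0)//.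
rewrite lee_fin; apply: (le_trans (ltW h2)).
rewrite /grid_value exprD mulfK ?lt0r_neq0 ?exprn_gt0//.
by rewrite ler_weXn2l ?ler1n// leq_maxr.
Qed.

Lemma grid_window_nd : nondecreasing_seq (fun M => `]grid_at M 0, grid_at M (M + M)%N]%classic).
Proof.
move=> M N MN; apply/subsetPset => x /=; rewrite !in_itv/= => /andP[h1 h2].
rewrite -(subnK MN); apply/andP; split.
  by apply: le_lt_trans h1; rewrite addnC -[X in _ <= X](gridSS (N - M)) grid_le.
apply: (le_trans h2); rewrite -(gridSS (N - M)) (addnC M (N - M)%N).
by rewrite grid_le//; lia.
Qed.

Definition line_cell M i : set R := `]grid_at M i, grid_at M i.+1]%classic.

Lemma linecell_trivI M : trivIset setT (line_cell M).
Proof.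
have h k l y : (k < l)%N -> line_cell M k y -> line_cell M l y -> False.
  rewrite /line_cell /= !in_itv/= => kl /andP[_ yk] /andP[+ _].
  by rewrite ltNge (le_trans yk)// grid_le.
move=> k l _ _ [y [yk yl]]; have [kl|lk|//] := ltngtP k l.
  by case: (h k l y).
by case: (h l k y).
Qed.

Lemma linewindow M N : (`]grid_at M 0, grid_at M N]%classic : set R) =
  \big[setU/set0]_(i < N) line_cell M i.
Proof.
elim: N => [|N IH]; first by rewrite big_ord0 set_itvoc0.
rewrite big_ord_recr /= -IH -itv_bndbnd_setU ?bnd_simp//.
  exact: grid_le.
exact: grid_le.
Qed.

Lemma grid_cell x : 0 < x -> exists M m, grid_at M m < x <= grid_at M m.+1.
Proof.
move=> x0; have : (`]0, +oo[%classic : set R) x by rewrite /= in_itv/= x0.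
rewrite grid_exhaust => -[M _] /=; rewrite in_itv/= => /andP[h1 h2]; exists M.
elim: (M + M)%N h2 => [|m IH] h2; first by rewrite ltNge h2 in h1.
by have [/IH//|h] := leP x (grid_at M m); exists m; rewrite h.
Qed.

End grid.
End admissible.
End Grid.

Section Sums.
Context {R : realType}.

(** Being nondecreasing in [k], the sequences tend to their suprema simultaneously, so a bound on
    the sums for each [k] passes to the limit, even if some suprema are infinite. *)
Lemma sum_sup (N : nat) (c : nat -> R) (e : nat -> nat -> R) (X : \bar R) :
  (forall m, (m < N)%N -> 0 <= c m) -> (forall m k, 0 <= e m k) ->
  (forall m k, e m k <= e m k.+1) ->
  (forall k, ((\sum_(m < N) c m * e m k)%:E <= X)%E) ->
  (\sum_(m < N) (c m)%:E * ereal_sup (range (fun k => (e m k)%:E)) <= X)%E.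
Proof.
move=> c0 e0 eS h.
have cv m : (fun k => (e m k)%:E) @ \oo --> ereal_sup (range (fun k => (e m k)%:E)).
  apply: ereal_nondecreasing_cvgn; apply: homo_leq => [x|x y z|k] //.
    exact: le_trans.
  by rewrite lee_fin.
have : (fun k => \sum_(m < N) (c m)%:E * (e m k)%:E)%E @ \oo -->
   (\sum_(m < N) (c m)%:E * ereal_sup (range (fun k => (e m k)%:E)))%E.
  apply: cvg_nnesum => m _.
    by apply: nearW => k; rewrite -EFinM lee_fin mulr_ge0// c0.
  by apply: cvgeZl.
move=> /cvg_lim <-//; apply: lime_le.
  apply: ereal_nondecreasing_is_cvgn; apply: homo_leq => [x|x y z|k] //.
    exact: le_trans.
  by apply: lee_sum => m _; rewrite -!EFinM lee_fin ler_wpM2l// c0.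
apply: nearW => k; apply: le_trans (h k); rewrite sumEFin lee_fin.
by apply: ler_sum => m _.
Qed.

Lemma abel_tail (T G : nat -> R) n : G 0%N = 0 ->
  \sum_(m < n.+1) T m * (G m.+1 - G m) =
  \sum_(m < n) (T m - T m.+1) * G m.+1 + T n * G n.+1.
Proof.
move=> G0; elim: n => [|n IH]; first by rewrite big_ord1 big_ord0 G0 subr0 add0r.
by rewrite big_ord_recr /= IH big_ord_recr /=; ring.
Qed.

Lemma abel_head (W F : nat -> R) n : F n.+1 = 0 ->
  \sum_(m < n.+1) W m * (F m - F m.+1) =
  W 0%N * F 0%N + \sum_(m < n) (W m.+1 - W m) * F m.+1.
Proof.
have h k : \sum_(m < k.+1) W m * (F m - F m.+1) + W k * F k.+1 =
  W 0%N * F 0%N + \sum_(m < k) (W m.+1 - W m) * F m.+1.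
  elim: k => [|k IH]; first by rewrite big_ord1 big_ord0; ring.
  by rewrite big_ord_recr [in RHS]big_ord_recr /= addrA -IH; ring.
by move=> Fn; rewrite -h Fn mulr0 addr0.
Qed.

End Sums.

(** * Balls, shells and grid cells *)

Section Shells.
Context {R : realType} (n : nat).
Notation Rn := (euclid R n).
Notation mu := (@lebesgueRn R n).
Implicit Types (x t : R) (S : set Rn).

Lemma complete_lebesgueRn : measure_is_complete mu.
Proof. exact: measure_is_complete_caratheodory. Qed.

Lemma measurable_eball t : measurable (@eball R n t).
Proof.
apply: sub_caratheodory; apply: sub_sigma_algebra.
pose f (x : n.-tuple (measurableTypeR R)) := Num.sqrt (\sum_(i < n) tnth x i ^+ 2).
have mf : measurable_fun setT f.
  apply: (@measurableT_comp _ _ _ _ _ _ (@Num.sqrt R)).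
    apply: continuous_measurable_fun; exact: sqrt_continuous.
  apply: measurable_sum => i; apply: measurable_funX; exact: measurable_tnth.
have := mf measurableT _ (measurable_itv `]-oo, t[); rewrite setTI.
by congr measurable; apply/seteqP; split => x /=; rewrite in_itv.
Qed.

Lemma le_eball x t : x <= t -> @eball R n x `<=` eball t.
Proof. by move=> xt y /= /lt_le_trans; exact. Qed.

Section weights.
Variables (v1 v2 : Rn -> \bar R) (p1 p2 : R).
Hypotheses (hv1 : weight mu setT v1) (hv2 : weight mu setT v2).
Hypotheses (p20 : 0 < p2) (p21 : p2 < p1).
Let P := arrow_exp p1 p2.
Let P0 : 0 < P. Proof. exact: arrow_exp_gt0. Qed.
Let V := Vtilde p1%:E p2%:E v1 v2.
Hypothesis hV : admissible V.
Notation dens := (dens v1 v2 p1 p2).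

Let dens0 y : (0 <= dens y)%E. Proof. exact: poweR_ge0. Qed.
Let mdens D : measurable D -> measurable_fun D dens.
Proof. exact: (measurable_dens complete_lebesgueRn). Qed.

Lemma dens_eball x : 0 <= x ->
  (\int[mu]_(y in eball x) dens y = (fine (V x) `^ P)%:E)%E.
Proof.
move=> x0; rewrite -poweR_EFin -(admissible_fin hV x0) /V /Vtilde arrowE// lnormE//.
rewrite -poweRrM mulVf ?lt0r_neq0// poweRe1// integral_ge0// => y _; exact: dens0.
Qed.

Definition shell x t : set Rn := eball t `\` eball x.

Lemma measurable_shell x t : measurable (shell x t).
Proof. by apply: measurableD; exact: measurable_eball. Qed.

Lemma dens_shell x t : 0 <= x -> x <= t ->
  (\int[mu]_(y in shell x t) dens y = (fine (V t) `^ P - fine (V x) `^ P)%:E)%E.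
Proof.
move=> x0 xt; have t0 := le_trans x0 xt.
have E : eball t = eball x `|` shell x t.
  apply/seteqP; split => y; last by case=> [|[]//]; exact: le_eball.
  by move=> yt; have [yx|yx] := pselect (eball x y); [left|right].
have : (\int[mu]_(y in eball t) dens y =
  \int[mu]_(y in eball x) dens y + \int[mu]_(y in shell x t) dens y)%E.
  rewrite {1}E ge0_integral_setU//.
  - exact: measurable_eball.
  - exact: measurable_shell.
  - by apply: mdens; apply: measurableU; [exact: measurable_eball|exact: measurable_shell].
  - by apply/eqP; rewrite predeqE => y; split => // -[yx []].
by rewrite !dens_eball// EFinB => ->; rewrite addeAC subee ?add0e.
Qed.

Section grid.
Variable g : R -> R.
Hypothesis hg : forall y, 0 < y -> 0 < g y /\ V (g y) = y%:E.
Notation grid := (grid_at g).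

Let rad0 (M k : nat) : 0 < grid (M + k) 0. Proof. exact: grid_gt0 hg _ _. Qed.

Let rad_ni M k : grid (M + k.+1) 0 <= grid (M + k) 0.
Proof.
have <- : grid (M + k.+1) 1 = grid (M + k) 0.
  by have := gridSS g 1 (M + k) 0; rewrite !addn1 addnS.
by rewrite ltW// (gridS_lt hV hg).
Qed.

(* the centre of the balls is a null set because [V] vanishes at 0 *)
Lemma eball_integral_le f t M B : measurable_fun setT f -> (forall y, 0 <= f y)%E ->
  (forall k, \int[mu]_(y in shell (grid (M + k) 0) t) f y <= B)%E ->
  (\int[mu]_(y in eball t) f y <= B)%E.
Proof.
move=> mf f0 hB; pose x k := grid (M + k) 0.
have mfS D : measurable_fun D f by exact: measurable_funTS.
pose Z : set Rn := eball t `&` \bigcap_k eball (x k).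
have mZ : measurable Z.
  by apply: measurableI; [|apply: bigcap_measurable => //; move=> k _]; exact: measurable_eball.
have mU : measurable (\bigcup_k shell (x k) t).
  by apply: bigcup_measurable => k _; exact: measurable_shell.
have E : eball t = Z `|` \bigcup_k shell (x k) t.
  apply/seteqP; split => y; last by case=> [[]//|[k _ []]].
  move=> yt; have [h|/existsNP[k hk]] := pselect (forall k, eball (x k) y).
    by left; split => // k _; exact: h.
  by right; exists k => //; split.
rewrite E ge0_integral_setU//; last first.
  by apply/eqP; rewrite predeqE => y; split => // -[[_ h]] [k _ [_]]; apply; exact: h.
have -> : (\int[mu]_(y in Z) f y = 0)%E.
  apply: (@dens_null _ _ _ mu complete_lebesgueRn v1 v2 p1 p2 hv1 hv2 Z f mZ) => //.
  apply/eqP; rewrite eq_le integral_ge0 ?andbT//.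
  apply/lee_addgt0Pr => e e0; rewrite add0e.
  have ep : 0 < e `^ P^-1 * 2 ^+ M by rewrite mulr_gt0 ?powR_gt0 ?exprn_gt0.
  have [k hk] := ex_pow2_lt ep.
  apply: (@le_trans _ _ (\int[mu]_(y in eball (x k)) dens y)%E).
    apply: ge0_subset_integral => //; first exact: measurable_eball.
    - by apply: mdens; exact: measurable_eball.
    - by move=> y [_]; apply.
  rewrite dens_eball ?(ltW (rad0 _ _))// lee_fin (V_grid hg)/=.
  rewrite -[leRHS](powRKV (lt0r_neq0 P0)) ?(ltW e0)//.
  apply: le_powR; rewrite ?(ltW P0) ?(ltW (grid_value_gt0 _ _))//.
  rewrite /grid_value expr0 mul1r exprD invfM mulrC ler_pdivrMr ?exprn_gt0//.
  exact: ltW.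
rewrite add0e.
have ndS : nondecreasing_seq (fun k => shell (x k) t).
  apply: homo_leq => [A|A B' C|k]; first by [].
    exact: le_trans.
  apply/subsetPset => y [yt hy]; split => //; apply: contra_not hy.
  exact: le_eball (rad_ni M k) _.
have mS k : measurable (shell (x k) t) by exact: measurable_shell.
have := @ge0_nondecreasing_set_cvg_integral _ _ _ (fun k => shell (x k) t)
  f mu ndS mS (fun k => mfS _) (fun k y _ => f0 y).
move=> /cvg_lim <-//; apply: lime_le; last exact: nearW.
apply: ereal_nondecreasing_is_cvgn.
exact: (@ge0_nondecreasing_set_nondecreasing_integral _ _ _ (fun k => shell (x k) t)
  f mu ndS mS (fun k => mfS _) (fun k y _ => f0 y)).
Qed.

Definition shell_cell M m : set Rn := shell (grid M m) (grid M m.+1).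

Lemma cellSS k M m : shell_cell (M + k) (m + k) = shell_cell M m.
Proof. by rewrite /shell_cell -addSn !gridSS. Qed.

Lemma measurable_cell M m : measurable (shell_cell M m). Proof. exact: measurable_shell. Qed.

Lemma trivIset_cell M : trivIset setT (shell_cell M).
Proof.
have h i j y : (i < j)%N -> shell_cell M i y -> shell_cell M j y -> False.
  move=> ij [y1 _] [_]; apply; apply: le_eball y1.
  exact: (grid_le hV hg).
move=> i j _ _ [y [yi yj]]; have [ij|ji|//] := ltngtP i j.
  by case: (h i j y).
by case: (h j i y).
Qed.

Lemma dens_cell M m :
  (\int[mu]_(y in shell_cell M m) dens y = (grid_value M m `^ P * (2 `^ P - 1))%:E)%E.
Proof.
rewrite dens_shell ?(ltW (grid_gt0 hg _ _)) ?(ltW (gridS_lt hV hg _ _))//.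
rewrite !(V_grid hg)/= grid_valueS powRM ?(ltW (grid_value_gt0 _ _))//.
by congr (_%:E); ring.
Qed.

Lemma cells_integral f M a b : measurable_fun setT f -> (forall y, 0 <= f y)%E ->
  (a <= b)%N -> (\int[mu]_(y in shell (grid M a) (grid M b)) f y =
  \sum_(a <= i < b) \int[mu]_(y in shell_cell M i) f y)%E.
Proof.
move=> mf f0 ab; have E : shell (grid M a) (grid M b) = \big[setU/set0]_(a <= i < b) shell_cell M i.
  elim: b ab => [|b IH].
    by rewrite leqn0 => /eqP ->; rewrite big_geq// /shell setDv.
  rewrite leq_eqVlt => /predU1P[->|]; first by rewrite big_geq// /shell setDv.
  rewrite ltnS => ab; rewrite big_nat_recr//= -IH//; apply/seteqP; split => y.
    move=> [y1 y2]; have [yb|yb] := pselect (eball (grid M b) y); first by left.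
    by right.
  move=> [[y1 y2]|[y1 y2]]; split => //.
    by apply: le_eball y1; exact: (grid_le hV hg).
  by apply: contra_not y2; apply: le_eball; exact: (grid_le hV hg).
rewrite E ge0_integral_bigsetU//=.
- exact: measurable_cell.
- exact: iota_uniq.
- by move=> i j _ _; exact: trivIset_cell.
- exact: measurable_funTS.
Qed.

End grid.
End weights.
End Shells.

Lemma subset_integral_le d (T : measurableType d) (R : realType)
    (mu : {measure set T -> \bar R}) (A B : set T) (h : T -> \bar R) :
  measurable A -> measurable B -> measurable_fun setT h -> (forall y, 0 <= h y)%E ->
  A `<=` B -> (\int[mu]_(y in A) h y <= \int[mu]_(y in B) h y)%E.
Proof.
move=> mA mB mh h0 AB; apply: ge0_subset_integral => //.
exact: measurable_funTS.
Qed.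

(** * Transfer between functions and sequences *)

Section Transfer.
Context {R : realType} (n : nat).
Notation Rn := (euclid R n).
Notation mu := (@lebesgueRn R n).
Notation leb := (@completed_lebesgue_measure R).
Variables (p1 p2 th1 th2 : R).
Hypotheses (p20 : 0 < p2) (p21 : p2 < p1) (p2th1 : p2 < th1) (p2th2 : p2 < th2).
Variables (v1 v2 : Rn -> \bar R) (w1 w2 : R -> \bar R).
Hypotheses (hv1 : weight mu setT v1) (hv2 : weight mu setT v2).
Hypotheses (hw1 : cOmega th1%:E w1) (hw2 : Omega th2%:E w2).
Let V := Vtilde p1%:E p2%:E v1 v2.
Hypothesis hV : admissible V.
Variable g : R -> R.
Hypothesis hg : forall y, 0 < y -> 0 < g y /\ V (g y) = y%:E.
Notation grid := (@grid_at R g).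
Notation cell := (@shell_cell R n g).

Let P := arrow_exp p1 p2.
Let P0 : 0 < P. Proof. exact: arrow_exp_gt0. Qed.
Let p10 : 0 < p1. Proof. exact: lt_trans p21. Qed.
Let th10 : 0 < th1. Proof. exact: lt_trans p2th1. Qed.
Let th20 : 0 < th2. Proof. exact: lt_trans p2th2. Qed.

Definition head_grid M m := head w1 th1 (grid M m).
Definition tail_grid M m := tail w2 th2 (grid M m).
Notation Vg := (@grid_value R).
Notation linecell := (@line_cell R g).

Let x0 M m : 0 < grid M m. Proof. exact: (grid_gt0 hg). Qed.
Let xle M i j : (i <= j)%N -> grid M i <= grid M j. Proof. exact: (grid_le hV hg). Qed.

Lemma tgrid_gt0 M m : 0 < tail_grid M m. Proof. exact: (tail_gt0 hw2). Qed.
Lemma tgridS M m : tail_grid M m.+1 <= tail_grid M m.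
Proof. by apply: (tail_le th20 hw2) => //; exact: xle. Qed.

Definition ball_mass f t : \bar R := (\int[mu]_(y in eball t) (`|f y * v2 y| `^ p2))%E.
Definition coball_mass f t : \bar R := (\int[mu]_(y in ~` eball t) (`|f y * v1 y| `^ p1))%E.

Lemma inner_mass_ge0 f t : (0 <= ball_mass f t)%E.
Proof. by apply: integral_ge0 => y _; exact: poweR_ge0. Qed.
Lemma outer_mass_ge0 f t : (0 <= coball_mass f t)%E.
Proof. by apply: integral_ge0 => y _; exact: poweR_ge0. Qed.

Lemma LM_normE f : LM_norm p2%:E th2%:E w2 v2 f =
  ((\int[leb]_(t in `]0%R, +oo[) (ball_mass f t `^ (th2 / p2) * wpow w2 th2 t)) `^ th2^-1)%E.
Proof.
rewrite /LM_norm /wlnorm lnormE//; congr (_ `^ _)%E; apply: eq_integral => t _.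
rewrite lnormE// abseM poweRM ?abse_ge0// gee0_abs ?poweR_ge0// -poweRrM.
by rewrite (mulrC _ th2).
Qed.

Lemma cLM_normE f : cLM_norm p1%:E th1%:E w1 v1 f =
  ((\int[leb]_(t in `]0%R, +oo[) (coball_mass f t `^ (th1 / p1) * wpow w1 th1 t)) `^ th1^-1)%E.
Proof.
rewrite /cLM_norm /wlnorm lnormE//; congr (_ `^ _)%E; apply: eq_integral => t _.
rewrite lnormE// abseM poweRM ?abse_ge0// gee0_abs ?poweR_ge0// -poweRrM.
by rewrite (mulrC _ th1).
Qed.

Lemma measurable_mass (f v : Rn -> \bar R) (p : R) : measurable_fun setT f -> measurable_fun setT v ->
  measurable_fun setT (fun y : Rn => (`|f y * v y| `^ p)%E).
Proof.
move=> mf mv; apply: (measurableT_comp (measurable_poweR p)).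
apply: (measurableT_comp (@abse_measurable R setT)); exact: emeasurable_funM.
Qed.

Lemma inner_mass_le f s t : measurable_fun setT f -> s <= t ->
  (ball_mass f s <= ball_mass f t)%E.
Proof.
move=> mf st; apply: subset_integral_le.
- exact: measurable_eball.
- exact: measurable_eball.
- by apply: measurable_mass; [exact: mf|case: hv2].
- by move=> y; exact: poweR_ge0.
- exact: le_eball.
Qed.

Lemma outer_mass_le f s t : measurable_fun setT f -> s <= t ->
  (coball_mass f t <= coball_mass f s)%E.
Proof.
move=> mf st; apply: subset_integral_le.
- by apply: measurableC; exact: measurable_eball.
- by apply: measurableC; exact: measurable_eball.
- by apply: measurable_mass; [exact: mf|case: hv1].
- by move=> y; exact: poweR_ge0.
- by apply: subsetC; exact: le_eball.
Qed.

(** Shifted by one: piece [i] ends at [grid M i], so for radii in it the complement of the ball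
    contains all cells from [i] on. *)
Definition headcell M i : set R :=
  if i is i'.+1 then linecell M i' else `]0, grid M 0[%classic.

Lemma headcell_le M i t : headcell M i t -> 0 < t <= grid M i.
Proof.
case: i => [|i] /=; rewrite ?/linecell /= in_itv/= => /andP[h1 h2].
  by rewrite h1 ltW.
by rewrite h2 (lt_trans _ h1).
Qed.

Lemma headcell_trivI M : trivIset setT (headcell M).
Proof.
have h i j y : (i < j)%N -> headcell M i y -> headcell M j y -> False.
  case: j => // j; rewrite ltnS => ij /headcell_le/andP[_ yi].
  rewrite /= /linecell /= in_itv/= => /andP[+ _].
  by rewrite ltNge (le_trans yi)// xle.
move=> i j _ _ [y [yi yj]]; have [ij|ji|//] := ltngtP i j.
  by case: (h i j y).
by case: (h j i y).
Qed.

Definition headmass M i : R :=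
  if i is i'.+1 then head_grid M i `^ th1 - head_grid M i' `^ th1 else head_grid M 0 `^ th1.

Lemma headcell_mass M i :
  (\int[leb]_(t in headcell M i) wpow w1 th1 t = (headmass M i)%:E)%E.
Proof.
case: i => [|i] /=; first exact: (head_pow th10 hw1).
by apply: (head_diff th10 hw1) => //; exact: xle.
Qed.

(** Summation by parts moves the differences onto w^th1, where they are masses of the pieces. *)
Lemma cLMd_headmass M a N : cLMd p1 th1 (head_grid M) a N.+1 =
  \sum_(i < N.+1) headmass M i * (\sum_(i <= j < N.+1) a j `^ p1) `^ (th1 / p1).
Proof.
rewrite /cLMd (@abel_head _ (fun m => head_grid M m `^ th1)
  (fun m => (\sum_(m <= i < N.+1) a i `^ p1) `^ (th1 / p1)) N).
  by rewrite big_ord_recl.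
by rewrite big_geq// powR0// lt0r_neq0// divr_gt0.
Qed.

Lemma measurable_headcell M i : measurable (headcell M i : set (realL R)).
Proof. by case: i => [|i]; exact: measurable_realL_itv. Qed.

Lemma headcell_pos M i : headcell M i `<=` `]0, +oo[.
Proof. by move=> t /headcell_le/andP[t0 _]; rewrite /= in_itv/= t0. Qed.

Section upper.
Variable f : Rn -> \bar R.
Hypothesis fX : carrier (cLM p1%:E th1%:E w1 v1) f.
Let mf : measurable_fun setT f. Proof. by case: fX. Qed.
Let mv1 : measurable_fun setT (fun y => `|f y * v1 y| `^ p1)%E.
Proof. by apply: measurable_mass; [exact: mf|case: hv1]. Qed.
Let mv2 : measurable_fun setT (fun y => `|f y * v2 y| `^ p2)%E.
Proof. by apply: measurable_mass; [exact: mf|case: hv2]. Qed.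

Definition cellnorm M m : R :=
  fine (\int[mu]_(y in cell M m) (`|f y * v1 y| `^ p1))%E `^ p1^-1.

Lemma outer_mass_fin t : 0 < t -> (coball_mass f t < +oo)%E.
Proof.
move=> t0; case: fX => _ /(_ t t0) + _; rewrite /wlnorm lnormE//.
by apply: lty_poweRy; rewrite lt0r_neq0// invr_gt0.
Qed.

Lemma cellnorm_ge0 M m : 0 <= cellnorm M m. Proof. exact: powR_ge0. Qed.

Lemma cellnorm_pow M m :
  (\int[mu]_(y in cell M m) (`|f y * v1 y| `^ p1) = (cellnorm M m `^ p1)%:E)%E.
Proof.
have i0 : (0 <= \int[mu]_(y in cell M m) (`|f y * v1 y| `^ p1))%E.
  by apply: integral_ge0 => y _; exact: poweR_ge0.
rewrite /cellnorm powRKV ?lt0r_neq0 ?fine_ge0// fineK// ge0_fin_numE//.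
apply: le_lt_trans (outer_mass_fin (x0 M m)).
apply: subset_integral_le.
- exact: measurable_cell.
- by apply: measurableC; exact: measurable_eball.
- exact: mv1.
- by move=> y; exact: poweR_ge0.
- by move=> y [].
Qed.

Lemma cellnormSS k M m : cellnorm (M + k) (m + k) = cellnorm M m.
Proof. by rewrite /cellnorm cellSS. Qed.

Lemma cellnorm_sum M m N :
  ((\sum_(m <= i < N) cellnorm M i `^ p1)%:E <= coball_mass f (grid M m))%E.
Proof.
have [Nm|mN] := leqP N m; first by rewrite big_geq// outer_mass_ge0.
rewrite -sumEFin; under eq_bigr do rewrite -cellnorm_pow.
rewrite -(cells_integral hV hg M mv1 (fun y => poweR_ge0 _ _) (ltnW mN)).
apply: subset_integral_le.
- exact: measurable_shell.
- by apply: measurableC; exact: measurable_eball.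
- exact: mv1.
- by move=> y; exact: poweR_ge0.
- by move=> y [].
Qed.

Let Y := (\int[leb]_(t in `]0%R, +oo[) (coball_mass f t `^ (th1 / p1) * wpow w1 th1 t))%E.

Lemma cLMd_le_cLM M N : ((cLMd p1 th1 (head_grid M) (cellnorm M) N)%:E <= Y)%E.
Proof.
have Y0 : (0 <= Y)%E.
  by apply: integral_ge0 => t _; rewrite mule_ge0 ?poweR_ge0.
case: N => [|N]; first by rewrite /cLMd big_ord0.
rewrite cLMd_headmass -sumEFin; under eq_bigr do rewrite EFinM -headcell_mass muleC.
apply: (@integral_ge_finite _ _ _ leb _ (headcell M) N.+1 _ (wpow w1 th1)
  (fun i => ((\sum_(i <= j < N.+1) cellnorm M j `^ p1) `^ (th1 / p1))%:E)) => //.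
- exact: measurable_realL_itv.
- exact: measurable_headcell.
- exact: headcell_trivI.
- by move=> i _; exact: headcell_pos.
- move=> i _; apply: (measurable_wpow th1 hw1.1.1); first exact: measurable_headcell.
  exact: headcell_pos.
- by move=> i; rewrite lee_fin powR_ge0.
- by move=> i t _; exact: wpow_ge0.
- by move=> t _; rewrite mule_ge0 ?poweR_ge0.
move=> i t _ /headcell_le/andP[_ ti]; apply: lee_wpmul2r; first exact: wpow_ge0.
rewrite -poweR_EFin; apply: gt0_ler_poweR.
- by rewrite divr_ge0 ?ltW.
- by rewrite in_itv/= leey andbT lee_fin sumr_ge0// => j _; exact: powR_ge0.
- by rewrite in_itv/= leey andbT outer_mass_ge0.
by apply: (le_trans (cellnorm_sum M i N.+1)); exact: outer_mass_le.
Qed.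

Definition cellsum M m : R := \sum_(i < m) (Vg M i * cellnorm M i) `^ p2.

Let kap : R := 2 * (2 `^ P - 1) `^ (p2 / P).
Let twoP : 0 < (2 : R) `^ P - 1.
Proof.
by rewrite subr_gt0; have := @gt0_ltr_powR R P P0 1 2; rewrite powR1 !nnegrE; apply; rewrite ?ltr1n.
Qed.
Let kap0 : 0 < kap. Proof. by rewrite mulr_gt0// powR_gt0. Qed.

Lemma inner_shell_le M N :
  (\int[mu]_(y in shell (grid M 0) (grid M N)) (`|f y * v2 y| `^ p2) <=
   (kap * cellsum M N)%:E)%E.
Proof.
rewrite (cells_integral hV hg M mv2 (fun y => poweR_ge0 _ _) (leq0n N)).
rewrite big_mkord /cellsum mulr_sumr -sumEFin; apply: lee_sum => i _.
have y0 : 0 < Vg M i `^ P * (2 `^ P - 1) by rewrite mulr_gt0 ?powR_gt0 ?grid_value_gt0.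
have := @shell_upper _ _ _ mu (@complete_lebesgueRn R n) v1 v2 p1 p2 hv1 hv2 p20 p21
  (cell M i) f (cellnorm M i `^ p1) (Vg M i `^ P * (2 `^ P - 1)) (measurable_cell g M i)
  mf (powR_ge0 _ _) y0.
rewrite cellnorm_pow (dens_cell hv1 hv2 p20 p21 hV hg) => /(_ (lexx _) (lexx _)).
move=> /le_trans; apply.
rewrite lee_fin le_eqVlt; apply/orP; left; apply/eqP.
have gv := ltW (grid_value_gt0 M i : 0 < Vg M i).
rewrite -/P -powRrM (mulrCA p1) mulfV ?mulr1 ?lt0r_neq0//.
rewrite (powRM _ (powR_ge0 _ _) (ltW twoP)) -powRrM (mulrCA P) mulfV ?mulr1 ?lt0r_neq0//.
rewrite (powRM _ gv (cellnorm_ge0 _ _)) /kap; ring.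
Qed.

Lemma cellsum_S M m k : cellsum (M + k) (m + k) <= cellsum (M + k.+1) (m + k.+1).
Proof.
rewrite !addnS [leRHS]big_ord_recl.
apply: (@le_trans _ _ (\sum_(i < m + k)
   (Vg (M + k).+1 (lift ord0 i) * cellnorm (M + k).+1 (lift ord0 i)) `^ p2)).
  apply: ler_sum => i _; rewrite /= /bump add1n -(addn1 (M + k)) -(addn1 i).
  by rewrite grid_valueSS cellnormSS.
by rewrite lerDr powR_ge0.
Qed.

(** The first [m + k] cells of the grid [M + k] fill the ball up to a null set as [k] grows, so a
    bound uniform in [k] suffices. *)
Lemma inner_mass_sup M m (L : R) : (forall k, cellsum (M + k) (m + k) <= L) ->
  (ball_mass f (grid M m) <= (kap * L)%:E)%E.
Proof.
move=> hL; apply: (eball_integral_le hv1 hv2 p20 p21 hV hg (M := M) mv2).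
  by move=> y; exact: poweR_ge0.
move=> k; rewrite -(gridSS g k M m); apply: (le_trans (inner_shell_le _ _)).
by rewrite lee_fin ler_wpM2l// ltW.
Qed.

(** For radii in the cell [m], the mass of the ball is bounded by a supremum, possibly infinite, of
    discrete sums over the finer grids [M + k]. By [sum_sup] it suffices to apply the discrete
    inequality for each [k]. *)
Lemma transfer_upper D : 0 <= D -> (forall M N a, (forall i, 0 <= a i) ->
    LMd p2 th2 (Vg M) (tail_grid M) a N <= D * cLMd p1 th1 (head_grid M) a N `^ (th2 / th1)) ->
  (LM_norm p2%:E th2%:E w2 v2 f <=
   ((kap `^ (th2 / p2) * D) `^ th2^-1)%:E * cLM_norm p1%:E th1%:E w1 v1 f)%E.
Proof.
move=> D0 hyp; pose t := th2 / p2; have t0 : 0 < t by rewrite divr_gt0.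
have Y0 : (0 <= Y)%E.
  by apply: integral_ge0 => z _; rewrite mule_ge0 ?poweR_ge0.
have Yfin : (Y < +oo)%E.
  case: fX => _ _; rewrite /= cLM_normE -/Y.
  by apply: lty_poweRy; rewrite lt0r_neq0// invr_gt0.
rewrite LM_normE cLM_normE -/Y; pose y := fine Y.
have YE : Y = y%:E by rewrite fineK// ge0_fin_numE.
have y0 : 0 <= y by rewrite fine_ge0.
have main : (\int[leb]_(z in `]0%R, +oo[) (ball_mass f z `^ t * wpow w2 th2 z) <=
   (kap `^ t * D * y `^ (th2 / th1))%:E)%E.
  rewrite (grid_exhaust hV hg); apply: integral_le_exhaust.
  - by move=> M; exact: measurable_realL_itv.
  - exact: (grid_window_nd hV hg).
  - by move=> z _; rewrite mule_ge0 ?poweR_ge0.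
  move=> M h hle; rewrite (linewindow hV hg).
  pose e m k := cellsum (M + k) (m.+1 + k) `^ t.
  pose c m := ((kap `^ t)%:E * ereal_sup (range (fun k => (e m k)%:E)))%E.
  have s0 m k : 0 <= cellsum m k by apply: sumr_ge0 => i _; exact: powR_ge0.
  have e0 m k : 0 <= e m k by exact: powR_ge0.
  have supe0 m : (0 <= ereal_sup (range (fun k => (e m k)%:E)))%E.
    apply: (@le_trans _ _ (e m 0%N)%:E); first by rewrite lee_fin.
    by apply: ereal_sup_ubound; exists 0%N.
  have hc m : (ball_mass f (grid M m.+1) `^ t <= c m)%E.
    rewrite /c; have : forall k, ((e m k)%:E <= ereal_sup (range (fun k => (e m k)%:E)))%E.
      by move=> k; apply: ereal_sup_ubound; exists k.
    move: (supe0 m); case: (ereal_sup _) => [z|_ _|//]; last first.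
      by rewrite gt0_muley ?leey// lte_fin powR_gt0.
    rewrite lee_fin => z0 hz.
    have : (ball_mass f (grid M m.+1) <= (kap * z `^ t^-1)%:E)%E.
      apply: inner_mass_sup => k; rewrite -(@le_powRP _ t)// ?powR_ge0//.
      by rewrite powRKV ?lt0r_neq0//; have := hz k; rewrite lee_fin.
    move=> hm; rewrite -EFinM -[z in leRHS](powRKV (lt0r_neq0 t0) z0) -powRM ?powR_ge0 ?(ltW kap0)//.
    rewrite -poweR_EFin; apply: gt0_ler_poweR; rewrite ?(ltW t0)//.
      by rewrite in_itv/= leey andbT inner_mass_ge0.
    by rewrite in_itv/= leey andbT lee_fin mulr_ge0 ?powR_ge0 ?(ltW kap0).
  apply: (@le_trans _ _ (\sum_(m < M + M) c m * \int[leb]_(z in linecell M m) wpow w2 th2 z)%E).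
    apply: integral_le_finite.
    - by move=> i; exact: measurable_realL_itv.
    - exact: (linecell_trivI hV hg).
    - move=> i _; apply: (measurable_wpow th2 hw2.1.1); first exact: measurable_realL_itv.
      by move=> z; rewrite /linecell /= !in_itv/= andbT => /andP[/(lt_trans (x0 _ _))].
    - by move=> i; rewrite /c mule_ge0 ?lee_fin ?powR_ge0.
    - by move=> i z _; exact: wpow_ge0.
    - by move=> i z _ _; rewrite lee_fin.
    move=> i z iM zi; apply: (@le_trans _ _ (ball_mass f z `^ t * wpow w2 th2 z)%E).
      by apply: hle; rewrite (linewindow hV hg) -bigcup_mkord; exists i.
    apply: lee_wpmul2r; first exact: wpow_ge0.
    apply: le_trans (hc i); apply: gt0_ler_poweR; rewrite ?(ltW t0)//.
    - by rewrite in_itv/= leey andbT inner_mass_ge0.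
    - by rewrite in_itv/= leey andbT inner_mass_ge0.
    by apply: inner_mass_le => //; move: zi; rewrite /linecell /= in_itv/= => /andP[].
  have dm i : (\int[leb]_(z in linecell M i) wpow w2 th2 z =
      (tail_grid M i `^ th2 - tail_grid M i.+1 `^ th2)%:E)%E.
    by apply: (tail_diff th20 hw2) => //; exact: xle.
  have dT K i : 0 <= tail_grid K i `^ th2 - tail_grid K i.+1 `^ th2.
    by rewrite subr_ge0 le_powR ?(ltW th20) ?tgridS// ltW// tgrid_gt0.
  under eq_bigr do rewrite dm /c -muleA (muleC (ereal_sup _)).
  rewrite -ge0_sume_distrr; last by move=> i _; rewrite mule_ge0 ?lee_fin.
  rewrite -mulrA EFinM; apply: lee_wpmul2l; first by rewrite lee_fin powR_ge0.
  apply: (@sum_sup _ (M + M) (fun i => tail_grid M i `^ th2 - tail_grid M i.+1 `^ th2) e) => //.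
    by move=> m k; rewrite /e le_powR ?(ltW t0)// cellsum_S.
  move=> k; rewrite lee_fin.
  have := hyp (M + k)%N (M + M + k).+1 (cellnorm (M + k)) (cellnorm_ge0 _).
  rewrite /LMd (@abel_tail _ (fun m => tail_grid (M + k) m `^ th2) (fun m => cellsum (M + k) m `^ t)); last first.
    by rewrite /cellsum big_ord0 powR0// lt0r_neq0.
  move=> hh; apply: (@le_trans _ _ (D * cLMd p1 th1 (head_grid (M + k)) (cellnorm (M + k)) (M + M + k).+1 `^ (th2 / th1))).
    (* The window of the grid [M] is matched with the indices from [k] on; the first [k] terms and
       the boundary term are nonnegative and dropped. *)
    apply: le_trans hh; rewrite (addnC (M + M) k) [X in _ <= X + _]big_split_ord /=.
    apply: (@le_trans _ _ (\sum_(i < M + M) (tail_grid (M + k) (k + i) `^ th2 -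
        tail_grid (M + k) (k + i).+1 `^ th2) * cellsum (M + k) (k + i).+1 `^ t)).
      apply: ler_sum => i _; rewrite /e /tail_grid (addnC k i) -addSn !gridSS.
      exact: lexx.
    rewrite -addrA addrCA lerDl addr_ge0//; last by rewrite mulr_ge0 ?powR_ge0.
    by apply: sumr_ge0 => i _; rewrite mulr_ge0 ?powR_ge0.
  rewrite ler_wpM2l// le_powR ?divr_ge0 ?(ltW th10) ?(ltW th20)//.
    apply: sumr_ge0 => i _; rewrite mulr_ge0 ?powR_ge0//.
    by apply: tail_diff_ge0; rewrite ?divr_gt0// => l; rewrite powR_ge0.
  by rewrite -lee_fin -YE; exact: cLMd_le_cLM.
have ti : 0 <= th2^-1 by rewrite invr_ge0 ltW.
apply: (@le_trans _ _ ((kap `^ t * D * y `^ (th2 / th1))%:E `^ th2^-1)%E).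
  apply: gt0_ler_poweR => //.
  - rewrite in_itv/= leey andbT integral_ge0// => z _.
    by rewrite mule_ge0 ?poweR_ge0.
  - by rewrite in_itv/= leey andbT lee_fin !mulr_ge0 ?powR_ge0.
rewrite YE !poweR_EFin -EFinM lee_fin powRM ?mulr_ge0 ?powR_ge0//.
by rewrite -(powRrM y) mulrAC mulfV ?mul1r// lt0r_neq0.
Qed.

End upper.
End Transfer.

(** * Test functions built from sequences *)

Section LowerTransfer.
Context {R : realType} (n : nat).
Notation Rn := (euclid R n).
Notation mu := (@lebesgueRn R n).
Notation leb := (@completed_lebesgue_measure R).
Variables (p1 p2 th1 th2 : R).
Hypotheses (p20 : 0 < p2) (p21 : p2 < p1) (p2th1 : p2 < th1) (p2th2 : p2 < th2).
Variables (v1 v2 : Rn -> \bar R) (w1 w2 : R -> \bar R).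
Hypotheses (hv1 : weight mu setT v1) (hv2 : weight mu setT v2).
Hypotheses (hw1 : cOmega th1%:E w1) (hw2 : Omega th2%:E w2).
Let V := Vtilde p1%:E p2%:E v1 v2.
Hypothesis hV : admissible V.
Variable g : R -> R.
Hypothesis hg : forall y, 0 < y -> 0 < g y /\ V (g y) = y%:E.
Notation grid := (@grid_at R g).
Notation cell := (@shell_cell R n g).

Let P := arrow_exp p1 p2.
Let P0 : 0 < P. Proof. exact: arrow_exp_gt0. Qed.
Let p10 : 0 < p1. Proof. exact: lt_trans p21. Qed.
Let th10 : 0 < th1. Proof. exact: lt_trans p2th1. Qed.
Let th20 : 0 < th2. Proof. exact: lt_trans p2th2. Qed.

Notation Vg := (@grid_value R).
Notation wgrid := (@head_grid R th1 w1 g).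
Notation tgrid := (@tail_grid R th2 w2 g).
Notation linecell := (@line_cell R g).
Notation inner_mass := (@ball_mass R n p2 v2).
Notation outer_mass := (@coball_mass R n p1 v1).

Let x0 M m : 0 < grid M m. Proof. exact: (grid_gt0 hg). Qed.
Let xle M i j : (i <= j)%N -> grid M i <= grid M j. Proof. exact: (grid_le hV hg). Qed.

Section pieces.
Variables (M N : nat).

Definition halfline_piece i : set R :=
  if i is i'.+1 then
    if (i' < N)%N then linecell M i'
    else if i' == N then `]grid M N, +oo[%classic else set0
  else `]0, grid M 0]%classic.

Lemma halfline_pieceP i t : halfline_piece i t ->
  [/\ 0 < t, (i <= N.+1)%N, (0 < i)%N -> grid M i.-1 < t & (i <= N)%N -> t <= grid M i].
Proof.
case: i => [|i] /=; first by rewrite in_itv/= => /andP[].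
case: ltnP => iN; rewrite ?/linecell /=.
  rewrite in_itv/= => /andP[h1 h2]; split => //; last exact: leqW.
  exact: lt_trans h1.
case: eqP => // ->; rewrite /= in_itv/= andbT => h1; split => //.
  exact: lt_trans h1.
Qed.

Lemma halfline_piece_trivI : trivIset setT halfline_piece.
Proof.
have h i j y : (i < j)%N -> halfline_piece i y -> halfline_piece j y -> False.
  move=> ij /halfline_pieceP[_ _ _ hi] /halfline_pieceP[_ jN hj _].
  have iN : (i <= N)%N by rewrite -ltnS (leq_trans ij).
  have := hj (leq_ltn_trans (leq0n _) ij); rewrite ltNge (le_trans (hi iN))// xle//.
  by rewrite -ltnS prednK// (leq_ltn_trans _ ij).
move=> i j _ _ [y [yi yj]]; have [ij|ji|//] := ltngtP i j.
  by case: (h i j y).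
by case: (h j i y).
Qed.

Lemma measurable_halfline_piece i : measurable (halfline_piece i : set (realL R)).
Proof.
case: i => [|i] /=; first exact: measurable_realL_itv.
by case: ifP => _; [|case: ifP => _ //]; exact: measurable_realL_itv.
Qed.

Lemma halfline_piece_pos i : halfline_piece i `<=` `]0, +oo[.
Proof. by move=> t /halfline_pieceP[t0 _ _ _]; rewrite /= in_itv/= t0. Qed.

Lemma halfline_piece_cover :
  (`]0, +oo[%classic : set R) = \big[setU/set0]_(i < N.+2) halfline_piece i.
Proof.
have E k : (k <= N)%N -> \big[setU/set0]_(i < k.+1) halfline_piece i = `]0, grid M k]%classic.
  elim: k => [|k IH] kN; first by rewrite big_ord1.
  rewrite big_ord_recr /= IH ?(ltnW kN)// kN -itv_bndbnd_setU ?bnd_simp//.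
    exact: (ltW (x0 _ _)).
  exact: xle.
rewrite big_ord_recr E//= ltnn eqxx -itv_bndbnd_setU ?bnd_simp//.
exact: (ltW (x0 _ _)).
Qed.

End pieces.

Let twoP : 0 < (2 : R) `^ P - 1.
Proof.
by rewrite subr_gt0; have := @gt0_ltr_powR R P P0 1 2; rewrite powR1 !nnegrE; apply; rewrite ?ltr1n.
Qed.

(** (2^P - 1)^(1/P) is the P-norm of v2 / v1 on a cell relative to [V]; the factor 1/2 comes from
    placing each mass one cell lower. *)
Let kap : R := (2 `^ P - 1) `^ P^-1 / 2.
Let kap0 : 0 < kap. Proof. by rewrite divr_gt0// powR_gt0. Qed.

Section test_function.
Variables (M N : nat) (a : nat -> R).
Hypothesis a0 : forall i, 0 <= a i.

(* the mass [a j] is carried by the cell below [grid M j], so that the truncated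
   norms of the test function dominate resp. are dominated by the discrete ones *)
Let C j := cell M.+1 j.
Let Nj j := Vg M.+1 j `^ P * (2 `^ P - 1).
Let Nj0 j : 0 < Nj j. Proof. by rewrite mulr_gt0 ?powR_gt0 ?grid_value_gt0. Qed.
Let coef j := a j / Nj j `^ p1^-1.
Let coef0 j : 0 <= coef j. Proof. by rewrite divr_ge0 ?powR_ge0. Qed.

Definition step_test (y : Rn) : \bar R :=
  ((\sum_(j < N.+1) coef j * \1_(C j) y) * test v1 v2 p1 p2 y)%:E.
Let f := step_test.

Lemma measurable_step_test : measurable_fun setT step_test.
Proof.
apply/measurable_EFinP; apply: measurable_funM.
  apply: measurable_sum => j; apply: measurable_funM; first exact: measurable_cst.
  by apply: measurable_indic; exact: measurable_cell.
exact: (measurable_test (mu := mu)).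
Qed.

Lemma step_test_cell j y : (j <= N)%N -> C j y -> f y = (coef j * test v1 v2 p1 p2 y)%:E.
Proof.
move=> jN Cj; rewrite /f /step_test; congr ((_ * _)%:E).
have jN' : (j < N.+1)%N by [].
rewrite (bigD1 (Ordinal jN'))//= big1 ?addr0.
  by rewrite indicE mem_set// mulr1.
move=> i ij; rewrite indicE memNset ?mulr0// => Ci; move/eqP: ij; apply.
by apply/val_inj; apply: (trivIset_cell hV hg (M := M.+1) Logic.I Logic.I); exists y.
Qed.

Lemma step_test_out y : (forall j, (j <= N)%N -> ~ C j y) -> f y = 0%E.
Proof.
move=> h; rewrite /f /step_test big1 ?mul0r// => j _; rewrite indicE memNset ?mulr0//.
by apply: h; rewrite -ltnS.
Qed.

Lemma step_test_integral j : (j <= N)%N ->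
  (\int[mu]_(y in C j) (`|f y * v1 y| `^ p1) = (a j `^ p1)%:E)%E /\
  (\int[mu]_(y in C j) (`|f y * v2 y| `^ p2) = ((kap * (Vg M j * a j)) `^ p2)%:E)%E.
Proof.
move=> jN.
have := @test_integral _ _ _ mu (@complete_lebesgueRn R n) v1 v2 p1 p2 hv1 hv2 p20 p21
  (C j) f (coef j) (measurable_cell g _ _) measurable_step_test (coef0 j)
  (fun y => @step_test_cell j y jN).
rewrite (dens_cell hv1 hv2 p20 p21 hV hg) -/P -/(Nj j) -!EFinM => -[-> ->].
have n1 : p1 != 0 by rewrite lt0r_neq0.
have n2 : P != 0 by rewrite lt0r_neq0.
split; congr (_%:E).
  rewrite /coef powR_div ?powR_ge0// powRKV ?(ltW (Nj0 _))// divfK//.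
  by rewrite lt0r_neq0// Nj0.
have -> : kap * (Vg M j * a j) = a j * Nj j `^ P^-1.
  have gv := ltW (grid_value_gt0 M.+1 j : 0 < Vg M.+1 j).
  rewrite /Nj (powRM _ (powR_ge0 _ _) (ltW twoP)) powRVK//.
  have -> : Vg M j = 2 * Vg M.+1 j.
    by rewrite -grid_valueS -(addn1 j) -(addn1 M) grid_valueSS.
  by rewrite /kap; field.
rewrite /coef powR_div ?powR_ge0// (powRM _ (a0 j) (powR_ge0 _ _)) -mulrA; congr (_ * _).
rewrite -!powRrM -powRN mulrC -{1}(powRr1 (ltW (Nj0 j))) -powRD_pos//; congr (_ `^ _).
have -> : P^-1 = p2^-1 - p1^-1 by rewrite /P /arrow_exp invrK.
by rewrite mulrBl mulVf// lt0r_neq0.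
Qed.

Let mv1 : measurable_fun setT (fun y => `|f y * v1 y| `^ p1)%E.
Proof. by apply: measurable_mass; [exact: measurable_step_test|case: hv1]. Qed.
Let mv2 : measurable_fun setT (fun y => `|f y * v2 y| `^ p2)%E.
Proof. by apply: measurable_mass; [exact: measurable_step_test|case: hv2]. Qed.

Lemma outer_step_test m t : (m <= N.+1)%N ->
  (forall j, (j < m)%N -> C j `<=` eball t) ->
  (outer_mass f t <= (\sum_(m <= j < N.+1) a j `^ p1)%:E)%E.
Proof.
move=> mN hm; pose U : set Rn := shell (grid M.+1 m) (grid M.+1 N.+1).
have -> : outer_mass f t = (\int[mu]_(y in ~` eball t `&` U) (`|f y * v1 y| `^ p1))%E.
  rewrite integral_mkcondr; apply: eq_integral => y /set_mem yt; rewrite /patch.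
  case: ifPn => // /negP yU; have -> : point = 0%E :> \bar R by [].
  rewrite step_test_out ?mul0e ?abse0 ?poweR0r ?lt0r_neq0// => j jN Cj.
  have [jm|mj] := ltnP j m; first by apply: yt; exact: hm Cj.
  apply: yU; apply/mem_set; case: Cj => y1 y2; split.
    by apply: le_eball y1; exact: xle.
  by apply: contra_not y2; apply: le_eball; exact: xle.
apply: (@le_trans _ _ (\int[mu]_(y in U) (`|f y * v1 y| `^ p1))%E).
  apply: subset_integral_le.
  - apply: measurableI; last exact: measurable_shell.
    by apply: measurableC; exact: measurable_eball.
  - exact: measurable_shell.
  - exact: mv1.
  - by move=> y; exact: poweR_ge0.
  - by move=> y [].
rewrite (cells_integral hV hg M.+1 mv1 (fun y => poweR_ge0 _ _) mN) -sumEFin.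
rewrite big_nat_cond [leRHS]big_nat_cond; apply: lee_sum => j /andP[/andP[_ jN] _].
by have [-> _] := step_test_integral (jN : (j <= N)%N).
Qed.

Lemma inner_step_test i : (i <= N)%N ->
  ((\sum_(j < i.+1) (kap * (Vg M j * a j)) `^ p2)%:E <= inner_mass f (grid M i))%E.
Proof.
move=> iN; rewrite -(big_mkord xpredT (fun j => (kap * (Vg M j * a j)) `^ p2)) -sumEFin.
apply: (@le_trans _ _ (\int[mu]_(y in shell (grid M.+1 0) (grid M.+1 i.+1)) (`|f y * v2 y| `^ p2))%E).
  rewrite (cells_integral hV hg M.+1 mv2 (fun y => poweR_ge0 _ _) (leq0n i.+1)).
  rewrite big_nat_cond [leRHS]big_nat_cond; apply: lee_sum => j /andP[/andP[_ ji] _].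
  by have [_ ->] := step_test_integral (leq_trans (ji : (j <= i)%N) iN).
apply: subset_integral_le.
- exact: measurable_shell.
- exact: measurable_eball.
- exact: mv2.
- by move=> y; exact: poweR_ge0.
- by move=> y [+ _]; rewrite -(addn1 M) -(addn1 i) gridSS.
Qed.

(** The last piece contributes nothing, because the test function vanishes outside the ball of
    radius [grid M N]. *)
Lemma cLM_step_test :
  (\int[leb]_(t in `]0%R, +oo[) (outer_mass f t `^ (th1 / p1) * wpow w1 th1 t) <=
   (cLMd p1 th1 (wgrid M) a N.+1)%:E)%E.
Proof.
pose F i := (\sum_(i <= j < N.+1) a j `^ p1) `^ (th1 / p1).
have F0 i : 0 <= F i by exact: powR_ge0.
rewrite (halfline_piece_cover M N).
apply: (@le_trans _ _ (\sum_(i < N.+2) (F i)%:E *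
    \int[leb]_(t in halfline_piece M N i) wpow w1 th1 t)%E).
  apply: (@integral_le_finite _ _ _ leb (halfline_piece M N) N.+2 _ (wpow w1 th1)
    (fun i => (F i)%:E)).
  - exact: measurable_halfline_piece.
  - exact: halfline_piece_trivI.
  - move=> i _; apply: (measurable_wpow th1 hw1.1.1); first exact: measurable_halfline_piece.
    exact: halfline_piece_pos.
  - by move=> i; rewrite lee_fin.
  - by move=> i t _; exact: wpow_ge0.
  - by move=> i t _ _; rewrite mule_ge0 ?poweR_ge0.
  move=> i t iN /halfline_pieceP[t0 _ ti _].
  apply: lee_wpmul2r; first exact: wpow_ge0.
  rewrite /F -poweR_EFin; apply: gt0_ler_poweR.
  - by rewrite divr_ge0 ?ltW.
  - by rewrite in_itv/= leey andbT outer_mass_ge0.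
  - by rewrite in_itv/= leey andbT lee_fin sumr_ge0// => j _; exact: powR_ge0.
  apply: outer_step_test => // j ji y [yj _].
  case: i iN ti ji => // i iN ti ji; apply: le_eball yj.
  apply: (le_trans (xle M.+1 (ji : (j.+1 <= i.+1)%N))).
  by rewrite -(addn1 M) -(addn1 i) gridSS ltW// ti.
rewrite big_ord_recr /= ltnn eqxx {2}/F big_geq// powR0 ?mul0e ?adde0; last first.
  by rewrite lt0r_neq0// divr_gt0.
rewrite (cLMd_headmass p20 p21 p2th1) -sumEFin; apply: lee_sum => i _; rewrite -/(F i) EFinM muleC.
apply: lee_wpmul2r; first by rewrite lee_fin.
case: i => -[|i] iN /=; first rewrite (wpow_close _ hw1.1.1 (x0 M 0)).
  by rewrite (head_pow _ hw1).
rewrite (iN : (i < N)%N) (head_diff _ hw1)//; exact: xle.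
Qed.

(** Piece 0 is dropped. For radii in piece [i.+1] the ball contains the one of radius [grid M i],
    which carries the masses of index up to [i]. *)
Lemma LM_step_test :
  ((kap `^ th2 * LMd p2 th2 (Vg M) (tgrid M) a N.+1)%:E <=
   \int[leb]_(t in `]0%R, +oo[) (inner_mass f t `^ (th2 / p2) * wpow w2 th2 t))%E.
Proof.
pose E i := (\sum_(j < i) (Vg M j * a j) `^ p2).
have E0 i : 0 <= E i by apply: sumr_ge0 => j _; exact: powR_ge0.
rewrite /LMd (@abel_tail _ (fun m => tgrid M m `^ th2) (fun m => E m `^ (th2 / p2))); last first.
  by rewrite /E big_ord0 powR0// lt0r_neq0// divr_gt0.
pose T i := if (i < N)%N then tgrid M i `^ th2 - tgrid M i.+1 `^ th2 else tgrid M i `^ th2.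
have -> : \sum_(m < N) (tgrid M m `^ th2 - tgrid M m.+1 `^ th2) * E m.+1 `^ (th2 / p2) +
    tgrid M N `^ th2 * E N.+1 `^ (th2 / p2) = \sum_(m < N.+1) T m * E m.+1 `^ (th2 / p2).
  rewrite big_ord_recr /= /T ltnn; congr (_ + _); apply: eq_bigr => i _.
  by rewrite ltn_ord.
rewrite mulr_sumr -sumEFin.
apply: (@le_trans _ _ (\sum_(i < N.+1) (kap `^ th2 * E i.+1 `^ (th2 / p2))%:E *
    \int[leb]_(t in halfline_piece M N i.+1) wpow w2 th2 t)%E).
  apply: lee_sum => i _; rewrite mulrCA mulrC EFinM.
  apply: lee_wpmul2l; first by rewrite lee_fin mulr_ge0 ?powR_ge0.
  rewrite /T /=; case: ltnP => iN; first by rewrite (tail_diff _ hw2)//; exact: xle.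
  have -> : i = N :> nat by apply/eqP; rewrite eqn_leq iN -ltnS ltn_ord.
  by rewrite eqxx (tail_pow _ hw2).
apply: (@integral_ge_finite _ _ _ leb _ (fun i => halfline_piece M N i.+1) N.+1 _ _
  (fun i => (kap `^ th2 * E i.+1 `^ (th2 / p2))%:E)).
- exact: measurable_realL_itv.
- by move=> i; exact: measurable_halfline_piece.
- by move=> i j _ _ /(halfline_piece_trivI Logic.I Logic.I)[].
- by move=> i _; exact: halfline_piece_pos.
- move=> i _; apply: (measurable_wpow th2 hw2.1.1); first exact: measurable_halfline_piece.
  exact: halfline_piece_pos.
- by move=> i; rewrite lee_fin mulr_ge0 ?powR_ge0.
- by move=> i t _; exact: wpow_ge0.
- by move=> t _; rewrite mule_ge0 ?poweR_ge0.
move=> i t iN /halfline_pieceP[t0 _ /(_ isT) ti _].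
apply: lee_wpmul2r; first exact: wpow_ge0.
have e1 : kap `^ th2 = (kap `^ p2) `^ (th2 / p2).
  by rewrite -powRrM mulrCA mulfV ?mulr1// lt0r_neq0.
rewrite e1 -powRM ?powR_ge0// -poweR_EFin; apply: gt0_ler_poweR.
- by rewrite divr_ge0 ?ltW.
- by rewrite in_itv/= leey andbT lee_fin mulr_ge0 ?powR_ge0.
- by rewrite in_itv/= leey andbT inner_mass_ge0.
apply: (@le_trans _ _ (inner_mass f (grid M i))); last first.
  by apply: (inner_mass_le p2 hv2 measurable_step_test); exact: (ltW ti).
apply: le_trans (inner_step_test (iN : (i <= N)%N)); rewrite lee_fin /E mulr_sumr.
apply: ler_sum => j _; rewrite (powRM _ (ltW kap0))// mulr_ge0//.
exact/ltW/grid_value_gt0.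
Qed.

End test_function.

Lemma transfer_lower c : 0 <= c ->
  (forall f, carrier (cLM p1%:E th1%:E w1 v1) f ->
    (LM_norm p2%:E th2%:E w2 v2 f <= c%:E * cLM_norm p1%:E th1%:E w1 v1 f)%E) ->
  forall M, lower_hyp p1 p2 th1 th2 (Vg M) (wgrid M) (tgrid M) (c / kap).
Proof.
move=> c0 hc M a [|N] a0.
  by rewrite /LMd big_ord0 mulr_ge0 ?powR_ge0.
pose f := step_test M N a; have Y := cLM_step_test M N a0; have X := LM_step_test M N a0.
set y := cLMd p1 th1 (wgrid M) a N.+1 in Y *.
have y0 : 0 <= y.
  apply: sumr_ge0 => i _; rewrite mulr_ge0 ?powR_ge0//.
  by apply: tail_diff_ge0; rewrite ?divr_gt0// => l; rewrite powR_ge0.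
have i1 : 0 <= th1^-1 by rewrite invr_ge0 ltW.
have cLMf : (cLM_norm p1%:E th1%:E w1 v1 f <= (y `^ th1^-1)%:E)%E.
  rewrite (cLM_normE p20 p21 p2th1) -poweR_EFin; apply: gt0_ler_poweR => //.
  - rewrite in_itv/= leey andbT integral_ge0// => z _.
    by rewrite mule_ge0 ?poweR_ge0.
  - by rewrite in_itv/= leey andbT lee_fin.
have fX : carrier (cLM p1%:E th1%:E w1 v1) f.
  split.
  - exact: measurable_step_test.
  - move=> t t0; rewrite /wlnorm lnormE//; apply: poweR_lty.
    apply: (@le_lt_trans _ _ (\sum_(0 <= j < N.+1) a j `^ p1)%:E); last exact: ltry.
    exact: outer_step_test.
  - by apply: (le_lt_trans cLMf); rewrite ltry.
have := hc f fX; rewrite (LM_normE p20 p2th2) => h.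
have L0 : 0 <= LMd p2 th2 (Vg M) (tgrid M) a N.+1.
  apply: sumr_ge0 => i _; rewrite mulr_ge0 ?powR_ge0//.
  by apply: (@head_diff_ge0 R (fun i => (Vg M i * a i) `^ p2) i (th2/p2)); rewrite ?divr_gt0// => l; rewrite powR_ge0.
have : (kap `^ th2 * LMd p2 th2 (Vg M) (tgrid M) a N.+1) `^ th2^-1 <= c * y `^ th1^-1.
  rewrite -lee_fin -poweR_EFin.
  apply: (@le_trans _ _ (c%:E * cLM_norm p1%:E th1%:E w1 v1 f)%E); last first.
    by rewrite EFinM; apply: lee_wpmul2l cLMf; rewrite lee_fin.
  apply: le_trans h; apply: gt0_ler_poweR => //.
  - by rewrite invr_ge0 ltW.
  - by rewrite in_itv/= leey andbT lee_fin mulr_ge0 ?powR_ge0.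
  - rewrite in_itv/= leey andbT integral_ge0// => z _.
    by rewrite mule_ge0 ?poweR_ge0.
have kL : 0 <= kap `^ th2 * LMd p2 th2 (Vg M) (tgrid M) a N.+1 by rewrite mulr_ge0 ?powR_ge0.
have yt : 0 <= c * y `^ th1^-1 by rewrite mulr_ge0 ?powR_ge0.
move=> /(le_powR (ltW th20) (powR_ge0 _ _)); rewrite powRKV ?lt0r_neq0//.
rewrite (powRM th2 c0 (powR_ge0 y th1^-1)) -(powRrM y) (mulrC th1^-1) => h2.
by rewrite powR_div ?(ltW kap0)// mulrAC ler_pdivlMr ?powR_gt0// mulrC.
Qed.

End LowerTransfer.

(** * Stieltjes integrals on dyadic grids *)

Section GridSums.
Context {R : realType}.
Implicit Types (V F : nat -> R) (rho : R).

Definition gsum V F rho i := \sum_(l < i) V l `^ rho * (F l - F l.+1).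

(** Where [V] is frozen, from the index [i] on, the differences telescope. *)
Lemma gsum_cut V F rho i n :
  \sum_(l < i + n) V (minn l i) `^ rho * (F l - F l.+1) =
  gsum V F rho i + V i `^ rho * (F i - F (i + n)%N).
Proof.
elim: n => [|n IH].
  rewrite addn0 subrr mulr0 addr0; apply: eq_bigr => l _.
  by rewrite (minn_idPl (ltnW (ltn_ord l))).
rewrite addnS big_ord_recr /= IH (minn_idPr (leq_addr n i)); ring.
Qed.

Lemma gsum_cut_le V F rho i N : (forall l, 0 <= F l) -> (forall l, F l.+1 <= F l) ->
  \sum_(l < N) V (minn l i) `^ rho * (F l - F l.+1) <=
  gsum V F rho i + V i `^ rho * F i.
Proof.
move=> F0 FS; apply: (@le_trans _ _ (\sum_(l < i + N) V (minn l i) `^ rho * (F l - F l.+1))).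
  rewrite addnC big_split_ord /= lerDl sumr_ge0// => l _.
  by rewrite mulr_ge0 ?powR_ge0// subr_ge0.
by rewrite gsum_cut lerD2l ler_wpM2l ?powR_ge0// gerBl.
Qed.

End GridSums.

(** * Stieltjes integrals of step functions on the grids *)

Section StieltjesGrid.
Context {R : realType}.
Variable V : R -> \bar R.
Hypothesis hV : admissible V.
Variable g : R -> R.
Hypothesis hg : forall y, 0 < y -> 0 < g y /\ V (g y) = y%:E.
Notation grid := (@grid_at R g).
Notation Vg := (@grid_value R).
Notation linecell := (@line_cell R g).

Let x0 M m : 0 < grid M m. Proof. exact: (grid_gt0 hg). Qed.
Let xle M i j : (i <= j)%N -> grid M i <= grid M j. Proof. exact: (grid_le hV hg). Qed.

Lemma grid_unbounded M T : exists n, forall i, (n <= i)%N -> T <= grid M i.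
Proof.
have [T0|T0] := leP T 0; first by exists 0%N => i _; rewrite (le_trans T0)// ltW.
have [m hm] := ex_pow2_gt (fine (V T)); exists (M + m)%N => i /(xle M); apply: le_trans.
rewrite -(V_le hV) ?(ltW T0) ?(ltW (x0 _ _))// (V_grid hg) (admissible_fin hV) ?(ltW T0)//.
rewrite lee_fin; apply: (le_trans (ltW hm)).
by rewrite /grid_value exprD mulrAC mulfV ?mul1r// lt0r_neq0// exprn_gt0.
Qed.

Lemma linecell_gt0 M i t : linecell M i t -> 0 < t.
Proof. by rewrite /linecell /= in_itv/= => /andP[/(lt_trans (x0 _ _))]. Qed.

Lemma linecellSS k M i : linecell (M + k) (i + k) = linecell M i.
Proof. by rewrite /linecell -addSn !gridSS. Qed.

Lemma V_linecell M i t : linecell M i t ->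
  exists2 y, V t = y%:E & Vg M i < y <= 2 * Vg M i.
Proof.
move=> ti; have t0 := linecell_gt0 ti; exists (fine (V t)).
  by rewrite -admissible_fin// ltW.
move: ti; rewrite /linecell /= in_itv/= => /andP[h1 h2]; rewrite -!lte_fin -lee_fin.
rewrite -admissible_fin ?(ltW t0)// -grid_valueS -!(V_grid hg).
by rewrite admissible_lt ?(ltW (x0 _ _))// V_le ?(ltW (x0 _ _)) ?(ltW t0).
Qed.

Implicit Types (f : R -> \bar R) (t rho a b e L : R) (B : \bar R).
Variables (G F : R -> R).
Hypothesis ndG : nondecreasing_pos G.
Hypothesis massG : forall (nd : nondecreasing_pos G) a b, 0 < a -> a <= b ->
  stieltjes nd `]a, b] = (F a - F b)%:E.
Hypothesis F0 : forall t, 0 < t -> 0 <= F t.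
Hypothesis F_le : forall s t, 0 < s -> s <= t -> F t <= F s.

Notation Fg M := (fun l => F (grid M l)).
Let Fg0 M l : 0 <= Fg M l. Proof. exact: F0. Qed.
Let FgS M l : Fg M l.+1 <= Fg M l. Proof. by apply: F_le => //; exact: xle. Qed.

Lemma stieltjes_integral_ge f (c : nat -> R) M N : (forall l, 0 <= c l) ->
  (forall t, (0 < t)%R -> 0 <= f t)%E ->
  (forall l t, (l < N)%N -> linecell M l t -> ((c l)%:E <= f t)%E) ->
  ((\sum_(l < N) c l * (Fg M l - Fg M l.+1))%:E <= stieltjes_integral G f)%E.
Proof.
move=> c0 f0 hc; rewrite /stieltjes_integral; case: pselect => // nd.
rewrite -sumEFin; apply: le_trans; last first.
  apply: (@integral_ge_finite _ _ _ (stieltjes nd) `]0, +oo[%classic (linecell M) N f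
    (fun=> 1%E) (fun l => (c l)%:E)).
  - exact: measurable_itv.
  - by move=> l; exact: measurable_itv.
  - exact: (linecell_trivI hV hg).
  - by move=> l _ t /linecell_gt0 t0; rewrite /= in_itv/= t0.
  - by move=> l _; exact: measurable_cst.
  - by move=> l; rewrite lee_fin.
  - by [].
  - by move=> t /=; rewrite in_itv/= andbT; exact: f0.
  - by move=> l t lN tl; rewrite mule1; exact: hc tl.
apply: lee_sum => l _; rewrite integral_cst//=; last exact: measurable_itv.
by rewrite mul1e /linecell massG// xle.
Qed.

Lemma stieltjes_integral_le f (c : nat -> nat -> \bar R) M B :
  (forall t, (0 < t)%R -> 0 <= f t)%E -> (forall k l, 0 <= c k l)%E ->
  (forall k l t, (l < (M + k) + (M + k))%N -> linecell (M + k) l t -> (f t <= c k l)%E) ->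
  (forall k, \sum_(l < (M + k) + (M + k)) c k l * (Fg (M + k)%N l - Fg (M + k)%N l.+1)%:E <= B)%E ->
  (stieltjes_integral G f <= B)%E.
Proof.
move=> f0 c0 hc hB; rewrite /stieltjes_integral; case: pselect => // nd.
have -> : (`]0, +oo[%classic : set R) =
    \bigcup_k `]grid (M + k)%N 0, grid (M + k)%N (M + k + (M + k))%N]%classic.
  rewrite (grid_exhaust hV hg); apply/seteqP; split => x [k _ xk].
    exists k => //; have /subsetPset := grid_window_nd hV hg (leq_addl M k); apply.
    exact: xk.
  by exists (M + k)%N.
apply: integral_le_exhaust.
- by move=> k; exact: measurable_itv.
- by move=> k l kl; apply: (grid_window_nd hV hg); rewrite leq_add2l.
- move=> t [k _]; rewrite /= in_itv/= => /andP[h _]; apply: f0; exact: lt_trans h.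
move=> k h hf; apply: le_trans (hB k); rewrite (linewindow hV hg).
apply: (@le_trans _ _ (\sum_(l < M + k + (M + k)) c k l *
   \int[stieltjes nd]_(t in linecell (M + k) l) (1 : \bar R))%E).
  apply: integral_le_finite.
  - by move=> l; exact: measurable_itv.
  - exact: (linecell_trivI hV hg).
  - by move=> l _; exact: measurable_cst.
  - exact: c0.
  - by [].
  - by move=> l t _ _; rewrite lee_fin.
  move=> l t lN tl; rewrite mule1; apply: le_trans (hc k l t lN tl).
  by apply: hf; rewrite (linewindow hV hg) -bigcup_mkord; exists l.
apply: lee_sum => l _; rewrite integral_cst//=; last exact: measurable_itv.
by rewrite mul1e /linecell massG// xle.
Qed.

(** The number of cells beyond [i] is unbounded, so the telescoped part F_i - F_(i+n) comes
    arbitrarily close to at least F_i - L. *)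
Lemma stieltjes_cut_ge f rho a M i L : 0 <= a -> (forall t, (0 < t)%R -> 0 <= f t)%E ->
  (forall l t, linecell M l t -> ((a * Vg M (minn l i) `^ rho)%:E <= f t)%E) ->
  (forall e, 0 < e -> exists2 T, 0 < T & forall t, T <= t -> F t <= L + e) ->
  ((a * (gsum (Vg M) (Fg M) rho i + Vg M i `^ rho * (F (grid M i) - L)))%:E <=
    stieltjes_integral G f)%E.
Proof.
move=> a0 f0 hf hL; apply/lee_addgt0Pr => e e0.
(* The summand 1 keeps the divisor positive when [a = 0]. *)
have v0 : 0 < a * Vg M i `^ rho + 1 by rewrite ltr_wpDl// mulr_ge0 ?powR_ge0.
have [T T0 hT] := hL (e / (a * Vg M i `^ rho + 1)) (divr_gt0 e0 v0).
have [n hn'] := grid_unbounded M T; have hn := hn' (i + n)%N (leq_addl _ _).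
have := @stieltjes_integral_ge f (fun l => a * Vg M (minn l i) `^ rho) M (i + n)
  (fun l => mulr_ge0 a0 (powR_ge0 _ _)) f0 (fun l t _ => hf l t).
under eq_bigr do rewrite -mulrA.
rewrite -mulr_sumr (gsum_cut (Vg M) (Fg M)) => h.
apply: (@le_trans _ _ ((a * (gsum (Vg M) (Fg M) rho i + Vg M i `^ rho *
    (F (grid M i) - F (grid M (i + n)%N))))%:E + e%:E)%E); last by rewrite leeD2r.
rewrite -EFinD lee_fin -[e in leRHS](@divfK _ (a * Vg M i `^ rho + 1)) ?lt0r_neq0//.
have := hT _ hn; set d := e / _ => hd.
have d0 : 0 <= d by rewrite /d divr_ge0 ?(ltW e0) ?(ltW v0).
have v1 : 0 <= a * Vg M i `^ rho by rewrite mulr_ge0 ?powR_ge0.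
move: (gsum _ _ _ _) (Vg M i `^ rho) (F (grid M i)) (F _) v1 hd => X Y Z W v1 hd.
by nra.
Qed.

(** An upper bound must account for radii near 0, hence for all finer grids; [iota k] is the
    position of the cut in the grid [M + k]. *)
Lemma stieltjes_cut_le f rho b M (iota : nat -> nat) L : 0 <= b ->
  (forall t, (0 < t)%R -> 0 <= f t)%E ->
  (forall k l t, (l < (M + k) + (M + k))%N -> linecell (M + k) l t ->
     (f t <= (b * Vg (M + k) (minn l (iota k)) `^ rho)%:E)%E) ->
  (forall k, gsum (Vg (M + k)) (Fg (M + k)%N) rho (iota k) +
     Vg (M + k) (iota k) `^ rho * F (grid (M + k) (iota k)) <= L) ->
  (stieltjes_integral G f <= (b * L)%:E)%E.
Proof.
move=> b0 f0 hf hL.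
apply: (@stieltjes_integral_le f (fun k l => (b * Vg (M + k) (minn l (iota k)) `^ rho)%:E) M) => //.
  by move=> k l; rewrite lee_fin mulr_ge0 ?powR_ge0.
move=> k; under eq_bigr do rewrite -EFinM -mulrA.
rewrite sumEFin lee_fin -mulr_sumr ler_wpM2l//; apply: le_trans (hL k).
exact: (gsum_cut_le _ _ _ _ (Fg0 _) (FgS _)).
Qed.

End StieltjesGrid.

Section GridEstimates.
Context {R : realType}.
Variables (V : R -> \bar R) (g : R -> R).
Hypothesis hV : admissible V.
Hypothesis hg : forall y, 0 < y -> 0 < g y /\ V (g y) = y%:E.
Notation grid := (@grid_at R g).
Notation Vg := (@grid_value R).
Notation linecell := (@line_cell R g).
Implicit Types (x t a b L : R).

Let x0 M m : 0 < grid M m. Proof. exact: (grid_gt0 hg). Qed.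

Lemma grid_value_le M i j : (i <= j)%N -> Vg M i <= Vg M j.
Proof. by move=> ij; rewrite ler_pM2r ?invr_gt0 ?exprn_gt0// ler_weXn2l ?ler1n. Qed.

Lemma admissible_real t : 0 < t -> exists2 a, V t = a%:E & 0 < a.
Proof.
move=> t0; exists (fine (V t)); first by rewrite (admissible_fin hV) ?ltW.
rewrite -lte_fin -(admissible_fin hV) ?(ltW t0)//; have [_ _ V00 _] := hV.
by have := admissible_lt hV (lexx 0) t0; rewrite V00.
Qed.

Lemma calVE t x a b : V t = a%:E -> V x = b%:E -> 0 < a -> 0 < b ->
  calV V t x = (a / (a + b))%:E.
Proof.
by move=> ta xb a0 b0; rewrite /calV ta xb -EFinD inver gt_eqF ?addr_gt0.
Qed.

Lemma calV_ge0 t x : 0 < t -> 0 < x -> (0 <= calV V t x)%E.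
Proof.
move=> /admissible_real[a ta a0] /admissible_real[b xb b0].
by rewrite (calVE ta xb a0 b0) lee_fin divr_ge0 ?ltW ?addr_gt0.
Qed.

(** V(t) V(x) / (V(t) + V(x)) is comparable to the minimum of [V t] and [V x]. *)
Lemma harmonic_bounds M i l t x : linecell M l t -> linecell M i x ->
  exists2 y, (V t * calV V x t = y%:E)%E &
    Vg M (minn l i) / 2 <= y <= 2 * Vg M (minn l i).
Proof.
move=> tl xi; have [a ta /andP[a1 a2]] := V_linecell hV hg tl.
have [b xb /andP[b1 b2]] := V_linecell hV hg xi.
have a0 : 0 < a := lt_trans (grid_value_gt0 _ _) a1.
have b0 : 0 < b := lt_trans (grid_value_gt0 _ _) b1.
exists (a * (b / (b + a))); first by rewrite (calVE xb ta b0 a0) ta.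
have v0 : 0 < Vg M (minn l i) := grid_value_gt0 _ _.
have va : Vg M (minn l i) <= a by rewrite (le_trans _ (ltW a1))// grid_value_le// geq_minl.
have vb : Vg M (minn l i) <= b by rewrite (le_trans _ (ltW b1))// grid_value_le// geq_minr.
have ab0 : 0 < b + a by rewrite addr_gt0.
rewrite mulrA ler_pdivlMr// ler_pdivrMr//; apply/andP; split.
  by move: v0 va vb; move: (Vg _ _) => v v0 va vb; nra.
have [li|il] := leqP l i.
  by nra.
by nra.
Qed.

Lemma calV_bounds M i l t x : linecell M l t -> linecell M i x ->
  exists2 y, calV V t x = y%:E &
    Vg M (minn l i) / (3 * Vg M i) <= y <= 2 * Vg M (minn l i) / Vg M i.
Proof.
move=> tl xi; have [a ta /andP[a1 a2]] := V_linecell hV hg tl.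
have [b xb /andP[b1 b2]] := V_linecell hV hg xi.
have v1 : 0 < Vg M i := grid_value_gt0 _ _.
have a0 : 0 < a := lt_trans (grid_value_gt0 _ _) a1.
have b0 : 0 < b := lt_trans v1 b1.
exists (a / (a + b)); first exact: calVE.
have v0 : 0 < Vg M (minn l i) := grid_value_gt0 _ _.
have va : Vg M (minn l i) <= a by rewrite (le_trans _ (ltW a1))// grid_value_le// geq_minl.
have vi : Vg M (minn l i) <= Vg M i by rewrite grid_value_le// geq_minr.
have ab0 : 0 < a + b by rewrite addr_gt0.
apply/andP; split; rewrite ler_pdivrMr ?mulr_gt0// mulrAC ler_pdivlMr//.
  move: v0 v1 va vi b1 b2; move: (Vg M i) (Vg M _) => v u u0 v0 ua uv b1 b2; nra.
have [li|il] := leqP l i.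
  by nra.
by nra.
Qed.

(** Summation by parts. It is an identity because V_(i+1)^q - V_i^q = (1 - 2^(-q)) V_(i+1)^q, which
    is the weight in [head_norm]. *)
Lemma gsum_head_norm M (tau : nat -> R) q i : 0 < q -> (forall l, 0 <= tau l) ->
  gsum (Vg M) (fun l => tau l `^ q) q i + Vg M i `^ q * tau i `^ q =
  head_norm q (fun l => tau l * Vg M l) i `^ q.
Proof.
move=> q0 t0; have v0 l : 0 <= Vg M l := ltW (grid_value_gt0 _ _).
rewrite head_norm_pow//; elim: i => [|i IH].
  by rewrite /gsum big_ord0 big_ord1 /head_weight mul1r add0r mulrC powRM.
rewrite big_ord_recr /= -IH /gsum big_ord_recr /= /head_weight /=.
rewrite (powRM _ (t0 _) (v0 _)) grid_valueS (powRM q (ler0n R 2) (v0 i)).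
have := @powRN _ 2 q; move: (2 `^ (- q)) (2 `^ q) (@powR_gt0 R 2 q (ltr0Sn _ 1)) => y z z0 ->.
by field; rewrite lt0r_neq0.
Qed.

(** Prepending [y 0] lowers the weight of the former first term from 1 to 1 - 2^(-q); the loss
    2^(-q) y_1^q is at most the new term y_0^q. *)
Lemma head_norm_shift (y z : nat -> R) q i : 0 < q -> (forall l, y l.+1 = z l) ->
  (forall l, 0 <= y l) -> y 1%N <= 2 * y 0%N -> head_norm q z i <= head_norm q y i.+1.
Proof.
move=> q0 yz y0 y1.
suff : head_norm q z i `^ q <= head_norm q y i.+1 `^ q.
  by move=> h; rewrite -(le_powRP q0 (powR_ge0 _ _) (powR_ge0 _ _)).
have h0 u : head_norm q u 0 `^ q = u 0%N `^ q.
  by rewrite (head_norm_pow u 0%N q0) big_ord1 /head_weight mul1r.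
elim: i => [|i IH]; last first.
  by rewrite (head_norm_powS z i q0) (head_norm_powS y i.+1 q0) yz lerD2r.
have el (a b : R) : a = b -> a <= b by move=> ->.
have E := etrans (head_norm_powS y 0%N q0) (congr1 (fun a => a + _) (h0 y)).
apply: (le_trans (el _ _ (h0 z))); apply: (le_trans _ (el _ _ (esym E))).
rewrite -yz; have := le_powR (ltW q0) (y0 1%N) y1; rewrite (powRM q (ler0n R 2) (y0 0%N)).
have := @powRN _ 2 q; move: (2 `^ (- q)) (2 `^ q) (@powR_gt0 R 2 q (ltr0Sn _ 1)) => a b b0 ->.
move: (y 1%N `^ q) (y 0%N `^ q) => Y Z h.
by rewrite mulrBl mul1r addrCA lerDl subr_ge0 ler_pdivrMl.
Qed.

Lemma head_max_shift (y z : nat -> R) i : (forall l, y l.+1 = z l) ->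
  head_max z i <= head_max y i.+1.
Proof.
move=> yz; elim: i => [|i IH]; first by rewrite /= le_max yz lexx orbT.
rewrite [head_max z _]/= [head_max y _]/= ge_max; apply/andP; split.
  by rewrite le_max IH.
by rewrite le_max -yz lexx orbT.
Qed.

End GridEstimates.

(** * Grid estimates for [phi2] and for the suprema and integrals over t *)

Section Profiles.
Context {R : realType}.
Variables (V : R -> \bar R) (g : R -> R).
Hypothesis hV : admissible V.
Hypothesis hg : forall y, 0 < y -> 0 < g y /\ V (g y) = y%:E.
Notation grid := (@grid_at R g).
Notation Vg := (@grid_value R).
Notation linecell := (@line_cell R g).
Implicit Types (x t a b L : R).

Let x0 M m : 0 < grid M m. Proof. exact: (grid_gt0 hg). Qed.
Let xle M i j : (i <= j)%N -> grid M i <= grid M j. Proof. exact: (grid_le hV hg). Qed.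

(* [calS] and [S0] are determined up to constants by the doubly indexed array [K];
   the indices [M + k], [i + k] denote the same grid point for all [k] *)
Definition profile c (K : nat -> nat -> R) (calS : R -> \bar R) (S0 : \bar R) :=
  [/\ forall x, 0 < x -> (0 <= calS x)%E,
    forall M i x, linecell M i x -> ((K M i / (c * Vg M i))%:E <= calS x)%E,
    forall M i x L, linecell M i x ->
      (forall k, K (M + k)%N (i + k)%N / Vg M i <= L) -> (calS x <= (c * L)%:E)%E,
    forall M i, ((K M i / c)%:E <= S0)%E &
    forall L, (forall M i, K M i <= L) -> (S0 <= (c * L)%:E)%E].

Section phi.
Variables (p2 th1 : R) (w1 : R -> \bar R).
Hypotheses (p20 : 0 < p2) (p2th1 : p2 < th1) (hw1 : cOmega th1%:E w1).
Let r := (p2^-1 - th1^-1)^-1.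
Let th10 : 0 < th1. Proof. exact: lt_trans p2th1. Qed.
Let r0 : 0 < r. Proof. by rewrite invr_gt0 subr_gt0 ltf_pV2//; exact: (lt_trans p20). Qed.
Notation wgrid := (@head_grid R th1 w1 g).
Notation omega := (total_inv w1 th1).
Notation phi := (phi2 V p2%:E th1%:E w1).

Let F t := head w1 th1 t `^ (- r).
Let F0 t : 0 < t -> 0 <= F t. Proof. by move=> _; exact: powR_ge0. Qed.
Let F_le s t : 0 < s -> s <= t -> F t <= F s.
Proof.
by move=> s0 st; apply: le_powRN; rewrite ?(ltW r0) ?(head_gt0 hw1)// (head_le th10 hw1).
Qed.
Let ndG : nondecreasing_pos (head_integrator th1%:E w1 r).
Proof. exact: (head_integrator_nd th10 hw1). Qed.
Let massG (nd : nondecreasing_pos (head_integrator th1%:E w1 r)) a b :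
  0 < a -> a <= b -> stieltjes nd `]a, b] = (F a - F b)%:E.
Proof. exact: (head_mass th10 hw1). Qed.

Lemma phiE x : phi x = (stieltjes_integral (head_integrator th1%:E w1 r)
     (fun t => (V t * calV V x t) `^ r) `^ r^-1)%E.
Proof. by rewrite /phi2 (arrowE p20 p2th1). Qed.

Lemma phi_ge0 x : (0 <= phi x)%E. Proof. by rewrite phiE poweR_ge0. Qed.

(** The integrand behaves like [V] cut at the cell of [x]. Beyond the cut the available mass is
    w^(-r) minus its limit: this is where the total norm of [w1] is lost. *)
Lemma phi_ge M i x : linecell M i x ->
  ((2^-1 * (Hsum r (Vg M) (wgrid M) i +
      Vg M i `^ r * (wgrid M i `^ (- r) - omega `^ r)) `^ r^-1)%:E <= phi x)%E.
Proof.
move=> xi; pose Y := Hsum r (Vg M) (wgrid M) i +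
      Vg M i `^ r * (wgrid M i `^ (- r) - omega `^ r).
have Y0 : 0 <= Y.
  rewrite addr_ge0 ?mulr_ge0 ?powR_ge0//.
    apply: sumr_ge0 => l _; rewrite mulr_ge0 ?powR_ge0//.
    by rewrite /jump subr_ge0; exact: F_le (xle _ _).
  by rewrite subr_ge0; have [h _] := total_invP th10 hw1 r0; exact: h.
rewrite phiE -/Y.
have := @stieltjes_cut_ge _ V hV g hg _ F ndG massG (fun t => (V t * calV V x t) `^ r)%E
  r (2^-1 `^ r) M i (omega `^ r).
rewrite -/Y => h.
have -> : 2^-1 * Y `^ r^-1 = (2^-1 `^ r * Y) `^ r^-1.
  by rewrite powRM ?powR_ge0// powRVK ?lt0r_neq0// invr_ge0 ler0n.
rewrite -poweR_EFin; apply: gt0_ler_poweR.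
- by rewrite invr_ge0 ltW.
- by rewrite in_itv/= leey andbT lee_fin mulr_ge0 ?powR_ge0.
- rewrite in_itv/= leey andbT /stieltjes_integral; case: pselect => // nd.
  by apply: integral_ge0 => t _; exact: poweR_ge0.
apply: h.
- exact: powR_ge0.
- by move=> t _; exact: poweR_ge0.
- move=> l t tl; have [y -> /andP[h _]] := harmonic_bounds hV hg tl xi.
  rewrite poweR_EFin lee_fin -powRM ?invr_ge0 ?ler0n ?(ltW (grid_value_gt0 _ _))//.
  rewrite le_powR ?(ltW r0)//; last by rewrite mulrC.
  by rewrite mulr_ge0 ?invr_ge0 ?(ltW (grid_value_gt0 _ _)).
- move=> e e0; have [_ /(_ e e0)[T T0 hT]] := total_invP th10 hw1 r0.
  by exists T => // t Tt; have := hT t Tt; rewrite lerBlDl.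
Qed.

(** The limit of w^(-r) is dropped, and the bound is asked on all finer grids because [Hsum] gains
    cells towards 0. *)
Lemma phi_le M i x L : linecell M i x ->
  (forall k, Hsum r (Vg (M + k)) (wgrid (M + k)) (i + k) +
    (Vg (M + k) (i + k)%N / wgrid (M + k) (i + k)) `^ r <= L) ->
  (phi x <= (2 * L `^ r^-1)%:E)%E.
Proof.
move=> xi hL; have L0 : 0 <= L.
  apply: le_trans (hL 0%N); rewrite addr_ge0 ?powR_ge0//.
  apply: sumr_ge0 => l _; rewrite mulr_ge0 ?powR_ge0//.
  by rewrite /jump subr_ge0; exact: F_le (xle _ _).
rewrite phiE.
have h := @stieltjes_cut_le _ V hV g hg _ F ndG massG F0 F_le
  (fun t => (V t * calV V x t) `^ r)%E r (2 `^ r) M (fun k => (i + k)%N) L.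
have -> : 2 * L `^ r^-1 = (2 `^ r * L) `^ r^-1.
  by rewrite powRM ?powR_ge0// powRVK ?lt0r_neq0.
rewrite -poweR_EFin; apply: gt0_ler_poweR.
- by rewrite invr_ge0 ltW.
- rewrite in_itv/= leey andbT /stieltjes_integral; case: pselect => // nd.
  by apply: integral_ge0 => t _; exact: poweR_ge0.
- by rewrite in_itv/= leey andbT lee_fin mulr_ge0 ?powR_ge0.
apply: h.
- exact: powR_ge0.
- by move=> t _; exact: poweR_ge0.
- move=> k l t _ tl; rewrite -(linecellSS g k) in xi.
  have [y -> /andP[h1 h2]] := harmonic_bounds hV hg tl xi.
  rewrite poweR_EFin lee_fin -powRM ?ler0n ?(ltW (grid_value_gt0 _ _))//.
  rewrite le_powR ?(ltW r0)//.
  by apply: le_trans h1; rewrite divr_ge0 ?(ltW (grid_value_gt0 _ _)).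
- move=> k; have w0 : 0 < wgrid (M + k) (i + k) by exact: (head_gt0 hw1 (x0 _ _)).
  apply: le_trans (hL k); rewrite lerD2l.
  by rewrite powR_div ?(ltW w0) ?(ltW (grid_value_gt0 _ _))// -powRN.
Qed.

End phi.

Section maximum.
Variables (th2 : R) (w2 : R -> \bar R).
Hypotheses (th20 : 0 < th2) (hw2 : Omega th2%:E w2).
Notation tgrid := (@tail_grid R th2 w2 g).
Notation w2_tail := (fun t => lnorm (@completed_lebesgue_measure R) th2%:E `]t, +oo[ w2).

Let Kmax M := head_max (fun l => tgrid M l * Vg M l).

Let t0 M l : 0 < tgrid M l. Proof. exact: (tail_gt0 hw2). Qed.
Let v0 M l : 0 < Vg M l. Proof. exact: grid_value_gt0. Qed.
Let y0 M l : 0 < tgrid M l * Vg M l. Proof. by rewrite mulr_gt0. Qed.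
Let t_le M i j : (i <= j)%N -> tgrid M j <= tgrid M i.
Proof. by move=> ij; apply: (tail_le th20 hw2) => //; exact: xle. Qed.

Let Kmax_ge M l i : (l <= i)%N -> tgrid M l * Vg M l <= Kmax M i.
Proof.
rewrite /Kmax; elim: i => [|i IH]; first by rewrite leqn0 => /eqP->.
rewrite leq_eqVlt ltnS => /predU1P[->|/IH h] /=; first by rewrite le_max lexx orbT.
by rewrite le_max h.
Qed.

Let Kmax_attained M i : exists2 l, (l <= i)%N & Kmax M i = tgrid M l * Vg M l.
Proof.
rewrite /Kmax; elim: i => [|i [l li IH]]; first by exists 0%N.
rewrite /= IH; case: (leP (tgrid M l * Vg M l) (tgrid M i.+1 * Vg M i.+1)) => _.
  by exists i.+1.
by exists l => //; exact: leqW.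
Qed.

Let tail_cell M l t : linecell M l t -> exists2 y, w2_tail t = y%:E & 0 < y <= tgrid M l.
Proof.
move=> tl; have tp := linecell_gt0 hg tl; exists (tail w2 th2 t).
  exact: (lnorm_tail hw2).
rewrite (tail_gt0 hw2)//=; apply: (tail_le th20 hw2) => //.
by move: tl; rewrite /line_cell /= in_itv/= => /andP[/ltW].
Qed.

(** Beyond the cell of [x], [calV] is bounded and the tail norm of [w2] decreases, so up to a
    constant only grid points up to that cell matter, and there the supremum is [Kmax]. *)
Lemma max_profile : profile 3 Kmax
  (fun x => ereal_sup [set (calV V t x * w2_tail t)%E | t in `]0, +oo[])
  (ereal_sup [set (V t * w2_tail t)%E | t in `]0, +oo[]).
Proof.
have cell t : (`]0, +oo[%classic : set R) t -> exists M m, linecell M m t.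
  rewrite /= in_itv/= andbT => /(grid_cell hV hg)[M [m h]]; exists M, m.
  by rewrite /line_cell /= in_itv.
have inb M l : (`]0, +oo[%classic : set R) (grid M l) by rewrite /= in_itv/= x0.
split.
- move=> x xp; apply: le_trans (ereal_sup_ubound _); last first.
    by exists x => //=; rewrite in_itv/= xp.
  by rewrite mule_ge0 ?(calV_ge0 hV)// Lnorm_ge0.
- move=> M i x xi; have [b xb /andP[b1 b2]] := V_linecell hV hg xi.
  have bp := lt_trans (v0 _ _) b1; have [l li ->] := Kmax_attained M i.
  apply: le_trans (ereal_sup_ubound _); last by exists (grid M l); [exact: inb|reflexivity].
  have vl := v0 M l; have vi := v0 M i; have tl := t0 M l.
  rewrite (calVE (V_grid hg M l) xb vl bp) (lnorm_tail hw2 (x0 M l)) -/(tgrid M l) -EFinM lee_fin.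
  have vli : Vg M l <= Vg M i by exact: grid_value_le.
  rewrite [leRHS]mulrC [leRHS]mulrA ler_wpM2l ?mulr_ge0 ?(ltW vl) ?(ltW tl)//.
  rewrite lef_pV2 ?posrE ?mulr_gt0 ?addr_gt0//; move: (Vg M l) (Vg M i) vli b2 => *; lra.
- move=> M i x L xi hL; apply: ge_ereal_sup => _ [t tp <-].
  have [M' [m tm]] := cell t tp; have [y -> /andP[yp ym]] := tail_cell tm.
  (* Both cells are moved to the common grid [M + M']. *)
  rewrite -(linecellSS g M' M) in xi; rewrite -(linecellSS g M M') (addnC M') in tm.
  have E : tgrid M' m = tgrid (M + M') (m + M) by rewrite /tail_grid addnC gridSS.
  rewrite E in ym; have [c -> /andP[_ c2]] := calV_bounds hV hg tm xi.
  rewrite -EFinM lee_fin; move: (hL M'); rewrite -(grid_valueSS M' M).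
  move: (M + M')%N (m + M)%N (i + M')%N ym c2 {xi tm hL E} => N l j ym c2 hL.
  have hK : tgrid N l * Vg N (minn l j) <= Kmax N j.
    apply: le_trans (Kmax_ge N (geq_minr l j)).
    by rewrite ler_wpM2r ?(ltW (v0 _ _))//; exact: t_le (geq_minl _ _).
  have vj := v0 N j; have K0 : 0 < Kmax N j by apply: lt_le_trans hK; rewrite mulr_gt0.
  have c2' : c * Vg N j <= 2 * Vg N (minn l j) by rewrite -ler_pdivlMr.
  have hL' : Kmax N j <= L * Vg N j by rewrite -ler_pdivrMr.
  rewrite -(ler_pM2r vj) mulrAC; apply: (@le_trans _ _ (2 * Vg N (minn l j) * tgrid N l)).
    apply: (@le_trans _ _ (2 * Vg N (minn l j) * y)); first by rewrite ler_wpM2r ?(ltW yp).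
    by rewrite ler_wpM2l// mulr_ge0 ?(ltW (v0 _ _)).
  by move: hK hL' K0; move: (Kmax N j) (Vg N j) (Vg N _) (tgrid N l) => *; lra.
- move=> M i; have [l li ->] := Kmax_attained M i.
  apply: le_trans (ereal_sup_ubound _); last by exists (grid M l); [exact: inb|reflexivity].
  rewrite (V_grid hg) (lnorm_tail hw2 (x0 M l)) -/(tgrid M l) -EFinM lee_fin mulrC.
  by rewrite ler_pdivrMl// [Vg M l * _]mulrC; have := y0 M l; move: (tgrid M l * _) => *; lra.
- move=> L hL; apply: ge_ereal_sup => _ [t tp <-].
  have [M [m tm]] := cell t tp; have [y -> /andP[yp ym]] := tail_cell tm.
  have [a -> /andP[a1 a2]] := V_linecell hV hg tm; rewrite -EFinM lee_fin.
  have hK := le_trans (Kmax_ge M (leqnn m)) (hL M m).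
  have a0 := lt_trans (v0 M m) a1; have L0 : 0 <= L by apply: le_trans hK; exact/ltW.
  apply: (@le_trans _ _ (2 * Vg M m * tgrid M m)); first by rewrite ler_pM ?(ltW a0) ?(ltW yp).
  by move: hK; rewrite mulrC; move: (Vg M m) (tgrid M m) => *; lra.
Qed.

Lemma max_shift M i : Kmax M i <= Kmax M.+1 i.+1.
Proof.
apply: head_max_shift => l.
by rewrite /tail_grid -(addn1 l) -(addn1 M) gridSS grid_valueSS.
Qed.

End maximum.

Section stieltjes_norm.
Variables (p1 th2 : R) (w2 : R -> \bar R).
Hypotheses (th20 : 0 < th2) (th2p1 : th2 < p1) (hw2 : Omega th2%:E w2).
Let q := (th2^-1 - p1^-1)^-1.
Let q0 : 0 < q.
Proof. by rewrite invr_gt0 subr_gt0 ltf_pV2//; exact: (lt_trans th20). Qed.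
Notation tgrid := (@tail_grid R th2 w2 g).

Let Knorm M := head_norm q (fun l => tgrid M l * Vg M l).

Let t0 M l : 0 < tgrid M l. Proof. exact: (tail_gt0 hw2). Qed.
Let v0 M l : 0 < Vg M l. Proof. exact: grid_value_gt0. Qed.

Let F t := tail w2 th2 t `^ q.
Let F0 t : 0 < t -> 0 <= F t. Proof. by move=> _; exact: powR_ge0. Qed.
Let F_le s t : 0 < s -> s <= t -> F t <= F s.
Proof.
move=> s0 st; apply: le_powR; rewrite ?(ltW q0) ?(ltW (tail_gt0 hw2 _)) ?(lt_le_trans s0)//.
exact: (tail_le th20 hw2).
Qed.
Let ndG : nondecreasing_pos (tail_integrator th2%:E w2 q).
Proof. exact: (tail_integrator_nd th20 hw2). Qed.
Let massG (nd : nondecreasing_pos (tail_integrator th2%:E w2 q)) a b :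
  0 < a -> a <= b -> stieltjes nd `]a, b] = (F a - F b)%:E.
Proof. exact: (tail_mass th20 hw2). Qed.

Let F_small e : 0 < e -> exists2 T, 0 < T & forall t, T <= t -> F t <= 0 + e.
Proof.
move=> e0; have [T T0 hT] := tail_small th20 hw2 (powR_gt0 q^-1 e0); exists T => // t Tt.
have tp := lt_le_trans T0 Tt; rewrite add0r -[e](powRKV (lt0r_neq0 q0) (ltW e0)).
by apply: le_powR; rewrite ?(ltW q0) ?(ltW (tail_gt0 hw2 _))// hT.
Qed.

Let gsumE M i : gsum (Vg M) (fun l => F (grid M l)) q i + Vg M i `^ q * F (grid M i) =
  Knorm M i `^ q.
Proof. by rewrite /Knorm -gsum_head_norm// => l; exact: ltW. Qed.

Let K0 M i : 0 <= Knorm M i. Proof. exact: powR_ge0. Qed.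

Notation dw2 := (tail_integrator th2%:E w2 q).
Notation J := (fun x => stieltjes_integral dw2 (fun t => calV V t x `^ q))%E.
Notation J0 := (stieltjes_integral dw2 (fun t => V t `^ q))%E.

Let int_ge0 f : (forall t, (0 <= f t)%E) -> (0 <= stieltjes_integral dw2 f)%E.
Proof.
by move=> f0; rewrite /stieltjes_integral; case: pselect => // nd; exact: integral_ge0.
Qed.

Let ge_root a b c f : 0 <= a -> 0 <= b -> (((a * b) `^ q)%:E <= stieltjes_integral dw2 f)%E ->
  (forall t, (0 <= f t)%E) -> c = a * b -> (c%:E <= stieltjes_integral dw2 f `^ q^-1)%E.
Proof.
move=> a0 b0 h f0 ->; rewrite -[a * b](powRVK (lt0r_neq0 q0)) ?mulr_ge0// -poweR_EFin.
apply: gt0_ler_poweR => //.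
- by rewrite invr_ge0 ltW.
- by rewrite in_itv/= leey andbT ?int_ge0// lee_fin powR_ge0.
by rewrite in_itv/= leey andbT ?int_ge0// lee_fin powR_ge0.
Qed.

Let le_root a f : 0 <= a -> (stieltjes_integral dw2 f <= (a `^ q)%:E)%E ->
  (forall t, (0 <= f t)%E) -> (stieltjes_integral dw2 f `^ q^-1 <= a%:E)%E.
Proof.
move=> a0 h f0; rewrite -[a](powRVK (lt0r_neq0 q0))// -poweR_EFin.
apply: gt0_ler_poweR => //.
- by rewrite invr_ge0 ltW.
- by rewrite in_itv/= leey andbT ?int_ge0// lee_fin powR_ge0.
by rewrite in_itv/= leey andbT ?int_ge0// lee_fin powR_ge0.
Qed.

(** The cut integrals are evaluated exactly by [gsum_head_norm]; as [F] tends to 0 at infinity,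
    nothing is lost in the lower bound. *)
Lemma norm_profile : profile 3 Knorm (fun x => J x `^ q^-1)%E (J0 `^ q^-1)%E.
Proof.
have J1 x t : (0 <= calV V t x `^ q)%E by exact: poweR_ge0.
have J2 t : (0 <= V t `^ q)%E by exact: poweR_ge0.
split.
- by move=> x _; exact: poweR_ge0.
- move=> M i x xi; have c0 : 0 <= (3 * Vg M i)^-1 by rewrite invr_ge0 mulr_ge0 ?(ltW (v0 _ _)).
  apply: (ge_root c0 (K0 M i)) => //; last by rewrite mulrC.
  have := @stieltjes_cut_ge _ V hV g hg dw2 F ndG massG (fun t => calV V t x `^ q)%E
    q ((3 * Vg M i)^-1 `^ q) M i 0 (powR_ge0 _ _).
  rewrite subr0 gsumE -(powRM q c0 (K0 M i)); apply => //.
  move=> l t tl; have [y -> /andP[y1 _]] := calV_bounds hV hg tl xi.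
  rewrite poweR_EFin lee_fin -(powRM q c0 (ltW (v0 _ _))); apply: le_powR.
  + exact: ltW.
  + by rewrite mulr_ge0 ?(ltW (v0 _ _)).
  + by rewrite mulrC.
- move=> M i x L xi hL; have L0 : 0 <= L.
    by apply: le_trans (hL 0%N); rewrite divr_ge0 ?(ltW (v0 _ _)).
  have c0 : 0 <= 2 / Vg M i by rewrite divr_ge0 ?(ltW (v0 _ _)).
  apply: (@le_trans _ _ (2 * L)%:E); last by rewrite lee_fin ler_wpM2r// ler_nat.
  apply: le_root => //; first by rewrite mulr_ge0.
  have := @stieltjes_cut_le _ V hV g hg dw2 F ndG massG F0 F_le (fun t => calV V t x `^ q)%E
    q ((2 / Vg M i) `^ q) M (fun k => i + k)%N ((L * Vg M i) `^ q) (powR_ge0 _ _).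
  rewrite -(powRM q c0) ?mulr_ge0 ?(ltW (v0 _ _))//.
  have -> : 2 / Vg M i * (L * Vg M i) = 2 * L by field; rewrite lt0r_neq0.
  apply => //.
  + move=> k l t _ tl; rewrite -(linecellSS g k) in xi.
    have [y -> /andP[h1 h2]] := calV_bounds hV hg tl xi.
    rewrite poweR_EFin lee_fin -(powRM q c0 (ltW (v0 _ _))); apply: le_powR.
    * exact: ltW.
    * by apply: le_trans h1; rewrite divr_ge0 ?mulr_ge0 ?(ltW (v0 _ _)).
    * by rewrite -(grid_valueSS k M i) mulrAC.
  + move=> k; rewrite gsumE; apply: le_powR; first exact: ltW.
      exact: K0.
    by rewrite -ler_pdivrMr.
- move=> M i; have c0 : 0 <= (3 : R)^-1 by rewrite invr_ge0.
  apply: (@le_trans _ _ (Knorm M i)%:E).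
    by rewrite lee_fin ler_pdivrMr// ler_peMr ?ler1n.
  apply: (ge_root ler01 (K0 M i)) => //; last by rewrite mul1r.
  have := @stieltjes_cut_ge _ V hV g hg dw2 F ndG massG (fun t => V t `^ q)%E
    q 1 M i 0 ler01.
  rewrite subr0 gsumE !mul1r; apply => //.
  move=> l t tl; have [a -> /andP[a1 _]] := V_linecell hV hg tl.
  rewrite poweR_EFin lee_fin mul1r; apply: le_powR => //.
  + exact: ltW.
  + exact: (ltW (v0 _ _)).
  + by apply: le_trans (ltW a1); apply: grid_value_le; exact: geq_minl.
- move=> L hL; have L0 : 0 <= L by apply: le_trans (hL 0%N 0%N).
  apply: (@le_trans _ _ (2 * L)%:E); last by rewrite lee_fin ler_wpM2r// ler_nat.
  apply: le_root => //; first by rewrite mulr_ge0.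
  (* Cutting at [k + k], the end of the [k]-th window, leaves [V] unchanged inside the window. *)
  have := @stieltjes_cut_le _ V hV g hg dw2 F ndG massG F0 F_le (fun t => V t `^ q)%E
    q (2 `^ q) 0%N (fun k => k + k)%N (L `^ q) (powR_ge0 _ _).
  rewrite -powRM//; apply => //.
  + move=> k l t; rewrite add0n => lk tl; have [a -> /andP[a1 a2]] := V_linecell hV hg tl.
    rewrite poweR_EFin lee_fin -(powRM q (ler0n R 2) (ltW (v0 _ _))); apply: le_powR.
    * exact: ltW.
    * by apply: le_trans (ltW a1); exact: ltW.
    * by rewrite (minn_idPl (ltnW lk)).
  + move=> k; rewrite gsumE; apply: le_powR; first exact: ltW.
      exact: K0.
    exact: hL.
Qed.

Lemma norm_shift M i : Knorm M i <= Knorm M.+1 i.+1.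
Proof.
apply: (head_norm_shift _ q0).
- by move=> l; rewrite /tail_grid -(addn1 l) -(addn1 M) gridSS grid_valueSS.
- by move=> l; rewrite mulr_ge0 ?(ltW (t0 _ _)) ?(ltW (v0 _ _)).
rewrite grid_valueS mulrCA ler_wpM2l// ler_wpM2r ?(ltW (v0 _ _))//.
by apply: (tail_le th20 hw2) => //; exact: xle.
Qed.

End stieltjes_norm.
End Profiles.

(** * The norm of the embedding *)

(** By monotonicity, mixed products are bounded by products at the larger index. A fixed [a k] thus
    bounds [P], and then a positive [P] bounds [S]; if [P = 0], the product is 0 even for infinite
    [S]. *)
Lemma prod_sup (R : realType) (al be : R) (a b : nat -> R) (z cS cP : R) (S P : \bar R) :
  0 < al -> 0 < be -> (forall k, 0 < a k) -> (forall k, 0 < b k) ->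
  (forall k, a k <= a k.+1) -> (forall k, b k <= b k.+1) ->
  (forall k, a k `^ al * b k `^ be <= z) -> 0 < cS -> 0 < cP -> (0 <= S)%E -> (0 <= P)%E ->
  (forall L, (forall k, a k <= L) -> (S <= (cS * L)%:E)%E) ->
  (forall L, (forall k, b k <= L) -> (P <= (cP * L)%:E)%E) ->
  (P `^ be * S `^ al <= (cP `^ be * cS `^ al * z)%:E)%E.
Proof.
move=> al0 be0 a0 b0 aS bS hz cS0 cP0 S0 P0 hS hP.
have am i j : (i <= j)%N -> a i <= a j by apply: (homo_leq (@lexx _ R) (@le_trans _ R)).
have bm i j : (i <= j)%N -> b i <= b j by apply: (homo_leq (@lexx _ R) (@le_trans _ R)).
have ap k : 0 < a k `^ al by exact: powR_gt0.
have z0 : 0 <= z by apply: le_trans (hz 0%N); rewrite mulr_ge0 ?powR_ge0.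
have hPk k : (P <= (cP * (z / a k `^ al) `^ be^-1)%:E)%E.
  apply: hP => l; rewrite -(le_powRP be0 (ltW (b0 l)) (powR_ge0 _ _)).
  rewrite powRKV ?lt0r_neq0 ?divr_ge0 ?powR_ge0// ler_pdivlMr// mulrC.
  apply: le_trans (hz (maxn k l)).
  by apply: ler_pM; rewrite ?powR_ge0// le_powR ?(ltW (a0 _)) ?(ltW (b0 _)) ?(ltW al0) ?(ltW be0) ?am ?bm ?leq_maxl ?leq_maxr.
case: P P0 hPk {hP} => [x|_ /(_ 0%N)|//]; last by rewrite leye_eq.
rewrite lee_fin => x0 hx; have [->|xn] := eqVneq x 0.
  by rewrite poweR_EFin powR0 ?lt0r_neq0// mul0e lee_fin !mulr_ge0 ?powR_ge0.
have xp : 0 < x by rewrite lt0r xn.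
have xb : 0 < x `^ be by exact: powR_gt0.
have hSk : (S <= (cS * (cP `^ be * z / x `^ be) `^ al^-1)%:E)%E.
  apply: hS => k; rewrite -(le_powRP al0 (ltW (a0 k)) (powR_ge0 _ _)).
  rewrite powRKV ?lt0r_neq0 ?divr_ge0 ?mulr_ge0 ?powR_ge0// ler_pdivlMr// mulrC -ler_pdivlMr//.
  have := hx k; rewrite lee_fin => /(le_powR (ltW be0) x0).
  by rewrite powRM ?powR_ge0 ?(ltW cP0)// powRKV ?lt0r_neq0 ?divr_ge0 ?powR_ge0// mulrA.
case: S S0 hSk {hS} => [y|_|//]; last by rewrite leye_eq.
rewrite !lee_fin => y0 /(le_powR (ltW al0) y0).
rewrite (powRM _ (ltW cS0) (powR_ge0 _ _)) powRKV ?lt0r_neq0 ?divr_ge0 ?mulr_ge0 ?powR_ge0// => h.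
rewrite mulrC -ler_pdivlMr//; apply: (le_trans h).
by rewrite le_eqVlt; apply/orP; left; apply/eqP; rewrite !mulrA; congr (_ / _); ring.
Qed.

(** * Comparison of the two terms of the theorem with their grid versions *)

Section Equivalence.
Context {R : realType}.
Variables (p1 p2 th1 th2 : R).
Hypotheses (p20 : 0 < p2) (p21 : p2 < p1) (p2th1 : p2 < th1) (p2th2 : p2 < th2).
Variables (w1 w2 : R -> \bar R).
Hypotheses (hw1 : cOmega th1%:E w1) (hw2 : Omega th2%:E w2).
Variables (V : R -> \bar R) (g : R -> R).
Hypothesis hV : admissible V.
Hypothesis hg : forall y, 0 < y -> 0 < g y /\ V (g y) = y%:E.
Notation grid := (@grid_at R g).
Notation Vg := (@grid_value R).
Notation linecell := (@line_cell R g).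
Notation wgrid := (@head_grid R th1 w1 g).
Notation tgrid := (@tail_grid R th2 w2 g).
Notation omega := (total_inv w1 th1).
Notation phi := (phi2 V p2%:E th1%:E w1).

Let r := (p2^-1 - th1^-1)^-1.
Let th10 : 0 < th1. Proof. exact: lt_trans p2th1. Qed.
Let th20 : 0 < th2. Proof. exact: lt_trans p2th2. Qed.
Let r0 : 0 < r. Proof. by rewrite invr_gt0 subr_gt0 ltf_pV2//; exact: (lt_trans p20). Qed.
Let x0 M m : 0 < grid M m. Proof. exact: (grid_gt0 hg). Qed.
Let xle M i j : (i <= j)%N -> grid M i <= grid M j. Proof. exact: (grid_le hV hg). Qed.
Let w0 M m : 0 < wgrid M m. Proof. exact: (head_gt0 hw1). Qed.
Let wS M m : wgrid M m <= wgrid M m.+1.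
Proof. by apply: (head_le th10 hw1) => //; exact: xle. Qed.
Let t0 M m : 0 < tgrid M m. Proof. exact: (tail_gt0 hw2). Qed.
Let v0 M l : 0 < Vg M l. Proof. exact: grid_value_gt0. Qed.

Variables (c : R) (K : nat -> nat -> R) (calS : R -> \bar R) (S0 : \bar R).
Hypotheses (c0 : 0 < c) (prof : profile g c K calS S0).
Hypothesis K0 : forall M i, 0 < K M i.

Notation X M i := (Hsum r (Vg M) (wgrid M) i +
  Vg M i `^ r * (wgrid M i `^ (- r) - omega `^ r)).
Notation N M i := (Hsum r (Vg M) (wgrid M) i + (Vg M i / wgrid M i) `^ r).

Let zeta_ge0 M i : 0 <= wgrid M i `^ (- r) - omega `^ r.
Proof. by rewrite subr_ge0; have [h _] := total_invP th10 hw1 r0; exact: h. Qed.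

Let jump0 M i : 0 <= jump r (wgrid M) i.
Proof. exact: (jump_ge0 i (ltW r0) (w0 M) (wS M)). Qed.

Let H0 M i : 0 <= Hsum r (Vg M) (wgrid M) i.
Proof. by apply: sumr_ge0 => l _; rewrite mulr_ge0 ?powR_ge0. Qed.

Let X_ge_zeta M i : Vg M i `^ r * (wgrid M i `^ (- r) - omega `^ r) <= X M i.
Proof. by rewrite lerDr. Qed.

Let X0 M i : 0 <= X M i.
Proof. by apply: le_trans (X_ge_zeta M i); rewrite mulr_ge0 ?powR_ge0. Qed.

Let X_ge_H M i : Hsum r (Vg M) (wgrid M) i.+1 <= X M i.
Proof.
rewrite [leLHS]big_ord_recr /= lerD2l ler_wpM2l ?powR_ge0// /jump lerD2l lerN2.
by have [h _] := total_invP th10 hw1 r0; exact: h.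
Qed.

Let H_le M i : Hsum r (Vg M) (wgrid M) i <= Hsum r (Vg M) (wgrid M) i.+1.
Proof. by rewrite [leRHS]big_ord_recr lerDl mulr_ge0 ?powR_ge0. Qed.

Let N0 M i : 0 < N M i.
Proof. by rewrite ltr_wpDl// powR_gt0// divr_gt0. Qed.

Let NS M i : N M i <= N M.+1 i.+1.
Proof.
have E l : wgrid M.+1 l.+1 = wgrid M l by rewrite /head_grid -(addn1 l) -(addn1 M) gridSS.
have E' l : Vg M.+1 l.+1 = Vg M l by rewrite -(addn1 l) -(addn1 M) grid_valueSS.
rewrite E E' lerD2r [leRHS]big_ord_recl /= -[leLHS]add0r.
apply: lerD; first exact: (mulr_ge0 (powR_ge0 _ _) (jump0 _ _)).
by apply: ler_sum => l _; rewrite /jump /bump /= add1n !E E'.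
Qed.

Let calS_ge0 x : 0 < x -> (0 <= calS x)%E. Proof. by case: prof => h _ _ _ _; exact: h. Qed.

Let cell_grid M i : linecell M i (grid M i.+1).
Proof. by rewrite /line_cell /= in_itv/= lexx andbT (gridS_lt hV hg). Qed.

Section upper.
Variable B : R.
Hypothesis B0 : 0 <= B.
Hypothesis hS0 : (omega%:E * S0 <= B%:E)%E.

Lemma total_K M i : omega * K M i <= c * B.
Proof.
case: prof => _ _ _ h _; rewrite -ler_pdivrMl// mulrCA (mulrC c^-1) -lee_fin EFinM.
apply: le_trans hS0; apply: lee_wpmul2l (h M i).
by rewrite lee_fin total_inv_ge0.
Qed.

(** The supremum bounds K/V X^(1/r), where [X] dominates both [H] and V^r (w^(-r) - omega^r). To
    bound [K / w] the missing omega^r comes from the second term, through [total_K]; adding the two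
    costs 2^(1/r). *)
Lemma grid_bounds_of_sup : (forall x, 0 < x -> (phi x * calS x <= B%:E)%E) ->
  let D := 2 `^ r^-1 * (2 * c) in forall M m,
  tgrid M m * Vg M m <= K M m ->
  tgrid M m * Hsum r (Vg M) (wgrid M) m `^ r^-1 <= D * B /\ K M m <= D * B * wgrid M m.
Proof.
move=> hB D M m tK; have r1 : 0 < r^-1 by rewrite invr_gt0.
have cB : 0 <= 2 * c * B by rewrite mulr_ge0 ?mulr_ge0 ?(ltW c0).
have h : K M m / Vg M m * X M m `^ r^-1 <= 2 * c * B.
  have := hB _ (x0 M m.+1); have := phi_ge hV hg p20 p2th1 hw1 (cell_grid M m).
  case: prof => _ /(_ _ _ _ (cell_grid M m)) h1 _ _ _ h2 h3.
  have := le_trans (lee_pmul _ _ h2 h1) h3; rewrite -EFinM !lee_fin.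
  rewrite mulr_ge0 ?powR_ge0 ?invr_ge0 ?ler0n//.
  rewrite divr_ge0 ?mulr_ge0 ?(ltW c0) ?(ltW (v0 _ _)) ?(ltW (K0 _ _))//.
  move=> /(_ isT isT); rewrite -/r invfM => h4.
  have -> : K M m / Vg M m * X M m `^ r^-1 =
      2 * c * (2^-1 * X M m `^ r^-1 * (K M m * (c^-1 / Vg M m))).
    by field; rewrite !lt0r_neq0.
  by rewrite ler_wpM2l// mulr_ge0 ?(ltW c0).
have D1 : 2 * c * B <= D * B.
  rewrite /D -[leRHS]mulrA ler_peMl//.
  by have := @ler_powR R 2 (ler1n R 2) 0 r^-1 (ltW r1); rewrite powRr0.
have tQ : tgrid M m <= K M m / Vg M m by rewrite ler_pdivlMr.
split.
  apply: le_trans D1; apply: le_trans h; apply: ler_pM; rewrite ?powR_ge0 ?(ltW (t0 _ _))//.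
  by apply: le_powR; rewrite ?(ltW r1)// (le_trans (H_le M m))// X_ge_H.
have hz : K M m `^ r * (wgrid M m `^ (- r) - omega `^ r) <= (2 * c * B) `^ r.
  apply: le_trans (le_powR (ltW r0) _ h); last first.
    by rewrite mulr_ge0 ?powR_ge0 ?divr_ge0 ?(ltW (K0 _ _)) ?(ltW (v0 _ _)).
  rewrite powRM ?powR_ge0 ?divr_ge0 ?(ltW (K0 _ _)) ?(ltW (v0 _ _))// powRKV ?lt0r_neq0//.
  rewrite powR_div ?(ltW (K0 _ _)) ?(ltW (v0 _ _))// -mulrA ler_wpM2l ?powR_ge0//.
  by rewrite ler_pdivlMl ?powR_gt0.
have hw : K M m `^ r * omega `^ r <= (2 * c * B) `^ r.
  rewrite -powRM ?(ltW (K0 _ _)) ?total_inv_ge0//; apply: le_powR; first exact: ltW.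
    by rewrite mulr_ge0 ?total_inv_ge0 ?(ltW (K0 _ _)).
  rewrite mulrC; apply: (le_trans (total_K M m)); rewrite -mulrA ler_peMl ?ler1n//.
  by rewrite mulr_ge0// ltW.
rewrite -(le_powRP r0 (ltW (K0 _ _))) ?mulr_ge0 ?powR_ge0 ?(ltW c0) ?(ltW (w0 _ _))//.
rewrite (powRM _ _ (ltW (w0 _ _))); last by rewrite !mulr_ge0 ?powR_ge0 ?(ltW c0).
rewrite -ler_pdivrMr ?powR_gt0// -powRN /D -mulrA powRM ?powR_ge0// powRKV ?lt0r_neq0//.
by rewrite -[w in _ * w <= _](subrK (omega `^ r)) mulrDr mulrDl mul1r lerD.
Qed.

Section sum.
Variable s : R.
Hypotheses (th21 : th2 < th1) (sE : s^-1 = th2^-1 - th1^-1).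
Let s0 : 0 < s. Proof. by rewrite -invr_gt0 sE subr_gt0 ltf_pV2. Qed.
Let rs : r < s.
Proof. by rewrite -ltf_pV2 ?posrE// sE invrK ltrD2r ltf_pV2. Qed.

Hypothesis hB : (stieltjes_integral (head_integrator th1%:E w1 r)
  (fun x => phi x `^ (s - r) * V x `^ r * calS x `^ s) <= (B `^ s)%:E)%E.

Lemma grid_sum_bound M n :
  \sum_(m < n) (K M m / Vg M m) `^ s * (Vg M m `^ r * jump r (wgrid M) m *
    X M m `^ (s / r - 1)) <= (2 * c * B) `^ s.
Proof.
pose cc m := (2^-1 * X M m `^ r^-1) `^ (s - r) * Vg M m `^ r * (K M m / (c * Vg M m)) `^ s.
have sr : 0 < s - r by rewrite subr_gt0.
have := @stieltjes_integral_ge _ V hV g hg _ (fun t => head w1 th1 t `^ (- r))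
  (head_integrator_nd th10 hw1 r0) (head_mass th10 hw1 (r := r))
  (fun x => phi x `^ (s - r) * V x `^ r * calS x `^ s)%E cc M n.
have cc0 m : 0 <= cc m by rewrite !mulr_ge0 ?powR_ge0.
move=> /(_ cc0) h.
have {h} : \sum_(m < n) cc m * jump r (wgrid M) m <= B `^ s.
  rewrite -lee_fin; apply: le_trans hB; apply: h.
    by move=> t tp; rewrite !mule_ge0 ?poweR_ge0.
  move=> m t _ tm; have := phi_ge hV hg p20 p2th1 hw1 tm.
  case: prof => _ /(_ _ _ _ tm) h1 _ _ _ h2; have [a ta /andP[a1 _]] := V_linecell hV hg tm.
  have k0 : 0 <= K M m / (c * Vg M m).
    by rewrite divr_ge0 ?mulr_ge0 ?(ltW c0) ?(ltW (v0 _ _)) ?(ltW (K0 _ _)).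
  have x1 : 0 <= 2^-1 * X M m `^ r^-1 by rewrite mulr_ge0 ?invr_ge0 ?powR_ge0.
  rewrite /cc !EFinM; apply: lee_pmul.
  - by rewrite -EFinM lee_fin mulr_ge0 ?powR_ge0.
  - by rewrite lee_fin powR_ge0.
  - apply: lee_pmul; rewrite ?lee_fin ?powR_ge0//.
      rewrite -poweR_EFin; apply: gt0_ler_poweR => //; first exact: ltW.
        by rewrite in_itv/= leey andbT lee_fin.
      by rewrite in_itv/= leey andbT phi_ge0.
    by rewrite ta poweR_EFin lee_fin; apply: le_powR; rewrite ?(ltW r0) ?(ltW (v0 _ _)) ?(ltW a1).
  rewrite -poweR_EFin; apply: gt0_ler_poweR => //; first exact: ltW.
    by rewrite in_itv/= leey andbT lee_fin.
  rewrite in_itv/= leey andbT; apply: calS_ge0; exact: (linecell_gt0 hg tm).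
move=> h; have c2 : 0 < 2 * c by rewrite mulr_gt0.
rewrite (powRM s (ltW c2) B0) -ler_pdivrMl ?powR_gt0//; apply: le_trans h.
rewrite mulr_sumr; apply: ler_sum => m _.
have -> : cc m = (2 `^ (s - r))^-1 * X M m `^ (s / r - 1) * Vg M m `^ r *
    ((K M m / Vg M m) `^ s / c `^ s).
  have i2 : (0 : R) <= 2^-1 by rewrite invr_ge0.
  rewrite /cc (powRM _ i2 (powR_ge0 _ _)) (powR_invf _ (ler0n R 2)) -powRrM.
  have -> : r^-1 * (s - r) = s / r - 1 by field; rewrite lt0r_neq0.
  have kv : 0 <= K M m / Vg M m by rewrite divr_ge0 ?(ltW (K0 _ _)) ?(ltW (v0 _ _)).
  rewrite -(powR_div _ kv (ltW c0)); congr (_ * _ `^ _).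
  by rewrite invfM (mulrC c^-1) mulrA.
rewrite (powRM s (ler0n R 2) (ltW c0)) invfM.
have h2 : ((2 : R) `^ s)^-1 <= (2 `^ (s - r))^-1.
  rewrite lef_pV2 ?posrE ?powR_gt0//; apply: ler_powR; first by rewrite ler1n.
  by rewrite gerBl ltW.
have z0 : 0 <= (K M m / Vg M m) `^ s *
    (Vg M m `^ r * jump r (wgrid M) m * X M m `^ (s / r - 1)) / c `^ s.
  by rewrite !mulr_ge0 ?powR_ge0// invr_ge0 powR_ge0.
have := ler_wpM2r z0 h2; congr (_ <= _).
  by ring.
by ring.
Qed.

(** [X] dominates [Hsum] at the next index, which gives the sum with [tau], and also V^r (w^(-r) -
    omega^r), which gives the sum required by [zeta_sum]. *)
Lemma grid_bounds_of_sum M :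
  (forall m, tgrid M m * Vg M m <= K M m) ->
  [/\ forall n, \sum_(m < n.-1) tgrid M m `^ s * (Vg M m `^ r * jump r (wgrid M) m *
        Hsum r (Vg M) (wgrid M) m.+1 `^ (s / r - 1)) <= (2 * c * B) `^ s,
    forall n, \sum_(m < n) (wgrid M m `^ (- r) - omega `^ r) `^ (s / r - 1) *
        (K M m `^ s * jump r (wgrid M) m) <= (2 * c * B) `^ s,
    forall m, (omega `^ r) `^ r^-1 * K M m <= 2 * c * B,
    forall m, omega `^ r <= wgrid M m `^ (- r) &
    forall e, 0 < e -> exists n, forall i, (n <= i)%N ->
      wgrid M i `^ (- r) - omega `^ r <= e].
Proof.
move=> tK; have u0 : 0 <= s / r - 1 by rewrite subr_ge0 ler_pdivlMr// mul1r ltW.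
split.
- move=> n; apply: le_trans (grid_sum_bound M n.-1); apply: ler_sum => m _.
  have tQ : tgrid M m <= K M m / Vg M m by rewrite ler_pdivlMr.
  apply: ler_pM; rewrite ?powR_ge0 ?mulr_ge0 ?powR_ge0//.
    by apply: le_powR tQ; rewrite ltW.
  by apply: ler_wpM2l; [rewrite mulr_ge0 ?powR_ge0|exact: (le_powR u0 (H0 _ _) (X_ge_H M m))].
- move=> n; apply: le_trans (grid_sum_bound M n); apply: ler_sum => m _.
  have h := le_powR u0 (mulr_ge0 (powR_ge0 _ _) (zeta_ge0 M m)) (X_ge_zeta M m).
  rewrite (powRM _ (powR_ge0 _ _) (zeta_ge0 M m)) -powRrM in h.
  apply: (@le_trans _ _ ((K M m / Vg M m) `^ s * (Vg M m `^ r * jump r (wgrid M) m *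
    (Vg M m `^ (r * (s / r - 1)) * (wgrid M m `^ (- r) - omega `^ r) `^ (s / r - 1))))).
    have -> : r * (s / r - 1) = s - r by field; rewrite lt0r_neq0.
    rewrite (powR_div _ (ltW (K0 _ _)) (ltW (v0 _ _))) (powRD_pos _ (- r) (v0 M m)) (powRN (Vg M m) r).
    rewrite le_eqVlt; apply/orP; left; apply/eqP; field.
    by rewrite !lt0r_neq0 ?powR_gt0.
  by rewrite ler_wpM2l ?powR_ge0// ler_wpM2l ?mulr_ge0 ?powR_ge0.
- move=> m; rewrite powRVK ?lt0r_neq0 ?total_inv_ge0//; apply: (le_trans (total_K M m)).
  by rewrite -mulrA ler_peMl ?ler1n// mulr_ge0// ltW.
- by move=> m; rewrite -subr_ge0.
move=> e e0; have [_ /(_ e e0)[T T0 hT]] := total_invP th10 hw1 r0.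
by have [n hn] := grid_unbounded hV hg M T; exists n => i /hn; exact: hT.
Qed.

End sum.
End upper.

Section lower.
Variable B : R.
Hypothesis B0 : 0 <= B.
Hypothesis KS : forall M i, K M i <= K M.+1 i.+1.

(** [w] is at most [1 / omega], so [K] is bounded by [B / omega] on all grids at once. For
    [omega = 0] the product is 0 even if [S0] is infinite. *)
Lemma total_le_of_grid : (forall M i, K M i <= B * wgrid M i) ->
  (omega%:E * S0 <= (c * B)%:E)%E.
Proof.
move=> hK; have := total_inv_ge0 w1 th1; rewrite le_eqVlt => /predU1P[<-|o0].
  by rewrite mul0e lee_fin mulr_ge0 ?(ltW c0).
have h M i : K M i <= B / omega.
  rewrite ler_pdivlMr// (le_trans (ler_wpM2r (ltW o0) (hK M i)))// -mulrA ler_piMr//.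
  have := total_invP th10 hw1 r0 => -[/(_ _ (x0 M i)) + _]; rewrite powRN -powR_invf ?(ltW (w0 _ _))//.
  rewrite le_powRP ?(ltW o0) ?invr_ge0 ?(ltW (w0 _ _))// => h.
  by rewrite mulrC -ler_pdivlMr// mul1r.
case: prof => _ _ _ _ /(_ _ h) hS.
apply: (@le_trans _ _ (omega%:E * (c * (B / omega))%:E)%E).
  by apply: lee_wpmul2l hS; rewrite lee_fin ltW.
rewrite -EFinM lee_fin le_eqVlt; apply/orP; left; apply/eqP; field.
exact: lt0r_neq0.
Qed.

Let cell_of x : 0 < x -> exists M i, linecell M i x.
Proof.
move=> /(grid_cell hV hg)[M [i h]]; exists M, i.
by rewrite /line_cell /= in_itv.
Qed.

Let NSk M i k : N (M + k)%N (i + k)%N <= N (M + k.+1)%N (i + k.+1)%N.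
Proof. by rewrite !addnS. Qed.

(** Both factors are controlled by quantities that increase along the finer grids, so by [prod_sup]
    it suffices to bound their products on the same grid. *)
Lemma phi_calS_le M i x be al z : linecell M i x -> 0 < al -> 0 < be ->
  (forall k, (K (M + k)%N (i + k)%N / Vg M i) `^ al *
     N (M + k)%N (i + k)%N `^ (be / r) <= z) ->
  (phi x `^ be * calS x `^ al <= (2 `^ be * c `^ al * z)%:E)%E.
Proof.
move=> xi al0 be0 hz; have r1 : 0 < r^-1 by rewrite invr_gt0.
pose a k := K (M + k)%N (i + k)%N / Vg M i.
pose b k := N (M + k)%N (i + k)%N `^ r^-1.
apply: (@prod_sup _ al be a b z c 2 (calS x) (phi x) al0 be0).
- by move=> k; rewrite divr_gt0.
- by move=> k; exact: powR_gt0 (N0 _ _).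
- by move=> k; rewrite /a ler_pM2r ?invr_gt0// !addnS.
- by move=> k; apply: (le_powR (ltW r1) (ltW (N0 _ _)) (NSk M i k)).
- by move=> k; rewrite /a /b -powRrM (mulrC r^-1); exact: hz.
- exact: c0.
- exact: ltr0Sn.
- exact: calS_ge0 (linecell_gt0 hg xi).
- exact: phi_ge0.
- by move=> L hL; case: prof => _ _ h _ _; exact: (h M i x L xi hL).
move=> L hL; have L0 : 0 <= L by apply: le_trans (hL 0%N); exact: powR_ge0.
rewrite -[L](powRVK (lt0r_neq0 r0))//; apply: (phi_le hV hg p20 p2th1 hw1 xi) => k.
rewrite -(le_powRP r1 (ltW (N0 _ _)) (powR_ge0 _ _)) powRVK ?lt0r_neq0//; exact: hL.
Qed.

Lemma sup_le_of_grid :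
  (forall M i, K M i / Vg M i * N M i `^ r^-1 <= B) ->
  forall x, 0 < x -> (phi x * calS x <= (2 * c * B)%:E)%E.
Proof.
move=> h x /[dup] xp /cell_of[M [i xi]].
have := @phi_calS_le M i x 1 1 B xi ltr01 ltr01.
rewrite !poweRe1 ?phi_ge0 ?calS_ge0// !powRr1 ?(ltW c0)//; apply => k.
rewrite mul1r powRr1 ?divr_ge0 ?(ltW (K0 _ _)) ?(ltW (v0 _ _))//.
by rewrite -(grid_valueSS k M i); exact: h.
Qed.

Section sum.
Variable s : R.
Hypotheses (th21 : th2 < th1) (sE : s^-1 = th2^-1 - th1^-1).
Let s0 : 0 < s. Proof. by rewrite -invr_gt0 sE subr_gt0 ltf_pV2. Qed.
Let rs : r < s.
Proof. by rewrite -ltf_pV2 ?posrE// sE invrK ltrD2r ltf_pV2. Qed.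

(** On a cell the integrand is bounded by a supremum over finer grids, possibly infinite; [sum_sup]
    exchanges it with the sum over the window. *)
Lemma sum_le_of_grid :
  (forall M n, \sum_(m < n) (K M m / Vg M m) `^ s * (Vg M m `^ r * jump r (wgrid M) m *
    N M m `^ (s / r - 1)) <= B `^ s) ->
  (stieltjes_integral (head_integrator th1%:E w1 r)
    (fun x => phi x `^ (s - r) * V x `^ r * calS x `^ s) <= ((2 * c * B) `^ s)%:E)%E.
Proof.
move=> hB; have sr : 0 < s - r by rewrite subr_gt0.
have uE : s / r - 1 = (s - r) / r by rewrite mulrBl mulfV ?lt0r_neq0.
pose e k m j := (K (k + j)%N (m + j)%N / Vg k m) `^ s * N (k + j)%N (m + j)%N `^ ((s - r) / r).
pose sup k m := ereal_sup (range (fun j => (e k m j)%:E)).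
have e0 k m j : 0 <= e k m j by rewrite mulr_ge0 ?powR_ge0.
have sup0 k m : (0 <= sup k m)%E.
  apply: (@le_trans _ _ (e k m 0%N)%:E); first by rewrite lee_fin.
  by apply: ereal_sup_ubound; exists 0%N.
have c2 : 0 < (2 * c) `^ s by rewrite powR_gt0// mulr_gt0.
apply: (@stieltjes_integral_le _ V hV g hg _ (fun t => head w1 th1 t `^ (- r))
  (head_integrator_nd th10 hw1 r0) (head_mass th10 hw1 (r := r)) _
  (fun k l => ((2 * c) `^ s * Vg k l `^ r)%:E * sup k l)%E 0%N).
- move=> t tp; apply: mule_ge0; last exact: poweR_ge0.
  by apply: mule_ge0; exact: poweR_ge0.
- by move=> k l; apply: mule_ge0 => //; rewrite lee_fin mulr_ge0 ?powR_ge0 ?(ltW c2).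
- move=> k l t; rewrite add0n => lk tl; rewrite muleAC muleC.
  have cv := mulr_gt0 c2 (powR_gt0 r (v0 k l)).
  have : forall j, ((e k l j)%:E <= sup k l)%E by move=> j; apply: ereal_sup_ubound; exists j.
  move: (sup0 k l); case: (sup k l) => [z|_ _|//]; last by rewrite gt0_muley ?leey// lte_fin.
  rewrite lee_fin => z0 hz.
  have /(phi_calS_le tl s0 sr) h : forall j, (K (k + j)%N (l + j)%N / Vg k l) `^ s *
      N (k + j)%N (l + j)%N `^ ((s - r) / r) <= z by move=> j; have := hz j; rewrite lee_fin.
  have [y ty /andP[y1 y2]] := V_linecell hV hg tl.
  have y0 : 0 <= y by apply: le_trans (ltW y1); exact: ltW.
  have yr := le_powR (ltW r0) y0 y2.
  apply: (@le_trans _ _ (((2 * Vg k l) `^ r)%:E * (2 `^ (s - r) * c `^ s * z)%:E)%E).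
    apply: lee_pmul.
    + exact: poweR_ge0.
    + by apply: mule_ge0; exact: poweR_ge0.
    + by rewrite ty poweR_EFin lee_fin.
    + exact: h.
  rewrite -!EFinM lee_fin le_eqVlt; apply/orP; left; apply/eqP.
  rewrite (powRM r (ler0n R 2) (ltW (v0 k l))) (powRM s (ler0n R 2) (ltW c0)).
  have -> : (2 : R) `^ s = 2 `^ r * 2 `^ (s - r) by rewrite -powRD_pos// addrC subrK.
  ring.
move=> k; rewrite (powRM s _ B0) ?mulr_ge0 ?(ltW c0)// add0n.
have Ek l : ((((2 * c) `^ s * Vg k l `^ r)%:E * sup k l) *
    (head w1 th1 (grid k l) `^ (- r) - head w1 th1 (grid k l.+1) `^ (- r))%:E =
    ((2 * c) `^ s)%:E * ((Vg k l `^ r * jump r (wgrid k) l)%:E * sup k l))%E.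
  by rewrite muleAC -EFinM -mulrA EFinM muleA.
under eq_bigr do rewrite Ek.
rewrite -ge0_sume_distrr; last first.
  by move=> l _; apply: mule_ge0 => //; rewrite lee_fin mulr_ge0 ?powR_ge0.
rewrite EFinM; apply: lee_wpmul2l; first by rewrite lee_fin ltW.
apply: (@sum_sup _ (k + k) (fun l => Vg k l `^ r * jump r (wgrid k) l) (e k)).
- by move=> m _; rewrite mulr_ge0 ?powR_ge0.
- by move=> m j.
- move=> m j; apply: (ler_pM (powR_ge0 _ _) (powR_ge0 _ _)).
    apply: (le_powR (ltW s0) (divr_ge0 (ltW (K0 _ _)) (ltW (v0 _ _)))).
    by rewrite ler_pM2r ?invr_gt0// !addnS.
  exact: (le_powR (divr_ge0 (ltW sr) (ltW r0)) (ltW (N0 _ _)) (NSk k m j)).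
move=> j; rewrite lee_fin; apply: le_trans (hB (k + j)%N (j + (k + k))%N).
rewrite [leRHS]big_split_ord /= -[leLHS]add0r; apply: lerD.
  by apply: sumr_ge0 => m _; rewrite !mulr_ge0 ?powR_ge0.
apply: ler_sum => m _; rewrite /e uE (addnC j m) (grid_valueSS j k m).
have -> : jump r (wgrid (k + j)) (m + j) = jump r (wgrid k) m.
  by rewrite /jump /head_grid -addSn !gridSS.
by rewrite le_eqVlt; apply/orP; left; apply/eqP; ring.
Qed.

End sum.
End lower.
End Equivalence.

(** * Two-sided estimates of the embedding norm *)

Section Embedding.
Context {R : realType} (n : nat).
Notation Rn := (euclid R n).
Notation mu := (@lebesgueRn R n).
Implicit Types (lam B c : R).

Lemma approx_embedding (X Y : qspace n) (A : \bar R) lam : 0 < lam -> (0 <= A)%E ->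
  (forall B, 0 <= B -> (A <= B%:E)%E ->
     forall f, carrier X f -> (snorm Y f <= (lam * B)%:E * snorm X f)%E) ->
  (forall c, 0 <= c -> (forall f, carrier X f -> (snorm Y f <= c%:E * snorm X f)%E) ->
     (A <= (lam * c)%:E)%E) ->
  approx_by lam (embedding_norm X Y) A.
Proof.
move=> l0 A0 hup hlow; split.
  apply: le_ereal_inf_tmp => _ [c [c0 hc] <-].
  apply: (@le_trans _ _ ((lam^-1)%:E * (lam * c)%:E)%E).
    by apply: lee_wpmul2l (hlow c c0 hc); rewrite lee_fin invr_ge0 ltW.
  by rewrite -EFinM mulKf ?lt0r_neq0.
case: A A0 hup {hlow} => [B|_ _|//]; last by rewrite gt0_muley ?leey// lte_fin.
rewrite lee_fin => B0 hup; apply: ereal_inf_lbound; exists (lam * B) => //.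
by split; [rewrite mulr_ge0// ltW|exact: hup].
Qed.

Lemma approx_by_le lam lam' (a b : \bar R) : 0 < lam -> lam <= lam' -> (0 <= b)%E ->
  approx_by lam a b -> approx_by lam' a b.
Proof.
move=> l0 ll b0 [h1 h2]; split.
  apply: le_trans h1; apply: lee_wpmul2r => //.
  by rewrite lee_fin lef_pV2 ?posrE// (lt_le_trans l0).
by apply: (le_trans h2); apply: lee_wpmul2r => //; rewrite lee_fin.
Qed.

Variables (p1 p2 th1 th2 : R).
Hypotheses (p20 : 0 < p2) (p21 : p2 < p1) (p2th1 : p2 < th1) (p2th2 : p2 < th2).
Let P := arrow_exp p1 p2.
Let P0 : 0 < P. Proof. exact: arrow_exp_gt0. Qed.
Let p10 : 0 < p1. Proof. exact: lt_trans p21. Qed.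
Let th10 : 0 < th1. Proof. exact: lt_trans p2th1. Qed.
Let th20 : 0 < th2. Proof. exact: lt_trans p2th2. Qed.
Let r := (p2^-1 - th1^-1)^-1.
Let r0 : 0 < r. Proof. by rewrite invr_gt0 subr_gt0 ltf_pV2//; exact: (lt_trans p20). Qed.

Let kup : R := (2 * (2 `^ P - 1) `^ (p2 / P)) `^ (th2 / p2).
Let klow : R := (2 `^ P - 1) `^ P^-1 / 2.
Let twoP : 0 < (2 : R) `^ P - 1.
Proof.
by rewrite subr_gt0; have := @gt0_ltr_powR R P P0 1 2; rewrite powR1 !nnegrE; apply; rewrite ?ltr1n.
Qed.
Let kup0 : 0 < kup. Proof. by rewrite powR_gt0// mulr_gt0// powR_gt0. Qed.
Let klow0 : 0 < klow. Proof. by rewrite divr_gt0// powR_gt0. Qed.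

Section transfer.
Variables (v1 v2 : Rn -> \bar R) (w1 w2 : R -> \bar R).
Hypotheses (hv1 : weight mu setT v1) (hv2 : weight mu setT v2).
Hypotheses (hw1 : cOmega th1%:E w1) (hw2 : Omega th2%:E w2).
Notation V := (Vtilde p1%:E p2%:E v1 v2).
Hypothesis hV : admissible V.
Variable g : R -> R.
Hypothesis hg : forall y, 0 < y -> 0 < g y /\ V (g y) = y%:E.
Notation Vg := (@grid_value R).
Notation wgrid := (@head_grid R th1 w1 g).
Notation tgrid := (@tail_grid R th2 w2 g).

Lemma embedding_le C B : 0 < C -> 0 <= B -> (forall M N a, (forall i, 0 <= a i) ->
    LMd p2 th2 (Vg M) (tgrid M) a N <=
    C * (B `^ th2 * cLMd p1 th1 (wgrid M) a N `^ (th2 / th1))) ->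
  forall f, carrier (cLM p1%:E th1%:E w1 v1) f ->
  (LM_norm p2%:E th2%:E w2 v2 f <=
    ((kup * C) `^ th2^-1 * B)%:E * cLM_norm p1%:E th1%:E w1 v1 f)%E.
Proof.
move=> C0 B0 h f fX.
have := @transfer_upper R n p1 p2 th1 th2 p20 p21 p2th1 p2th2 v1 v2 w1 w2 hv1 hv2 hw1 hw2
  hV g hg f fX (C * B `^ th2).
have -> : (kup * C) `^ th2^-1 * B = (kup * (C * B `^ th2)) `^ th2^-1.
  rewrite mulrA (powRM _ (mulr_ge0 (ltW kup0) (ltW C0)) (powR_ge0 B th2)) powRVK//.
  exact: lt0r_neq0.
apply; first by rewrite mulr_ge0 ?powR_ge0 ?ltW.
by move=> M N a a0; rewrite -mulrA; exact: h.
Qed.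

End transfer.

(* [K M] plays the role of the norms of the multipliers [tau V] truncated to the first
   cells of the grid [grid M] *)
Definition grid_multipliers qq ce g (w1 w2 : R -> \bar R) (K : nat -> nat -> R) :=
  [/\ forall M i, tail_grid th2 w2 g M i * grid_value M i <= K M i,
    forall M i, K M i <= K M.+1 i.+1,
    forall M, decreasing_data (grid_value M) (head_grid th1 w1 g M) (tail_grid th2 w2 g M) (K M) qq,
    forall M, multiplier_envelope p1 th2 ce (tail_grid th2 w2 g M) (grid_value M) (K M) &
    forall M, multiplier_attained p1 th2 qq (tail_grid th2 w2 g M) (grid_value M) (K M)].

Lemma grid_multipliers_admissible qq ce g w1 w2 K M : grid_multipliers qq ce g w1 w2 K ->
  admissible_data (grid_value M) (head_grid th1 w1 g M) (tail_grid th2 w2 g M) (K M).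
Proof. by case=> tK _ /(_ M)[h1 h2 h3 h4 [h5 h6 _ _]] _ _; split. Qed.

Lemma grid_multipliers_gt0 qq ce g w1 w2 K M i : grid_multipliers qq ce g w1 w2 K -> 0 < K M i.
Proof.
case=> /(_ M i) tK _ /(_ M)[h1 _ _ [h4 _] _] _ _.
by apply: lt_le_trans tK; rewrite mulr_gt0.
Qed.

(** [calS] and [S0] stay abstract so that one argument serves both the supremum and the Stieltjes
    integral over t. [Cu] and [Cl] are the constants of the upper and the lower bound; they depend
    only on the exponents, [qq] and [ce]. *)
Lemma embedding_sup qq ce : th1 <= th2 -> 0 < qq -> 0 < ce ->
  exists2 C, 0 < C & forall v1 v2 w1 w2 g K calS S0,
  weight mu setT v1 -> weight mu setT v2 -> cOmega th1%:E w1 -> Omega th2%:E w2 ->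
  let V := Vtilde p1%:E p2%:E v1 v2 in
  let phi := phi2 V p2%:E th1%:E w1 in
  admissible V -> (forall y, 0 < y -> 0 < g y /\ V (g y) = y%:E) ->
  profile g 3 K calS S0 -> grid_multipliers qq ce g w1 w2 K ->
  let A := (ereal_sup [set (phi x * calS x)%E | x in `]0%R, +oo[] +
    (lnorm (@completed_lebesgue_measure R) th1%:E `]0%R, +oo[ w1)^-1 * S0)%E in
  (0 <= A)%E /\
  approx_by C (embedding_norm (cLM p1%:E th1%:E w1 v1) (LM p2%:E th2%:E w2 v2)) A.
Proof.
move=> th12 q0 ce0.
have [C1 C10 up] := upper_sup p20 p21 p2th1 p2th2 ce0 th12.
have [C2 C20 low] := lower_sup p20 p21 p2th1 p2th2 q0.
pose D : R := 2 `^ r^-1 * (2 * 3).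
have D0 : 0 < D by rewrite mulr_gt0 ?powR_gt0.
pose Cu := (kup * C1) `^ th2^-1 * D; have Cu0 : 0 < Cu.
  by rewrite mulr_gt0// powR_gt0// mulr_gt0.
pose Cl := (2 * 3 * C2 + 3) / klow; have Cl0 : 0 < Cl.
  by rewrite divr_gt0// addr_gt0// mulr_gt0.
exists (Cu + Cl) => [|v1 v2 w1 w2 g K calS S0 hv1 hv2 hw1 hw2 V phi hV hg prof dat A].
  by rewrite addr_gt0.
have K0 M i : 0 < K M i := grid_multipliers_gt0 M i dat.
have c3 : (0 : R) < 3 by [].
have S00 : (0 <= S0)%E.
  case: prof => _ _ _ /(_ 0%N 0%N) h _; apply: le_trans h.
  by rewrite lee_fin divr_ge0 ?ltW.
have calS0 x : 0 < x -> (0 <= calS x)%E by case: prof => h _ _ _ _; exact: h.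
have A10 : (0 <= ereal_sup [set phi x * calS x | x in `]0%R, +oo[])%E.
  apply: (@le_trans _ _ (phi 1%R * calS 1%R)%E); first by rewrite mule_ge0 ?phi_ge0 ?calS0.
  by apply: ereal_sup_ubound; exists 1 => //=; rewrite in_itv/= ltr01.
have A20 : (0 <= (total_inv w1 th1)%:E * S0)%E by rewrite mule_ge0 ?lee_fin ?total_inv_ge0.
have AE : A = (ereal_sup [set (phi x * calS x)%E | x in `]0%R, +oo[] +
    (total_inv w1 th1)%:E * S0)%E by rewrite /A (total_invE th10 hw1).
have A0 : (0 <= A)%E by rewrite AE adde_ge0.
split=> //; apply: approx_embedding => //; first by rewrite addr_gt0.
- move=> B B0; rewrite AE => AB f fX.
  have h1 x : 0 < x -> (phi x * calS x <= B%:E)%E.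
    move=> x0; apply: (le_trans _ AB); apply: (@le_trans _ _ (phi x * calS x + 0)%E).
      by rewrite adde0.
    apply: leeD => //; apply: ereal_sup_ubound; exists x => //=.
    by rewrite in_itv/= x0.
  have h2 : ((total_inv w1 th1)%:E * S0 <= B%:E)%E.
    by apply: (le_trans _ AB); rewrite leeDr.
  have DB : 0 <= D * B by rewrite mulr_ge0// ltW.
  have [tK _ _ env _] := dat.
  have hb M m := grid_bounds_of_sup p20 p2th1 hw1 hw2 hV hg c3 prof K0 B0 h2 h1 (tK M m).
  apply: (@le_trans _ _ (((kup * C1) `^ th2^-1 * (D * B))%:E * cLM_norm p1%:E th1%:E w1 v1 f)%E).
    apply: (embedding_le hv1 hv2 hw1 hw2 hV hg C10 DB _ fX) => M N a a0.
    apply: (up _ _ _ _ _ _ _ (grid_multipliers_admissible M dat) (env M) a0 DB).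
      by move=> m _; have [h _] := hb M m.
    by move=> m _; have [_ h] := hb M m.
  apply: lee_wpmul2r; first exact: Lnorm_ge0.
  by rewrite lee_fin mulrA ler_wpM2r// lerDl ltW.
move=> c c0 hc.
have hl := transfer_lower p20 p21 p2th1 p2th2 hv1 hv2 hw1 hw2 hV hg c0 hc.
have ck : 0 <= c / klow by rewrite divr_ge0// ltW.
have [_ KS dec _ att] := dat.
have h1 := total_le_of_grid p20 p2th1 hw1 hg c3 prof ck
  (fun M i => lower_K p20 p21 p2th1 p2th2 i q0 (dec M) (att M) ck (hl M)).
have h2 := sup_le_of_grid p20 p2th1 hw1 hV hg c3 prof K0 KS
  (fun M i => low _ _ _ _ _ i (dec M) (att M) ck (hl M)).
rewrite AE; apply: (@le_trans _ _ ((2 * 3 * (C2 * (c / klow)))%:E + (3 * (c / klow))%:E)%E).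
  apply: leeD h1; apply: ge_ereal_sup => _ [x x0 <-]; apply: h2.
  by move: x0; rewrite /= in_itv/= andbT.
rewrite -EFinD lee_fin; apply: (@le_trans _ _ (Cl * c)); last first.
  by rewrite ler_wpM2r// lerDr ltW.
rewrite le_eqVlt; apply/orP; left; apply/eqP; rewrite /Cl; field.
exact: lt0r_neq0.
Qed.

Lemma embedding_sum qq ce s : th2 < th1 -> s^-1 = th2^-1 - th1^-1 -> 0 < qq -> 0 < ce ->
  exists2 C, 0 < C & forall v1 v2 w1 w2 g K calS S0,
  weight mu setT v1 -> weight mu setT v2 -> cOmega th1%:E w1 -> Omega th2%:E w2 ->
  let V := Vtilde p1%:E p2%:E v1 v2 in
  let phi := phi2 V p2%:E th1%:E w1 in
  admissible V -> (forall y, 0 < y -> 0 < g y /\ V (g y) = y%:E) ->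
  profile g 3 K calS S0 -> grid_multipliers qq ce g w1 w2 K ->
  let A := (stieltjes_integral (head_integrator th1%:E w1 r)
      (fun x => phi x `^ (s - r) * V x `^ r * calS x `^ s) `^ s^-1 +
    (lnorm (@completed_lebesgue_measure R) th1%:E `]0%R, +oo[ w1)^-1 * S0)%E in
  (0 <= A)%E /\
  approx_by C (embedding_norm (cLM p1%:E th1%:E w1 v1) (LM p2%:E th2%:E w2 v2)) A.
Proof.
move=> th21 sE q0 ce0.
have s0 : 0 < s by rewrite -invr_gt0 sE subr_gt0 ltf_pV2.
have rs : r < s by rewrite -ltf_pV2 ?posrE// sE invrK ltrD2r ltf_pV2.
have [C1 C10 up] := upper_sum p20 p21 p2th1 p2th2 ce0 th21 sE.
have [C2 C20 low] := lower_sum p20 p21 p2th1 p2th2 q0 th21 sE.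
have [C3 C30 zeta] := zeta_sum r0 (ltW rs).
pose D : R := (1 + C3 `^ s^-1) * (2 * 3).
have D0 : 0 < D by rewrite mulr_gt0// ltr_wpDr ?powR_ge0.
pose Cu := (kup * C1) `^ th2^-1 * D; have Cu0 : 0 < Cu.
  by rewrite mulr_gt0// powR_gt0// mulr_gt0.
pose Cl := (2 * 3 * C2 `^ s^-1 + 3) / klow; have Cl0 : 0 < Cl.
  by rewrite divr_gt0// addr_gt0// mulr_gt0// powR_gt0.
exists (Cu + Cl) => [|v1 v2 w1 w2 g K calS S0 hv1 hv2 hw1 hw2 V phi hV hg prof dat A].
  by rewrite addr_gt0.
have K0 M i : 0 < K M i := grid_multipliers_gt0 M i dat.
have c3 : (0 : R) < 3 by [].
have S00 : (0 <= S0)%E.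
  case: prof => _ _ _ /(_ 0%N 0%N) h _; apply: le_trans h.
  by rewrite lee_fin divr_ge0 ?ltW.
pose I := stieltjes_integral (head_integrator th1%:E w1 r)
      (fun x => phi x `^ (s - r) * V x `^ r * calS x `^ s)%E.
have I0 : (0 <= I)%E.
  rewrite /I /stieltjes_integral; case: pselect => // nd; apply: integral_ge0 => t _.
  by apply: mule_ge0; [apply: mule_ge0|]; exact: poweR_ge0.
have A20 : (0 <= (total_inv w1 th1)%:E * S0)%E by rewrite mule_ge0 ?lee_fin ?total_inv_ge0.
have AE : A = (I `^ s^-1 + (total_inv w1 th1)%:E * S0)%E by rewrite /A (total_invE th10 hw1).
have A0 : (0 <= A)%E by rewrite AE adde_ge0 ?poweR_ge0.
split=> //; apply: approx_embedding => //; first by rewrite addr_gt0.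
- move=> B B0; rewrite AE => AB f fX.
  have h1 : (I <= (B `^ s)%:E)%E.
    have : (I `^ s^-1 <= B%:E)%E by apply: le_trans AB; rewrite leeDl.
    case: (I) I0 => [x|_|//]; last by rewrite poweRyr ?leye_eq// invr_neq0// lt0r_neq0.
    rewrite lee_fin poweR_EFin !lee_fin => x0 /(le_powR (ltW s0) (powR_ge0 _ _)).
    by rewrite powRKV// lt0r_neq0.
  have h2 : ((total_inv w1 th1)%:E * S0 <= B%:E)%E.
    by apply: (le_trans _ AB); rewrite leeDr ?poweR_ge0.
  have DB : 0 <= D * B by rewrite mulr_ge0// ltW.
  have [tK _ dec env _] := dat.
  have DE : (D * B) `^ s = (1 + C3 `^ s^-1) `^ s * (2 * 3 * B) `^ s.
    by rewrite /D -mulrA powRM ?mulr_ge0 ?addr_ge0 ?powR_ge0.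
  have D1 : (2 * 3 * B) `^ s <= (D * B) `^ s.
    have B6 : 0 <= 2 * 3 * B by rewrite mulr_ge0.
    apply: (le_powR (ltW s0) B6); rewrite /D ler_wpM2r// ler_peMl//.
    by rewrite lerDl; exact: powR_ge0.
  have D2 : C3 * (2 * 3 * B) `^ s <= (D * B) `^ s.
    have h := le_powR (ltW s0) (powR_ge0 C3 s^-1) (_ : C3 `^ s^-1 <= 1 + C3 `^ s^-1).
    rewrite DE; apply: (ler_wpM2r (powR_ge0 _ _)); move: h.
    by rewrite (powRKV (lt0r_neq0 s0) (ltW C30)); apply; rewrite lerDr.
  have hb M := grid_bounds_of_sum p20 p2th1 p2th2 hw1 hw2 hV hg c3 prof K0 B0 h2 th21 sE h1 (tK M).
  apply: (@le_trans _ _ (((kup * C1) `^ th2^-1 * (D * B))%:E * cLM_norm p1%:E th1%:E w1 v1 f)%E).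
    apply: (embedding_le hv1 hv2 hw1 hw2 hV hg C10 DB _ fX) => M N a a0.
    have [g1 g2 g3 g4 g5] := hb M; have [_ _ [w0 wS] _ [KM0 KMS _ _]] := dec M.
    apply: (up _ _ _ _ _ _ _ (grid_multipliers_admissible M dat) (env M) a0 DB).
      by apply: (le_trans (g1 N)).
    apply: le_trans D2.
    have B6 : 0 <= 2 * 3 * B by rewrite mulr_ge0.
    exact: (zeta _ _ _ _ N w0 wS KM0 KMS (powR_ge0 _ _) g4 g5 B6 g2 g3).
  apply: lee_wpmul2r; first exact: Lnorm_ge0.
  by rewrite lee_fin mulrA ler_wpM2r// lerDl ltW.
move=> c c0 hc.
have hl := transfer_lower p20 p21 p2th1 p2th2 hv1 hv2 hw1 hw2 hV hg c0 hc.
have ck : 0 <= c / klow by rewrite divr_ge0// ltW.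
have [_ KS dec _ att] := dat.
have h1 := total_le_of_grid p20 p2th1 hw1 hg c3 prof ck
  (fun M i => lower_K p20 p21 p2th1 p2th2 i q0 (dec M) (att M) ck (hl M)).
pose E := C2 `^ s^-1 * (c / klow).
have E0 : 0 <= E by rewrite mulr_ge0 ?powR_ge0.
have EE : E `^ s = C2 * (c / klow) `^ s.
  by rewrite /E (powRM s (powR_ge0 _ _) ck) (powRKV (lt0r_neq0 s0) (ltW C20)).
have h2 : (I <= ((2 * 3 * E) `^ s)%:E)%E.
  apply: (sum_le_of_grid p20 p2th1 p2th2 hw1 hV hg c3 prof K0 E0 KS th21 sE) => M N.
  by rewrite EE; exact: (low _ _ _ _ _ N (dec M) (att M) ck (hl M)).
rewrite AE; apply: (@le_trans _ _ ((2 * 3 * E)%:E + (3 * (c / klow))%:E)%E).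
  apply: leeD h1; have E6 : 0 <= 2 * 3 * E by rewrite mulr_ge0.
  rewrite -[2 * 3 * E](powRVK (lt0r_neq0 s0) E6) -poweR_EFin; apply: gt0_ler_poweR h2.
  - by rewrite invr_ge0 ltW.
  - by rewrite in_itv/= leey andbT.
  - by rewrite in_itv/= leey andbT lee_fin powR_ge0.
rewrite -EFinD lee_fin; apply: (@le_trans _ _ (Cl * c)); last first.
  by rewrite ler_wpM2r// lerDr ltW.
rewrite le_eqVlt; apply/orP; left; apply/eqP; rewrite /Cl /E; field.
exact: lt0r_neq0.
Qed.

Section multipliers.
Variables (V : R -> \bar R) (w1 w2 : R -> \bar R) (g : R -> R).
Hypotheses (hw1 : cOmega th1%:E w1) (hw2 : Omega th2%:E w2) (hV : admissible V).
Hypothesis hg : forall y, 0 < y -> 0 < g y /\ V (g y) = y%:E.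
Notation Vg := (@grid_value R).
Notation wgrid := (@head_grid R th1 w1 g).
Notation tgrid := (@tail_grid R th2 w2 g).

Let v0 M i : 0 < Vg M i. Proof. exact: grid_value_gt0. Qed.
Let vS M i : Vg M i.+1 = 2 * Vg M i. Proof. exact: grid_valueS. Qed.
Let wd M : (forall i, 0 < wgrid M i) /\ (forall i, wgrid M i <= wgrid M i.+1).
Proof.
split=> i; first exact: (head_gt0 hw1 (grid_gt0 hg _ _)).
exact: (head_le th10 hw1 (grid_gt0 hg _ _) (grid_le hV hg _ (leqnSn i))).
Qed.
Let t0 M i : 0 < tgrid M i. Proof. exact: (tail_gt0 hw2 (grid_gt0 hg _ _)). Qed.
Let tS M i : tgrid M i.+1 <= tgrid M i.
Proof. exact: (tail_le th20 hw2 (grid_gt0 hg _ _) (grid_le hV hg _ (leqnSn i))). Qed.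

Lemma head_max_multipliers : p1 <= th2 -> grid_multipliers 1 1 g w1 w2
  (fun M => head_max (fun i => tgrid M i * Vg M i)).
Proof.
move=> pt; split=> M.
- by move=> i; have [h _ _ _ _] := head_max_data (v0 M) (vS M) (t0 M) (tS M); exact: h.
- by move=> i; exact: (max_shift g th2 w2 M i).
- have [_ h1 h2 h3 h4] := head_max_data (v0 M) (vS M) (t0 M) (tS M).
  by split.
- exact: (head_max_envelope (v0 M) (vS M) (t0 M) (tS M) p10 pt).
- exact: (head_max_attained (v0 M) (vS M) (t0 M) (tS M) p10 th20 pt).
Qed.

Lemma head_norm_multipliers : th2 < p1 -> let q := (th2^-1 - p1^-1)^-1 in
  grid_multipliers q ((1 - 2 `^ (- q)) `^ (- q^-1)) g w1 w2
  (fun M => head_norm q (fun i => tgrid M i * Vg M i)).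
Proof.
move=> tp q; have qE : q^-1 = th2^-1 - p1^-1 by rewrite invrK.
have q0 : 0 < q by rewrite invr_gt0 subr_gt0 ltf_pV2.
split=> M.
- by move=> i; have [h _ _ _ _] := head_norm_data (v0 M) (vS M) (t0 M) (tS M) q0; exact: h.
- by move=> i; exact: (norm_shift hV hg th20 tp hw2 M i).
- have [_ h1 h2 h3 h4] := head_norm_data (v0 M) (vS M) (t0 M) (tS M) q0.
  by split.
- exact: (head_norm_envelope (v0 M) (t0 M) p10 th20 tp qE).
- exact: (head_norm_attained (v0 M) (t0 M) p10 th20 tp qE).
Qed.

End multipliers.
End Embedding.

(** Extracts a constant from each case before it is known which case applies, as one constant has to
    serve all four. *)
Lemma exists2_cond (R : realType) (Q : bool) (T : R -> Prop) :
  (Q -> exists2 C, 0 < C & T C) -> exists2 C, 0 < C & (Q -> T C).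
Proof. by case: Q => [/(_ isT)[C C0 TC]|_]; [exists C|exists 1]. Qed.

Lemma common_bound (R : realType) (a b c d : R) : 0 < a -> 0 < b -> 0 < c -> 0 < d ->
  exists2 lam, 1 <= lam & [/\ a <= lam, b <= lam, c <= lam & d <= lam].
Proof. by move=> *; exists (1 + a + b + c + d); [lra|split; lra]. Qed.

(** With 1/s = 1/th2 - 1/th1 and 1/r = 1/p2 - 1/th1, the difference 1/r - 1/s is 1/p2 - 1/th2;
    multiplied by [s r] it gives [s - r], the exponent of [phi] in [embedding_sum]. *)
Lemma arrow_quotient (R : realType) (p2 th1 th2 : R) : 0 < p2 -> p2 < th2 -> th2 < th1 ->
  fine (arrow th1%:E th2%:E) * fine (arrow th1%:E p2%:E) / fine (arrow th2%:E p2%:E) =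
  fine (arrow th1%:E th2%:E) - fine (arrow th1%:E p2%:E).
Proof.
move=> p20 h21 h; have h2 := lt_trans p20 h21; have h1 := lt_trans h2 h.
rewrite !arrowE//=; last exact: lt_trans h.
have n1 : th2^-1 - th1^-1 != 0 by rewrite lt0r_neq0// subr_gt0 ltf_pV2.
have n2 : p2^-1 - th1^-1 != 0.
  by rewrite lt0r_neq0// subr_gt0 ltf_pV2//; exact: lt_trans h.
rewrite invrK; move: n1 n2; move: (th2^-1) (th1^-1) (p2^-1) => x y z n1 n2.
by field; apply/andP.
Qed.

Lemma norm_constants (R : realType) (p1 th2 : R) : 0 < th2 -> th2 < p1 ->
  let q := (th2^-1 - p1^-1)^-1 in 0 < q /\ 0 < (1 - 2 `^ (- q)) `^ (- q^-1).
Proof.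
move=> th20 h q; have q0 : 0 < q.
  by rewrite invr_gt0 subr_gt0 ltf_pV2//; exact: lt_trans h.
by split=> //; have /andP[_ hq] := @half_pow_lt1 R q q0; rewrite powR_gt0// subr_gt0.
Qed.

Local Open Scope ereal_scope.

Theorem theorem2p10 (R : realType) (n : nat) (p1 p2 th1 th2 : R)
    (hn : (0 < n)%N)
    (hp1 : (0 < p1)%R) (hp2 : (0 < p2)%R)
    (hth1 : (0 < th1)%R) (hth2 : (0 < th2)%R)
    (hp : (p2 < p1)%R) (hpth : (p2 < Num.min th1 th2)%R) :
  exists lam : R, (1 <= lam)%R /\
  forall (v1 v2 : euclid R n -> \bar R) (w1 w2 : R -> \bar R),
    weight (@lebesgueRn R n) setT v1 -> weight (@lebesgueRn R n) setT v2 ->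
    cOmega th1%:E w1 -> Omega th2%:E w2 ->
    let p1_p2 := fine (arrow p1%:E p2%:E) in
    let th1_p2 := fine (arrow th1%:E p2%:E) in
    let th2_p2 := fine (arrow th2%:E p2%:E) in
    let th1_th2 := fine (arrow th1%:E th2%:E) in
    let p1_th2 := fine (arrow p1%:E th2%:E) in
    let V := Vtilde p1%:E p2%:E v1 v2 in
    let phi := phi2 V p2%:E th1%:E w1 in
    admissible V ->
    QU (fun t => V t `^ p1_p2^-1) phi ->
    let normI :=
      embedding_norm (cLM p1%:E th1%:E w1 v1) (LM p2%:E th2%:E w2 v2) in
    let w1_total := lnorm (@completed_lebesgue_measure R) th1%:E `]0%R, +oo[ w1 in
    let w2_tail t := lnorm (@completed_lebesgue_measure R) th2%:E `]t, +oo[ w2 in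
    let dw1 := head_integrator th1%:E w1 th1_p2 in
    let dw2 := tail_integrator th2%:E w2 p1_th2 in
    let S x := ereal_sup [set calV V t x * w2_tail t | t in `]0%R, +oo[] in
    let J x := stieltjes_integral dw2 (fun t => calV V t x `^ p1_th2) in
    let S0 := ereal_sup [set V t * w2_tail t | t in `]0%R, +oo[] in
    let J0 := stieltjes_integral dw2 (fun t => V t `^ p1_th2) in
    [/\ (Num.max p1 th1 <= th2)%R ->
          approx_by lam normI
            (ereal_sup [set phi x * S x | x in `]0%R, +oo[] + w1_total^-1 * S0),
        (p1 <= th2)%R -> (th2 < th1)%R ->
          approx_by lam normI
            (stieltjes_integral dw1 (fun x =>
                phi x `^ (th1_th2 * th1_p2 / th2_p2) * V x `^ th1_p2
                * S x `^ th1_th2) `^ th1_th2^-1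
             + w1_total^-1 * S0),
        (th1 <= th2)%R -> (th2 < p1)%R ->
          approx_by lam normI
            (ereal_sup [set phi x * J x `^ p1_th2^-1 | x in `]0%R, +oo[]
             + w1_total^-1 * J0 `^ p1_th2^-1) &
        (th2 < Num.min p1 th1)%R ->
          approx_by lam normI
            (stieltjes_integral dw1 (fun x =>
                phi x `^ (th1_th2 * th1_p2 / th2_p2) * V x `^ th1_p2
                * J x `^ (th1_th2 / p1_th2)) `^ th1_th2^-1
             + w1_total^-1 * J0 `^ p1_th2^-1)].

Proof.
have [h1 h2] : (p2 < th1 /\ p2 < th2)%R by move: hpth; rewrite lt_min => /andP[].
pose s : R := ((th2^-1 - th1^-1)^-1)%R.
have sE : (s^-1 = th2^-1 - th1^-1)%R by rewrite invrK.
(* For [head_max] both the exponent of the recursion and the constant of the envelope are 1. *)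
have o1 : (0 < 1 :> R)%R := ltr01.
have nc := fun h => @norm_constants R p1 th2 hth2 h.
have [C1 C10 H1] := exists2_cond (Q := (th1 <= th2)%R)
  (fun h => embedding_sup n hp2 hp h1 h2 h o1 o1).
have [C2 C20 H2] := exists2_cond (Q := (th2 < th1)%R)
  (fun h => embedding_sum n hp2 hp h1 h2 h sE o1 o1).
have [C3 C30 H3] := exists2_cond (Q := ((th1 <= th2) && (th2 < p1))%R)
  (fun h => let: conj a b := andP h in
     embedding_sup n hp2 hp h1 h2 a (nc b).1 (nc b).2).
have [C4 C40 H4] := exists2_cond (Q := ((th2 < th1) && (th2 < p1))%R)
  (fun h => let: conj a b := andP h in
     embedding_sum n hp2 hp h1 h2 a sE (nc b).1 (nc b).2).
have [lam l1 [l2 l3 l4 l5]] := common_bound C10 C20 C30 C40.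
exists lam; split=> // v1 v2 w1 w2 hv1 hv2 hw1 hw2 p1_p2 th1_p2 th2_p2 th1_th2 p1_th2 V phi hV _.
move=> normI w1_total w2_tail dw1 dw2 S J S0 J0.
have [g hg] := admissible_inverse hV.
have rE : th1_p2 = ((p2^-1 - th1^-1)^-1)%R by rewrite /th1_p2 arrowE.
have s_E : (th2 < th1)%R -> th1_th2 = s by move=> h; rewrite /th1_th2 arrowE.
have eE : (th2 < th1)%R -> (th1_th2 * th1_p2 / th2_p2 = s - (p2^-1 - th1^-1)^-1)%R.
  by move=> h; rewrite arrow_quotient// -/th1_th2 -/th1_p2 s_E// rE.
have qE : (th2 < p1)%R -> p1_th2 = ((th2^-1 - p1^-1)^-1)%R.
  by move=> h; rewrite /p1_th2 arrowE.
have q_n0 : (th2 < p1)%R -> p1_th2 != 0%R by move=> h; rewrite qE// lt0r_neq0// (nc h).1.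
split.
- rewrite ge_max => /andP[hA hB].
  have [A0 A] := H1 hB _ _ _ _ _ _ _ _ hv1 hv2 hw1 hw2 hV hg
    (max_profile hV hg hth2 hw2) (head_max_multipliers hp2 hp h1 h2 hw1 hw2 hV hg hA).
  exact: (approx_by_le C10 l2 A0 A).
- move=> hA hB; have [A0 A] := H2 hB _ _ _ _ _ _ _ _ hv1 hv2 hw1 hw2 hV hg
    (max_profile hV hg hth2 hw2) (head_max_multipliers hp2 hp h1 h2 hw1 hw2 hV hg hA).
  rewrite eE// /dw1 s_E// rE.
  exact: (approx_by_le C20 l3 A0 A).
- move=> hB hA; have hBA : ((th1 <= th2) && (th2 < p1))%R by rewrite hB.
  have [A0 A] := H3 hBA _ _ _ _ _ _ _ _ hv1 hv2 hw1 hw2 hV hg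
    (norm_profile hV hg hth2 hA hw2) (head_norm_multipliers hp2 hp h1 h2 hw1 hw2 hV hg hA).
  rewrite /J0 /J /dw2 qE//.
  exact: (approx_by_le C30 l4 A0 A).
rewrite lt_min => /andP[hA hB]; have hBA : ((th2 < th1) && (th2 < p1))%R by rewrite hA hB.
have [A0 A] := H4 hBA _ _ _ _ _ _ _ _ hv1 hv2 hw1 hw2 hV hg
  (norm_profile hV hg hth2 hA hw2) (head_norm_multipliers hp2 hp h1 h2 hw1 hw2 hV hg hA).
(* The profile is the root of [J], so the exponent is split to show its power [s]. *)
have JE x : J x `^ (th1_th2 / p1_th2) = (J x `^ p1_th2^-1) `^ s.
  by rewrite -poweRrM s_E// mulrC.
under eq_fun do rewrite JE.
rewrite eE// /dw1 s_E// rE /J0 /J /dw2 qE//.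
exact: (approx_by_le C40 l5 A0 A).
Qed.
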